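(* Let $X$ be a Lévy process, $\delta>0$, $\theta>0$, and $f,c\colon\mathbb{R}\to\mathbb{R}$ satisfying the standing assumptions described in the context. Suppose there exist a constant $x^\ast\in\mathbb{R}$ and a function $u\colon\mathbb{R}\to\mathbb{R}$ such that: (i) $u$ is continuously differentiable if $X$ has bounded variation, and twice continuously differentiable if $X$ has unbounded variation; (ii) $|u(x)|\le K(1+\cosh(\theta x))$ for all $x\in\mathbb{R}$ and some $K>0$; (iii) $u$ satisfies $$\mathcal{L}u(x)-\delta u(x)+f(x)\ge 0\ \text{ for all } x\in\mathbb{R},\ \text{ with equality for } x<x^\ast,$$ $$u'(x)\le c(x)\ \text{ for all } x\in\mathbb{R},\ \text{ with equality for } x\ge x^\ast.$$ Then $u$ is the value function of the control problem and the reflecting control at $x^\ast$ is optimal: for every $x\in\mathbb{R}$, $$u(x)=J_\delta(x,D^{x^\ast})=G_\delta(x).$$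
   Context: **Process.** $X=\{X_t\}_{t\ge0}$ is a non-trivial real Lévy process with finite mean on a stochastic basis $(\Omega,\mathcal{F},\mathbf{F}=(\mathcal{F}_t),\mathbf{P}_x)$ with right-continuous complete filtration (as usual, $X$ is $\mathbf{F}$-adapted and its increments are independent of the past); under $\mathbf{P}_x$ it starts from $X_{0^-}=X_0=x$. $\mathbf{E}_x$ is expectation under $\mathbf{P}_x$, $\mathbf{E}=\mathbf{E}_0$. Its characteristic exponent is $\phi(z)=\log\mathbf{E}(e^{zX_1})=\mu z+\frac{\sigma^2}{2}z^2+\int_{\mathbb{R}}(e^{zy}-1-zy)\,\Pi(dy)$, with $\mu=\mathbf{E}(X_1)$, $\sigma\ge0$ and jump measure $\Pi$ with $\int(y^2\wedge|y|)\,\Pi(dy)<\infty$. The infinitesimal generator is $\mathcal{L}u(x)=\lim_{t\to0^+}\frac{\mathbf{E}_x(u(X_t))-u(x)}{t}$, defined for every $u\colon\mathbb{R}\to\mathbb{R}$ for which the limit exists at every $x\in\mathbb{R}$ (then $u$ is said to be in the domain of the generator); (iii) in the claim is understood to include that $\mathcal{L}u$ is defined. **Standing assumptions.** $\delta>0$ is a fixed discount rate. (A1) $\theta>0$ is a constant such that $\mathbf{E}(e^{\pm\theta X_1})<\infty$ and $\max(\phi(\theta),\phi(-\theta))<\delta$. (A2) (i) $c\colon\mathbb{R}\to\mathbb{R}$ is continuously differentiable and in the domain of the infinitesimal generator. (ii) $f\colon\mathbb{R}\to\mathbb{R}$ is continuously differentiable and at least one of the following holds: (a) $\limsup_{x\to-\infty}f(x)\le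 M$ for some $M\in\mathbb{R}$; (b) $f|_{(-\infty,-M]}$ is decreasing for some $M>0$. (iii) There is $K>0$ with $\max(|f(x)|,|f'(x)|,|c(x)|)\le K(1+\cosh(\theta x))$ for all $x\in\mathbb{R}$. **Admissible controls.** An admissible control (for starting point $x$) is a non-negative $\mathbf{F}$-adapted process $D$ such that: $D$ is almost surely right-continuous and non-decreasing with $D_{0^-}=0$ (a jump $d_0:=D_0\ge0$ at time $0$ is allowed), the controlled process being $X^D_t=X_t-D_t$, with $X^D_{0^-}=x$; $D_t$ has finite expectation for every $t\ge0$; and $$\mathbf{E}_x\Big(\int_{0^+}^\infty e^{-\delta s}\big(|f(X^D_{s^-})|\,ds+|c(X^D_{s^-})|\,dD^c_s\big)+\sum_{0^-<s<\infty}e^{-\delta s}\Delta D_s\Big|\int_0^1c(X^D_{s^-}+\Delta X_s-\lambda\Delta D_s)\,d\lambda\Big|\Big)<\infty .$$ Here $D^c$ is the continuous part of $D$, and $\Delta D_s$, $\Delta X_s$ are the jumps at time $s$ (sums over $0^-<s$ include $s=0$, where $\Delta D_0=d_0$, $\Delta X_0=0$). $\mathcal{A}$ is the set of admissible controls. **Cost and value.** For $D\in\mathcal{A}$, $$J_\delta(x,D)=\mathbf{E}_x\Big[\int_{0^+}^\infty e^{-\delta s}\big(f(X^D_{s^-})\,ds+c(X^D_{s^-})\,dD^c_s\big)+\sum_{0^-<s<\infty}e^{-\delta s}\Delta D_s\int_0^1c(X^D_{s^-}+\Delta X_s-\lambda\Delta D_s)\,d\lambda\Big],$$ and $G_\delta(x)=\inf_{D\in\mathcal{A}}J_\delta(x,D)$.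 **Reflecting control.** For $b\in\mathbb{R}$, $D^b_t=\max\{\sup_{0\le s\le t}X_s-b,\,0\}$. *)

(* Defs.v *)
From HB Require Import structures.
From mathcomp Require Import all_boot all_order all_algebra.
From mathcomp Require Import all_classical all_reals all_analysis.

Set Implicit Arguments.
Unset Strict Implicit.
Unset Printing Implicit Defensive.
Import Order.TTheory GRing.Theory Num.Theory.
Import numFieldNormedType.Exports.
Local Open Scope classical_set_scope.
Local Open Scope ring_scope.

Section real_functions.
Context {R : realType}.
Implicit Types (f g : R -> R) (t x : R).

Definition cosh x : R := (expR x + expR (- x)) / 2.

Definition C1 f : Prop := (forall x, derivable f x 1) /\ continuous (derive1 f).

Definition C2 f : Prop := C1 f /\ C1 (derive1 f).

(** A path given on [0, +oo[ is extended by 0 to negative times, so that its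
    left limit at 0 is 0 and a nonzero value at 0 is a jump at time 0. *)
Definition from0 g : R -> R := fun t => if 0 <= t then g t else 0.

Definition left_lim g t : R := lim (g @ t^'-).

Definition jump g t : R := g t - left_lim g t.

Definition cont_part g : R -> R :=
  fun t => g t - fine (\esum_(s in [set s | s <= t]) (jump g s)%:E)%R.

Definition cadlag g : Prop :=
  (forall t, 0 <= t -> g @ t^'+ --> g t) /\
  (forall t, 0 < t -> cvg (g @ t^'-)).

Section cumulative_mk.
Variables (g : R -> R) (gmono : nondecreasing g) (grc : right_continuous g).
Definition cumulative_fun := let _ := (gmono, grc) in g.
HB.instance Definition _ := isCumulative.Build R _ R cumulative_fun gmono grc.
Definition cumulative_mk : cumulative R R := cumulative_fun.
End cumulative_mk.

(** The measure dg on the real line. A function that is not non-decreasing and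
    right-continuous gets the null measure; this only concerns the paths of a
    control in a null set. *)
Definition stieltjes g : {measure set (measurableTypeR R) -> \bar R} :=
  match pselect (nondecreasing g /\ right_continuous g) with
  | left h => lebesgue_stieltjes_measure (cumulative_mk h.1 h.2)
  | right _ => mzero
  end.

(** [esum] is meant for non-negative families. *)
Definition signed_esum (A : set R) (a : R -> \bar R) : \bar R :=
  (esum A (a^\+) - esum A (a^\-))%E.

End real_functions.

Section path_costs.
Context {R : realType}.
Variables (delta : R) (f c : R -> R).
Local Notation mu := (@lebesgue_measure R).

(** In what follows [xi] is a path of X - x and [eta] a path of D, both extended
    by 0 to negative times. *)
Variables (x : R) (xi eta : R -> R).

Definition controlled : R -> R := fun s => x + xi s - eta s.

Definition jump_pos (s lambda : R) : R :=
  left_lim controlled s + jump xi s - lambda * jump eta s.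

Definition jump_cost (s : R) : R :=
  \int[mu]_(lambda in `[0, 1]) c (jump_pos s lambda).

Definition path_cost : \bar R :=
  (\int[mu]_(s in `]0%R, +oo[)
      (expR (- delta * s) * f (left_lim controlled s))%:E
   + \int[stieltjes (cont_part eta)]_(s in `]0%R, +oo[)
      (expR (- delta * s) * c (left_lim controlled s))%:E
   + signed_esum [set s | 0 <= s]%R
      (fun s => (expR (- delta * s) * jump eta s * jump_cost s)%:E))%E.

Definition path_abs_cost : \bar R :=
  (\int[mu]_(s in `]0%R, +oo[)
      (expR (- delta * s) * `|f (left_lim controlled s)|)%:E
   + \int[stieltjes (cont_part eta)]_(s in `]0%R, +oo[)
      (expR (- delta * s) * `|c (left_lim controlled s)|)%:E
   + \esum_(s in [set s | 0 <= s]%R)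
      (expR (- delta * s) * jump eta s * `|jump_cost s|)%:E)%E.

End path_costs.

(** A process indexed by time is a function [X : R -> T -> R] of which only the
    times [0 <= t] are used. *)
Section processes.
Context {R : realType} {d : measure_display} {T : measurableType d}.
Variable P : probability T R.
Implicit Types (F : R -> set (set T)) (X D : R -> T -> R).

Record usual_filtration F : Prop := {
  filtration_sigma : forall t, 0 <= t -> sigma_algebra [set: T] (F t) ;
  filtration_measurable : forall t, 0 <= t -> F t `<=` measurable ;
  filtration_mono : forall s t, 0 <= s -> s <= t -> F s `<=` F t ;
  filtration_right_continuous : forall t, 0 <= t ->
    \bigcap_(s in [set s | t < s]) F s `<=` F t ;
  filtration_complete : forall A, P.-negligible A -> F 0 A }.

Definition adapted F X : Prop :=
  forall t, 0 <= t -> forall B : set R, measurable B -> F t (X t @^-1` B).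

(** [P] is P_0. The law P_x is realized by translation: under P_x the process
    is [fun t w => x + X t w], with the same filtration for all x. (A filtration
    on one sample space cannot be complete for all the laws of a process whose
    starting point is encoded in the measure, as these are mutually singular.) *)
Record levy_process F X : Prop := {
  levy_adapted : adapted F X ;
  levy_start : {ae P, forall w, X 0 w = 0} ;
  levy_cadlag : {ae P, forall w, cadlag (X ^~ w)} ;
  levy_independent : forall s t, 0 <= s -> s <= t ->
    forall (A : set T) (B : set R), F s A -> measurable B ->
    P (A `&` ((X t \- X s)%R @^-1` B))
    = (P A * P ((X t \- X s)%R @^-1` B))%E ;
  levy_stationary : forall s t, 0 <= s -> s <= t ->
    forall B : set R, measurable B ->
    P ((X t \- X s)%R @^-1` B) = P (X (t - s) @^-1` B) }.

Definition nontrivial X : Prop :=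
  ~ {ae P, forall w, forall t, 0 <= t -> X t w = 0}.

Definition finite_mean X : Prop := P.-integrable setT (EFin \o X 1).

(** A Lévy process has either almost surely, or almost surely not, paths of
    bounded variation on compacts; unbounded variation is the negation. *)
Definition has_bounded_variation X : Prop :=
  {ae P, forall w, forall t, 0 <= t -> bounded_variation 0 t (X ^~ w)}.

Definition char_exponent X (z : R) : R := ln (fine (mmt_gen_fun P (X 1) z)).

Definition generator_quotient X (u : R -> R) (x t : R) : \bar R :=
  (('E_P[fun w => u (x + X t w)%R] - (u x)%:E) * (t^-1)%:E)%E.

Definition in_generator_domain X (u : R -> R) : Prop :=
  forall x, exists l : R, generator_quotient X u x t @[t --> 0^'+] --> l%:E.

Definition generator X (u : R -> R) (x : R) : R :=
  fine (lim (generator_quotient X u x t @[t --> 0^'+])).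

Definition assumption_A1 X (delta theta : R) : Prop :=
  [/\ 0 < theta,
      (mmt_gen_fun P (X 1%R) theta < +oo)%E,
      (mmt_gen_fun P (X 1%R) (- theta)%R < +oo)%E &
      Num.max (char_exponent X theta) (char_exponent X (- theta)) < delta].

Record assumption_A2 X (theta : R) (f c : R -> R) : Prop := {
  A2_c_C1 : C1 c ;
  A2_c_domain : in_generator_domain X c ;
  A2_f_C1 : C1 f ;
  A2_f_left :
    (exists M : R, (limf_esup (EFin \o f) -oo%R <= M%:E)%E) \/
    (exists2 M : R, 0 < M & forall x y, x <= y -> y <= - M -> f y <= f x) ;
  A2_growth : exists2 K : R, 0 < K &
    forall x, Num.max (Num.max `|f x| `|derive1 f x|) `|c x|
              <= K * (1 + cosh (theta * x)) }.

Section control_problem.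
Variables (F : R -> set (set T)) (X : R -> T -> R) (delta : R) (f c : R -> R).

Record admissible (x : R) (D : R -> T -> R) : Prop := {
  admissible_ge0 : forall t w, 0 <= t -> 0 <= D t w ;
  admissible_adapted : adapted F D ;
  admissible_path : {ae P, forall w,
    (forall t, 0 <= t -> D ^~ w @ t^'+ --> D t w) /\
    (forall s t, 0 <= s -> s <= t -> D s w <= D t w)} ;
  admissible_mean : forall t, 0 <= t -> P.-integrable setT (EFin \o D t) ;
  admissible_cost :
    (\int[P]_w path_abs_cost delta f c x (from0 (X ^~ w)) (from0 (D ^~ w))
     < +oo)%E }.

(** For an inadmissible control this is the library's convention for a possibly
    undefined integral; only admissible controls enter [value_G]. *)
Definition cost_J (x : R) (D : R -> T -> R) : \bar R :=
  (\int[P]_w path_cost delta f c x (from0 (X ^~ w)) (from0 (D ^~ w)))%E.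

Definition value_G (x : R) : \bar R :=
  ereal_inf [set cost_J x D | D in admissible x].

End control_problem.

(** The reflecting control under P_x, i.e. for the process [x + X]. *)
Definition reflecting X (x b : R) : R -> T -> R := fun t w =>
  Num.max (sup [set x + X s w | s in `[0, t]] - b) 0.

End processes.

(* Main.v *)
Require Import Defs.
From mathcomp Require Import all_boot all_order all_algebra.
From mathcomp Require Import all_classical all_reals all_analysis.
From mathcomp Require Import measurable_realfun.
From mathcomp Require Import ring lra.
Set Implicit Arguments.
Unset Strict Implicit.
Unset Printing Implicit Defensive.
Import Order.TTheory GRing.Theory Num.Theory.
Import numFieldNormedType.Exports.
Local Open Scope classical_set_scope.
Local Open Scope ring_scope.

(** Write [V y := e^{-delta h} E u(y + X_h) + h f(y) - u(y)] for a dyadic step [h].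
    Both smoothness cases make the difference quotients [(E u(y + X_h) - u(y)) / h]
    equicontinuous, so that [V = h (L u - delta u + f) + o(h)] uniformly on bounded sets.
    A control frozen between grid times then gives a Markov chain along which, by the
    independence of the increments and [u' <= c], discounted [u] plus accumulated cost
    is a submartingale up to [o(1)]; this replaces Ito's formula. The chain of the
    reflecting control stays below [xstar] and is pushed only where [u' = c], and for
    it the inequality is an equality up to [o(1)].

    The passage to the limit is made path by path: the control cost is an integral over
    the levels reached by the control, evaluated at their passage times, and the passage
    times of the chain converge for all but countably many levels.

    As the horizon [m] grows, an arbitrary control is first capped at a level
    proportional to [m], which makes [e^{-delta m} u] vanish in mean; the running cost
    after the cap is controlled by [f y <= |f z| + C (1 + e^{theta y})] for [z <= y]. For
    the reflecting control, [cosh (theta (Y_t - xstar))] at the reflected position [Y_t]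
    grows in mean at most like [e^{d t}] with [d < delta], which gives admissibility and
    transversality. *)

(** * Paths on dyadic grids *)

(** Three obstacles shape the proof. Convergence to the generator is given only pointwise.
    Equicontinuity makes it uniform on compact sets, and it rests on two facts about one increment
    of the process: moments of order [h] and an exponential tail small compared with [h]. Because
    the uniformity is only on compact sets, the chain is frozen outside a ball whose radius grows
    slowly with the grid, and limits of means are taken by domination. The dominating functions are
    exponentials of running maxima; their means are controlled through a functional [e^M g(v - M)]
    which grows in mean by a factor [1 + O(h)] per step, for the free process as well as for the
    drawdown of the reflected chain.

    The cost of a control mixes a Stieltjes integral with a sum over jumps. Both are images of
    Lebesgue measure on the levels under the passage time, and this is what allows one integral over
    levels to stand for them.

    Regularity of paths holds only almost surely. On a null set the process and the control are
    replaced by the zero path, which a complete filtration permits, so the intermediate results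
    speak of every path. *)

Section paths.
Context {R : realType}.
Implicit Types (g : R -> R) (s t h l M : R).

Lemma cvgEF (u : nat -> R) l : u n @[n --> \oo] --> l ->
  (u n)%:E @[n --> \oo] --> l%:E.
Proof. by move=> ul; apply: cvg_EFin => //; near=> n. Unshelve. all: by end_near. Qed.

Lemma cvg_expR (u : nat -> R) l : u n @[n --> \oo] --> l ->
  expR (u n) @[n --> \oo] --> expR l.
Proof. by move=> ul; apply: continuous_cvg => //; exact: continuous_expR. Qed.

Lemma cvg_le_near (u : nat -> R) l M : u n @[n --> \oo] --> l ->
  (\forall n \near \oo, u n <= M) -> l <= M.
Proof.
move=> ul uM; have cu : cvgn u by apply/cvg_ex; exists l.
by rewrite -(cvg_lim (@Rhausdorff R) ul); apply: limr_le.
Qed.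

Lemma cvg_ge_near (u : nat -> R) l M : u n @[n --> \oo] --> l ->
  (\forall n \near \oo, M <= u n) -> M <= l.
Proof.
move=> ul uM; have cu : cvgn u by apply/cvg_ex; exists l.
by rewrite -(cvg_lim (@Rhausdorff R) ul); apply: limr_ge.
Qed.

Lemma rc_near g t : g @ t^'+ --> g t -> forall e, 0 < e ->
  exists2 r, 0 < r & forall s, t <= s -> s < t + r -> `|g s - g t| < e.
Proof.
move=> /cvgrPdist_lt gt e e0.
have [r /= r0 rP] := gt e e0.
exists r => // s; rewrite le_eqVlt => /predU1P[<- _|ts str].
  by rewrite subrr normr0.
by rewrite distrC; apply: rP => //=; rewrite distrC ger0_norm ?subr_ge0 ?ltW// ltrBlDl.
Qed.

Lemma ll_near g t l : g @ t^'- --> l -> forall e, 0 < e ->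
  exists2 r, 0 < r & forall s, s < t -> t - r < s -> `|g s - l| < e.
Proof.
move=> /cvgrPdist_lt gt e e0.
have [r /= r0 rP] := gt e e0.
exists r => // s ts str.
by rewrite distrC; apply: rP => //=; rewrite ger0_norm ?subr_ge0 ?ltW// ltrBlDl -ltrBlDr.
Qed.

Lemma rc_seq g t (u : nat -> R) : g @ t^'+ --> g t ->
  (\forall n \near \oo, t <= u n) -> u n @[n --> \oo] --> t ->
  g (u n) @[n --> \oo] --> g t.
Proof.
move=> gt tu ut; apply/cvgrPdist_lt => e e0.
have [r r0 rP] := rc_near gt e0.
near=> n; rewrite distrC; apply: rP; first by near: n.
rewrite -ltrBlDl; apply: (le_lt_trans (ler_norm _)); rewrite distrC.
by near: n; move/cvgrPdist_lt : ut => /(_ _ r0).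
Unshelve. all: by end_near. Qed.

Lemma ll_seq g t l (u : nat -> R) : g @ t^'- --> l ->
  (\forall n \near \oo, u n < t) -> u n @[n --> \oo] --> t ->
  g (u n) @[n --> \oo] --> l.
Proof.
move=> gt tu ut; apply/cvgrPdist_lt => e e0.
have [r r0 rP] := ll_near gt e0.
near=> n; rewrite distrC; apply: rP; first by near: n.
rewrite ltrBlDr -ltrBlDl; apply: (le_lt_trans (ler_norm _)).
by near: n; move/cvgrPdist_lt : ut => /(_ _ r0).
Unshelve. all: by end_near. Qed.

(** Around each time the path is close to its value on the right and to its left limit on the left;
    compactness of the segment, in near-covering form, turns the local bounds into one. *)
Lemma cadlag_bounded g t : cadlag g ->
  exists2 M, 0 <= M & forall s, 0 <= s -> s <= t -> `|g s| <= M.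
Proof.
move=> [grc gll].
have : near_covering `[0, t] by apply/compact_near_coveringP; exact: segment_compact.
move=> /(_ R (+oo : set_system R) (fun M s => 0 <= s -> `|g s| <= M)).
move=> /(_ _); case.
  move=> s; rewrite /= in_itv/= => /andP[s0 st].
  have [r1 r10 r1P] := rc_near (grc s s0) ltr01.
  have [r2 r20 [l r2P]] : exists2 r, 0 < r & exists l, forall y, 0 <= y -> y < s ->
      s - r < y -> `|g y - l| < 1.
    move: s0; rewrite le_eqVlt => /predU1P[<-|s0].
      by exists 1 => //; exists 0 => y y0 /(le_lt_trans y0); rewrite ltxx.
    have [r r0 rP] := ll_near (gll s s0) ltr01.
    by exists r => //; exists (lim (g @ s^'-)) => y _; exact: rP.
  exists ([set y | `|s - y| < Num.min r1 r2], [set M | `|g s| + 1 + (`|l| + 1) <= M]).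
    split => /=.
      by apply/nbhs_ballP; exists (Num.min r1 r2) => //=; rewrite lt_min r10.
    by apply: nbhs_pinfty_ge; rewrite num_real.
  move=> [y M] /= [ys yM] y0; apply: le_trans yM.
  have [sy|ys'] := leP s y.
    have : `|g y - g s| < 1.
      apply: r1P => //; rewrite -ltrBlDl; apply: (le_lt_trans (ler_norm _)).
      by rewrite distrC (lt_le_trans ys)// ge_min lexx.
    move=> h; apply: (@le_trans _ _ (`|g s| + 1)); last by rewrite lerDl addr_ge0.
    by rewrite -[g y](subrK (g s)) addrC (le_trans (ler_normD _ _))// lerD2l ltW.
  have h : `|g y - l| < 1.
    apply: r2P => //; rewrite ltrBlDr -ltrBlDl; apply: (le_lt_trans (ler_norm _)).
    by rewrite (lt_le_trans ys)// ge_min lexx orbT.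
  apply: (@le_trans _ _ (`|l| + 1)); last by rewrite lerDr addr_ge0.
  by rewrite -[g y](subrK l) addrC (le_trans (ler_normD _ _))// lerD2l ltW.
move=> M [_ MP].
exists (Num.max 0 (M + 1)); first by rewrite le_max lexx.
move=> s s0 st; rewrite le_max; apply/orP; right; apply: MP => //.
  by rewrite ltrDl.
by rewrite /= in_itv/= s0.
Qed.

Fixpoint grid_max g (h : R) k : R :=
  if k is k'.+1 then Num.max (grid_max g h k') (g (k%:R * h)) else g 0.

Lemma grid_max_ge g h k j : (j <= k)%N -> g (j%:R * h) <= grid_max g h k.
Proof.
elim: k => [|k IH]; first by rewrite leqn0 => /eqP ->; rewrite mul0r.
rewrite leq_eqVlt => /predU1P[->|/IH] /=; first by rewrite le_max lexx orbT.
by rewrite le_max => ->.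
Qed.

Lemma grid_max_le g h k M : (forall j, (j <= k)%N -> g (j%:R * h) <= M) -> grid_max g h k <= M.
Proof.
elim: k => [/(_ 0%N)|k IH hM] /=; first by rewrite mul0r; apply.
by rewrite ge_max hM// IH// => j jk; rewrite hM// leqW.
Qed.

Lemma grid_max_attained g h k : exists2 j, (j <= k)%N & grid_max g h k = g (j%:R * h).
Proof.
elim: k => [|k [j jk e]] /=; first by exists 0%N; rewrite ?mul0r.
case: (leP (grid_max g h k) (g (k.+1%:R * h))) => _; first by exists k.+1.
by exists j; rewrite // leqW.
Qed.

Lemma grid_max_nd g h k j : (j <= k)%N -> grid_max g h j <= grid_max g h k.
Proof. by move=> jk; apply: grid_max_le => i ij; rewrite grid_max_ge// (leq_trans ij). Qed.

Lemma grid_max_dyadic g h h' m k : h = m%:R * h' -> grid_max g h k <= grid_max g h' (m * k).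
Proof.
move=> ->; apply: grid_max_le => j jk; rewrite mulrA -natrM grid_max_ge// mulnC leq_mul2l.
by rewrite jk orbT.
Qed.

Definition dyadic n : R := 2^-1 ^+ n.

Lemma dyadic_gt0 n : 0 < dyadic n. Proof. by rewrite exprn_gt0// invr_gt0. Qed.
Lemma dyadic_ge0 n : 0 <= dyadic n. Proof. exact/ltW/dyadic_gt0. Qed.
Lemma dyadic_le1 n : dyadic n <= 1.
Proof. by rewrite exprn_ile1// ?invr_ge0// invf_le1// ler1n. Qed.
Lemma hhM n : (2 ^ n)%:R * dyadic n = 1.
Proof. by rewrite /dyadic exprVn natrX mulfV// expf_neq0. Qed.
Lemma dyadic_cvg0 : dyadic n @[n --> \oo] --> (0 : R).
Proof. by apply: cvg_expr; rewrite ger0_norm ?invr_ge0// invf_lt1// ltr1n. Qed.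

Lemma dyadic_cvg0_right : dyadic n @[n --> \oo] --> (0 : R)^'+.
Proof.
move=> A /= [e e0 eA].
have /cvgrPdist_lt /(_ _ e0) := dyadic_cvg0.
by apply: filterS => n hn; apply: (eA (dyadic n)) => //; exact: dyadic_gt0.
Qed.

Lemma ceil_grid (h s : R) : 0 < h -> 0 <= s ->
  exists k : nat, s <= k%:R * h /\ k%:R * h < s + h.
Proof.
move=> h0 s0.
exists (`|Num.ceil (s / h)|)%N.
have e : (`|Num.ceil (s / h)|)%N%:R = (Num.ceil (s / h))%:~R :> R.
  by rewrite natr_absz ger0_norm// ceil_ge0 (lt_le_trans (@ltrN10 R))// divr_ge0// ltW.
rewrite e; split.
  by rewrite -ler_pdivrMr//; exact: ceil_ge.
rewrite -ltr_pdivlMr// mulrDl divff ?gt_eqF//.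
by have /andP[] := ceil_itv (s / h); rewrite intrD ltrBlDr.
Qed.

(** Refining the grid only adds points, so the maxima increase. A value [g s] with [s < t] is
    recovered at the next grid point by right-continuity; the end point [t] lies on every grid, so
    right-continuity is asked only before [t]. *)
Lemma grid_max_cvg g t M : 0 <= t ->
  (forall s, 0 <= s -> s < t -> g @ s^'+ --> g s) ->
  (forall s, 0 <= s -> s <= t -> g s <= M) ->
  grid_max g (t * dyadic n) (2 ^ n) @[n --> \oo] --> sup [set g s | s in `[0, t]].
Proof.
move=> t0 grc gM.
pose S := [set g s | s in `[0, t]].
have Sub : has_ubound S.
  exists M => _ [s + <-]; rewrite /= in_itv/= => /andP[s0 st]; exact: gM.
have S0 : S !=set0 by exists (g 0); exists 0 => //=; rewrite in_itv/= lexx.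
have up n : grid_max g (t * dyadic n) (2 ^ n) <= sup S.
  apply: grid_max_le => j jn; apply: ub_le_sup => //; exists (j%:R * (t * dyadic n)) => //=.
  rewrite in_itv/= mulr_ge0 ?mulr_ge0 ?dyadic_ge0//=.
  rewrite mulrCA ler_piMr//.
  by rewrite -[leRHS](hhM n) ler_pM2r ?dyadic_gt0// ler_nat.
have nd : nondecreasing_seq (fun n => grid_max g (t * dyadic n) (2 ^ n)).
  apply/nondecreasing_seqP => n; rewrite expnS.
  apply: (@grid_max_dyadic _ _ _ 2); rewrite mulrCA; congr (_ * _).
  by rewrite /dyadic exprS mulrA divff ?mul1r.
suff -> : sup S = sup (range (fun n => grid_max g (t * dyadic n) (2 ^ n))).
  apply: nondecreasing_cvgn => //.
  by exists (sup S) => _ [n _ <-]; exact: up.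
apply/le_anti/andP; split; last first.
  by apply: ge_sup; [exists (grid_max g (t * dyadic 0) (2 ^ 0)); exists 0%N | move=> _ [n _ <-]; exact: up].
have hub : has_ubound (range (fun n => grid_max g (t * dyadic n) (2 ^ n))).
  by exists (sup S) => _ [n _ <-]; exact: up.
apply: ge_sup => // _ [s + <-]; rewrite /= in_itv/= => /andP[s0]; rewrite le_eqVlt => /predU1P[->|st].
  apply: (@le_trans _ _ (grid_max g (t * dyadic 0) (2 ^ 0))); last by apply: ub_le_sup => //; exists 0%N.
  by have := @grid_max_ge g (t * dyadic 0) (2 ^ 0) 1 isT; rewrite mul1r /dyadic expr0 mulr1.
apply/ler_addgt0Pr => e e0.
have [r r0 rP] := rc_near (grc s s0 st) e0.
have tgt0 : 0 < t by exact: le_lt_trans st.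
have [n _ nP] : \forall n \near \oo, t * dyadic n < Num.min r (t - s).
  have : t * dyadic n @[n --> \oo] --> t * 0 by apply: cvgMr; exact: dyadic_cvg0.
  rewrite mulr0 => /cvgrPdist_lt /(_ (Num.min r (t - s))).
  rewrite lt_min r0 subr_gt0 st => /(_ isT); apply: filterS => n.
  by rewrite sub0r normrN ger0_norm// mulr_ge0// ?dyadic_ge0.
have {nP} nP := nP n (leqnn n).
have h0 : 0 < t * dyadic n by rewrite mulr_gt0// dyadic_gt0.
have [k [sk ks]] := ceil_grid h0 s0.
have kn : (k <= 2 ^ n)%N.
  rewrite -(ler_nat R) -(ler_pM2r h0) [leRHS]mulrCA hhM mulr1 ltW//.
  rewrite (lt_le_trans ks)//; move: nP; rewrite lt_min => /andP[_ /ltW].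
  by rewrite lerBrDl.
have : `|g (k%:R * (t * dyadic n)) - g s| < e.
  apply: rP => //; rewrite (lt_le_trans ks)// lerD2l ltW//.
  by move: nP; rewrite lt_min => /andP[].
rewrite ltr_distlC => /andP[_ gse].
apply: (@le_trans _ _ (g (k%:R * (t * dyadic n)) + e)); first exact: ltW.
rewrite lerD2r; apply: (le_trans (grid_max_ge _ _ kn)).
by apply: ub_le_sup => //; exists n.
Qed.

(** Times are rounded up to the grid, so that a right-continuous path evaluated at [cT n t]
    converges to its value at [t]. *)
Definition ck n t : nat := `|Num.ceil (t / dyadic n)|%N.
Definition cT n t : R := (ck n t)%:R * dyadic n.
Lemma ckE n t : 0 <= t -> (ck n t)%:R = (Num.ceil (t / dyadic n))%:~R :> R.
Proof.
move=> t0; rewrite /ck natr_absz ger0_norm// ceil_ge0.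
by rewrite (lt_le_trans (@ltrN10 R))// divr_ge0// dyadic_ge0.
Qed.

Lemma cT_ge n t : 0 <= t -> t <= cT n t.
Proof. by move=> t0; rewrite /cT ckE// -ler_pdivrMr ?dyadic_gt0//; exact: ceil_ge. Qed.

Lemma cT_lt n t : 0 <= t -> cT n t < t + dyadic n.
Proof.
move=> t0; rewrite /cT ckE// -ltr_pdivlMr ?dyadic_gt0// mulrDl divff ?gt_eqF ?dyadic_gt0//.
by have /andP[] := ceil_itv (t / dyadic n); rewrite intrD ltrBlDr.
Qed.

Lemma cT_cvg t : 0 <= t -> cT n t @[n --> \oo] --> t.
Proof.
move=> t0; apply/cvgrPdist_lt => e e0.
near=> n; rewrite distrC ger0_norm ?subr_ge0 ?cT_ge//.
rewrite ltrBlDl (lt_trans (cT_lt n t0))// ltrD2l.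
near: n; have /cvgrPdist_lt /(_ _ e0) := dyadic_cvg0.
by apply: filterS => n; rewrite sub0r normrN ger0_norm ?dyadic_ge0.
Unshelve. all: by end_near. Qed.

Lemma ck_gt n t j : 0 <= t -> (j < ck n t)%N = (j%:R * dyadic n < t).
Proof.
move=> t0; apply/idP/idP => [jk|jt].
  rewrite ltNge; apply/negP => tj.
  have : cT n t < (j.+1)%:R * dyadic n.
    by rewrite (lt_le_trans (cT_lt n t0))// -addn1 natrD mulrDl mul1r lerD2r.
  by rewrite /cT ltr_pM2r ?dyadic_gt0// ltr_nat ltnS leqNgt jk.
by rewrite -(ltr_nat R) -(ltr_pM2r (dyadic_gt0 n)) (lt_le_trans jt)// cT_ge.
Qed.

Lemma ck_le n t j : 0 <= t -> (ck n t <= j)%N = (t <= j%:R * dyadic n).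
Proof. by move=> t0; rewrite leqNgt ck_gt// -leNgt. Qed.

End paths.

(** * Inequalities for the exponential and for the kernel of the maximal inequality *)

Section exp_calculus.
Context {R : realType}.
Implicit Types (y s z : R).

Lemma is_derive_continuous (k k' : R -> R) : (forall z, is_derive z 1 k (k' z)) -> continuous k.
Proof.
by move=> dk z; have := dk z => ?; exact/differentiable_continuous/derivable1_diffP/ex_derive.
Qed.

Lemma is_derive_le (k k' : R -> R) a b : (forall z, is_derive z 1 k (k' z)) ->
  (forall z, a < z -> z < b -> 0 <= k' z) -> a <= b -> k a <= k b.
Proof.
move=> dk k'0 ab.
apply: (@ger0_derive1_le_cc _ k a b) => //.
- move=> r; rewrite in_itv/= => /andP[grid_overshoot rb]; have := dk r => ?.
  by rewrite derive1E derive_val; exact: k'0.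
- by apply: continuous_subspaceT; exact: is_derive_continuous dk.
- by rewrite in_itv/= lexx.
- by rewrite in_itv/= lexx andbT.
Qed.

(* Taylor polynomial of exp on y <= 0: it is C^2, >= 1/2 and reaches y >= 0 as exp,
   so that [e^M g(X - M)] with M the running maximum of X is almost a supermartingale *)
Definition gk (y : R) : R := if 0 <= y then expR y else 1 + y + y ^+ 2 / 2.

Lemma gk_ge y : 2^-1 <= gk y.
Proof.
rewrite /gk; case: ifP => [y0|_]; last by have := sqr_ge0 (1 + y); rewrite sqrrD; lra.
by apply: (@le_trans _ _ 1); [lra|rewrite -expR0 ler_expR].
Qed.

Lemma gk_meas : measurable_fun setT gk.
Proof.
apply: measurable_fun_ifT => //.
  by apply: measurable_fun_ler.
apply: measurable_funD; first exact: measurable_funD.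
by apply: measurable_funM => //; exact: measurable_funX.
Qed.

(** By parity [y >= 0] suffices; there the difference of the two sides vanishes to first order at 0
    and has the non-negative second derivative [cosh z - 1]. *)
Lemma cosh_ge_sqr (y : R) : 1 + y ^+ 2 / 2 <= cosh y.
Proof.
wlog y0 : y / 0 <= y.
  move=> H; have [/H //|/ltW y0] := leP 0 y.
  have := H (- y); rewrite oppr_ge0 y0 sqrrN => /(_ isT).
  by rewrite /cosh opprK addrC (addrC (expR _)) addrC.
pose g := fun y : R => (cosh y - y ^+ 2 / 2).
have dg (z : R) : is_derive z 1 g ((expR z - expR (- z)) / 2 - z).
  rewrite /g /cosh; apply: is_derive_eq.
  by rewrite /GRing.scale/=; field.
pose k := fun y : R => (expR y - expR (- y)) / 2 - y.
have dk (z : R) : is_derive z 1 k (cosh z - 1).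
  rewrite /k /cosh; apply: is_derive_eq.
  by rewrite /GRing.scale/=; field.
have c1 z : 1 <= cosh z.
  have e1 := expR_gt0 z; have e2 := expR_gt0 (- z).
  have : expR z * expR (- z) = 1 by rewrite -expRD subrr expR0.
  rewrite /cosh => e.
  have := sqr_ge0 (expR z - expR (- z)); nra.
have kp z : 0 <= z -> 0 <= k z.
  move=> z0; have -> : 0 = k 0 :> R by rewrite /k oppr0 expR0; ring.
  by apply: (is_derive_le dk) => // r _ _; rewrite subr_ge0.
suff : g 0 <= g y by rewrite /g /cosh oppr0 expR0 expr0n/= mul0r; lra.
by apply: (is_derive_le dg) => // r r0 _; apply: kp; exact: ltW.
Qed.

(** Over a step with [E e^s] and [E e^{-s}] at most [1 + O(h)], the mean of [gk (y + s)] is at most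
    [(1 + O(h)) gk y]: the excess is written with [e^s - 1] and [e^{-s} - 1] alone, and their
    coefficients are bounded by a multiple of [gk y] itself. *)
Lemma gk_step y : y <= 0 -> exists A1 A2 : R, [/\ 0 <= A1, 0 <= A2,
  A1 + A2 <= 7 * gk y &
  forall s, gk (y + s) + (A1 + A2) <= gk y + A1 * expR s + A2 * expR (- s)].
Proof.
move=> y0; pose q := (fun z : R => 1 + z + z ^+ 2 / 2).
have gy : gk y = q y.
  rewrite /gk; case: ifPn => // y0'.
  have -> : y = 0 by apply/le_anti; rewrite y0 y0'.
  by rewrite /q expR0 expr0n/= mul0r !addr0.
have c s : 1 + s ^+ 2 / 2 <= (expR s + expR (- s)) / 2 by exact: cosh_ge_sqr.
have e1 s := expR_ge1Dx s.
(* The polynomial [q] expands exactly around [y]. Where the argument is non-negative, the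
   exponential exceeds [q (y + s)] by at most [e^s - q s], because [e^z - q z] is non-decreasing and
   [y <= 0]. *)
have up s : gk (y + s) <= q y + (1 + y) * s + s ^+ 2 / 2 + (expR s - 1 - s).
  rewrite /gk; case: ifPn => [ys|]; last by move=> _; have := e1 s; rewrite /q; nra.
    have yq : expR (y + s) <= expR s by rewrite ler_expR gerDr.
    have : expR (y + s) - q (y + s) <= expR s - 1 - s - s ^+ 2 / 2.
      pose k := fun z : R => expR z - q z.
      have dk (z : R) : is_derive z 1 k (expR z - 1 - z).
        rewrite /k /q; apply: is_derive_eq.
        by rewrite /GRing.scale/=; field.
      have : k (y + s) <= k s.
        apply: (is_derive_le dk); last by rewrite gerDr.
        by move=> r _ _; rewrite -addrA -opprD subr_ge0; exact: expR_ge1Dx.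
      by rewrite /k /q; lra.
    by rewrite /q; nra.
have gq : 1 <= 2 * q y by rewrite -gy; have := gk_ge y; lra.
have gq1 : `|1 + y| <= q y.
  by rewrite /q ler_norml; apply/andP; split; have := sqr_ge0 (1 + y); have := sqr_ge0 (2 + y); nra.
(* The linear term is bounded by the exponential of matching sign, the remainder by
   [3 (cosh s - 1)], whence the two coefficients [3 / 2]. Since [|1 + y| <= gk y] and [1 <= 2 gk y],
   the total is at most [7 gk y]. *)
rewrite gy; have [y1|y1] := leP 0 (1 + y).
  exists (1 + y + 3 / 2), (3 / 2); rewrite ger0_norm// in gq1; split; [lra|lra|lra|move=> s].
  have := c s; have := e1 s; have := e1 (- s); have := up s => ? ? ? ?.
  have : (1 + y) * s <= (1 + y) * (expR s - 1) by rewrite ler_wpM2l//; lra.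
  lra.
exists (3 / 2), (- (1 + y) + 3 / 2); rewrite ltr0_norm// in gq1; split; [lra|lra|lra|move=> s].
have := c s; have := e1 s; have := e1 (- s); have := up s => ? ? ? ?.
have : - (1 + y) * (- s) <= - (1 + y) * (expR (- s) - 1) by rewrite ler_wpM2l//; lra.
lra.
Qed.

End exp_calculus.

(** * Expectations and the Markov property *)

Section real_expectation.
Context {R : realType} {d : measure_display} {T : measurableType d}.
Variable P : probability T R.
Implicit Types f g h : T -> R.

Definition intg f := P.-integrable setT (EFin \o f).

Definition EE f : R := \int[P]_w f w.

Lemma intg_meas f : intg f -> measurable_fun setT f.
Proof. by move=> /measurable_int/measurable_EFinP. Qed.

Lemma intg_dom g f : measurable_fun setT f -> intg g ->
  (forall w, `|f w| <= g w) -> intg f.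
Proof.
move=> mf ig fg; apply: (le_integrable measurableT _ _ ig).
  exact/measurable_EFinP.
by move=> w _ /=; rewrite lee_fin (le_trans (fg w))// ler_norm.
Qed.

Lemma intg_cst r : intg (fun=> r).
Proof. exact: finite_measure_integrable_cst. Qed.

Lemma intgD f g : intg f -> intg g -> intg (fun w => f w + g w).
Proof. exact: integrableD. Qed.

Lemma intgB f g : intg f -> intg g -> intg (fun w => f w - g w).
Proof. exact: integrableB. Qed.

Lemma intgZ r f : intg f -> intg (fun w => r * f w).
Proof. exact: integrableZl. Qed.

Lemma intgN f : intg f -> intg (fun w => - f w).
Proof. exact: integrableN. Qed.

Lemma intg_norm f : intg f -> intg (fun w => `|f w|).
Proof. exact: integrable_norm. Qed.

Lemma intg_sum (I : Type) (s : seq I) (F : I -> T -> R) :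
  (forall i, intg (F i)) -> intg (fun w => \sum_(i <- s) F i w).
Proof.
move=> iF; elim: s => [|i s IH].
  by rewrite (_ : (fun w => _) = (fun=> 0)); [exact: intg_cst|
    apply/funext => w; rewrite big_nil].
rewrite (_ : (fun w => _) = (fun w => F i w + \sum_(i <- s) F i w)).
  exact: intgD.
by apply/funext => w; rewrite big_cons.
Qed.

Lemma EE_EFin f : intg f -> (\int[P]_w (f w)%:E)%E = (EE f)%:E.
Proof. by move=> jf; rewrite /EE /Rintegral fineK//; exact: integrable_fin_num. Qed.

Lemma EED f g : intg f -> intg g -> EE (fun w => f w + g w) = EE f + EE g.
Proof. exact: RintegralD. Qed.

Lemma EEB f g : intg f -> intg g -> EE (fun w => f w - g w) = EE f - EE g.
Proof. exact: RintegralB. Qed.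

Lemma EEZ r f : intg f -> EE (fun w => r * f w) = r * EE f.
Proof. exact: RintegralZl. Qed.

Lemma EE_cst r : EE (fun=> r) = r.
Proof.
by rewrite /EE /Rintegral integral_cst// [X in (_ * X)%E](@probability_setT _ _ _ P) mule1.
Qed.

Lemma EE_le f g : intg f -> intg g -> (forall w, f w <= g w) -> EE f <= EE g.
Proof. by move=> jf jg fg; apply: le_Rintegral => // w _; exact: fg. Qed.

Lemma EE_ge0 f : (forall w, 0 <= f w) -> 0 <= EE f.
Proof. by move=> f0; apply: Rintegral_ge0. Qed.

Lemma EE_sum (I : Type) (s : seq I) (F : I -> T -> R) :
  (forall i, intg (F i)) ->
  EE (fun w => \sum_(i <- s) F i w) = \sum_(i <- s) EE (F i).
Proof.
move=> iF; elim: s => [|i s IH].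
  rewrite big_nil -[RHS](EE_cst 0); congr EE.
  by apply/funext => w; rewrite big_nil.
rewrite big_cons -IH -EED//; last exact: intg_sum.
by congr EE; apply/funext => w; rewrite big_cons.
Qed.

Lemma EE_norm f : intg f -> `|EE f| <= EE (fun w => `|f w|).
Proof. by move=> jf; exact: le_normr_Rintegral. Qed.

Lemma intg_ge0 f : measurable_fun setT f -> (forall w, 0 <= f w) ->
  (\int[P]_w (f w)%:E < +oo)%E -> intg f.
Proof.
move=> mf f0 fi; apply/integrableP; split; first exact/measurable_EFinP.
by under eq_integral do rewrite /= ger0_norm//.
Qed.

Lemma EE_cvg (f_ : nat -> T -> R) f g : (forall n, measurable_fun setT (f_ n)) ->
  (forall w, f_ n w @[n --> \oo] --> f w) -> intg g ->
  (forall n w, `|f_ n w| <= g w) ->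
  intg f /\ EE (f_ n) @[n --> \oo] --> EE f.
Proof.
move=> mf ff ig fg.
have mlim : measurable_fun setT f.
  by apply: (measurable_fun_cvg mf) => w _; exact: ff.
have [] := @dominated_convergence _ _ _ P setT measurableT
  (fun n => EFin \o f_ n) (EFin \o f) (EFin \o g).
- by move=> n; exact/measurable_EFinP.
- exact/measurable_EFinP.
- apply: aeW => w _ /=; apply: cvg_EFin; last exact: ff.
  by near=> n.
- exact: ig.
- by apply: aeW => w n _ /=; rewrite lee_fin.
move=> jf _ cv; split => //.
have ifn n : intg (f_ n) by exact: (intg_dom _ ig).
by apply: fine_cvg; rewrite fineK//; exact: integrable_fin_num.
Unshelve. all: by end_near. Qed.

End real_expectation.

Section fatou.
Context {R : realType} {d : measure_display} {T : measurableType d}.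
Variable mu : {measure set T -> \bar R}.

Lemma fatou_cvg (f_ : nat -> T -> \bar R) (f : T -> \bar R) (B : nat -> \bar R) L D :
  measurable D ->
  (forall n, measurable_fun D (f_ n)) -> (forall n w, D w -> 0 <= f_ n w)%E ->
  (forall w, D w -> f_ n w @[n --> \oo] --> f w) ->
  (forall n, \int[mu]_(w in D) f_ n w <= B n)%E -> B n @[n --> \oo] --> L ->
  (\int[mu]_(w in D) f w <= L)%E.
Proof.
move=> mD mf f0 ff fB BL.
have -> : (\int[mu]_(w in D) f w = \int[mu]_(w in D) limn_einf (f_ ^~ w))%E.
  by apply: eq_integral => w /set_mem Dw; rewrite (cvg_limn_einf_sup (ff w Dw)).1.
apply: (le_trans (fatou mu mD mf f0)).
rewrite limn_einf_lim -(cvg_lim _ BL)//.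
apply: lee_lim; [exact: is_cvg_einfs|by apply/cvg_ex; exists L|].
near=> n; apply: le_trans (fB n); apply: ereal_inf_lbound; exists n => //=.
Unshelve. all: by end_near. Qed.

Lemma fatou_cvgR (f_ : nat -> T -> R) (f : T -> R) (B : nat -> R) L :
  (forall n, measurable_fun setT (f_ n)) -> (forall n w, 0 <= f_ n w) ->
  (forall w, f_ n w @[n --> \oo] --> f w) ->
  (forall n, \int[mu]_w (f_ n w)%:E <= (B n)%:E)%E -> B n @[n --> \oo] --> L ->
  (\int[mu]_w (f w)%:E <= L%:E)%E.
Proof.
move=> mf f0 ff fB BL.
apply: (@fatou_cvg (fun n w => (f_ n w)%:E) _ (fun n => (B n)%:E)) => //.
- by move=> n; exact/measurable_EFinP.
- by move=> n w _; rewrite lee_fin.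
- by move=> w _; exact: cvgEF.
- exact: cvgEF.
Qed.

End fatou.

Section markov.
Context {R : realType} {d : measure_display} {T : measurableType d}.
Variables (P : probability T R) (F : R -> set (set T)) (X : R -> T -> R).
Hypothesis hF : usual_filtration P F.
Hypothesis hX : levy_process P F X.

Definition Fm d' (U : measurableType d') s (Y : T -> U) :=
  forall B, measurable B -> F s (Y @^-1` B).

(** [F s] is a bare set of sets; passing to the type that carries the sigma-algebra generated by it
    makes the closure properties of measurable functions available for adapted variables. *)
Lemma FmE d' (U : measurableType d') s (Y : T -> U) : 0 <= s ->
  Fm s Y <-> measurable_fun setT (Y : g_sigma_algebraType (F s) -> U).
Proof.
move=> s0; have sF := sigma_algebra_id (filtration_sigma hF s0).
split => [YF _ B mB|YF B mB].
  by rewrite setTI /measurable/= sF; exact: YF.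
by have := YF measurableT B mB; rewrite setTI /measurable/= sF.
Qed.

Lemma Fm_mono d' (U : measurableType d') s t (Y : T -> U) : 0 <= s -> s <= t ->
  Fm s Y -> Fm t Y.
Proof. by move=> s0 st YF B mB; apply: (filtration_mono hF s0 st); exact: YF. Qed.

Lemma Fm_meas d' (U : measurableType d') s (Y : T -> U) : 0 <= s ->
  Fm s Y -> measurable_fun setT Y.
Proof.
by move=> s0 YF _ B mB; rewrite setTI; apply: (filtration_measurable hF s0); exact: YF.
Qed.

Lemma Fm_X s : 0 <= s -> Fm s (X s).
Proof. by move=> s0 B; exact: (levy_adapted hX). Qed.

Lemma X_meas s : 0 <= s -> measurable_fun setT (X s).
Proof. by move=> s0; apply: (Fm_meas s0); exact: Fm_X. Qed.

Lemma Fm_comp d1 d2 (U : measurableType d1) (V : measurableType d2) s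
    (Y : T -> U) (g : U -> V) :
  measurable_fun setT g -> Fm s Y -> Fm s (fun w => g (Y w)).
Proof. by move=> mg YF B mB; have := mg measurableT B mB; rewrite setTI => /YF. Qed.

Lemma Fm_pair d1 d2 (U : measurableType d1) (V : measurableType d2) s
    (Y : T -> U) (Z : T -> V) : 0 <= s ->
  Fm s Y -> Fm s Z -> Fm s (fun w => (Y w, Z w)).
Proof.
move=> s0 /(FmE _ s0) mY /(FmE _ s0) mZ; apply/(FmE _ s0).
exact: measurable_fun_pair.
Qed.

Lemma Fm_cst d' (U : measurableType d') s (r : U) : 0 <= s -> Fm s (fun=> r).
Proof. by move=> s0; apply/(FmE _ s0). Qed.

Lemma Fm_max s (Y Z : T -> R) : 0 <= s -> Fm s Y -> Fm s Z ->
  Fm s (fun w => Num.max (Y w) (Z w)).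
Proof.
move=> s0 /(FmE _ s0) mY /(FmE _ s0) mZ; apply/(FmE _ s0).
exact: measurable_maxr.
Qed.

Lemma Fm_add s (Y Z : T -> R) : 0 <= s -> Fm s Y -> Fm s Z -> Fm s (fun w => Y w + Z w).
Proof.
move=> s0 /(FmE _ s0) mY /(FmE _ s0) mZ; apply/(FmE _ s0).
exact: measurable_funD.
Qed.

Lemma Fm_sub s (Y Z : T -> R) : 0 <= s -> Fm s Y -> Fm s Z -> Fm s (fun w => Y w - Z w).
Proof.
move=> s0 /(FmE _ s0) mY /(FmE _ s0) mZ; apply/(FmE _ s0).
exact: measurable_funB.
Qed.

Lemma Fm_mul s (Y Z : T -> R) : 0 <= s -> Fm s Y -> Fm s Z -> Fm s (fun w => Y w * Z w).
Proof.
move=> s0 /(FmE _ s0) mY /(FmE _ s0) mZ; apply/(FmE _ s0).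
exact: measurable_funM.
Qed.

Lemma Fm_grid_max (g : R -> T -> R) h k : 0 <= h -> (forall t, 0 <= t -> Fm t (g t)) ->
  Fm (k%:R * h) (fun w => grid_max (g ^~ w) h k).
Proof.
move=> h0 gF; elim: k => [|k IH] /=; first by rewrite mul0r; exact: gF.
have kh : 0 <= k.+1%:R * h by rewrite mulr_ge0.
apply: Fm_max => //; last exact: gF.
by apply: Fm_mono IH; rewrite ?mulr_ge0// ler_wpM2r// ler_nat.
Qed.

Lemma measurable_integral_shift d' (U : measurableType d') t (phi : R -> \bar R) (Y : U -> R) :
  0 <= t -> measurable_fun setT phi -> (forall y, 0 <= phi y)%E ->
  measurable_fun setT Y ->
  measurable_fun setT (fun x => \int[P]_v phi (Y x + X t v)%R)%E.
Proof.
move=> t0 mphi phi0 mY.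
pose g (p : U * T) : \bar R := phi (Y p.1 + X t p.2).
have mg : measurable_fun setT g.
  apply: measurableT_comp => //; apply: measurable_funD; apply: measurableT_comp => //.
  exact: X_meas.
exact: (@measurable_fun_fubini_tonelli_F _ _ _ _ _ P g mg (fun=> phi0 _)).
Qed.

(** By independence and stationarity, the joint law of [(Z, Y)] and the increment agrees on
    rectangles with a product of laws, hence is the product measure; Tonelli's theorem then
    integrates the increment out. *)
Lemma markov_ge0 s t (Z Y : T -> R) (phi : R -> \bar R) :
  0 <= s -> s <= t -> measurable_fun setT phi -> (forall y, 0 <= phi y)%E ->
  (forall w, 0 <= Z w) -> Fm s Z -> Fm s Y ->
  (\int[P]_w ((Z w)%:E * phi (Y w + (X t w - X s w))%R) =
   \int[P]_w ((Z w)%:E * \int[P]_v phi (Y w + X (t - s) v)%R))%E.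
Proof.
move=> s0 st mphi phi0 Z0 ZF YF.
have t0 : 0 <= t by exact: le_trans st.
have ts0 : 0 <= t - s by rewrite subr_ge0.
have mZ := Fm_meas s0 ZF; have mY := Fm_meas s0 YF.
pose ZY w := (Z w, Y w).
have ZYF : Fm s ZY by exact: Fm_pair.
have mZY : measurable_fun setT ZY by exact: (Fm_meas s0).
have mW : measurable_fun setT (X t \- X s).
  by apply: measurable_funB; exact: X_meas.
have mV : measurable_fun setT (X (t - s)) by exact: X_meas.
pose ZYm : {mfun T >-> (R * R)%type} := mfun_Sub (mem_set mZY).
pose Vm : {mfun T >-> R} := mfun_Sub (mem_set mV).
pose Jm : {mfun T >-> ((R * R) * R)%type} :=
  mfun_Sub (mem_set (measurable_fun_pair mZY mW)).
pose m1 : probability (R * R)%type R := distribution P ZYm.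
pose m2 : probability R R := distribution P Vm.
pose m' : probability ((R * R) * R)%type R := distribution P Jm.
have rect A B : measurable A -> measurable B -> (m' (A `*` B) = m1 A * m2 B)%E.
  move=> mA mB.
  have -> : m' (A `*` B) = P (ZY @^-1` A `&` (X t \- X s) @^-1` B) by [].
  rewrite (levy_independent hX s0 st) ?(levy_stationary hX s0 st)//.
  exact: ZYF.
have mu' := @product_measure_unique _ _ _ _ _ m1 m2 m' rect.
pose g (p : (R * R) * R) : \bar R := (p.1.1%:E * phi (p.1.2 + p.2)%R)%E.
have mg : measurable_fun setT g.
  apply: emeasurable_funM.
    apply/measurable_EFinP; apply: measurableT_comp => //.
  apply: measurableT_comp => //.
  by apply: measurable_funD => //; apply: measurableT_comp.
pose k (p : R * R) := (p.1%:E * \int[P]_v phi (p.2 + X (t - s) v)%R)%E.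
have Zp (p : R * R) : (\int[m2]_v phi (p.2 + v)%R = \int[P]_v phi (p.2 + X (t - s) v)%R)%E.
  rewrite ge0_integral_pushforward ?preimage_setT//.
  by apply: measurableT_comp => //; apply: measurable_funD.
(* Tonelli's theorem asks for a non-negative integrand on the whole product space, while the first
   coordinate is non-negative only on the image of [Z]. *)
pose g' (p : (R * R) * R) : \bar R := ((Num.max p.1.1 0)%:E * phi (p.1.2 + p.2)%R)%E.
have mg' : measurable_fun setT g'.
  apply: emeasurable_funM.
    apply/measurable_EFinP; apply: measurable_maxr => //; apply: measurableT_comp => //.
  apply: measurableT_comp => //.
  by apply: measurable_funD => //; apply: measurableT_comp.
have g'0 p : (0 <= g' p)%E.
  by rewrite mule_ge0// lee_fin le_max lexx orbT.
have -> : (\int[P]_w ((Z w)%:E * phi (Y w + (X t w - X s w))%R) = \int[m']_p g' p)%E.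
  rewrite ge0_integral_pushforward ?preimage_setT//.
  by apply: eq_integral => w _ /=; rewrite /g'/= max_l.
rewrite -(@eq_measure_integral _ _ _ _ m' (m1 \x m2)%E); last first.
  by move=> A mA _; rewrite -mu'.
rewrite fubini_tonelli1//.
rewrite ge0_integral_pushforward ?preimage_setT//; last 2 first.
  exact: measurable_fun_fubini_tonelli_F.
  by move=> p _; apply: integral_ge0.
apply: eq_integral => w _ /=.
rewrite /fubini_F /g' /= ge0_integralZl//; last 2 first.
- by apply: measurableT_comp => //; apply: measurable_funD.
- by rewrite lee_fin le_max lexx orbT.
by rewrite max_l// (Zp (Z w, Y w)).
Qed.

End markov.

(** * Exponential moments and small times *)

Section moments.
Context {R : realType} {d : measure_display} {T : measurableType d}.
Variables (P : probability T R) (F : R -> set (set T)) (X : R -> T -> R).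
Hypothesis hF : usual_filtration P F.
Hypothesis hX : levy_process P F X.
Hypothesis hX0 : forall w, X 0 w = 0.
Hypothesis hXc : forall w, cadlag (X ^~ w).

Implicit Types (a s t h : R).

Lemma expX_meas a t : 0 <= t -> measurable_fun setT (fun w => expR (a * X t w)).
Proof.
move=> t0; apply: measurableT_comp => //; apply: measurable_funM => //.
exact: (X_meas hF hX).
Qed.

Definition mg a t : \bar R := (\int[P]_w (expR (a * X t w))%:E)%E.

Lemma mg_ge0 a t : (0 <= mg a t)%E.
Proof. by apply: integral_ge0 => w _; rewrite lee_fin expR_ge0. Qed.

Lemma mg0 a : mg a 0 = 1%E.
Proof.
rewrite /mg; under eq_integral => w _ do rewrite hX0 mulr0 expR0.
by rewrite integral_cst// mul1e; exact: probability_setT.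
Qed.

Lemma mgM a s t : 0 <= s -> 0 <= t -> mg a (s + t) = (mg a s * mg a t)%E.
Proof.
move=> s0 t0; have st : s <= s + t by rewrite lerDl.
have mphi : measurable_fun setT (fun y : R => (expR (a * y))%:E).
  by apply/measurable_EFinP; apply: measurableT_comp => //; exact: measurable_funM.
have := @markov_ge0 _ _ _ P F X hF hX s (s + t) (fun w => expR (a * X s w)) (fun=> 0)
  (fun y => (expR (a * y))%:E) s0 st mphi.
have e0 (y : R) : (0 <= (expR y)%:E)%E by rewrite lee_fin expR_ge0.
move=> /(_ (fun=> e0 _) (fun=> expR_ge0 _)).
have FZ : Fm F s (fun w => expR (a * X s w)).
  apply: (Fm_comp (Y := X s) (g := fun y => expR (a * y))).
    by apply: measurableT_comp => //; exact: measurable_funM.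
  exact: (Fm_X hX).
have F0 : Fm F s (fun=> 0 : R) by apply/(FmE hF).
move=> /(_ FZ F0).
under eq_integral => w _ do rewrite -EFinM -expRD -mulrDr add0r addrC subrK.
move=> e; rewrite /mg e.
under eq_integral => w _ do
  (rewrite (_ : (\int[P]_v _)%E = mg a t); last by
    rewrite /mg; apply: eq_integral => v _; rewrite add0r addrAC subrr add0r).
rewrite ge0_integralZr//; last exact: mg_ge0.
by apply/measurable_EFinP; exact: expX_meas.
Qed.

Lemma mg_pow a h n : 0 <= h -> mg a (n%:R * h) = (mg a h ^+ n)%E.
Proof.
move=> h0; elim: n => [|n IH]; first by rewrite mul0r mg0.
by rewrite expeS -natr1 mulrDl mul1r addrC mgM ?mulr_ge0// IH.
Qed.

Lemma mg_gt0 a t : 0 <= t -> (0 < mg a t)%E.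
Proof.
move=> t0; rewrite lt_neqAle mg_ge0 andbT eq_sym; apply/negP => /eqP e.
have me := expX_meas a t0.
have : (\int[P]_(w in setT) `|(expR (a * X t w))%:E|)%E = 0%E.
  by under eq_integral => w _ do rewrite gee0_abs ?lee_fin ?expR_ge0//.
have {}me : measurable_fun setT (fun w => (expR (a * X t w))%:E) by exact/measurable_EFinP.
move=> /(ae_eq_integral_abs P measurableT me).
move=> [N [mN N0 sub]].
have : P setT = 0%E.
  apply/eqP; rewrite eq_le measure_ge0 andbT -N0 le_measure ?inE//.
  move=> w _; apply: sub => /= /(_ I) [] /eqP.
  by rewrite gt_eqF// expR_gt0.
by move/eqP; rewrite [P _]probability_setT onee_eq0.
Qed.

Section finite.
Variable a : R.
Hypothesis ha : (mg a 1 < +oo)%E.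
Definition phi1 := ln (fine (mg a 1)).

Lemma mg1E : mg a 1 = (expR phi1)%:E.
Proof.
rewrite /phi1 lnK ?fineK//; first by rewrite ge0_fin_numE ?mg_ge0.
by rewrite posrE fine_gt0// ha mg_gt0.
Qed.

(** The [2 ^ n]-th power of this moment is [mg a 1]: this excludes the value [+oo] and determines
    the moment as a non-negative root. *)
Lemma mg_dyadic n : mg a (dyadic n) = (expR (phi1 * dyadic n))%:E.
Proof.
have p := mg_pow a (2 ^ n) (dyadic_ge0 n).
rewrite hhM mg1E in p.
have fm : (mg a (dyadic n) \is a fin_num)%E.
  rewrite ge0_fin_numE; last exact: mg_ge0.
  rewrite ltey; apply/eqP => e.
  move: p; rewrite e; have : (0 < 2 ^ n)%N by rewrite expn_gt0.
  case: (2 ^ n)%N => // m _.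
  suff -> : ((+oo : \bar R) ^+ m.+1 = +oo)%E by [].
  by elim: m => [|m IH]; rewrite expeS ?expe0 ?mule1 // IH mulyy.
rewrite -(fineK fm) in p *.
move: p; rewrite -EFin_expe => -[] /esym p; congr EFin.
apply/eqP; rewrite -(@eqrXn2 _ (2 ^ n)) ?expn_gt0//; last by rewrite fine_ge0// mg_ge0.
apply/eqP; rewrite p -expRM_natl; congr expR.
by rewrite mulrCA hhM mulr1.
Qed.

Lemma mg_grid n k : mg a (k%:R * dyadic n) = (expR (phi1 * (k%:R * dyadic n)))%:E.
Proof.
rewrite mg_pow ?dyadic_ge0// mg_dyadic -EFin_expe -expRM_natl; congr (expR _)%:E.
by rewrite mulrCA.
Qed.

(** Equality holds on dyadic times; right-continuity of the paths and Fatou's lemma carry the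
    inequality to every time. *)
Lemma mg_le t : 0 <= t -> (mg a t <= (expR (phi1 * t))%:E)%E.
Proof.
move=> t0.
apply: (@fatou_cvgR _ _ _ P (fun n w => expR (a * X (cT n t) w)) _
  (fun n => expR (phi1 * cT n t))).
- by move=> n; apply: expX_meas; rewrite (le_trans t0)// cT_ge.
- by move=> n w; exact: expR_ge0.
- move=> w; apply: cvg_expR; apply: cvgMr; apply: (rc_seq ((hXc w).1 t t0)).
    by near=> n; exact: cT_ge.
  exact: cT_cvg.
- by move=> n; have := mg_grid n (ck n t); rewrite /mg => ->.
- by apply: cvg_expR; apply: cvgMr; exact: cT_cvg.
Unshelve. all: by end_near. Qed.

End finite.

End moments.

Section small_time.
Context {R : realType} {d : measure_display} {T : measurableType d}.
Variables (P : probability T R) (F : R -> set (set T)) (X : R -> T -> R).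
Hypothesis hF : usual_filtration P F.
Hypothesis hX : levy_process P F X.
Hypothesis hX0 : forall w, X 0 w = 0.
Hypothesis hXc : forall w, cadlag (X ^~ w).
Variables (theta dl : R).
Hypothesis th0 : 0 < theta.
Hypothesis dl0 : 0 <= dl.
Hypothesis mgp : forall t : R, 0 <= t -> (mg P X theta t <= (expR (dl * t))%:E)%E.
Hypothesis mgm : forall t : R, 0 <= t -> (mg P X (- theta) t <= (expR (dl * t))%:E)%E.
Implicit Types (a s t h : R).

Lemma intg_expX a t : a = theta \/ a = - theta -> 0 <= t ->
  intg P (fun w => expR (a * X t w)).
Proof.
move=> ha t0; apply: intg_ge0 => //; first exact: (expX_meas hF hX).
by case: ha => ->; [apply: (le_lt_trans (mgp t0))|apply: (le_lt_trans (mgm t0))]; rewrite ltry.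
Qed.

Lemma EE_expX a t : a = theta \/ a = - theta -> 0 <= t ->
  EE P (fun w => expR (a * X t w)) <= expR (dl * t).
Proof.
move=> ha t0; rewrite -lee_fin -EE_EFin; last exact: intg_expX.
by case: ha => ->; [exact: mgp|exact: mgm].
Qed.

(** A Lipschitz constant of [h |-> e^{dl h}] on [[0, H]]. *)
Definition kd (H : R) := dl * expR (dl * H).

Lemma kd_ge0 H : 0 <= kd H. Proof. by rewrite mulr_ge0// expR_ge0. Qed.

Lemma expR_small h H : 0 <= h -> h <= H -> expR (dl * h) - 1 <= kd H * h.
Proof.
move=> h0 h1.
have : expR (dl * h) * (1 - dl * h) <= 1.
  have := expR_ge1Dx (- (dl * h)); rewrite expRN => e.
  apply: (@le_trans _ _ (expR (dl * h) * (expR (dl * h))^-1)).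
    by rewrite ler_pM2l ?expR_gt0.
  by rewrite divff// gt_eqF// expR_gt0.
rewrite mulrBr mulr1 => e.
have : expR (dl * h) * (dl * h) <= kd H * h.
  rewrite /kd -mulrA mulrCA ler_wpM2l// mulrC (mulrC (expR _)) ler_wpM2l//.
  by rewrite ler_expR ler_wpM2l.
by lra.
Qed.

Lemma intg_coshX t : 0 <= t -> intg P (fun w => cosh (theta * X t w)).
Proof.
move=> t0; rewrite (_ : (fun w => _) = (fun w => 2^-1 * (expR (theta * X t w) + expR (- theta * X t w)))).
  apply: intgZ; apply: intgD; apply: intg_expX => //; [by left|by right].
by apply/funext => w; rewrite /cosh mulrC mulNr.
Qed.

Lemma EE_coshX t : 0 <= t -> EE P (fun w => cosh (theta * X t w)) <= expR (dl * t).
Proof.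
move=> t0; rewrite (_ : (fun w => _) = (fun w => 2^-1 * (expR (theta * X t w) + expR (- theta * X t w)))).
  have i1 := intg_expX (or_introl erefl) t0.
  have i2 := intg_expX (or_intror erefl) t0.
  rewrite EEZ ?EED//; last exact: intgD.
  have := EE_expX (or_introl erefl) t0.
  by have := EE_expX (or_intror erefl) t0; lra.
by apply/funext => w; rewrite /cosh mulrC mulNr.
Qed.

Definition Mx a h k w := grid_max (fun t => a * X t w) h k.

Lemma Mx_Fm a h k : 0 <= h -> Fm F (k%:R * h) (Mx a h k).
Proof.
move=> h0; apply: (Fm_grid_max hF (g := fun t w => a * X t w)) => // t t0.
apply: (Fm_comp (Y := X t) (g := fun y => a * y)); last exact: (Fm_X hX).
exact: measurable_funM.
Qed.

Section drift_of_maximum.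
Variables (a h H C0 : R) (M v : nat -> T -> R).
Hypothesis ha : a = theta \/ a = - theta.
Hypothesis h0 : 0 <= h.
Hypothesis hH : h <= H.
Hypothesis MF : forall k, Fm F (k%:R * h) (M k).
Hypothesis vF : forall k, Fm F (k%:R * h) (v k).
Hypothesis vM : forall k w, v k w <= M k w.
Hypothesis Mstep : forall k w, expR (M k.+1 w) * gk (v k.+1 w - M k.+1 w) <=
  expR (M k w) * gk (v k w + a * (X (k.+1%:R * h) w - X (k%:R * h) w) - M k w).
Hypothesis C00 : 0 <= C0.
Hypothesis M0 : forall w, expR (M 0 w) * gk (v 0 w - M 0 w) <= C0.

Let kh0 k : 0 <= k%:R * h. Proof. by rewrite mulr_ge0. Qed.

Let mMv k : measurable_fun setT (fun w => expR (M k w) * gk (v k w - M k w)).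
Proof.
apply: measurable_funM; first by apply: measurableT_comp => //; exact: (Fm_meas hF (kh0 k) (MF k)).
apply: measurableT_comp; first exact: gk_meas.
by apply: measurable_funB; [exact: (Fm_meas hF (kh0 k) (vF k))|exact: (Fm_meas hF (kh0 k) (MF k))].
Qed.

(** [M] is a running maximum and [v] the current value below it. By [Mstep], updating the maximum
    does not increase the functional, so only an increment of the process acts, and by [gk_step] it
    costs a factor [1 + 7 kd H h]. The pair is left abstract because it is needed for the free
    process and for the drawdown of the reflected chain. *)
Lemma expM_step k :
  (\int[P]_w (expR (M k.+1 w) * gk (v k.+1 w - M k.+1 w))%:E <=
   (1 + 7 * kd H * h)%:E * \int[P]_w (expR (M k w) * gk (v k w - M k w))%:E)%E.
Proof.
have a0 : a != 0 by case: ha => ->; rewrite ?oppr_eq0 gt_eqF.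
have k0 := kh0 k.
have kk : k%:R * h <= k.+1%:R * h by rewrite ler_wpM2r// ler_nat.
have dh : k.+1%:R * h - k%:R * h = h by rewrite -natr1; ring.
pose phi (y : R) : \bar R := (gk (a * y))%:E.
have mphi : measurable_fun setT phi.
  by apply/measurable_EFinP; apply: measurableT_comp; [exact: gk_meas|exact: measurable_funM].
have phi0 y : (0 <= phi y)%E by rewrite lee_fin (le_trans _ (gk_ge _)).
(* The Markov property speaks of increments of [X], the functional of increments of [a X]; hence the
   division by [a]. *)
pose Y w := (v k w - M k w) / a.
have YF : Fm F (k%:R * h) Y.
  apply: (Fm_comp (Y := fun w => v k w - M k w) (g := fun y => y / a)); first exact: measurable_funM.
  exact: (Fm_sub hF).
have ZF : Fm F (k%:R * h) (fun w => expR (M k w)).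
  exact: (Fm_comp (Y := M k) (g := expR)).
have mdX : measurable_fun setT (fun w => X (k.+1%:R * h) w - X (k%:R * h) w).
  by apply: measurable_funB; exact: (X_meas hF hX).
apply: (@le_trans _ _ (\int[P]_w ((expR (M k w))%:E * phi (Y w + (X (k.+1%:R * h) w - X (k%:R * h) w))%R))%E).
  apply: ge0_le_integral => //.
  - by move=> w _; rewrite lee_fin mulr_ge0 ?expR_ge0// (le_trans _ (gk_ge _)).
  - exact/measurable_EFinP.
  - apply: emeasurable_funM; first by apply/measurable_EFinP; exact: (Fm_meas hF k0 ZF).
    apply: measurableT_comp => //; apply: measurable_funD => //.
    exact: (Fm_meas hF k0 YF).
  - move=> w _; rewrite /phi -EFinM lee_fin; apply: (le_trans (Mstep k w)).
    rewrite le_eqVlt; apply/orP; left; apply/eqP; congr (_ * gk _).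
    by rewrite /Y; field.
rewrite (markov_ge0 hF hX k0 kk mphi phi0 _ ZF YF)//.
rewrite -ge0_integralZl//; last 3 first.
- exact/measurable_EFinP.
- by move=> w _; rewrite lee_fin mulr_ge0 ?expR_ge0// (le_trans _ (gk_ge _)).
- by rewrite lee_fin addr_ge0// !mulr_ge0// kd_ge0.
have step w : (\int[P]_u phi (Y w + X (k.+1%:R * h - k%:R * h) u)%R <=
   ((1 + 7 * kd H * h) * gk (v k w - M k w))%:E)%E.
  rewrite dh /phi; set y := v k w - M k w.
  have y0 : y <= 0 by rewrite subr_le0.
  under eq_integral => u _.
    rewrite (_ : a * _ = y + a * X h u); last by rewrite /Y -/y; field.
    over.
  have [A1 [A2 [A10 A20 A12 gA]]] := gk_step y0.
  have na : - a = theta \/ - a = - theta by case: ha => ->; rewrite ?opprK; [right|left].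
  have i1 := intg_expX ha h0; have i2 := intg_expX na h0.
  pose G v := gk y + A1 * expR (a * X h v) + A2 * expR (- a * X h v) - (A1 + A2).
  have iG : intg P G.
    apply: intgB; last exact: intg_cst.
    apply: intgD; last exact: intgZ.
    by apply: intgD; [exact: intg_cst|exact: intgZ].
  have gG z : gk (y + a * X h z) <= G z.
    by rewrite /G; have := gA (a * X h z); rewrite mulNr; lra.
  have jg : intg P (fun v => gk (y + a * X h v)).
    apply: (intg_dom _ iG).
      apply: measurableT_comp; first exact: gk_meas.
      apply: measurable_funD => //; apply: measurable_funM => //; exact: (X_meas hF hX).
    by move=> z; rewrite ger0_norm// (le_trans _ (gk_ge _)).
  rewrite (EE_EFin jg) lee_fin; apply: (le_trans (EE_le jg iG gG)).
  rewrite /G EEB; last 2 first.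
    apply: intgD; last exact: intgZ.
    by apply: intgD; [exact: intg_cst|exact: intgZ].
    exact: intg_cst.
  rewrite EED; last 2 first.
    by apply: intgD; [exact: intg_cst|exact: intgZ].
    exact: intgZ.
  rewrite EED ?EE_cst ?EEZ//; last 2 first.
    exact: intg_cst.
    exact: intgZ.
  have E1 := EE_expX ha h0; have E2 := EE_expX na h0.
  have es := expR_small h0 hH.
  have g0 := gk_ge y.
  have k1 : 0 <= kd H * h by rewrite mulr_ge0// kd_ge0.
  have B1 : A1 * (EE P (fun w => expR (a * X h w)) - 1) <= A1 * (kd H * h).
    by rewrite ler_wpM2l// lerBlDr (le_trans E1)// -lerBlDr.
  have B2 : A2 * (EE P (fun w => expR (- a * X h w)) - 1) <= A2 * (kd H * h).
    by rewrite ler_wpM2l// lerBlDr (le_trans E2)// -lerBlDr.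
  have B3 : (A1 + A2) * (kd H * h) <= 7 * gk y * (kd H * h) by rewrite ler_wpM2r.
  nra.
apply: ge0_le_integral => //.
- by move=> w _; rewrite mule_ge0 ?lee_fin ?expR_ge0// integral_ge0.
- apply: emeasurable_funM; first by apply/measurable_EFinP; exact: (Fm_meas hF k0 ZF).
  apply: (measurable_integral_shift hF hX (Y := Y)) => //.
    by rewrite dh.
  exact: (Fm_meas hF k0 YF).
- by apply: emeasurable_funM => //; apply/measurable_EFinP.
- move=> w _; apply: (le_trans (lee_wpmul2l _ (step w))); first by rewrite lee_fin expR_ge0.
  by rewrite -!EFinM mulrCA.
Qed.

(** Iterating the step gives [(1 + 7 kd H h)^k <= e^{7 kd H k h}]; the factor 2 pays for dropping
    [gk], which is at least [1 / 2]. *)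
Lemma expM_le k : (\int[P]_w (expR (M k w))%:E <= (2 * C0 * expR (7 * kd H * (k%:R * h)))%:E)%E.
Proof.
have h1 : (\int[P]_w (expR (M k w) * gk (v k w - M k w))%:E <=
   (C0 * expR (7 * kd H * (k%:R * h)))%:E)%E.
  elim: k => [|k IH].
    rewrite mul0r mulr0 expR0 mulr1.
    apply: (@le_trans _ _ (\int[P]_w (cst C0%:E w))%E).
      apply: ge0_le_integral => //.
      - by move=> w _; rewrite lee_fin mulr_ge0 ?expR_ge0// (le_trans _ (gk_ge _)).
      - exact/measurable_EFinP.
      - by move=> w _; rewrite lee_fin.
    by rewrite integral_cst// [X in (_ * X)%E](@probability_setT _ _ _ P) mule1.
  apply: (le_trans (expM_step k)).
  have e0 : (0 <= (1 + 7 * kd H * h)%:E)%E by rewrite lee_fin addr_ge0// !mulr_ge0// kd_ge0.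
  apply: (le_trans (lee_wpmul2l e0 IH)).
  have -> : 7 * kd H * (k.+1%:R * h) = 7 * kd H * (k%:R * h) + 7 * kd H * h by rewrite -natr1; ring.
  rewrite -EFinM lee_fin expRD mulrCA ler_wpM2l// mulrC ler_wpM2l ?expR_ge0//.
  exact: expR_ge1Dx.
rewrite -mulrA EFinM; apply: le_trans (lee_wpmul2l _ h1) => //.
have mM : measurable_fun setT (M k) by exact: (Fm_meas hF (kh0 k)).
rewrite -ge0_integralZl//; last 2 first.
- exact/measurable_EFinP.
- by move=> w _; rewrite lee_fin mulr_ge0 ?expR_ge0// (le_trans _ (gk_ge _)).
apply: ge0_le_integral => //.
- by apply/measurable_EFinP; exact: measurableT_comp.
- by apply: emeasurable_funM => //; exact/measurable_EFinP.
- move=> w _; rewrite -EFinM lee_fin mulrCA ler_peMr ?expR_ge0//.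
  by have := gk_ge (v k w - M k w); lra.
Qed.

End drift_of_maximum.

Lemma gk0 : gk 0 = 1 :> R. Proof. by rewrite /gk lexx expR0. Qed.

(* As [gk] is the exponential on the half-line of positive arguments, both sides of the
   recursion have the same form whether or not the maximum is updated. *)
Lemma gk_max (M v : R) : expR (Num.max M v) * gk (v - Num.max M v) = expR M * gk (v - M).
Proof.
case: leP => // Mv; rewrite subrr gk0 mulr1 /gk subr_ge0 Mv -expRD; congr expR; ring.
Qed.

Lemma expMx_le a h H k : a = theta \/ a = - theta -> 0 <= h -> h <= H ->
  (\int[P]_w (expR (Mx a h k w))%:E <= (2 * expR (7 * kd H * (k%:R * h)))%:E)%E.
Proof.
move=> ha h0 hH; rewrite -[2]mulr1.
apply: (@expM_le a h H 1 (Mx a h) (fun k w => a * X (k%:R * h) w)) => //.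
- by move=> j; exact: Mx_Fm.
- move=> j; apply: (Fm_comp (Y := X (j%:R * h)) (g := fun y => a * y)); first exact: measurable_funM.
  by apply: (Fm_X hX); rewrite mulr_ge0.
- by move=> j w; exact: (@grid_max_ge _ (fun t => a * X t w) h j j).
- move=> j w; rewrite [Mx a h j.+1 w]/(Num.max (Mx a h j w) (a * X (j.+1%:R * h) w)) gk_max.
  rewrite le_eqVlt; apply/orP; left; apply/eqP; congr (_ * gk _); ring.
- by move=> w; rewrite /Mx /= !mul0r hX0 mulr0 subrr gk0 expR0 mulr1.
Qed.

Definition Xs (N : R) w := sup [set `|X s w| | s in `[0, N]].

Lemma Xs_ub N s w : 0 <= s -> s <= N -> `|X s w| <= Xs N w.
Proof.
move=> s0 sN; apply: ub_le_sup; last by exists s => //=; rewrite in_itv/= s0.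
have [M M0 MP] := cadlag_bounded N (hXc w).
by exists M => _ [r + <-]; rewrite /= in_itv/= => /andP[r0 rN]; exact: MP.
Qed.

Lemma Xs_cvg N w : 0 <= N ->
  grid_max (fun s => `|X s w|) (N * dyadic n) (2 ^ n) @[n --> \oo] --> Xs N w.
Proof.
move=> N0; have [M M0 MP] := cadlag_bounded N (hXc w).
apply: (@grid_max_cvg _ _ N M) => // s s0 sN.
by apply: cvg_norm; exact: (hXc w).1.
Qed.

Lemma Xs_ge0 N w : 0 <= N -> 0 <= Xs N w.
Proof. by move=> N0; apply: le_trans (Xs_ub w (lexx 0) N0); exact: normr_ge0. Qed.

Lemma grid_max_normX_meas h k : 0 <= h -> measurable_fun setT (fun w => grid_max (fun s => `|X s w|) h k).
Proof.
move=> h0; have kh : 0 <= k%:R * h by rewrite mulr_ge0.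
apply: (Fm_meas hF kh); apply: (Fm_grid_max hF (g := fun t w => `|X t w|)) => // t t0.
by apply: (Fm_comp (Y := X t) (g := fun y => `|y|)) => //; exact: (Fm_X hX).
Qed.

Lemma Xs_meas N : 0 <= N -> measurable_fun setT (Xs N).
Proof.
move=> N0; apply: (@measurable_fun_cvg _ _ _ _ (fun n w => grid_max (fun s => `|X s w|) (N * dyadic n) (2 ^ n))).
  by move=> n; apply: grid_max_normX_meas; rewrite mulr_ge0// dyadic_ge0.
by move=> w _; exact: Xs_cvg.
Qed.

(** The maximum of [|X|] over a grid is attained at some point, where the sign of [X] tells whether
    it is a maximum of [X] or of [-X]. Both have exponential moments bounded uniformly in the grid,
    each contributing 2 to the constant 4, and Fatou's lemma passes to the supremum. *)
Lemma intg_expXs N : 0 <= N -> intg P (fun w => expR (theta * Xs N w)).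
Proof.
move=> N0; apply: intg_ge0.
- by apply: measurableT_comp => //; apply: measurable_funM => //; exact: Xs_meas.
- by move=> w; exact: expR_ge0.
apply: (@le_lt_trans _ _ (4 * expR (7 * kd N * N))%:E); last by rewrite ltry.
apply: (@fatou_cvgR _ _ _ P (fun n w => expR (theta * grid_max (fun s => `|X s w|) (N * dyadic n) (2 ^ n))) _
  (fun=> 4 * expR (7 * kd N * N))).
- move=> n; apply: measurableT_comp => //; apply: measurable_funM => //.
  by apply: grid_max_normX_meas; rewrite mulr_ge0// dyadic_ge0.
- by move=> n w; exact: expR_ge0.
- by move=> w; apply: cvg_expR; apply: cvgMr; exact: Xs_cvg.
- move=> n; set h := N * dyadic n; set k := (2 ^ n)%N.
  have h0 : 0 <= h by rewrite mulr_ge0// dyadic_ge0.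
  have hN : h <= N by rewrite ler_piMr// dyadic_le1.
  have kh : k%:R * h = N by rewrite mulrCA hhM mulr1.
  have b1 := expMx_le k (or_introl erefl) h0 hN.
  have b2 := expMx_le k (or_intror erefl) h0 hN.
  have mM a : measurable_fun setT (Mx a h k).
    by apply: (Fm_meas hF _ (Mx_Fm a k h0)); rewrite kh.
  have em a : measurable_fun setT (fun w => (expR (Mx a h k w))%:E).
    by apply/measurable_EFinP; exact: measurableT_comp.
  rewrite kh in b1 b2.
  have -> : 4 * expR (7 * kd N * N) = 2 * expR (7 * kd N * N) + 2 * expR (7 * kd N * N).
    by ring.
  rewrite EFinD; apply: le_trans (leeD b1 b2).
  rewrite -ge0_integralD//.
  apply: ge0_le_integral => //.
  - apply/measurable_EFinP; apply: measurableT_comp => //; apply: measurable_funM => //.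
    exact: grid_max_normX_meas.
  - exact: emeasurable_funD.
  - move=> w _; rewrite -EFinD lee_fin.
    have [j jk ->] := grid_max_attained (fun s => `|X s w|) h k.
    have [x0|x0] := leP 0 (X (j%:R * h) w).
      apply: (@le_trans _ _ (expR (Mx theta h k w))); last by rewrite lerDl expR_ge0.
      rewrite ler_expR; apply: le_trans (grid_max_ge _ h jk).
      by rewrite ger0_norm.
    apply: (@le_trans _ _ (expR (Mx (- theta) h k w))); last by rewrite lerDr expR_ge0.
    rewrite ler_expR; apply: le_trans (grid_max_ge _ h jk).
    by rewrite ltr0_norm// mulrN mulNr.
- exact: cvg_cst.
Qed.

End small_time.

(** * Large increments, and small increments in the case of bounded variation *)

Section tail.
Context {R : realType} {d : measure_display} {T : measurableType d}.
Variables (P : probability T R) (F : R -> set (set T)) (X : R -> T -> R).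
Hypothesis hF : usual_filtration P F.
Hypothesis hX : levy_process P F X.
Hypothesis hX0 : forall w, X 0 w = 0.
Hypothesis hXc : forall w, cadlag (X ^~ w).

Definition incr (h : R) k w := X (k.+1%:R * h) w - X (k%:R * h) w.

Lemma incr_Fm h k : 0 <= h -> Fm F (k.+1%:R * h) (incr h k).
Proof.
move=> h0; have kh : 0 <= k.+1%:R * h by rewrite mulr_ge0.
apply: (Fm_sub hF) => //; first exact: (Fm_X hX).
apply: (@Fm_mono _ _ _ P F hF _ _ (k%:R * h)); rewrite ?mulr_ge0//.
  by rewrite ler_wpM2r// ler_nat.
by apply: (Fm_X hX); rewrite mulr_ge0.
Qed.

Lemma sum_incr h k w : \sum_(i < k) incr h i w = X (k%:R * h) w.
Proof.
elim: k => [|k IH]; first by rewrite big_ord0 mul0r hX0.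
by rewrite big_ord_recr /= IH /incr addrC subrK.
Qed.

Lemma prod_incr_Fm h (g : R -> R) k : 0 <= h -> measurable_fun setT g ->
  Fm F (k%:R * h) (fun w => \prod_(i < k) g (incr h i w)).
Proof.
move=> h0 mg; elim: k => [|k IH].
  have -> : (fun w => \prod_(i < 0) g (incr h i w)) = fun=> 1 :> R.
    by apply/funext => w; rewrite big_ord0.
  by apply: (Fm_cst hF); rewrite mul0r.
have -> : (fun w => \prod_(i < k.+1) g (incr h i w)) =
    fun w => \prod_(i < k) g (incr h i w) * g (incr h k w).
  by apply/funext => w; rewrite big_ord_recr.
have kh : 0 <= k.+1%:R * h by rewrite mulr_ge0.
apply: (Fm_mul hF) => //.
  apply: (Fm_mono hF _ _ IH); first by rewrite mulr_ge0.
  by rewrite ler_wpM2r// ler_nat.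
by apply: (Fm_comp mg); exact: incr_Fm.
Qed.

(** The Markov property, applied from the position 0, splits off the last factor; by stationarity
    each factor has the mean of [g (X h)]. *)
Lemma prod_incr h (g : R -> R) k : 0 <= h -> measurable_fun setT g -> (forall x, 0 <= g x) ->
  (\int[P]_w (\prod_(i < k) g (incr h i w))%:E = (\int[P]_w (g (X h w))%:E) ^+ k)%E.
Proof.
move=> h0 mg g0; elim: k => [|k IH].
  under eq_integral => w _ do rewrite big_ord0.
  by rewrite integral_cst// mul1e expe0 [LHS]probability_setT.
have k0 : 0 <= k%:R * h by rewrite mulr_ge0.
have kk : k%:R * h <= k.+1%:R * h by rewrite ler_wpM2r// ler_nat.
have dh : k.+1%:R * h - k%:R * h = h by rewrite -natr1; ring.
under eq_integral => w _.
  rewrite big_ord_recr EFinM /= (_ : incr h k w = 0 + (X (k.+1%:R * h) w - X (k%:R * h) w)).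
    over.
  by rewrite add0r.
have mphi : measurable_fun setT (fun y => (g y)%:E) by exact/measurable_EFinP.
have p0 w : 0 <= \prod_(i < k) g (incr h i w) by apply: prodr_ge0 => i _.
have c0 : Fm F (k%:R * h) (fun=> 0 : R) by exact: (Fm_cst hF).
rewrite (markov_ge0 hF hX k0 kk mphi _ p0 (prod_incr_Fm k h0 mg) c0); last first.
  by move=> y; rewrite lee_fin.
under eq_integral => w _.
  rewrite (_ : (\int[P]_v _)%E = (\int[P]_v (g (X h v))%:E)%E); first over.
  by apply: eq_integral => v _; rewrite add0r dh.
rewrite ge0_integralZr//; last 3 first.
- by apply/measurable_EFinP; exact: (Fm_meas hF k0 (prod_incr_Fm k h0 mg)).
- by move=> w _; rewrite lee_fin.
- by apply: integral_ge0 => w _; rewrite lee_fin.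
by rewrite IH expeS muleC.
Qed.

Lemma prod_incr_EE h (g : R -> R) k : 0 <= h -> measurable_fun setT g -> (forall x, 0 <= g x) ->
  intg P (fun w => g (X h w)) ->
  intg P (fun w => \prod_(i < k) g (incr h i w)) /\
  EE P (fun w => \prod_(i < k) g (incr h i w)) = EE P (fun w => g (X h w)) ^+ k.
Proof.
move=> h0 mg g0 ig; have e := prod_incr k h0 mg g0.
rewrite (EE_EFin ig) -EFin_expe in e.
have j : intg P (fun w => \prod_(i < k) g (incr h i w)).
  apply: intg_ge0.
  - have k0 : 0 <= k%:R * h by rewrite mulr_ge0.
    exact: (Fm_meas hF k0 (prod_incr_Fm k h0 mg)).
  - by move=> w; apply: prodr_ge0.
  - by rewrite e ltry.
by split => //; move: e; rewrite (EE_EFin j) => -[].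
Qed.

Variables (theta dl : R).
Hypothesis th0 : 0 < theta.
Hypothesis dl0 : 0 <= dl.
Hypothesis mgp : forall t : R, 0 <= t -> (mg P X theta t <= (expR (dl * t))%:E)%E.
Hypothesis mgm : forall t : R, 0 <= t -> (mg P X (- theta) t <= (expR (dl * t))%:E)%E.

Lemma measurable_ltn (r : R) : measurable_fun setT (fun x : R => (r < `|x|)%R%:R : R).
Proof.
have -> : (fun x : R => (r < `|x|)%R%:R : R) = (fun x => if r < `|x| then 1 else 0).
  by apply/funext => x; case: ifP.
apply: measurable_fun_ifT => //; apply: measurable_fun_ltr => //.
Qed.

(* If [p] is the exponentially weighted chance of a large increment over a step
   [2^-n], independence bounds [(1 - p) ^ 2^n] from below by the weighted chance of
   no large increment up to time 1, so that [p] is small compared with [2^-n]. *)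
Lemma tail_exp1 a e : a = theta \/ a = - theta -> 0 < e ->
  exists2 r : nat, (0 < r)%N & forall n, intg P (fun w => expR (a * X (dyadic n) w) * (r%:R < `|X (dyadic n) w|)%R%:R) /\
    EE P (fun w => expR (a * X (dyadic n) w) * (r%:R < `|X (dyadic n) w|)%R%:R) <= e * dyadic n.
Proof.
move=> ha e0.
have i1 : intg P (fun w => expR (a * X 1 w)) by exact: (intg_expX hF hX mgp mgm).
have m1 : 0 < EE P (fun w => expR (a * X 1 w)).
  by rewrite -lte_fin -EE_EFin//; exact: (mg_gt0 hF hX).
set m := EE P _ in m1.
(* An increment larger than [r] within [[0, 1]] forces [2 sup |X| > r], since it is a difference of
   two values. The weighted probability of this event tends to 0 as [r] grows, uniformly over all
   grids. *)
pose Bad (r : nat) w := expR (a * X 1 w) * (r%:R < 2 * Xs X 1 w)%R%:R.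
have mXs := Xs_meas hF hX hXc (N := 1) ler01.
have mBad r : measurable_fun setT (Bad r).
  apply: measurable_funM; first exact: (expX_meas hF hX).
  rewrite (_ : (fun w => _) = (fun w => if r%:R < 2 * Xs X 1 w then 1 else 0)); last first.
    by apply/funext => x; case: ifP.
  apply: measurable_fun_ifT => //; apply: measurable_fun_ltr => //; exact: measurable_funM.
have [_ cB] : intg P (fun=> 0) /\ EE P (Bad r) @[r --> \oo] --> EE P (fun=> 0).
  apply: (EE_cvg mBad _ i1).
  - move=> w; apply/cvgrPdist_lt => eps eps0; near=> r.
    rewrite /Bad (_ : (r%:R < 2 * Xs X 1 w) = false) ?mulr0 ?subrr ?normr0//.
    by apply/negbTE; rewrite -leNgt; near: r; exact: nbhs_infty_ger.
  - move=> r w; rewrite ger0_norm; last by rewrite mulr_ge0.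
    by rewrite /Bad; case: (_ < _); rewrite ?mulr1// mulr0.
rewrite EE_cst in cB.
(* From [1 - q <= e^{-kp}] and [(1 + kp) e^{-kp} <= 1] one gets [kp <= q / (1 - q)], which is at
   most [2 q] by the first bound on [q]; the second turns [2 q e^{dl}] into at most [e]. *)
pose q := Num.min (1 / 2) (e / (2 * expR dl)).
have ed0 := expR_gt0 dl.
have q0 : 0 < q by rewrite lt_min !divr_gt0// mulr_gt0.
have [r _ rP] : \forall r \near \oo, EE P (Bad r) < q * m.
  move/cvgrPdist_lt : cB => /(_ (q * m)); rewrite mulr_gt0// => /(_ isT).
  apply: filterS => r; rewrite sub0r normrN; apply: le_lt_trans; exact: ler_norm.
have {}rP := rP r.+1 (leqnSn r).
exists r.+1 => // n.
set h := dyadic n; have h0 : 0 <= h := dyadic_ge0 n.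
set k := (2 ^ n)%N; have kh : k%:R * h = 1 by exact: hhM.
have ih : intg P (fun w => expR (a * X h w)) by exact: (intg_expX hF hX mgp mgm).
have mi b : measurable_fun setT (fun w => expR (a * X h w) * ((r.+1%:R < `|X h w|) == b)%R%:R).
  apply: measurable_funM; first exact: (expX_meas hF hX).
  have := measurableT_comp (measurable_ltn r.+1%:R) (X_meas hF hX h0).
  case: b => H; first by apply: eq_measurable_fun H => w _ /=; rewrite eqb_id.
  have := measurable_funB (measurable_cst (1 : R)) H.
  by apply: eq_measurable_fun => w _ /=; case: (_ < _); rewrite ?subrr ?subr0.
have ii b : intg P (fun w => expR (a * X h w) * ((r.+1%:R < `|X h w|) == b)%R%:R).
  apply: (intg_dom (mi b) ih) => w; rewrite ger0_norm; last by rewrite mulr_ge0.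
  by case: (_ == _); rewrite ?mulr1// mulr0.
have it := ii true.
rewrite (_ : (fun w => _ * ((_ < _) == true)%:R) = (fun w => expR (a * X h w) * (r.+1%:R < `|X h w|)%R%:R)) in it; last first.
  by apply/funext => w; rewrite eqb_id.
split => //; set A := EE P _.
pose g x := expR (a * x) * ((r.+1%:R < `|x|) == false)%R%:R.
have mgg : measurable_fun setT g.
  apply: measurable_funM; first by apply: measurableT_comp => //; exact: measurable_funM.
  have := measurable_funB (measurable_cst (1 : R)) (measurable_ltn r.+1%:R).
  by apply: eq_measurable_fun => w _ /=; case: (_ < _); rewrite ?subrr ?subr0.
have g0 x : 0 <= g x by rewrite mulr_ge0.
have [jp Ep] := prod_incr_EE k h0 mgg g0 (ii false).
set mh := EE P (fun w => expR (a * X h w)).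
have mhA : EE P (fun w => g (X h w)) = mh - A.
  rewrite -EEB//; congr EE; apply/funext => w; rewrite /g.
  by case: (_ < _) => /=; rewrite ?mulr0 ?mulr1 ?subrr ?subr0.
have mhk : mh ^+ k = m.
  have := mg_pow hF hX hX0 a k h0; rewrite kh /mg (EE_EFin i1) (EE_EFin ih) -EFin_expe.
  by case.
have mh0 : 0 < mh by rewrite -lte_fin -EE_EFin//; exact: (mg_gt0 hF hX).
(* Off the event counted by [Bad] no grid increment is large, and the product of the truncated
   weights is the whole of [e^{a X_1}]. *)
have low : m * (1 - q) <= (mh - A) ^+ k.
  rewrite -mhA -Ep; apply: (@le_trans _ _ (m - EE P (Bad r.+1))); first by nra.
  rewrite -EEB//; last by apply: (intg_dom (mBad _) i1) => w; rewrite ger0_norm ?mulr_ge0// /Bad; case: (_ < _); rewrite ?mulr1// mulr0.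
  apply: EE_le => //.
    apply: intgB => //; apply: (intg_dom (mBad _) i1) => w.
    by rewrite ger0_norm ?mulr_ge0// /Bad; case: (_ < _); rewrite ?mulr1// mulr0.
  move=> w; rewrite /Bad; have [_|big] := ltP.
    by rewrite mulr1 subrr prodr_ge0.
  have X1 : X 1 w = \sum_(i < k) incr h i w by rewrite sum_incr kh.
  rewrite mulr0 subr0 X1 mulr_sumr expR_sum.
  apply: ler_prod => i _; rewrite expR_ge0/= /g.
  rewrite (_ : (_ < _) = false) ?eqxx ?mulr1//.
  apply/negbTE; rewrite -leNgt (le_trans _ big)// /incr.
  have b0 : i.+1%:R * h <= 1 by rewrite -[leRHS]kh ler_wpM2r// ler_nat.
  have b1 : i%:R * h <= 1 by rewrite -[leRHS]kh ler_wpM2r// ler_nat ltnW.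
  have := Xs_ub hXc w (mulr_ge0 (ler0n R i.+1) h0) b0.
  have := Xs_ub hXc w (mulr_ge0 (ler0n R i) h0) b1.
  have := ler_normB (X (i.+1%:R * h) w) (X (i%:R * h) w); lra.
have A0 : 0 <= A by apply: EE_ge0 => w; rewrite mulr_ge0.
pose p := A / mh.
have p0 : 0 <= p := divr_ge0 A0 (ltW mh0).
have Ap : A = p * mh by rewrite divfK// gt_eqF.
have low2 : 1 - q <= (1 - p) ^+ k.
  move: low; rewrite Ap -{1}[mh]mul1r -mulrBl exprMn mhk (mulrC m) ler_pM2r//.
have Amh : A <= mh.
  apply: EE_le => // w; by case: (_ < _); rewrite ?mulr1// mulr0.
have p1 : p <= 1 by rewrite (ler_pdivrMr _ _ mh0) mul1r.
have low3 : 1 - q <= expR (- (k%:R * p)).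
  apply: (le_trans low2); rewrite (_ : - (k%:R * p) = k%:R * (- p)); last by rewrite mulrN.
  rewrite expRM_natl; apply: lerXn2r; rewrite ?nnegrE ?expR_ge0//.
    by rewrite subr_ge0.
  exact: expR_ge1Dx.
have q12 : q <= 1 / 2 by rewrite ge_min lexx.
have kp : k%:R * p <= 2 * q.
  have : (1 + k%:R * p) * expR (- (k%:R * p)) <= 1.
    rewrite expRN ler_pdivrMr ?expR_gt0// mul1r; exact: expR_ge1Dx.
  have kp0 : 0 <= k%:R * p by rewrite mulr_ge0.
  nra.
have hle : mh <= expR dl.
  apply: (le_trans (EE_expX hF hX mgp mgm ha h0)).
  by rewrite ler_expR ler_piMr// dyadic_le1.
have -> : A = (k%:R * p) * h * mh.
  have e1 : k%:R * p * h * mh = (k%:R * h) * (p * mh) by ring.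
  by rewrite e1 kh mul1r -Ap.
rewrite mulrAC ler_wpM2r//.
apply: (@le_trans _ _ (2 * q * expR dl)).
  exact: ler_pM (mulr_ge0 (ler0n _ _) p0) (ltW mh0) kp hle.
have : q <= e / (2 * expR dl) by rewrite ge_min lexx orbT.
rewrite ler_pdivlMr ?mulr_gt0//; lra.
Unshelve. all: by end_near. Qed.

Lemma tail_cosh e : 0 < e -> exists2 r : nat, (0 < r)%N & forall n,
    intg P (fun w => cosh (theta * X (dyadic n) w) * (r%:R < `|X (dyadic n) w|)%R%:R) /\
    EE P (fun w => cosh (theta * X (dyadic n) w) * (r%:R < `|X (dyadic n) w|)%R%:R) <= e * dyadic n.
Proof.
move=> e0.
have [r1 r10 h1] := tail_exp1 (or_introl erefl) e0.
have [r2 r20 h2] := tail_exp1 (or_intror erefl) e0.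
exists (maxn r1 r2); first by rewrite leq_max r10.
move=> n; have [i1 l1] := h1 n; have [i2 l2] := h2 n.
have hn : 0 <= dyadic n :> R := dyadic_ge0 n.
pose G w := 2^-1 * (expR (theta * X (dyadic n) w) * (r1%:R < `|X (dyadic n) w|)%R%:R
  + expR (- theta * X (dyadic n) w) * (r2%:R < `|X (dyadic n) w|)%R%:R).
have iG : intg P G by apply: intgZ; exact: intgD.
have le w : cosh (theta * X (dyadic n) w) * ((maxn r1 r2)%:R < `|X (dyadic n) w|)%R%:R <= G w.
  rewrite /G /cosh; have [c|_] := ltP.
    have c1 : r1%:R < `|X (dyadic n) w| by apply: le_lt_trans c; rewrite ler_nat leq_maxl.
    have c2 : r2%:R < `|X (dyadic n) w| by apply: le_lt_trans c; rewrite ler_nat leq_maxr.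
    by rewrite c1 c2 !mulr1 mulNr mulrC.
  by rewrite mulr0 mulr_ge0// addr_ge0// mulr_ge0.
have j : intg P (fun w => cosh (theta * X (dyadic n) w) * ((maxn r1 r2)%:R < `|X (dyadic n) w|)%R%:R).
  apply: (intg_dom _ iG).
    apply: measurable_funM.
      exact: (intg_meas (intg_coshX hF hX mgp mgm hn)).
    exact: (measurableT_comp (measurable_ltn _) (X_meas hF hX hn)).
  move=> w; rewrite ger0_norm// mulr_ge0// /cosh divr_ge0// addr_ge0//.
split => //; apply: (le_trans (EE_le j iG le)).
rewrite EEZ ?EED//; [lra|exact: intgD].
Qed.

(** The cap leaves a bounded functional of order [|x|] near 0; what happens to large increments is
    the matter of the exponential tail. *)
Definition cap1 (x : R) := Num.min `|x| 1.

Lemma cap1_ge0 x : 0 <= cap1 x. Proof. by rewrite le_min normr_ge0 ler01. Qed.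

Lemma cap1_meas : measurable_fun setT cap1.
Proof. by apply: measurable_minr => //. Qed.

(* The total variation [V] on [0, 1] bounds the sum of the capped increments, hence
   [(E e^{-cap1 X})^(2^n) >= E e^{-V} > 0]. *)
Lemma bv_small : has_bounded_variation P X ->
  exists2 C, 0 <= C & forall n, EE P (fun w => cap1 (X (dyadic n) w)) <= C * dyadic n.
Proof.
move=> bv.
pose W n w : R := \sum_(i < 2 ^ n) `|incr (dyadic n) i w|.
have mW n : measurable_fun setT (W n).
  apply: (@measurable_sum _ _ _ _ _ _ (fun (i : 'I_(2 ^ n)) w => `|incr (dyadic n) i w|)) => i.
  have h0 : 0 <= i.+1%:R * dyadic n :> R by rewrite mulr_ge0// dyadic_ge0.
  by apply: measurableT_comp => //; exact: (Fm_meas hF h0 (incr_Fm i (dyadic_ge0 n))).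
have Wnd n w : W n w <= W n.+1 w.
  rewrite /W expnS mul2n -addnn.
  have -> : \sum_(i < 2 ^ n + 2 ^ n) `|incr (dyadic n.+1) i w| =
     \sum_(i < 2 ^ n) (`|incr (dyadic n.+1) i.*2 w| + `|incr (dyadic n.+1) i.*2.+1 w|).
    rewrite addnn; elim: (2 ^ n)%N => [|m IH]; first by rewrite double0 !big_ord0.
    by rewrite doubleS !big_ord_recr/= IH addrA.
  apply: ler_sum => i _; apply: le_trans (ler_normD _ _); rewrite le_eqVlt; apply/orP; left.
  apply/eqP; congr `|_|; rewrite /incr.
  have e : dyadic n = 2 * dyadic n.+1 :> R by rewrite /dyadic exprS mulrA divff ?mul1r.
  have e1 : i.*2.+2%:R * dyadic n.+1 = i.+1%:R * dyadic n :> R.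
    by rewrite -doubleS -muln2 natrM e; ring.
  have e2 : i.*2%:R * dyadic n.+1 = i%:R * dyadic n :> R by rewrite -muln2 natrM e; ring.
  by rewrite e1 e2; ring.
have nW w : nonincreasing_seq (fun n => expR (- W n w)).
  by apply/nonincreasing_seqP => n; rewrite ler_expR lerN2.
have W0 n w : 0 <= W n w by apply: sumr_ge0.
pose L w := lim (expR (- W n w) @[n --> \oo]).
have cL w : expR (- W n w) @[n --> \oo] --> L w.
  apply: nonincreasing_is_cvgn => //.
  by exists 0 => _ [n _ <-]; exact: expR_ge0.
have L0 w : 0 <= L w by apply: limr_ge; [apply/cvg_ex; exists (L w)|near=> n; exact: expR_ge0].
have [iL cEL] : intg P L /\ EE P (fun w => expR (- W n w)) @[n --> \oo] --> EE P L.
  apply: (@EE_cvg _ _ _ P (fun n w => expR (- W n w)) L (fun=> 1)) => //.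
  - by move=> n; apply: measurableT_comp => //; exact: measurableT_comp.
  - exact: intg_cst.
  - by move=> n w; rewrite ger0_norm ?expR_ge0// -[leRHS]expR0 ler_expR oppr_le0.
(* A vanishing mean would force [L = 0] almost surely, that is, [W n] unbounded; but each [W n] is a
   variation sum on [[0, 1]] and stays below the total variation of the path. *)
have ELp : 0 < EE P L.
  rewrite lt_neqAle EE_ge0// andbT eq_sym; apply/negP => /eqP e.
  have eL : (\int[P]_(w in setT) `|(L w)%:E|)%E = 0%E.
    under eq_integral => w _ do rewrite gee0_abs ?lee_fin//.
    by rewrite (EE_EFin iL) e.
  have mL : measurable_fun setT (fun w => (L w)%:E) by exact/measurable_EFinP/intg_meas/iL.
  have := (ae_eq_integral_abs P measurableT mL).1 eL.
  move=> aeL.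
  have [N [mN N0 sub]] : P.-negligible setT.
    have : {ae P, forall w, False}.
      near=> w.
      have Lw : setT w -> (L w)%:E = 0%E by near: w; exact: aeL.
      have : forall t, 0 <= t -> bounded_variation 0 t (X ^~ w) by near: w; exact: bv.
      move=> /(_ 1 ler01) [M MP].
      have : expR (- M) <= L w.
        apply: limr_ge; first by apply/cvg_ex; exists (L w).
        near=> n; rewrite ler_expR lerN2; apply: MP.
        exists [seq i%:R * dyadic n | i <- iota 1 (2 ^ n)].
          split.
            have -> : 0 = 0%N%:R * dyadic n :> R by rewrite mul0r.
            have H m j : path <%R (j%:R * dyadic n) [seq i%:R * dyadic n | i <- iota j.+1 m].
              by elim: m j => //= m IH j; rewrite IH andbT ltr_pM2r ?dyadic_gt0// ltr_nat.
            exact: H.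
          have : (0 < 2 ^ n)%N by rewrite expn_gt0.
          case E : (2 ^ n)%N => [//|m] _; rewrite -[m.+1]addn1 iotaD map_cat last_cat/= add1n -E.
          by rewrite hhM.
        rewrite /variation /= size_map size_iota /W -(big_mkord xpredT (fun i => `|incr (dyadic n) i w|)).
        rewrite big_nat_cond [RHS]big_nat_cond; apply: eq_bigr => i /andP[/= ilt _].
        have nn j : (j <= 2 ^ n)%N -> nth 1 (0 :: [seq i0%:R * dyadic n | i0 <- iota 1 (2 ^ n)]) j = j%:R * dyadic n :> R.
          case: j => [|j] jl /=; first by rewrite mul0r.
          by rewrite (nth_map 0%N) ?size_iota// nth_iota// add1n.
        by have := nn i.+1 ilt; rewrite /= => ->; rewrite (nn i (ltnW ilt)).
      by move: (Lw I) => [] -> ; rewrite leNgt expR_gt0.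
    by apply: (@negligibleS _ _ _ P) => w _ /=; exact.
  have : P setT = 0%E.
    by apply/eqP; rewrite eq_le measure_ge0 andbT -N0 le_measure ?inE//.
  by move/eqP; rewrite [P _]probability_setT onee_eq0.
have lowE n : EE P L <= EE P (fun w => expR (- W n w)).
  apply: EE_le => //.
    apply: (intg_dom _ (intg_cst P 1)).
      by apply: measurableT_comp => //; exact: measurableT_comp.
    by move=> w; rewrite ger0_norm ?expR_ge0// -[leRHS]expR0 ler_expR oppr_le0.
  move=> w; have := nonincreasing_cvgn_ge (nW w); apply.
  by apply/cvg_ex; exists (L w).
(* The constant comes from taking logarithms in [E L <= e^{- 2^n E (cap1 X_h) / 2}]; it is
   non-negative because [L <= 1]. *)
exists (2 * - ln (EE P L)).
  rewrite mulr_ge0// oppr_ge0 ln_le0//.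
  have := lowE 0%N => /le_trans; apply; rewrite -[leRHS](EE_cst P 1); apply: EE_le.
  - apply: (intg_dom _ (intg_cst P 1)).
      by apply: measurableT_comp => //; exact: measurableT_comp.
    by move=> w; rewrite ger0_norm ?expR_ge0// -[leRHS]expR0 ler_expR oppr_le0.
  - exact: intg_cst.
  - by move=> w; rewrite -[leRHS]expR0 ler_expR oppr_le0.
move=> n; set h := dyadic n; have h0 : 0 <= h := dyadic_ge0 n.
set k := (2 ^ n)%N; have kh : k%:R * h = 1 by exact: hhM.
pose g x := expR (- cap1 x).
have mg : measurable_fun setT g by apply: measurableT_comp => //; apply: measurableT_comp => //; exact: cap1_meas.
have g0 x : 0 <= g x by exact: expR_ge0.
have mXh := X_meas hF hX h0.
have ig : intg P (fun w => g (X h w)).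
  apply: (intg_dom _ (intg_cst P 1)); first exact: measurableT_comp.
  by move=> w; rewrite ger0_norm// -[leRHS]expR0 ler_expR oppr_le0 cap1_ge0.
have ic : intg P (fun w => cap1 (X h w)).
  apply: (intg_dom _ (intg_cst P 1)); first by apply: measurableT_comp => //; exact: cap1_meas.
  by move=> w; rewrite ger0_norm ?cap1_ge0// ge_min lexx orbT.
have [jp Ep] := prod_incr_EE k h0 mg g0 ig.
have low : EE P L <= EE P (fun w => g (X h w)) ^+ k.
  rewrite -Ep; apply: (le_trans (lowE n)); apply: EE_le => //.
    apply: (intg_dom _ (intg_cst P 1)).
      by apply: measurableT_comp => //; exact: measurableT_comp.
    by move=> w; rewrite ger0_norm ?expR_ge0// -[leRHS]expR0 ler_expR oppr_le0.
  move=> w; rewrite /W -sumrN expR_sum; apply: ler_prod => i _.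
  by rewrite expR_ge0/= ler_expR lerN2 ge_min lexx.
(* On [[0, 1]], where the cap keeps its argument, [e^{-x} <= 1 - x / 2]. *)
have gc : EE P (fun w => g (X h w)) <= expR (- (2^-1 * EE P (fun w => cap1 (X h w)))).
  apply: (le_trans _ (expR_ge1Dx _)).
  rewrite -{1}[1](EE_cst P 1) -EEZ// -EEB//; [|exact: intg_cst|exact: intgZ].
  apply: EE_le => //; first by apply: intgB; [exact: intg_cst|exact: intgZ].
  move=> w; rewrite /g; set x := cap1 _.
  have x0 : 0 <= x by exact: cap1_ge0.
  have x1 : x <= 1 by rewrite ge_min lexx orbT.
  rewrite expRN; have e1 := expR_ge1Dx x.
  rewrite -[leLHS]mul1r ler_pdivrMr ?expR_gt0//; nra.
have : expR (ln (EE P L)) <= expR (- (2^-1 * EE P (fun w => cap1 (X h w))) *+ k).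
  rewrite lnK ?posrE//; apply: (le_trans low).
  rewrite -(mulr_natl _ k) expRM_natl.
  apply: lerXn2r; rewrite ?nnegrE ?expR_ge0//.
  by apply: EE_ge0 => w.
rewrite ler_expR -(mulr_natl _ k) => le.
set E := EE P (fun w => cap1 (X h w)) in le *.
have l2 := ler_wpM2l h0 le.
have e1 : h * (k%:R * - (2^-1 * E)) = - (2^-1 * ((k%:R * h) * E)) by ring.
by rewrite e1 kh mul1r in l2; lra.
Unshelve. all: by end_near. Qed.

End tail.

(** * The generator along dyadic steps *)

Section calculus.
Context {R : realType}.
Implicit Types (y s z a b v M e : R) (f g : R -> R).

Lemma cosh_ge1 y : 1 <= cosh y.
Proof. by apply: le_trans (cosh_ge_sqr y); rewrite lerDl divr_ge0// sqr_ge0. Qed.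

Lemma cosh_ge0 y : 0 <= cosh y.
Proof. exact: le_trans ler01 (cosh_ge1 y). Qed.

Lemma coshN y : cosh (- y) = cosh y.
Proof. by rewrite /cosh opprK addrC. Qed.

Lemma cosh0 : cosh 0 = 1 :> R.
Proof. by rewrite /cosh oppr0 expR0; lra. Qed.

Lemma cosh_add a b : cosh (a + b) <= 2 * cosh a * cosh b.
Proof.
rewrite /cosh opprD !expRD.
have := expR_ge0 a; have := expR_ge0 b; have := expR_ge0 (- a); have := expR_ge0 (- b).
nra.
Qed.

Lemma expR_le_cosh y : expR y <= 2 * cosh y.
Proof. by rewrite /cosh; have := expR_ge0 (- y); lra. Qed.

Lemma cosh_le_expR y : cosh y <= expR `|y|.
Proof.
have : expR y <= expR `|y| by rewrite ler_expR ler_norm.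
have : expR (- y) <= expR `|y| by rewrite ler_expR -normrN ler_norm.
by rewrite /cosh; lra.
Qed.

Lemma cosh_leD a b : 0 <= a -> 0 <= b -> cosh a <= cosh (a + b).
Proof.
move=> a0 b0; rewrite /cosh opprD !expRD.
have e1 : 1 <= expR b by rewrite -expR0 ler_expR.
have e2 : expR b * expR (- b) = 1 by rewrite -expRD subrr expR0.
have e3 : expR (- a) <= expR a by rewrite ler_expR; lra.
have e4 := expR_gt0 (- a); have e5 := expR_gt0 (- b).
have : 0 <= (expR b - 1) * (expR a - expR (- a) * expR (- b)).
  rewrite mulr_ge0 ?subr_ge0//; nra.
nra.
Qed.

Lemma cosh_le a b : `|a| <= b -> cosh a <= cosh b.
Proof.
move=> ab; have -> : cosh a = cosh `|a|.
  have [a0|a0] := leP 0 a; first by rewrite ger0_norm.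
  by rewrite ltr0_norm// coshN.
by rewrite -(subrK `|a| b) addrC cosh_leD// subr_ge0.
Qed.

Lemma norm_le_cosh y : `|y| <= cosh y.
Proof.
have := cosh_ge_sqr y; rewrite -real_normK ?num_real//.
have := sqr_ge0 (`|y| - 1); nra.
Qed.

Lemma cosh_continuous : continuous (@cosh R).
Proof.
move=> x; rewrite /cosh; apply: cvgM; last exact: cvg_cst.
apply: cvgD; first exact: continuous_expR.
by apply: (@continuous_comp _ _ _ (-%R) expR); [exact: opp_continuous|exact: continuous_expR].
Qed.

Lemma cosh_meas : measurable_fun setT (@cosh R).
Proof. exact: continuous_measurable_fun cosh_continuous. Qed.

Lemma continuous_bounded f M : continuous f ->
  exists2 K, 0 <= K & forall y, `|y| <= M -> `|f y| <= K.
Proof.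
move=> cf; have [M0|M0] := leP 0 M; last first.
  by exists 0 => // y /le_lt_trans /(_ M0); rewrite ltNge normr_ge0.
have cn : {within `[- M, M], continuous (fun y => `|f y|)}.
  by apply: continuous_subspaceT => y; apply: cvg_norm; exact: cf.
have [|c _ cP] := EVT_max _ cn; first by lra.
by exists `|f c| => // y; rewrite ler_norml => yM; apply: cP; rewrite in_itv.
Qed.

Lemma unif_cont f M e : continuous f -> 0 < e ->
  exists2 r, 0 < r & forall y z, `|y| <= M -> `|y - z| < r -> `|f y - f z| <= e.
Proof.
move=> cf e0.
have : near_covering `[- M, M] by apply/compact_near_coveringP; exact: segment_compact.
move=> /(_ R (0 : R)^'+ (fun r y => forall z, `|y - z| < r -> `|f y - f z| <= e)) /(_ _).
case.
  move=> y _.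
  have /cvgrPdist_lt /(_ (e / 2)) := cf y; rewrite divr_gt0// => /(_ isT) [r /= r0 rP].
  exists ([set z | `|y - z| < r / 2], [set q | q < r / 2]).
    split => /=.
      by apply/nbhs_ballP; exists (r / 2) => //=; rewrite divr_gt0.
    by apply: nbhs_right_lt; rewrite divr_gt0.
  move=> [x q] /= [yx qr] z xz.
  have h1 : `|f y - f x| < e / 2 by apply: rP => /=; lra.
  have h2 : `|f y - f z| < e / 2.
    apply: rP => /=; apply: (le_lt_trans (ler_distD x _ _)); lra.
  by apply: (le_trans (ler_distD (f y) _ _)); rewrite distrC; lra.
move=> r /= r0 rP; exists (r / 2); first by rewrite divr_gt0.
move=> y z yM; apply: (rP (r / 2)) => /=.
- by rewrite sub0r normrN ger0_norm ?divr_ge0 ?ltW//; lra.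
- by rewrite divr_gt0.
- by move: yM; rewrite in_itv/= ler_norml.
Qed.

Lemma mvt_lip g g' K s : (forall z, is_derive z 1 g (g' z)) ->
  (forall z, `|z| <= `|s| -> `|g' z| <= K) -> `|g s - g 0| <= K * `|s|.
Proof.
move=> dg gK.
have cg := is_derive_continuous dg.
have [s0|s0] := leP 0 s.
  have [|c /[!in_itv]/= /andP[c0 cs] ->] := @MVT_segment R g g' 0 s s0 (fun z _ => dg z).
    exact: continuous_subspaceT.
  rewrite subr0 normrM ler_wpM2r//; apply: gK.
  by rewrite !ger0_norm.
have [|c /[!in_itv]/= /andP[c0 cs]] := @MVT_segment R g g' s 0 (ltW s0) (fun z _ => dg z).
  exact: continuous_subspaceT.
rewrite sub0r distrC => ->; rewrite normrM normrN ler_wpM2r//; apply: gK.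
by rewrite ler0_norm// ltr0_norm// lerN2.
Qed.

Lemma is_derive_translate f f' a v : (forall z, is_derive z 1 f (f' z)) ->
  is_derive v 1 (fun s => f (a + s)) (f' (a + v)).
Proof.
move=> df; have df1 : is_derive (shift a v) 1 f (f' (a + v)) by rewrite /= addrC.
have -> : (fun s => f (a + s)) = f \o shift a.
  by apply/funext => s /=; rewrite addrC.
by have := is_derive1_comp df1 (is_derive_shift v 1 a); rewrite mulr1.
Qed.

Lemma C1_is_derive f : C1 f -> forall z, is_derive z 1 f (derive1 f z).
Proof. by move=> [df _] z; rewrite derive1E; exact: derivableP. Qed.

Lemma C1_continuous f : C1 f -> continuous f.
Proof. by move=> /C1_is_derive; exact: is_derive_continuous. Qed.

Lemma expRN_taylor (x : R) : 0 <= x -> 0 <= expR (- x) - 1 + x <= x ^+ 2.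
Proof.
move=> x0; apply/andP; split; first by have := expR_ge1Dx (- x); lra.
have : (1 + x) * expR (- x) <= 1.
  by rewrite expRN ler_pdivrMr ?expR_gt0// mul1r expR_ge1Dx.
have := expR_gt0 (- x); nra.
Qed.

End calculus.

Section generator.
Context {R : realType} {d : measure_display} {T : measurableType d}.
Variables (P : probability T R) (F : R -> set (set T)) (X : R -> T -> R).
Hypothesis hF : usual_filtration P F.
Hypothesis hX : levy_process P F X.
Hypothesis hX0 : forall w, X 0 w = 0.
Hypothesis hXc : forall w, cadlag (X ^~ w).
Variables (theta dl : R).
Hypothesis th0 : 0 < theta.
Hypothesis dl0 : 0 <= dl.
Hypothesis mgp : forall t : R, 0 <= t -> (mg P X theta t <= (expR (dl * t))%:E)%E.
Hypothesis mgm : forall t : R, 0 <= t -> (mg P X (- theta) t <= (expR (dl * t))%:E)%E.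
Implicit Types (h y z e r s t : R).

Lemma intg_shift (g : R -> R) C t y : 0 <= t -> measurable_fun setT g ->
  (forall z, `|g (y + z)| <= C * cosh (theta * z)) -> intg P (fun w => g (y + X t w)).
Proof.
move=> t0 mg gC; apply: (intg_dom _ (intgZ C (intg_coshX hF hX mgp mgm t0))) => //.
by apply: measurableT_comp => //; apply: measurable_funD => //; exact: (X_meas hF hX).
Qed.

Lemma intg_X t : 0 <= t -> intg P (X t).
Proof.
move=> t0; apply: (intg_dom (X_meas hF hX t0) (intgZ theta^-1 (intg_coshX hF hX mgp mgm t0))) => w.
rewrite ler_pdivlMl//; apply: le_trans (norm_le_cosh _).
by rewrite normrM gtr0_norm.
Qed.

Lemma intg_X2 t : 0 <= t -> intg P (fun w => X t w ^+ 2).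
Proof.
move=> t0; apply: (intg_dom _ (intgZ (2 / theta ^+ 2) (intg_coshX hF hX mgp mgm t0))).
  by apply: measurable_funX; exact: (X_meas hF hX).
move=> w; rewrite ger0_norm ?sqr_ge0// mulrAC ler_pdivlMr ?exprn_gt0//.
by have := cosh_ge_sqr (theta * X t w); rewrite exprMn; lra.
Qed.

Definition cm1 := kd dl 1 / theta.
Definition cm2 := 2 * kd dl 1 / theta ^+ 2.

(** [e^z >= 1 + z] with [z = theta X_h] and [z = -theta X_h] turns the two exponential moments into
    a two-sided bound. It concerns the mean of [X h], where cancellation occurs, and not the mean of
    [|X h|]. *)
Lemma EE_X_small h : 0 <= h -> h <= 1 -> `|EE P (X h)| <= cm1 * h.
Proof.
move=> h0 h1; have iX := intg_X h0.
have bd a : a = theta \/ a = - theta -> a * EE P (X h) <= kd dl 1 * h.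
  move=> ha; have ie := intg_expX hF hX mgp mgm ha h0.
  rewrite -EEZ//; apply: le_trans (expR_small dl0 h0 h1).
  apply: (@le_trans _ _ (EE P (fun w => expR (a * X h w) - 1))).
    apply: EE_le; [exact: intgZ|apply: intgB => //; exact: intg_cst|].
    by move=> w; have := expR_ge1Dx (a * X h w); lra.
  rewrite EEB ?EE_cst//; last exact: intg_cst.
  by have := EE_expX hF hX mgp mgm ha h0; lra.
rewrite /cm1 mulrAC ler_pdivlMr// -[theta in leLHS]gtr0_norm// -normrM mulrC ler_norml.
have := bd _ (or_introl erefl); have := bd _ (or_intror erefl); lra.
Qed.

(** [cosh z - 1] dominates [z^2 / 2], and its mean at [z = theta X_h] is of order [h]. *)
Lemma EE_X2_small h : 0 <= h -> h <= 1 -> EE P (fun w => X h w ^+ 2) <= cm2 * h.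
Proof.
move=> h0 h1; have iX := intg_X2 h0; have ic := intg_coshX hF hX mgp mgm h0.
have t2 : 0 < theta ^+ 2 by rewrite exprn_gt0.
rewrite /cm2 mulrAC ler_pdivlMr// mulrC -EEZ//.
apply: (@le_trans _ _ (EE P (fun w => 2 * (cosh (theta * X h w) - 1)))).
  apply: EE_le; [exact: intgZ|apply: intgZ; apply: intgB => //; exact: intg_cst|].
  by move=> w; have := cosh_ge_sqr (theta * X h w); rewrite exprMn; lra.
rewrite EEZ ?EEB ?EE_cst//; last 2 first.
  exact: intg_cst.
  by apply: intgB => //; exact: intg_cst.
have := EE_coshX hF hX mgp mgm h0; have := expR_small dl0 h0 h1; lra.
Qed.

Lemma cm1_ge0 : 0 <= cm1. Proof. by rewrite divr_ge0 ?kd_ge0// ltW. Qed.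
Lemma cm2_ge0 : 0 <= cm2. Proof. 
by rewrite /cm2 divr_ge0//; [rewrite mulr_ge0// kd_ge0|exact/exprn_ge0/ltW].
Qed.

Variables (u : R -> R) (K : R).
Hypothesis K0 : 0 <= K.
Hypothesis uK : forall x, `|u x| <= K * (1 + cosh (theta * x)).
Hypothesis cu : continuous u.
Hypothesis u_bv : has_bounded_variation P X -> C1 u.
Hypothesis u_ubv : ~ has_bounded_variation P X -> C2 u.

Definition mean_shift h y := EE P (fun w => u (y + X h w)).
Definition mean_quotient n y := (mean_shift (dyadic n) y - u y) / dyadic n.

(** The inequality [cosh (a + b) <= 2 cosh a cosh b] moves the growth in the base point into this
    constant and leaves a moment of the increment alone, as in [u_shift]. *)
Definition Cy y := K * (1 + 2 * cosh (theta * y)).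

Lemma Cy_ge0 y : 0 <= Cy y.
Proof. by rewrite mulr_ge0// addr_ge0// mulr_ge0// cosh_ge0. Qed.

Lemma u_shift y z : `|u (y + z)| <= Cy y * cosh (theta * z).
Proof.
apply: (le_trans (uK _)); rewrite /Cy -mulrA ler_wpM2l// mulrDr.
have := cosh_add (theta * y) (theta * z); have := cosh_ge1 (theta * z); lra.
Qed.

Lemma u_meas : measurable_fun setT u.
Proof. exact: continuous_measurable_fun cu. Qed.

Lemma intg_u h y : 0 <= h -> intg P (fun w => u (y + X h w)).
Proof. by move=> h0; apply: (intg_shift h0 u_meas (u_shift y)). Qed.

Lemma mean_quotient_diff n y z : mean_quotient n z - mean_quotient n y =
  (EE P (fun w => u (z + X (dyadic n) w) - u (y + X (dyadic n) w)) - (u z - u y)) / dyadic n.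
Proof.
rewrite /mean_quotient -mulrBl EEB; [|exact: (intg_u _ (dyadic_ge0 n))..].
by congr (_ / _); rewrite /mean_shift; ring.
Qed.

Lemma Cy_near y z : `|z - y| < 1 -> Cy z <= 2 * cosh theta * Cy y.
Proof.
move=> zy; have c0 := cosh_ge1 theta; have cy := cosh_ge0 (theta * y).
have : cosh (theta * z) <= 2 * cosh (theta * y) * cosh theta.
  have -> : theta * z = theta * y + theta * (z - y) by ring.
  apply: (le_trans (cosh_add _ _)); rewrite ler_wpM2l ?mulr_ge0//.
  apply: cosh_le; rewrite normrM gtr0_norm// ler_piMr ?ltW//.
rewrite /Cy => h; rewrite (mulrCA (2 * cosh theta)) ler_wpM2l//; nra.
Qed.

(** The difference of two quotients is the mean of [g (X_h) - g 0] over [h], where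
    [g s = u (z + s) - u (y + s)]. Increments larger than [r] contribute little by the tail
    estimate. On the others, for bounded variation, [|g s - g 0|] is a small multiple of [|s|] since
    [u'] is uniformly continuous on compact sets, and the capped mean is of order [h]. For unbounded
    variation the linear part of [g] is split off, its mean being governed by [E X_h], and the
    second derivative controls the rest by [E X_h^2]. *)
Lemma mean_quotient_equicont y e : 0 < e ->
  exists2 r, 0 < r & forall z, `|z - y| < r -> forall n, `|mean_quotient n z - mean_quotient n y| <= e.
Proof.
move=> e0.
pose C := 2 * cosh theta * Cy y + Cy y.
have c1 := cosh_ge1 theta.
have cy0 := Cy_ge0 y.
have c00 : 0 <= cosh theta by exact: cosh_ge0.
have C0 : 0 <= C by have := mulr_ge0 c00 cy0; rewrite /C; lra.
pose g z s := u (z + s) - u (y + s).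
have gC z s : `|z - y| < 1 -> `|g z s| <= C * cosh (theta * s).
  move=> zy; apply: (le_trans (ler_normB _ _)).
  rewrite /C mulrDl lerD ?u_shift//; apply: (le_trans (u_shift _ _)).
  by rewrite ler_wpM2r ?cosh_ge0//; exact: Cy_near.
have [bv|nbv] := pselect (has_bounded_variation P X).
  have C1u := u_bv bv.
  have [B B0 Bh] := bv_small hF hX bv.
  have e2 : 0 < e / 2 / (2 * C + 1) by rewrite !divr_gt0//; lra.
  have [r r0 rT] := tail_cosh hF hX hX0 hXc dl0 mgp mgm e2.
  pose k := e / 2 / (r%:R * B + 1).
  have rB : 0 <= r%:R * B by rewrite mulr_ge0.
  have k0 : 0 < k by rewrite !divr_gt0//; lra.
  have [q q0 qP] := unif_cont (`|y| + 1 + r%:R) C1u.2 k0.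
  exists (Num.min q 1); first by rewrite lt_min q0 ltr01.
  move=> z; rewrite lt_min => /andP[zq z1] n.
  pose h : R := dyadic n; have h0 : 0 <= h := dyadic_ge0 n.
  have [iT lT] := rT n.
  (* On [|s| <= r] the cap loses at most the factor [r], because [1 <= r]. *)
  have gk s : `|g z s - g z 0| <= (k * r%:R) * cap1 s + 2 * C * (cosh (theta * s) * (r%:R < `|s|)%R%:R).
    have r1 : 1 <= r%:R :> R by rewrite ler1n.
    have [sr|sr] := ltP (r%:R) `|s|.
      rewrite mulr1; apply: (@le_trans _ _ (2 * C * cosh (theta * s))); last first.
        by rewrite lerDr; apply: mulr_ge0; [apply: mulr_ge0 => //; exact: ltW|exact: cap1_ge0].
      apply: (le_trans (ler_normB _ _)).
      have := gC z s z1; have := gC z 0 z1; rewrite mulr0 cosh0.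
      have := cosh_ge1 (theta * s); nra.
    rewrite mulr0 mulr0 addr0.
    apply: (@le_trans _ _ (k * `|s|)).
      apply: (@mvt_lip _ (g z) (fun s => derive1 u (z + s) - derive1 u (y + s))).
        move=> v; rewrite /g; apply: is_deriveB.
          exact: (is_derive_translate z v (C1_is_derive C1u)).
        exact: (is_derive_translate y v (C1_is_derive C1u)).
      move=> v vs; rewrite distrC; apply: qP.
        apply: (le_trans (ler_normD _ _)); lra.
      by rewrite opprD addrACA subrr addr0 distrC.
    rewrite -mulrA; apply: ler_wpM2l; first exact: ltW.
    rewrite /cap1 /Num.min; case: ifP => _; last by rewrite mulr1.
    by rewrite ler_peMl.
  rewrite mean_quotient_diff normrM normfV (ger0_norm h0) ler_pdivrMr ?dyadic_gt0//.
  have mX := X_meas hF hX h0.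
  have ig : intg P (fun w => g z (X h w)) by apply: intgB; exact: intg_u.
  have icap : intg P (fun w => cap1 (X h w)).
    apply: (intg_dom _ (intg_cst P 1)); first by apply: measurableT_comp => //; exact: cap1_meas.
    by move=> w; rewrite ger0_norm ?cap1_ge0// ge_min lexx orbT.
  have -> : u z - u y = g z 0 by rewrite /g !addr0.
  rewrite -{1}[g z 0](EE_cst P) -EEB//; last exact: intg_cst.
  apply: (le_trans (EE_norm _)); first by apply: intgB => //; exact: intg_cst.
  apply: (@le_trans _ _ (EE P (fun w => (k * r%:R) * cap1 (X h w) + 2 * C * (cosh (theta * X h w) * (r%:R < `|X h w|)%R%:R)))).
    apply: EE_le.
    - by apply: intg_norm; apply: intgB => //; exact: intg_cst.
    - by apply: intgD; exact: intgZ.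
    - by move=> w; exact: gk.
  rewrite EED ?EEZ//; [|exact: intgZ..].
  have hb := Bh n; rewrite -/h in hb lT.
  have kr : k * r%:R * (B * h) <= e / 2 * h.
    rewrite mulrA ler_wpM2r// -mulrA /k mulrAC ler_pdivrMr; last exact: ltr_wpDl rB ltr01.
    by rewrite ler_wpM2l ?lerDl// ltW// divr_gt0.
  have C2 : 2 * C * (e / 2 / (2 * C + 1) * h) <= e / 2 * h.
    rewrite mulrA ler_wpM2r// mulrCA ler_piMr; [by []|lra|].
    by rewrite ler_pdivrMr; lra.
  have s1 := ler_wpM2l (mulr_ge0 (ltW k0) (ler0n R r)) hb.
  have C20 : 0 <= 2 * C by lra.
  have s2 := ler_wpM2l C20 lT.
  lra.
have [C1u C1u'] := u_ubv nbv.
(* In the tail, the two values of [g] account for [2 C], and the linear term, whose slope is at most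
   1, for [1 / theta], since [|s| <= cosh (theta s) / theta]. *)
pose C' := 2 * C + 1 / theta.
have ti : 0 < theta^-1 by rewrite invr_gt0.
have C'0 : 0 < C' by rewrite /C' div1r; lra.
have e3 : 0 < e / 3 / C' by rewrite !divr_gt0//; lra.
have [r r0 rT] := tail_cosh hF hX hX0 hXc dl0 mgp mgm e3.
have m1 := cm1_ge0; have m2 := cm2_ge0.
pose k := e / 3 / (cm2 + 1).
have k0 : 0 < k by rewrite !divr_gt0//; lra.
(* This bounds the slope [u' z - u' y] at 0: by 1 for use in the tail, by the other term so that the
   contribution of [E X_h] is at most [e h / 3]. *)
pose k' := Num.min 1 (e / 3 / (cm1 + 1)).
have k'0 : 0 < k' by rewrite lt_min ltr01 !divr_gt0//; lra.
have [q q0 qP] := unif_cont (`|y| + 1 + r%:R) C1u'.2 k0.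
have [q' q'0 qP'] := unif_cont `|y| C1u.2 k'0.
exists (Num.min q (Num.min q' 1)); first by rewrite !lt_min q0 q'0 ltr01.
move=> z; rewrite !lt_min => /and3P[zq zq' z1] n.
pose h : R := dyadic n; have h0 : 0 <= h := dyadic_ge0 n; have h1 : h <= 1 := dyadic_le1 n.
have [iT lT] := rT n.
pose g' s := derive1 u (z + s) - derive1 u (y + s).
have dg (v : R) : is_derive v 1 (g z) (g' v).
  rewrite /g; apply: is_deriveB.
    exact: (is_derive_translate z v (C1_is_derive C1u)).
  exact: (is_derive_translate y v (C1_is_derive C1u)).
have dg' (v : R) : is_derive v 1 g' (derive1 (derive1 u) (z + v) - derive1 (derive1 u) (y + v)).
  rewrite /g'; apply: is_deriveB.
    exact: (is_derive_translate z v (C1_is_derive C1u')).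
  exact: (is_derive_translate y v (C1_is_derive C1u')).
have g'0 : `|g' 0| <= k'.
  by rewrite /g' !addr0 distrC; apply: qP' => //; rewrite distrC.
have k'1 : k' <= 1 by rewrite ge_min lexx.
have gk s : `|g z s - g z 0 - g' 0 * s| <= k * s ^+ 2 + C' * (cosh (theta * s) * (r%:R < `|s|)%R%:R).
  have [sr|sr] := ltP (r%:R) `|s|.
    rewrite mulr1; apply: (@le_trans _ _ (C' * cosh (theta * s))); last first.
      by rewrite lerDr mulr_ge0 ?sqr_ge0// ltW.
    apply: (le_trans (ler_normB _ _)); apply: (@le_trans _ _ (`|g z s| + `|g z 0| + `|g' 0 * s|)).
      by rewrite lerD2r ler_normB.
    have c1s := cosh_ge1 (theta * s).
    have : `|g' 0 * s| <= 1 / theta * cosh (theta * s).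
      rewrite normrM div1r ler_pdivlMl//; apply: le_trans (norm_le_cosh _).
      rewrite normrM (gtr0_norm th0) ler_wpM2l ?(ltW th0)//.
      rewrite ler_piMl// (le_trans g'0)//.
    have := gC z s z1; have := gC z 0 z1; rewrite mulr0 cosh0 /C'; nra.
  rewrite mulr0 mulr0 addr0.
  have dgl (v : R) : is_derive v 1 (fun s => g z s - g' 0 * s) (g' v - g' 0).
    apply: is_deriveB => //; apply: is_derive_eq.
    by rewrite /GRing.scale/=; ring.
  have := mvt_lip (K := k * `|s|) (s := s) dgl.
  rewrite mulr0 subr0 => /(_ _) mv.
  have -> : k * s ^+ 2 = k * `|s| * `|s| by rewrite -mulrA -expr2 real_normK// num_real.
  have -> : g z s - g z 0 - g' 0 * s = g z s - g' 0 * s - g z 0 by ring.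
  apply: mv => v vs.
  apply: (@le_trans _ _ (k * `|v|)); last by rewrite ler_wpM2l// ltW.
  apply: (mvt_lip dg') => a av; rewrite distrC; apply: qP.
    apply: (le_trans (ler_normD _ _)); lra.
  by rewrite opprD addrACA subrr addr0 distrC.
rewrite mean_quotient_diff normrM normfV (ger0_norm h0) ler_pdivrMr ?dyadic_gt0//.
have mX := X_meas hF hX h0.
have ig : intg P (fun w => g z (X h w)) by apply: intgB; exact: intg_u.
have iX := intg_X h0; have iX2 := intg_X2 h0.
have igX : intg P (fun w => g z (X h w) - g z 0 - g' 0 * X h w).
  by apply: intgB; [apply: intgB => //; exact: intg_cst|exact: intgZ].
have -> : u z - u y = g z 0 by rewrite /g !addr0.
have -> : EE P (fun w => u (z + X h w) - u (y + X h w)) - g z 0 =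
    EE P (fun w => g z (X h w) - g z 0 - g' 0 * X h w) + g' 0 * EE P (X h).
  have E1 : EE P (fun w => g z (X h w) - g z 0) = EE P (fun w => g z (X h w)) - g z 0.
    by rewrite EEB ?EE_cst//; exact: intg_cst.
  have E2 : EE P (fun w => g z (X h w) - g z 0 - g' 0 * X h w) =
      EE P (fun w => g z (X h w) - g z 0) - EE P (fun w => g' 0 * X h w).
    by apply: EEB; [apply: intgB => //; exact: intg_cst|exact: intgZ].
  by rewrite E2 E1 EEZ// subrK.
apply: (le_trans (ler_normD _ _)).
have b1 : `|g' 0 * EE P (X h)| <= e / 3 * h.
  rewrite normrM; apply: (le_trans (ler_pM (normr_ge0 _) (normr_ge0 _) g'0 (EE_X_small h0 h1))).
  rewrite mulrA ler_wpM2r//.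
  apply: (@le_trans _ _ (e / 3 / (cm1 + 1) * cm1)).
    by rewrite ler_wpM2r// ge_min lexx orbT.
  rewrite mulrAC ler_pdivrMr; last exact: ltr_wpDl m1 ltr01.
  by rewrite ler_wpM2l ?lerDl// ltW// divr_gt0.
have b2 : `|EE P (fun w => g z (X h w) - g z 0 - g' 0 * X h w)| <=
   EE P (fun w => k * X h w ^+ 2 + C' * (cosh (theta * X h w) * (r%:R < `|X h w|)%R%:R)).
  apply: (le_trans (EE_norm igX)); apply: EE_le => //.
  - exact: intg_norm.
  - by apply: intgD; exact: intgZ.
have E3 : EE P (fun w => k * X h w ^+ 2 + C' * (cosh (theta * X h w) * (r%:R < `|X h w|)%R%:R)) =
    k * EE P (fun w => X h w ^+ 2) + C' * EE P (fun w => cosh (theta * X h w) * (r%:R < `|X h w|)%R%:R).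
  rewrite -!EEZ//; apply: EED; exact: intgZ.
rewrite E3 in b2.
have hb := EE_X2_small h0 h1; rewrite -/h in lT.
have kr : k * (cm2 * h) <= e / 3 * h.
  rewrite mulrA ler_wpM2r// /k mulrAC ler_pdivrMr; last exact: ltr_wpDl m2 ltr01.
  by rewrite ler_wpM2l ?lerDl// ltW// divr_gt0.
have C2' : C' * (e / 3 / C' * h) = e / 3 * h by field; exact: lt0r_neq0.
have s1 := ler_wpM2l (ltW k0) hb.
have s2 := ler_wpM2l (ltW C'0) lT.
rewrite (_ : e * h = e / 3 * h + e / 3 * h + e / 3 * h); last by field.
apply: lerD b1; apply: (le_trans b2); apply: lerD; first exact: le_trans s1 kr.
by rewrite -{1}C2'.
Qed.

Variable L : R -> R.
Hypothesis hL : forall y, generator_quotient P X u y t @[t --> 0^'+] --> (L y)%:E.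

Lemma mean_quotient_cvg y : mean_quotient n y @[n --> \oo] --> L y.
Proof.
have : generator_quotient P X u y (dyadic n) @[n --> \oo] --> (L y)%:E.
  by move=> A /(@hL y) hA; exact: (@dyadic_cvg0_right R (fun t => A (generator_quotient P X u y t)) hA).
have -> : (fun n => generator_quotient P X u y (dyadic n)) = (fun n => (mean_quotient n y)%:E).
  apply/funext => n; rewrite /generator_quotient unlock.
  have := EE_EFin (intg_u y (dyadic_ge0 n)).
  by move=> ->; rewrite -EFinB -EFinM.
by move=> /fine_cvg.
Qed.

(** The modulus of continuity of the quotients is uniform in [n], so it survives in the limit; this
    is how the generator of [u] is seen to be continuous. *)
Lemma L_equi y e : 0 < e -> exists2 r, 0 < r & forall z, `|z - y| < r -> `|L z - L y| <= e.
Proof.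
move=> e0; have [r r0 rP] := mean_quotient_equicont y e0; exists r => // z zy.
have c : `|mean_quotient n z - mean_quotient n y| @[n --> \oo] --> `|L z - L y|.
  by apply: cvg_norm; apply: cvgB; exact: mean_quotient_cvg.
apply: (cvg_le_near c).
by near=> n; exact: rP.
Unshelve. all: by end_near. Qed.

Lemma L_cont : continuous L.
Proof.
move=> y; apply/cvgrPdist_le => e e0; have [r r0 rP] := L_equi y e0.
by near=> z; rewrite distrC; apply: rP; rewrite distrC; near: z; apply/nbhs_ballP; exists r.
Unshelve. all: by end_near. Qed.

(** An equicontinuous family that converges pointwise converges uniformly on compact sets. *)
Lemma mean_quotient_unif M e : 0 < e -> \forall n \near \oo, forall y, `|y| <= M -> `|mean_quotient n y - L y| <= e.
Proof.
move=> e0.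
have : near_covering `[- M, M] by apply/compact_near_coveringP; exact: segment_compact.
move=> /(_ nat \oo (fun n y => `|mean_quotient n y - L y| <= e)) /(_ _).
have e3 : 0 < e / 3 by rewrite divr_gt0.
case.
  move=> y _.
  have [r1 r10 r1P] := mean_quotient_equicont y e3.
  have [r2 r20 r2P] := L_equi y e3.
  have := @mean_quotient_cvg y; move=> /cvgrPdist_le /(_ _ e3) cy.
  exists ([set z | `|y - z| < Num.min r1 r2], [set n | `|L y - mean_quotient n y| <= e / 3]).
    split => //=.
    by apply/nbhs_ballP; exists (Num.min r1 r2) => //=; rewrite lt_min r10.
  move=> [z n] /=; rewrite lt_min => -[/andP[z1 z2] ny].
  have a1 : `|mean_quotient n z - mean_quotient n y| <= e / 3 by apply: r1P; rewrite distrC.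
  have a2 : `|L z - L y| <= e / 3 by apply: r2P; rewrite distrC.
  have -> : mean_quotient n z - L z = (mean_quotient n z - mean_quotient n y) - (L y - mean_quotient n y) - (L z - L y) by ring.
  apply: (le_trans (ler_normB _ _)); apply: (@le_trans _ _ (`|mean_quotient n z - mean_quotient n y| + `|L y - mean_quotient n y| + `|L z - L y|)).
    by rewrite lerD2r ler_normB.
  lra.
move=> n _ nP; exists n => // m /= nm y yM; apply: nP => //.
by rewrite /= in_itv/= -ler_norml.
Qed.

Variables (delta : R) (f : R -> R).
Hypothesis delta0 : 0 < delta.

(** The quantity [V] of the overview, at the step [dyadic n]; [rho] is the left side of the
    variational inequality. *)
Definition step_defect n y := expR (- delta * dyadic n) * mean_shift (dyadic n) y + dyadic n * f y - u y.
Definition rho y := L y - delta * u y + f y.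

Lemma step_defect_unif M e : 0 < e -> \forall n \near \oo, forall y, `|y| <= M ->
  `|step_defect n y - dyadic n * rho y| <= e * dyadic n.
Proof.
move=> e0.
have [B1 B10 B1P] := continuous_bounded M L_cont.
have [B2 B20 B2P] := continuous_bounded M cu.
have e2 : 0 < e / 2 by rewrite divr_gt0.
have du := mean_quotient_unif M e2.
have d1 := mean_quotient_unif M ltr01.
(* The constant collects the errors of replacing [e^{-delta h}] by its expansion: first order
   against the quotient, which is at most [B1 + 1], and second order against [u], which is at most
   [B2]. *)
pose C := delta * (B1 + 1) + delta ^+ 2 * B2.
have C0 : 0 <= C.
  have a := mulr_ge0 (ltW delta0) (addr_ge0 B10 ler01).
  by have b := mulr_ge0 (sqr_ge0 delta) B20; rewrite /C; lra.
have hs : \forall n \near \oo, C * dyadic n <= e / 2.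
  have : C * dyadic n @[n --> \oo] --> C * 0 by apply: cvgMr; exact: dyadic_cvg0.
  rewrite mulr0 => /cvgrPdist_le /(_ _ e2); apply: filterS => n.
  by rewrite sub0r normrN ger0_norm// mulr_ge0// dyadic_ge0.
near=> n.
have n1 : forall y, `|y| <= M -> `|mean_quotient n y - L y| <= e / 2 by near: n.
have n2 : forall y, `|y| <= M -> `|mean_quotient n y - L y| <= 1 by near: n.
have e5 : C * dyadic n <= e / 2 by near: n.
move=> y yM.
set h := dyadic n in e5 *; have h0 : 0 < h := dyadic_gt0 n.
have e1 := n1 y yM.
have e3 : `|mean_quotient n y| <= B1 + 1.
  have := n2 y yM.
  have := B1P y yM; rewrite -[X in `|X| <= B1 + 1](subrK (L y)) => a b.
  by rewrite (le_trans (ler_normD _ _))// addrC lerD.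
have e4 := B2P y yM.
have dh0 : 0 <= delta * h by rewrite mulr_ge0 ?ltW.
have /andP[t1 t2] := expRN_taylor dh0.
have q0 : expR (- (delta * h)) <= 1 by rewrite -[leRHS]expR0 ler_expR oppr_le0.
have -> : step_defect n y - h * rho y = h * ((mean_quotient n y - L y) + (expR (- (delta * h)) - 1) * mean_quotient n y)
    + (expR (- (delta * h)) - 1 + delta * h) * u y.
  by rewrite /step_defect /rho -/h mulNr (_ : mean_shift h y = h * mean_quotient n y + u y); [ring|rewrite /mean_quotient -/h; field; rewrite gt_eqF].
apply: (le_trans (ler_normD _ _)); rewrite !normrM (gtr0_norm h0).
have a1 : `|(mean_quotient n y - L y) + (expR (- (delta * h)) - 1) * mean_quotient n y| <= e / 2 + delta * h * (B1 + 1).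
  apply: (le_trans (ler_normD _ _)); apply: lerD => //.
  rewrite normrM; apply: ler_pM => //.
  by rewrite ler0_norm ?subr_le0// -subr_ge0 opprK addrC.
have a2 : `|expR (- (delta * h)) - 1 + delta * h| * `|u y| <= (delta * h) ^+ 2 * B2.
  by apply: ler_pM => //; rewrite ger0_norm.
have a3 := ler_wpM2l (ltW h0) a1.
have a4 : h * (C * h) <= h * (e / 2) by rewrite ler_wpM2l// ltW.
rewrite /C in a4; nra.
Unshelve. all: by end_near. Qed.

End generator.

(** * The controlled chain *)

Section markov_real.
Context {R : realType} {d : measure_display} {T : measurableType d}.
Variables (P : probability T R) (F : R -> set (set T)) (X : R -> T -> R).
Hypothesis hF : usual_filtration P F.
Hypothesis hX : levy_process P F X.
Implicit Types (h y z e r s t : R).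

Lemma markov_EE0 s t (Z Y : T -> R) (phi : R -> R) : 0 <= s -> s <= t ->
  measurable_fun setT phi -> (forall y, 0 <= phi y) ->
  (forall y, intg P (fun w => phi (y + X (t - s) w))) ->
  (forall w, 0 <= Z w <= 1) -> Fm F s Z -> Fm F s Y ->
  intg P (fun w => phi (Y w + (X t w - X s w))) ->
  intg P (fun w => Z w * mean_shift P X phi (t - s) (Y w)) /\
  EE P (fun w => Z w * phi (Y w + (X t w - X s w))) =
  EE P (fun w => Z w * mean_shift P X phi (t - s) (Y w)).
Proof.
move=> s0 st mphi phi0 iphi Z01 ZF YF iY.
have ts : 0 <= t - s by rewrite subr_ge0.
have Z0 w : 0 <= Z w by have /andP[] := Z01 w.
have Z1 w : Z w <= 1 by have /andP[] := Z01 w.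
have mZ := Fm_meas hF s0 ZF; have mY := Fm_meas hF s0 YF.
have mphiE : measurable_fun setT (fun y => (phi y)%:E) by apply/measurable_EFinP.
have phiE0 y : (0 <= (phi y)%:E)%E by rewrite lee_fin.
have PEE y : (\int[P]_v (phi (y + X (t - s) v))%:E)%E = (mean_shift P X phi (t - s) y)%:E.
  by rewrite /mean_shift -EE_EFin.
have PE0 y : 0 <= mean_shift P X phi (t - s) y by exact: EE_ge0.
have mk := markov_ge0 hF hX s0 st mphiE phiE0 Z0 ZF YF.
have iZ : intg P (fun w => Z w * phi (Y w + (X t w - X s w))).
  apply: (intg_dom _ iY).
    by apply: measurable_funM => //; exact: (intg_meas iY).
  move=> w; rewrite ger0_norm ?mulr_ge0//; apply: ler_piMl => //.
have mk' : ((EE P (fun w => Z w * phi (Y w + (X t w - X s w))))%:E =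
    \int[P]_w (Z w * mean_shift P X phi (t - s) (Y w))%:E)%E.
  rewrite -EE_EFin//; under eq_integral do rewrite EFinM.
  by rewrite mk; apply: eq_integral => w _; rewrite PEE -EFinM.
have mPE : measurable_fun setT (fun w => mean_shift P X phi (t - s) (Y w)).
  have := measurable_integral_shift hF hX ts mphiE phiE0 mY.
  by under eq_fun do rewrite PEE; move=> /measurable_EFinP.
have iP : intg P (fun w => Z w * mean_shift P X phi (t - s) (Y w)).
  apply: intg_ge0; first exact: measurable_funM.
    by move=> w; rewrite mulr_ge0.
  by rewrite -mk' ltry.
by split => //; apply: EFin_inj; rewrite mk' EE_EFin.
Qed.

Lemma markov_EE s t (Z Y : T -> R) (phi : R -> R) : 0 <= s -> s <= t ->
  measurable_fun setT phi ->
  (forall y, intg P (fun w => phi (y + X (t - s) w))) ->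
  (forall w, 0 <= Z w <= 1) -> Fm F s Z -> Fm F s Y ->
  intg P (fun w => phi (Y w + (X t w - X s w))) ->
  intg P (fun w => Z w * mean_shift P X phi (t - s) (Y w)) /\
  EE P (fun w => Z w * phi (Y w + (X t w - X s w))) =
  EE P (fun w => Z w * mean_shift P X phi (t - s) (Y w)).
Proof.
move=> s0 st mphi iphi Z01 ZF YF iY.
(* Both [|phi|] and [|phi| - phi] are non-negative and as integrable as [phi], and their difference
   is [phi]. *)
pose p1 y : R := `|phi y|; pose p2 y : R := `|phi y| - phi y.
have phiE y : phi y = p1 y - p2 y by rewrite /p1 /p2; ring.
have m1 : measurable_fun setT p1 by exact: measurableT_comp.
have m2 : measurable_fun setT p2 by apply: measurable_funB.
have p10 y : 0 <= p1 y by exact: normr_ge0.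
have p20 y : 0 <= p2 y by rewrite subr_ge0 ler_norm.
have i1 y : intg P (fun w => p1 (y + X (t - s) w)) by exact: intg_norm.
have i2 y : intg P (fun w => p2 (y + X (t - s) w)) by apply: intgB => //; exact: intg_norm.
have [j1 e1] := markov_EE0 s0 st m1 p10 i1 Z01 ZF YF (intg_norm iY).
have [j2 e2] := markov_EE0 s0 st m2 p20 i2 Z01 ZF YF (intgB (intg_norm iY) iY).
have Zi (g : T -> R) : intg P g -> intg P (fun w => Z w * g w).
  move=> ig; apply: (intg_dom _ (intg_norm ig)).
    by apply: measurable_funM; [exact: (Fm_meas hF s0 ZF)|exact: intg_meas ig].
  move=> w; rewrite normrM; have /andP[z0 z1] := Z01 w.
  by rewrite ler_piMl// ger0_norm.
have PEE y : mean_shift P X phi (t - s) y = mean_shift P X p1 (t - s) y - mean_shift P X p2 (t - s) y.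
  by rewrite /mean_shift -EEB//; congr (EE P _); apply/funext => w; exact: phiE.
have -> : (fun w => Z w * mean_shift P X phi (t - s) (Y w)) =
    (fun w => Z w * mean_shift P X p1 (t - s) (Y w) - Z w * mean_shift P X p2 (t - s) (Y w)).
  by apply/funext => w; rewrite PEE mulrBr.
split; first exact: intgB.
rewrite EEB// -e1 -e2 -EEB.
- by congr (EE P _); apply/funext => w; rewrite {1}phiE mulrBr.
- exact: (Zi _ (intg_norm iY)).
- exact: (Zi _ (intgB (intg_norm iY) iY)).
Qed.

End markov_real.

Section chain.
Context {R : realType} {d : measure_display} {T : measurableType d}.
Variables (P : probability T R) (F : R -> set (set T)) (X : R -> T -> R).
Hypothesis hF : usual_filtration P F.
Hypothesis hX : levy_process P F X.
Hypothesis hX0 : forall w, X 0 w = 0.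
Variables (x h delta : R) (u f CC : R -> R) (a : nat -> T -> R).

Definition prev (a : nat -> T -> R) k w := if k is k'.+1 then a k' w else 0.
Definition pos k w := x + X (k%:R * h) w.
Definition chain_pos k w := pos k w - a k w.
(** With [CC] a primitive of [c], this is the cost of the push at grid time [k], from the position
    before it to the one after. Other choices of [CC] serve to derive moment bounds from the same
    chain inequality. *)
Definition control_step k w := CC (pos k w - prev a k w) - CC (chain_pos k w).
Definition ee k := expR (- delta * (k%:R * h)).

Definition cost_upto m w := \sum_(k < m) h * (ee k * f (chain_pos k w)) +
  \sum_(k < m.+1) ee k * control_step k w + ee m * u (chain_pos m w).

Definition dcost k w := h * (ee k * f (chain_pos k w)) + ee k.+1 * control_step k.+1 w +
  (ee k.+1 * u (chain_pos k.+1 w) - ee k * u (chain_pos k w)).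

Lemma cost_uptoS m w : cost_upto m.+1 w = cost_upto m w + dcost m w.
Proof.
rewrite /cost_upto /dcost big_ord_recr/= [\sum_(k < m.+2) _]big_ord_recr/=; ring.
Qed.

Variable G : pred R.
Fixpoint inside_upto k w : bool :=
  G (chain_pos k w) && (if k is k'.+1 then inside_upto k' w else true).

(* [cost_upto], frozen when the chain first leaves [G]: the generator estimate is
   uniform on bounded sets only. *)
Fixpoint stopped_cost m w : R := if m is m'.+1 then stopped_cost m' w + (inside_upto m' w)%:R * dcost m' w
  else cost_upto 0 w.

Lemma inside_upto_le k w : inside_upto k w -> G (chain_pos k w).
Proof. by case: k => [|k] /andP[]. Qed.

Lemma inside_upto_all k w : (forall j, (j <= k)%N -> G (chain_pos j w)) -> inside_upto k w.
Proof.
elim: k => [|k IH] hj /=; first by rewrite hj.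
by rewrite hj//= IH// => j jk; apply: hj; rewrite leqW.
Qed.

Lemma stopped_cost_run m w : (forall k, (k < m)%N -> inside_upto k w) -> stopped_cost m w = cost_upto m w.
Proof.
elim: m => [//|m IH] hB /=.
by rewrite IH ?hB// ?mul1r ?cost_uptoS// => k km; apply: hB; rewrite ltnW.
Qed.

(** Freezing only changes the index at which the cost is read, so a bound valid for every
    [cost_upto] dominates the stopped cost. *)
Lemma stopped_cost_stop m w : exists2 j, (j <= m)%N & stopped_cost m w = cost_upto j w.
Proof.
case: m => [|m]; first by exists 0%N.
suff [[_ H]|[H1 [j jm E]]] : (inside_upto m w /\ stopped_cost m.+1 w = cost_upto m.+1 w) \/
   (~~ inside_upto m w /\ exists2 j, (j <= m)%N & stopped_cost m.+1 w = cost_upto j w).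
  by exists m.+1.
  by exists j => //; rewrite leqW.
elim: m => [|m IH] /=.
  have E0 := cost_uptoS 0 w.
  case: (G _) => /=; [left; rewrite mul1r -E0|right; rewrite mul0r addr0]; split => //.
  by exists 0%N.
case: IH => [[H1 E1]|[H1 [j jm E1]]]; rewrite -/(inside_upto m w) -/(stopped_cost m.+1 w) E1.
  have E2 := cost_uptoS m.+1 w; rewrite H1 andbT.
  case: (G _) => /=; [left; rewrite mul1r -E2 //|right; rewrite mul0r addr0].
  by split => //; exists m.+1.
rewrite (negbTE H1) andbF mul0r addr0; right; split => //; exists j => //; exact: leqW.
Qed.

Hypothesis h0 : 0 <= h.
Hypothesis delta0 : 0 <= delta.
Hypothesis aF : forall k, Fm F (k%:R * h) (a k).
Hypothesis hv : forall k w, u (pos k w - prev a k w) - u (chain_pos k w) <= control_step k w.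
Variable e : R.
Hypothesis e0 : 0 <= e.
Hypothesis mG : measurable_fun setT (fun y : R => (G y)%:R : R).
Hypothesis hvt : forall k w, G (chain_pos k w) ->
  - (e * h) <= expR (- delta * h) * mean_shift P X u h (chain_pos k w) + h * f (chain_pos k w) - u (chain_pos k w).
Hypothesis mu_ : measurable_fun setT u.
Hypothesis iu : forall y, intg P (fun w => u (y + X h w)).
Hypothesis iu1 : forall k, intg P (fun w => u (pos k.+1 w - a k w)).
Hypothesis iu0 : forall k, intg P (fun w => u (chain_pos k w)).
Hypothesis if0 : forall k, intg P (fun w => f (chain_pos k w)).
Hypothesis iC : forall k, intg P (control_step k).

Lemma kh0 k : 0 <= k%:R * h :> R. Proof. by rewrite mulr_ge0. Qed.

Lemma chain_pos_F k : Fm F (k%:R * h) (chain_pos k).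
Proof.
have k0 := kh0 k; apply: (Fm_sub hF k0) => //; apply: (Fm_add hF k0).
  exact: (Fm_cst hF).
exact: (Fm_X hX).
Qed.

Lemma inside_upto_F k : Fm F (k%:R * h) (fun w => (inside_upto k w)%:R : R).
Proof.
have YB j : Fm F (j%:R * h) (fun w => (G (chain_pos j w))%:R : R).
  exact: (Fm_comp mG (chain_pos_F j)).
elim: k => [|k IH] /=.
  by under eq_fun do rewrite andbT; exact: YB.
have -> : (fun w => (G (chain_pos k.+1 w) && inside_upto k w)%:R : R) =
    (fun w => (G (chain_pos k.+1 w))%:R * (inside_upto k w)%:R).
  by apply/funext => w; case: (G _); rewrite /= ?mul1r ?mul0r.
apply: (Fm_mul hF (kh0 _)) => //; apply: (Fm_mono hF (kh0 k) _ IH).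
by rewrite ler_wpM2r// ler_nat.
Qed.

Lemma ee_ge0 k : 0 <= ee k. Proof. exact: expR_ge0. Qed.
Lemma ee_le1 k : ee k <= 1.
Proof. by rewrite /ee -[leRHS]expR0 ler_expR mulNr oppr_le0 mulr_ge0// kh0. Qed.
Lemma eeS k : ee k.+1 = ee k * expR (- delta * h).
Proof. by rewrite /ee -expRD; congr expR; rewrite -natr1; ring. Qed.

Lemma intg_dcost k : intg P (dcost k).
Proof.
rewrite /dcost; apply: intgD; last by apply: intgB; apply: intgZ.
by apply: intgD; [apply: intgZ; apply: intgZ|apply: intgZ].
Qed.

Lemma BkZ k (g : T -> R) : intg P g -> intg P (fun w => (inside_upto k w)%:R * g w).
Proof.
move=> ig; apply: (intg_dom _ (intg_norm ig)).
  apply: measurable_funM; [exact: (Fm_meas hF (kh0 k) (inside_upto_F k))|exact: intg_meas ig].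
by move=> w; rewrite normrM; case: (inside_upto _ _); rewrite ?normr1 ?mul1r// normr0 mul0r.
Qed.

Lemma stopped_cost_intg m : intg P (stopped_cost m).
Proof.
elim: m => [|m IH] /=.
  rewrite /cost_upto; under eq_fun do rewrite big_ord0 big_ord1 add0r.
  by apply: intgD; apply: intgZ.
by apply: intgD => //; apply: BkZ; exact: intg_dcost.
Qed.

(** [hv] trades the push at time [k + 1] for the value before it, which leaves an uncontrolled step.
    The indicator of not having left [G] is known at time [k], so the Markov property replaces the
    step by [mean_shift], where [hvt] applies on [G]. *)
Lemma EE_dcost k : - (e * h) <= EE P (fun w => (inside_upto k w)%:R * dcost k w).
Proof.
have k0 := kh0 k.
have kk : k%:R * h <= k.+1%:R * h by rewrite ler_wpM2r// ler_nat.
have kd : k.+1%:R * h - k%:R * h = h by rewrite -natr1; ring.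
have uE w : u (chain_pos k w + (X (k.+1%:R * h) w - X (k%:R * h) w)) = u (pos k.+1 w - a k w).
  by congr u; rewrite /chain_pos /pos; ring.
have Z01 w : 0 <= ((inside_upto k w)%:R : R) <= 1 by case: (inside_upto k w); rewrite ?lexx ?ler01.
have [] := @markov_EE _ _ _ P F X hF hX _ _ (fun w => (inside_upto k w)%:R) (chain_pos k) u k0 kk mu_.
- by rewrite kd.
- exact: Z01.
- exact: inside_upto_F.
- exact: chain_pos_F.
- by under eq_fun do rewrite uE.
rewrite kd => iP eP.
pose g w := ee k.+1 * u (pos k.+1 w - a k w) + ee k * (h * f (chain_pos k w) - u (chain_pos k w)).
have ig : intg P g.
  by apply: intgD; apply: intgZ => //; apply: intgB => //; exact: intgZ.
apply: (@le_trans _ _ (EE P (fun w => (inside_upto k w)%:R * g w))); last first.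
  apply: EE_le; [exact: BkZ|apply: BkZ; exact: intg_dcost|].
  move=> w; rewrite ler_wpM2l//; rewrite /g /dcost.
  have := ler_wpM2l (ee_ge0 k.+1) (hv k.+1 w); rewrite /=; lra.
have -> : EE P (fun w => (inside_upto k w)%:R * g w) = EE P (fun w =>
    ee k.+1 * ((inside_upto k w)%:R * mean_shift P X u h (chain_pos k w)) + ee k * ((inside_upto k w)%:R * (h * f (chain_pos k w) - u (chain_pos k w)))).
  have i3 : intg P (fun w => (inside_upto k w)%:R * (h * f (chain_pos k w) - u (chain_pos k w))).
    by apply: BkZ; apply: intgB => //; exact: intgZ.
  rewrite EED; [|exact: intgZ|exact: intgZ].
  rewrite !EEZ// -eP -[X in X + _]EEZ; last by under eq_fun do rewrite uE; exact: BkZ.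
  rewrite -[X in _ + X]EEZ// -EED.
  - by congr (EE P _); apply/funext => w; rewrite uE /g; ring.
  - by apply: intgZ; under eq_fun do rewrite uE; exact: BkZ.
  - exact: intgZ.
rewrite -[leLHS](EE_cst P); apply: EE_le; first exact: intg_cst.
  apply: intgD; apply: intgZ => //.
  by apply: BkZ; apply: intgB => //; exact: intgZ.
move=> w; have eh : 0 <= e * h by rewrite mulr_ge0.
case: (boolP (inside_upto k w)) => [/inside_upto_le bk|_]; last by rewrite !mul0r !mulr0 addr0 oppr_le0.
rewrite !mul1r eeS -mulrA -mulrDr.
have := hvt bk; set v := (X in - _ <= X) => v0.
have -> : expR (- delta * h) * mean_shift P X u h (chain_pos k w) + (h * f (chain_pos k w) - u (chain_pos k w)) = v.
  by rewrite /v; ring.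
have := ee_ge0 k; have := ee_le1 k; nra.
Qed.

(** The one-step bounds are summed; at index 0, [hv] accounts for the push at time 0. *)
Lemma chain m : u x <= EE P (stopped_cost m) + e * (m%:R * h).
Proof.
elim: m => [|m IH].
  rewrite mul0r mulr0 addr0 -[leLHS](EE_cst P); apply: EE_le.
  - exact: intg_cst.
  - exact: (stopped_cost_intg 0).
  move=> w; rewrite /= /cost_upto big_ord0 big_ord1 add0r.
  have := hv 0%N w; rewrite /= /ee mul0r mulr0 expR0 !mul1r subr0.
  by rewrite {1}/pos mul0r hX0 addr0; lra.
rewrite /= EED; [|exact: stopped_cost_intg|apply: BkZ; exact: intg_dcost].
by have := EE_dcost m; rewrite -natr1; nra.
Qed.

End chain.

(** * Limits of running and control costs *)

Section level_sums.
Context {R : realType}.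
Local Notation mu := (@lebesgue_measure R).
Implicit Types (l L M : R).

Lemma lebesgue_integrable_cst (A : set R) M : measurable A -> (mu A < +oo)%E ->
  mu.-integrable A (EFin \o (fun=> M)).
Proof.
move=> mA Afin; apply/integrableP; split; first exact/measurable_EFinP.
under eq_integral do rewrite /=.
by rewrite integral_cst// lte_mul_pinfty.
Qed.

Lemma fine_mu_oc (a b : R) : a <= b -> fine (mu `]a, b]) = b - a.
Proof.
move=> ab; rewrite lebesgue_measure_itv/= lte_fin; case: ifPn => //=.
by rewrite -leNgt => ba; apply/eqP; rewrite eq_sym subr_eq0 eq_le ba ab.
Qed.

(** Every subset of a countable set is Borel, so what the limit does there cannot spoil
    measurability. *)
Lemma meas_lim (A : set R) (f_ : nat -> R -> R) (f : R -> R) (N : set R) :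
  measurable A -> (forall n, measurable_fun A (f_ n)) -> countable N ->
  (forall l, A l -> ~ N l -> f_ n l @[n --> \oo] --> f l) -> measurable_fun A f.
Proof.
move=> mA mf_ cN ff.
have mN (B : set R) : B `<=` N -> measurable B.
  by move=> BN; apply: countable_measurable => //; exact: sub_countable (subset_card_le BN) cN.
have -> : A = (A `\` N) `|` (A `&` N) by rewrite setUC setUIDK.
apply/measurable_funU; [apply: measurableD => //; exact: mN|apply: mN; exact: subIsetr|split].
  apply: (@measurable_fun_cvg _ _ _ _ f_) => [n|l [Al Nl]]; last exact: ff.
  exact: measurable_funS mA (@subDsetl _ _ _) (mf_ n).
by move=> _ B mB; apply: mN => l [[_ Nl] _].
Qed.

Lemma Rint_cvg (A : set R) (f_ : nat -> R -> R) (f : R -> R) (N : set R) M :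
  measurable A -> (mu A < +oo)%E -> (forall n, measurable_fun A (f_ n)) -> countable N ->
  (forall l, A l -> ~ N l -> f_ n l @[n --> \oo] --> f l) ->
  (forall n l, A l -> `|f_ n l| <= M) ->
  mu.-integrable A (EFin \o f) /\
  (\int[mu]_(l in A) f_ n l) @[n --> \oo] --> \int[mu]_(l in A) f l.
Proof.
move=> mA Afin mf_ cN ff fM.
have mf := meas_lim mA mf_ cN ff.
have N0 : mu N = 0 by exact: countable_lebesgue_measure0.
have mN : measurable N by exact: countable_measurable.
have iM : mu.-integrable A (EFin \o (fun=> M)) by apply: lebesgue_integrable_cst.
have [] := @dominated_convergence _ _ R mu A mA (fun n l => (f_ n l)%:E)
  (fun l => (f l)%:E) (fun=> M%:E) _ _ _ iM _.
- by move=> n; apply/measurable_EFinP; exact: mf_.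
- by apply/measurable_EFinP; exact: mf.
- exists N; split => // l /= nl; apply: contrapT => Nl; apply: nl => Al.
  exact: cvgEF (@ff l Al Nl).
- exists set0; split => // l /= nl; exfalso; apply: nl => n Al.
  by rewrite lee_fin fM.
move=> iF _ cF; split => //.
have Fn : (\int[mu]_(l in A) (f l)%:E)%E \is a fin_num by exact: integrable_fin_num.
have := cF; rewrite -(fineK Fn) => /fine_cvg; exact.
Qed.

Definition pv (a : nat -> R) k := if k is k'.+1 then a k' else 0.

(** As a function of the level [l]: the level is charged at the one step at which [a] passes it. The
    sum over steps of integrals over the levels gained thus becomes a single integral over
    levels. *)
Definition level_sum (a : nat -> R) (G : nat -> R -> R) m l :=
  \sum_(k < m.+1) G k l * (pv a k < l <= a k)%R%:R.

Section one_level.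
Variables (a : nat -> R) (G : nat -> R -> R) (m : nat).
Hypothesis a_nd : forall j k, (j <= k)%N -> a j <= a k.

Lemma pv_le j k : (j < k)%N -> a j <= pv a k.
Proof. by case: k => // k; rewrite ltnS; exact: a_nd. Qed.

Lemma level_sum_eq k l : (k <= m)%N -> pv a k < l <= a k -> level_sum a G m l = G k l.
Proof.
move=> km /andP[l1 l2]; have km' : (k < m.+1)%N by [].
rewrite /level_sum (bigD1 (Ordinal km'))//= l1 l2 mulr1 big1 ?addr0// => i ik.
have /negbTE -> : ~~ (pv a i < l <= a i); last by rewrite mulr0.
have : (i : nat) != k by apply: contra ik => /eqP ik; apply/eqP/val_inj.
rewrite neq_ltn negb_and -leNgt -ltNge => /orP[ik'|ki].
  by rewrite (le_lt_trans (pv_le ik'))// orbT.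
by rewrite (le_trans l2 (pv_le ki)).
Qed.

Lemma level_sum_bound M L l : 0 <= M -> (forall k l, (k <= m)%N -> 0 < l -> l <= L -> `|G k l| <= M) ->
  0 < l -> l <= L -> `|level_sum a G m l| <= M.
Proof.
move=> M0 GM l0 lL.
have [[k km kl]|nk] := pselect (exists2 k, (k <= m)%N & pv a k < l <= a k).
  by rewrite (level_sum_eq km kl) GM.
rewrite /level_sum big1 ?normr0// => -[k km] _ /=.
have /negbTE -> : ~~ (pv a k < l <= a k); last by rewrite mulr0.
by apply/negP => kl; apply: nk; exists k.
Qed.

Lemma level_sum_meas : (forall k, measurable_fun setT (G k)) -> measurable_fun setT (level_sum a G m).
Proof.
move=> mG; apply: measurable_sum => k; apply: measurable_funM => //.
have -> : (fun l => (pv a k < l <= a k)%R%:R : R) = \1_(`]pv a k, a k]).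
  by apply/funext => l; rewrite indicE mem_setE in_itv.
exact: measurable_indic.
Qed.

Lemma level_sum_int M L : 0 <= M -> (forall k, measurable_fun setT (G k)) ->
  (forall k l, (k <= m)%N -> 0 < l -> l <= L -> `|G k l| <= M) ->
  (forall k, 0 <= a k) -> (forall k, (k <= m)%N -> a k <= L) ->
  \sum_(k < m.+1) \int[mu]_(l in `]pv a k, a k]) G k l =
  \int[mu]_(l in `]0, L]) level_sum a G m l.
Proof.
move=> M0 mG GM a0 aL.
have mD : measurable (`]0, L] : set R) by exact: measurable_itv.
have mE k : measurable (`]pv a k, a k] : set R) by exact: measurable_itv.
have DE k : (k <= m)%N -> [set` `]pv a k, a k]] `&` [set` `]0, L]] = [set` `]pv a k, a k]] :> set R.
  move=> km; apply/setIidPl => l /=; rewrite !in_itv/= => /andP[l1 l2].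
  apply/andP; split; last exact: le_trans l2 (aL _ km).
  by apply: le_lt_trans l1; case: k {km l2} => [|k] /=.
have fD : (mu (`]0%R, L]) < +oo)%E.
  by rewrite lebesgue_measure_itv/=; case: ifP => // _; rewrite -EFinB ltry.
pose H k l := G k l * (pv a k < l <= a k)%R%:R.
have mH k : measurable_fun setT (H k).
  apply: measurable_funM => //.
  have -> : (fun l => (pv a k < l <= a k)%R%:R : R) = \1_(`]pv a k, a k]).
    by apply/funext => l; rewrite indicE mem_setE in_itv.
  exact: measurable_indic.
have iH k : (k <= m)%N -> mu.-integrable `]0, L] (EFin \o H k).
  move=> km; apply: (@le_integrable _ _ _ mu _ mD _ (EFin \o (fun=> M))).
  - by apply/measurable_EFinP; apply: measurable_funTS; exact: mH.
  - move=> l /=; rewrite in_itv/= => /andP[l0 lL]; rewrite lee_fin /H normrM (ger0_norm M0).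
    apply: le_trans (GM k l km l0 lL); rewrite ler_piMr//.
    by case: (_ && _); rewrite ?normr1 ?normr0.
  - exact: lebesgue_integrable_cst.
have key j : (j <= m.+1)%N -> mu.-integrable `]0, L] (EFin \o (fun l => \sum_(k < j) H k l)) /\
   \sum_(k < j) \int[mu]_(l in `]pv a k, a k]) G k l = \int[mu]_(l in `]0, L]) \sum_(k < j) H k l.
  elim: j => [_|j IH jm].
    have -> : (fun l => \sum_(k < 0) H k l) = (fun=> 0) by apply/funext => l; rewrite big_ord0.
    split; first exact: lebesgue_integrable_cst.
    by rewrite big_ord0 Rintegral_cst// mul0r.
  have [i1 e1] := IH (ltnW jm).
  have -> : (fun l => \sum_(k < j.+1) H k l) = (fun l => \sum_(k < j) H k l + H j l).
    by apply/funext => l; rewrite big_ord_recr.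
  split.
    have i2 := @integrableD _ _ _ mu _ mD _ _ i1 (iH j jm).
    apply: eq_integrable i2 => // l _ /=; exact: EFinD.
  rewrite big_ord_recr/= e1 RintegralD//; last exact: iH.
  congr (_ + _); rewrite -{1}(DE j)// /Rintegral integral_mkcondl; congr fine.
  apply: eq_integral => l _; rewrite /H patchE mem_setE in_itv/=.
  by case: ifP => _; rewrite ?mulr1 ?mulr0.
by have [_ ->] := key m.+1 (leqnn _).
Qed.

End one_level.

(** For a fixed level only the index [kap n] at which it is passed matters, so convergence is asked
    level by level, off a countable set, and bounded convergence over the levels does the rest. *)
Lemma level_cvg (a : nat -> nat -> R) (G : nat -> nat -> R -> R) (mm : nat -> nat)
    (g : R -> R) (N : set R) M L :
  0 <= M -> (forall n j k, (j <= k)%N -> a n j <= a n k) ->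
  (forall n k, 0 <= a n k) -> (forall n k, (k <= mm n)%N -> a n k <= L) ->
  (forall n k, measurable_fun setT (G n k)) ->
  (forall n k l, (k <= mm n)%N -> 0 < l -> l <= L -> `|G n k l| <= M) ->
  countable N ->
  (forall l, 0 < l -> l <= L -> ~ N l -> exists2 kap : nat -> nat,
     \forall n \near \oo, (kap n <= mm n)%N /\ pv (a n) (kap n) < l <= a n (kap n) &
     G n (kap n) l @[n --> \oo] --> g l) ->
  mu.-integrable `]0, L] (EFin \o g) /\
  (\sum_(k < (mm n).+1) \int[mu]_(l in `]pv (a n) k, a n k]) G n k l) @[n --> \oo] -->
  \int[mu]_(l in `]0, L]) g l.
Proof.
move=> M0 a_nd a0 aL mG GM cN hk.
have mD : measurable (`]0, L] : set R) by exact: measurable_itv.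
have fD : (mu (`]0%R, L]) < +oo)%E.
  by rewrite lebesgue_measure_itv/=; case: ifP => // _; rewrite -EFinB ltry.
have [] := @Rint_cvg `]0, L] (fun n => level_sum (a n) (G n) (mm n)) g N M mD fD _ cN _ _.
- by move=> n; apply: measurable_funTS; exact: level_sum_meas.
- move=> l /=; rewrite in_itv/= => /andP[l0 lL] Nl; have [kap kP kc] := hk l l0 lL Nl.
  apply: cvg_trans kc; apply: near_eq_cvg; near=> n.
  have [|k1 k2] := near kP n; first by [].
  by rewrite (@level_sum_eq (a n) (G n) (mm n) (a_nd n) _ _ k1 k2).
- move=> n l /=; rewrite in_itv/= => /andP[l0 lL].
  by exact: (@level_sum_bound (a n) (G n) (mm n) (a_nd n) M L l M0 (GM n) l0 lL).
move=> ig cg; split => //; apply: cvg_trans cg; apply: near_eq_cvg; near=> n.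
by rewrite (@level_sum_int (a n) (G n) (mm n) M L M0 (mG n) (GM n) (a0 n) (aL n)).
Unshelve. all: by end_near. Qed.

End level_sums.

(** * Primitives of the cost rate and averages over a jump *)

Section primitive.
Context {R : realType}.
Local Notation mu := (@lebesgue_measure R).
Implicit Types (l p q a b y z : R).

Lemma cvg_cont (k : R -> R) (v : nat -> R) y : continuous k -> v n @[n --> \oo] --> y ->
  k (v n) @[n --> \oo] --> k y.
Proof. by move=> ck cv; apply: continuous_cvg => //; exact: ck. Qed.

Lemma integrable_continuous (k : R -> R) a b : continuous k ->
  mu.-integrable `[a, b] (EFin \o k).
Proof.
move=> ck; apply: continuous_compact_integrable; first exact: segment_compact.
by apply: continuous_subspaceT.
Qed.

Lemma derive_segment (k k' : R -> R) a b : (forall z, is_derive z 1 k (k' z)) ->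
  continuous k' -> a <= b -> \int[mu]_(l in `[a, b]) k' l = k b - k a.
Proof.
move=> dk ck; rewrite le_eqVlt => /predU1P[<-|ab].
  by rewrite set_itv1 Rintegral_set1 subrr.
rewrite /Rintegral (@continuous_FTC2 _ k' k a b ab) //.
- by apply: continuous_subspaceT.
- have ckk := is_derive_continuous dk.
  by split; [move=> z _; exact: ex_derive|exact/cvg_at_right_filter/ckk|exact/cvg_at_left_filter/ckk].
- by move=> z _; rewrite derive1E; exact: derive_val.
Qed.

Lemma Rint_cst01 (r : R) : \int[mu]_(l in `[0, 1]) r = r.
Proof.
have dk (z : R) : is_derive z 1 (fun l : R => r * l) r.
  by apply: is_derive_eq; rewrite /GRing.scale/= mulr1.
by rewrite (derive_segment dk (fun=> cvg_cst r) ler01) mulr1 mulr0 subr0.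
Qed.

(** The oriented integral from 0 to [y]: one of the two terms always vanishes. *)
Definition prim (c : R -> R) y : R :=
  \int[mu]_(l in `[0, y]) c l - \int[mu]_(l in `[y, 0]) c l.

Lemma Rint_itv_add (c : R -> R) a b y : continuous c -> a <= b -> b <= y ->
  \int[mu]_(l in `[a, y]) c l = \int[mu]_(l in `[a, b]) c l + \int[mu]_(l in `[b, y]) c l.
Proof.
move=> cc ab by_.
have := @Rintegral_itvB R c (BLeft a) (BRight y) b.
rewrite !bnd_simp => /(_ (integrable_continuous a y cc) ab by_) H.
rewrite -[X in _ = _ + X]Rintegral_itv_obnd_cbnd; first by rewrite -H addrC subrK.
by apply: integrableS (integrable_continuous b y cc) => //; apply: subset_itvr; rewrite bnd_simp.
Qed.

Lemma primE (c : R -> R) M y : continuous c -> 0 <= M -> - M <= y ->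
  prim c y = \int[mu]_(l in `[- M, y]) c l - \int[mu]_(l in `[- M, 0]) c l.
Proof.
move=> cc M0 My; have M0' : - M <= 0 by rewrite oppr_le0.
rewrite /prim; have [y0|y0] := leP 0 y.
  rewrite (Rint_itv_add cc M0' y0) addrAC subrr add0r.
  have [->|yn] := eqVneq y 0; first by rewrite set_itv1 Rintegral_set1 subrr.
  by rewrite (_ : `[y, 0]%classic = set0) ?Rintegral_set0 ?subr0// set_itv_ge// bnd_simp -ltNge lt_neqAle eq_sym yn.
rewrite (Rint_itv_add cc My (ltW y0)) opprD addrA subrr add0r.
by rewrite (_ : `[0, y]%classic = set0) ?Rintegral_set0 ?add0r// set_itv_ge// bnd_simp -ltNge.
Qed.

Lemma prim_derive (c : R -> R) y : continuous c -> is_derive y 1 (prim c) (c y).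
Proof.
move=> cc; pose M := `|y| + 1.
have M0 : 0 <= M by rewrite addr_ge0.
have My : - M < y by rewrite /M; have := ler_norm (- y); rewrite normrN; lra.
have y1 : y < y + 1 by rewrite ltrDl.
pose k z := \int[mu]_(t in `[- M, z]) c t.
have [dk ek] := @continuous_FTC1 R c (BLeft (- M)) y (y + 1) y1
  (integrable_continuous _ _ cc) My (cc y).
have dk' : is_derive y 1 k (c y) by split; [exact: dk|rewrite -derive1E; exact: ek].
pose C := \int[mu]_(l in `[- M, 0]) c l.
have dk2 : is_derive y 1 (fun z => k z - C) (c y).
  by apply: is_derive_eq; rewrite subr0.
apply: near_eq_is_derive dk2; near=> z.
by rewrite /= (primE cc M0)//; near: z; exact: lt_le_nbhsr.
Unshelve. all: by end_near. Qed.

Variable c : R -> R.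
Hypothesis cc : continuous c.

Lemma prim_affine p q z : is_derive z 1 (fun l => - prim c (p - l * q)) (q * c (p - z * q)).
Proof.
have d1 := prim_derive (p - z * q) cc.
have d2 : is_derive z 1 (fun l => p - l * q) (- q).
  have dq : is_derive z 1 (fun l : R => q * l) q.
    by apply: is_derive_eq; rewrite /GRing.scale/= mulr1.
  rewrite (_ : (fun l => p - l * q) = (fun l => p - q * l)); last first.
    by apply/funext => l; rewrite mulrC.
  have := is_deriveB (is_derive_cst p z 1) dq; rewrite sub0r; exact.
have d3 := @is_derive1_comp R (prim c) (fun l => p - l * q) z _ _ d1 d2.
have d4 := is_deriveN d3.
by apply: (is_derive_eq d4); ring.
Qed.

Lemma comp_affine_cont p q : continuous (fun l => c (p - l * q)).
Proof.
move=> z; apply: continuous_comp; last exact: cc.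
apply: cvgB; first exact: cvg_cst.
by apply: cvgM; [exact: cvg_id|exact: cvg_cst].
Qed.

Lemma prim_level p a b : a <= b ->
  \int[mu]_(l in `]a, b]) c (p - l) = prim c (p - a) - prim c (p - b).
Proof.
move=> ab; have cc' : continuous (fun l => c (p - l)).
  by have := @comp_affine_cont p 1; under eq_fun do rewrite mulr1.
rewrite Rintegral_itv_obnd_cbnd; last first.
  by apply: integrableS (integrable_continuous a b cc') => //; apply: subset_itvr; rewrite bnd_simp.
have dk z : is_derive z 1 (fun l => - prim c (p - l)) (c (p - z)).
  have := @prim_affine p 1 z; rewrite mul1r mulr1.
  by under eq_fun do rewrite mulr1.
by rewrite (derive_segment dk cc' ab) opprK addrC.
Qed.

(** The average of [c] along a push of size [q] from [p] downwards. It makes sense for [q = 0],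
    where it is [c p], so jumps and continuous pushes can share one formula. *)
Definition cbar p q := \int[mu]_(l in `[0, 1]) c (p - l * q).

Lemma cbarE p q : q * cbar p q = prim c p - prim c (p - q).
Proof.
rewrite /cbar -RintegralZl//; last exact: (integrable_continuous _ _ (@comp_affine_cont p q)).
have ck : continuous (fun l => q * c (p - l * q)).
  by move=> z; apply: cvgM; [exact: cvg_cst|exact: (@comp_affine_cont p q z)].
by rewrite (derive_segment (prim_affine p q) ck ler01) mul1r mul0r subr0 opprK addrC.
Qed.

Lemma cbar0 p : cbar p 0 = c p.
Proof.
rewrite /cbar; under eq_Rintegral do rewrite mulr0 subr0.
exact: Rint_cst01.
Qed.

Lemma cbar_bound p q M : 0 <= M -> (forall l, 0 <= l <= 1 -> `|c (p - l * q)| <= M) ->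
  `|cbar p q| <= M.
Proof.
move=> M0 cM; have ic := integrable_continuous 0 1 (@comp_affine_cont p q).
apply: (le_trans (le_normr_Rintegral _ ic)) => //.
apply: (@le_trans _ _ (\int[mu]_(l in `[0, 1]) (cst M l))); last first.
  by rewrite (Rint_cst01 M).
apply: le_Rintegral => //.
- exact: (integrable_norm ic).
- exact: (integrable_continuous 0 1 (fun=> cvg_cst M)).
Qed.

Lemma cbar_cvg (p_ q_ : nat -> R) p q : p_ n @[n --> \oo] --> p -> q_ n @[n --> \oo] --> q ->
  cbar (p_ n) (q_ n) @[n --> \oo] --> cbar p q.
Proof.
move=> capped_sup cq.
have [B1 B10 B1P] : exists2 B, 0 <= B & forall n, `|p_ n| <= B.
  have := cvg_seq_bounded (cvgP _ capped_sup); move=> [B [_ hB]].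
  exists `|B + 1| => // n; apply: le_trans (ler_norm _).
  by apply: hB => //; rewrite ltrDl.
have [B2 B20 B2P] : exists2 B, 0 <= B & forall n, `|q_ n| <= B.
  have := cvg_seq_bounded (cvgP _ cq); move=> [B [_ hB]].
  exists `|B + 1| => // n; apply: le_trans (ler_norm _).
  by apply: hB => //; rewrite ltrDl.
have [M M0 MP] := continuous_bounded (B1 + B2) cc.
have mc (p' q' : R) : measurable_fun ([set` `[0, 1]] : set R) (fun l => c (p' - l * q')).
  by apply: measurable_funTS; apply: continuous_measurable_fun; exact: comp_affine_cont.
have [] := @Rint_cvg R `[0, 1] (fun n l => c (p_ n - l * q_ n)) (fun l => c (p - l * q)) set0 M => //.
- by rewrite lebesgue_measure_itv/= lte_fin ltr01 -EFinB ltry.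
- move=> l _ _.
  have cl : p_ n - l * q_ n @[n --> \oo] --> p - l * q.
    by apply: cvgB => //; apply: cvgM => //; exact: cvg_cst.
  exact: cvg_cont.
- move=> n l /=; rewrite in_itv/= => /andP[l0 l1]; apply: MP.
  apply: (le_trans (ler_normB _ _)); apply: lerD; first exact: B1P.
  rewrite normrM (ger0_norm l0); apply: le_trans (B2P n).
  by rewrite ler_piMl.
Qed.

End primitive.

(** * Left limits and paths of controls *)

Section left_limits.
Context {R : realType}.
Implicit Types (g : R -> R) (s t e l : R).

(** Going through [from0] gives the value 0 at time 0, so that [g 0 - lm g 0] is the initial
    jump. *)
Definition lm g t := left_lim (from0 g) t.

Lemma from0E g t : 0 <= t -> from0 g t = g t.
Proof. by rewrite /from0 => ->. Qed.

Lemma from0_cvg g t l : 0 < t -> g @ t^'- --> l -> from0 g @ t^'- --> l.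
Proof.
move=> t0; apply: cvg_trans; apply: near_eq_cvg; near=> s.
by rewrite from0E//; near: s; exact: nbhs_left_ge.
Unshelve. all: by end_near. Qed.

Lemma cadlag_lm g t : cadlag g -> 0 < t -> g @ t^'- --> lm g t.
Proof.
move=> [_ gl] t0; have /= cg := gl t t0.
by rewrite /lm /left_lim (cvg_lim _ (from0_cvg t0 cg)).
Qed.

Lemma lmE g t l : 0 < t -> g @ t^'- --> l -> lm g t = l.
Proof. by move=> t0 gl; apply: cvg_lim => //; exact: from0_cvg. Qed.

Lemma left_le g t l M : g @ t^'- --> l -> (\forall s \near t^'-, g s <= M) -> l <= M.
Proof.
move=> gl h; rewrite leNgt; apply/negP => Ml.
have [r r0 rP] := ll_near gl (e := l - M) ltac:(by rewrite subr_gt0).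
have : \forall s \near t^'-, False.
  near=> s; have : g s <= M by near: s.
  have : `|g s - l| < l - M.
    apply: rP; first by near: s; exact: nbhs_left_lt.
    by near: s; apply: nbhs_left_gt; rewrite ltrBlDr ltrDl.
  by rewrite ltr_norml => /andP[]; lra.
by case/filter_ex.
Unshelve. all: by end_near. Qed.

Lemma left_ge g t l M : g @ t^'- --> l -> (\forall s \near t^'-, M <= g s) -> M <= l.
Proof.
move=> gl h; rewrite -lerN2; apply: (@left_le (fun s => - g s) t); first exact: cvgN.
by apply: filterS h => s; rewrite lerN2.
Qed.

Lemma lm0 g : lm g 0 = 0.
Proof.
apply: cvg_lim => //; apply: cvg_near_cst; near=> s.
have : s < 0 by near: s; exact: nbhs_left_lt.
by rewrite /from0 ltNge => /negbTE ->.
Unshelve. all: by end_near. Qed.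

Lemma lm_seq g t (v : nat -> R) : cadlag g -> 0 < t ->
  (\forall n \near \oo, v n < t) -> v n @[n --> \oo] --> t ->
  g (v n) @[n --> \oo] --> lm g t.
Proof. by move=> cg t0; apply: ll_seq; exact: cadlag_lm. Qed.

Record control_path g : Prop := {
  nd_ge0 : forall t, 0 <= t -> 0 <= g t ;
  nd_le : forall s t, 0 <= s -> s <= t -> g s <= g t ;
  nd_rc : forall t, 0 <= t -> g @ t^'+ --> g t }.

Lemma control_path_cadlag g : control_path g -> cadlag g.
Proof.
move=> [g0 gle grc]; split => // t t0.
apply: nondecreasing_at_left_is_cvgr.
  near=> s => y z; rewrite !in_itv/= => /andP[sy _] _ yz.
  have s0 : 0 <= s by near: s; exact: nbhs_left_ge.
  by apply: gle => //; rewrite (le_trans s0)// ltW.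
near=> s; have s0 : 0 <= s by near: s; exact: nbhs_left_ge.
exists (g t) => r [y]; rewrite /= in_itv/= => /andP[sy yt] <-.
by apply: gle; [rewrite (le_trans s0)// ltW|exact: ltW].
Unshelve. all: by end_near. Qed.

Lemma lm_le g s t : control_path g -> 0 <= s -> s < t -> g s <= lm g t.
Proof.
move=> ng s0 st; have t0 := le_lt_trans s0 st.
apply: (left_ge (cadlag_lm (control_path_cadlag ng) t0)).
near=> r; apply: (nd_le ng) => //; apply: ltW; near: r; exact: nbhs_left_gt.
Unshelve. all: by end_near. Qed.

Lemma lm_le_self g t : control_path g -> 0 <= t -> lm g t <= g t.
Proof.
move=> ng; rewrite le_eqVlt => /predU1P[<-|t0]; first by rewrite lm0 (nd_ge0 ng).
apply: (left_le (cadlag_lm (control_path_cadlag ng) t0)).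
near=> r; apply: (nd_le ng).
  by near: r; exact: nbhs_left_ge.
by apply: ltW; near: r; exact: nbhs_left_lt.
Unshelve. all: by end_near. Qed.

Lemma lm_ge0 g t : control_path g -> 0 <= t -> 0 <= lm g t.
Proof.
move=> ng; rewrite le_eqVlt => /predU1P[<-|t0]; first by rewrite lm0.
exact: le_trans (nd_ge0 ng (lexx 0)) (lm_le ng (lexx 0) t0).
Qed.

Lemma lm_lt_ex g t l : control_path g -> 0 < t -> l < lm g t -> exists s, [/\ 0 <= s, s < t & l < g s].
Proof.
move=> ng t0 lt; have [r r0 rP] : exists2 r, 0 < r & forall s, s < t -> t - r < s -> `|g s - lm g t| < lm g t - l.
  by apply: ll_near; [exact/cadlag_lm/t0/control_path_cadlag|rewrite subr_gt0].
pose s := Num.max 0 (t - r / 2); exists s.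
have st : s < t by rewrite gt_max t0/=; lra.
split => //; first by rewrite le_max lexx.
have /rP : t - r < s by rewrite lt_max; apply/orP; right; lra.
by rewrite ltr_norml => /(_ st)/andP[]; lra.
Qed.

End left_limits.

(** * Passage times of levels *)

Section levels.
Context {R : realType}.
Local Notation mu := (@lebesgue_measure R).
Implicit Types (s t e l : R).
Variables (eta : R -> R).
Hypothesis ne : control_path eta.

(** A level that is never reached gets the value 0, the infimum of the empty set; hence the
    restriction to attained levels further on. *)
Definition passage l := inf [set t | 0 <= t /\ l <= eta t].

Lemma passage_ge0 l : 0 <= passage l.
Proof.
have [E0|/set0P ne0] := eqVneq [set t | 0 <= t /\ l <= eta t] set0.
  by rewrite /passage E0 inf0.
by apply: lb_le_inf => // t [].
Qed.

Lemma passage_le l t : 0 <= t -> l <= eta t -> passage l <= t.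
Proof. by move=> t0 lt; apply: ge_inf; [exists 0 => s []|split]. Qed.

(** The infimum is attained: were the path below [l] at its passage time, right-continuity would
    keep it below for a while longer. *)
Lemma passage_at l t : 0 <= t -> l <= eta t -> l <= eta (passage l).
Proof.
move=> t0 lt; have T0 := passage_ge0 l.
rewrite leNgt; apply/negP => lT.
have [r r0 rP] := rc_near (nd_rc ne T0) (e := l - eta (passage l)) ltac:(by rewrite subr_gt0).
suff : passage l + r <= passage l by lra.
apply: lb_le_inf; first by exists t.
move=> s [s0 ls]; have Ts := passage_le s0 ls; rewrite leNgt; apply/negP => sr.
by have := rP s Ts sr; rewrite ltr_norml => /andP[]; lra.
Qed.

Lemma passage_leP l t : 0 <= t -> (exists2 s, 0 <= s & l <= eta s) -> (passage l <= t) = (l <= eta t).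
Proof.
move=> t0 [s s0 ls]; apply/idP/idP => [Tt|]; last exact: passage_le.
exact: le_trans (passage_at s0 ls) (nd_le ne (passage_ge0 l) Tt).
Qed.

Lemma lt_passage l t : 0 <= t -> t < passage l -> eta t < l.
Proof. by move=> t0; rewrite !ltNge; apply: contra; exact: passage_le. Qed.

Lemma lm_passage l t : 0 < l -> 0 <= t -> l <= eta t -> lm eta (passage l) <= l.
Proof.
move=> l0 t0 lt; have := passage_ge0 l; rewrite le_eqVlt => /predU1P[<-|T0]; first by rewrite lm0 ltW.
rewrite leNgt; apply/negP => /(lm_lt_ex ne T0)[s [s0 sT ls]].
by have := lt_passage s0 sT; rewrite ltNge ltW.
Qed.

End levels.

Section grid_limits.
Context {R : realType}.
Local Notation mu := (@lebesgue_measure R).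
Implicit Types (s t e l : R).

Lemma kh_ge0 (n k : nat) : 0 <= k%:R * dyadic n :> R.
Proof. by rewrite mulr_ge0// dyadic_ge0. Qed.

Lemma kh_le (n j k : nat) : (j <= k)%N -> j%:R * dyadic n <= k%:R * dyadic n :> R.
Proof. by move=> jk; rewrite ler_wpM2r ?dyadic_ge0// ler_nat. Qed.

Lemma khm n m : (m * 2 ^ n)%:R * dyadic n = m%:R :> R.
Proof. by rewrite natrM -mulrA hhM mulr1. Qed.

Lemma kh_m n m k : (k <= m * 2 ^ n)%N -> k%:R * dyadic n <= m%:R :> R.
Proof. by move=> km; rewrite -(khm n m); exact: kh_le. Qed.

Lemma ck_m n m t : 0 <= t -> t <= m%:R -> (ck n t <= m * 2 ^ n)%N.
Proof. by move=> t0 tm; rewrite ck_le// khm. Qed.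

(* [ck n t] is the index of the first grid point at or after [t], so its
   predecessor is the last grid point strictly before [t]. *)
Lemma ckP n t : 0 < t -> [/\ (0 < ck n t)%N, (ck n t).-1%:R * dyadic n < t & t <= (ck n t)%:R * dyadic n].
Proof.
move=> t0; have t0' := ltW t0.
have c0 : (0 < ck n t)%N by rewrite ck_gt// mul0r.
by split => //; [rewrite -ck_gt// prednK|rewrite -ck_le].
Qed.

Lemma ck0 n : ck n (0 : R) = 0%N.
Proof. by apply/eqP; rewrite -leqn0 ck_le// mul0r. Qed.

Lemma ck_pred_cvg t : 0 < t -> (ck n t).-1%:R * dyadic n @[n --> \oo] --> t.
Proof.
move=> t0; have -> : (fun n => (ck n t).-1%:R * dyadic n) = (fun n => cT n t - dyadic n).
  by apply/funext => n; have [c0 _ _] := ckP n t0; rewrite /cT -{2}(prednK c0) -natr1 mulrDl mul1r addrK.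
by rewrite -[X in _ --> X]subr0; apply: cvgB; [exact/cT_cvg/ltW|exact: dyadic_cvg0].
Qed.

(** Riemann sums are level sums for the control [t], whose levels are the times themselves. *)
Lemma time_cvg (H : nat -> nat -> R) (m : nat) M (g : R -> R) : 0 <= M ->
  (forall n k, (k < m * 2 ^ n)%N -> `|H n k| <= M) ->
  (forall s, 0 < s -> s <= m%:R -> H n (ck n s).-1 @[n --> \oo] --> g s) ->
  mu.-integrable `]0, m%:R] (EFin \o g) /\
  \sum_(k < m * 2 ^ n) dyadic n * H n k @[n --> \oo] --> \int[mu]_(s in `]0, m%:R]) g s.
Proof.
move=> M0 HM Hg.
have [] := @level_cvg R (fun n k => k%:R * dyadic n)
  (* An interval between grid times carries the value at its left end, hence the shift by one; index
     0 belongs to an empty interval. *)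
  (fun n k _ => if (k <= m * 2 ^ n)%N then (if k is k'.+1 then H n k' else 0) else 0)
  (fun n => m * 2 ^ n)%N g set0 M m%:R M0.
- by move=> n j k; exact: kh_le.
- exact: kh_ge0.
- by move=> n k km; apply: (le_trans (kh_le n km)); rewrite khm.
- by move=> n k; exact: measurable_cst.
- move=> n [|k] l km _ _; first by rewrite km normr0.
  by rewrite km HM.
- exact: countable0.
- move=> s s0 sm _; exists (fun n => ck n s).
    near=> n; have [c0 c1 c2] := ckP n s0; split; first exact: (ck_m n (ltW s0) sm).
    by move: c0 c1 c2; case: (ck n s) => //= k _ -> ->.
  apply: cvg_trans (Hg s s0 sm); apply: near_eq_cvg; near=> n.
  have [c0 _ _] := ckP n s0; rewrite (ck_m n (ltW s0) sm).
  by case: (ck n s) c0.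
move=> ig; set S1 := (X in X n @[n --> _] --> _ -> _) => c1; split => //.
apply: cvg_trans c1; apply: near_eq_cvg; near=> n.
rewrite /S1 big_ord_recl /= set_itv_ge ?bnd_simp ?mul0r ?ltxx// Rintegral_set0 add0r.
apply: eq_bigr => -[k km] _ /=.
rewrite /bump leq0n add1n km Rintegral_cst//= lebesgue_measure_itv/= lte_fin.
rewrite ltr_pM2r ?dyadic_gt0// ltr_nat ltnSn /= mulrC; congr (_ * _).
by rewrite -mulrBl -natr1 addrC addKr mul1r.
Unshelve. all: by end_near. Qed.

End grid_limits.

Section path_limits.
Context {R : realType}.
Local Notation mu := (@lebesgue_measure R).
Implicit Types (s t e l : R).
Variables (delta x : R) (f c : R -> R) (xi eta : R -> R) (m : nat).
Hypothesis delta0 : 0 <= delta.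
Hypothesis cf : continuous f.
Hypothesis cc : continuous c.
Hypothesis cxi : cadlag xi.
Hypothesis ne : control_path eta.

Definition discount s : R := expR (- delta * s).

Lemma discount_le1 s : 0 <= s -> discount s <= 1.
Proof. by move=> s0; rewrite /discount -[leRHS]expR0 ler_expR mulNr oppr_le0 mulr_ge0. Qed.

Lemma discount_norm s : 0 <= s -> `|discount s| <= 1.
Proof. by move=> s0; rewrite ger0_norm ?expR_ge0// discount_le1. Qed.

Lemma discount_cvg (v : nat -> R) s : v n @[n --> \oo] --> s -> discount (v n) @[n --> \oo] --> discount s.
Proof.
by move=> vs; apply: cvg_expR; apply: cvgM => //; exact: cvg_cst.
Qed.

Lemma pos_bounded (k : R -> R) : continuous k -> exists2 M, 0 <= M &
  forall s l, 0 <= s -> s <= m%:R -> 0 <= l -> l <= eta m%:R -> `|k (x + xi s - l)| <= M.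
Proof.
move=> ck; have [B B0 BP] := cadlag_bounded m%:R cxi.
have [M M0 MP] := continuous_bounded (`|x| + B + eta m%:R) ck.
exists M => // s l s0 sm l0 le; apply: MP.
apply: (le_trans (ler_normB _ _)); apply: lerD; last by rewrite ger0_norm.
by apply: (le_trans (ler_normD _ _)); rewrite lerD2l BP.
Qed.

Section control_approx.
Variable a : nat -> nat -> R.
Hypothesis a_nd : forall n j k, (j <= k)%N -> a n j <= a n k.
Hypothesis a_ge0 : forall n k, 0 <= a n k.
Hypothesis a_le : forall n k, (k <= m * 2 ^ n)%N -> a n k <= eta (k%:R * dyadic n).
Hypothesis a_lim : forall t t' l, 0 <= t -> t < t' -> l < eta t ->
  \forall n \near \oo, forall k, (k <= m * 2 ^ n)%N -> t' <= k%:R * dyadic n -> l <= a n k.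
Hypothesis a_end : a n (m * 2 ^ n)%N @[n --> \oo] --> eta m%:R.

Lemma a_le_end n k : (k <= m * 2 ^ n)%N -> a n k <= eta m%:R.
Proof.
move=> km; apply: (le_trans (a_le km)).
by apply: (nd_le ne); [exact: kh_ge0|exact: kh_m].
Qed.

(** The approximating control lies below [eta] on the grid and exceeds any [l < eta t] at grid times
    past [t' > t]. Both [eta] read on the grid and grid maxima with supremum [eta] have this
    property. At the last grid time before [s] it squeezes [a] towards the left limit of [eta]. *)
Lemma run_cvg : mu.-integrable `]0, m%:R] (EFin \o (fun s => discount s * f (x + lm xi s - lm eta s))) /\
  \sum_(k < m * 2 ^ n) dyadic n * (discount (k%:R * dyadic n) * f (x + xi (k%:R * dyadic n) - a n k)) @[n --> \oo]
  --> \int[mu]_(s in `]0, m%:R]) (discount s * f (x + lm xi s - lm eta s)).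
Proof.
have [M M0 MP] := pos_bounded cf.
apply: (@time_cvg R (fun n k => discount (k%:R * dyadic n) * f (x + xi (k%:R * dyadic n) - a n k)) m M) => //.
  move=> n k km; rewrite normrM -[leRHS]mul1r; apply: ler_pM => //.
    exact/discount_norm/kh_ge0.
  by apply: MP; [exact: kh_ge0|exact/kh_m/ltnW|exact: a_ge0|exact/a_le_end/ltnW].
move=> s s0 sm.
have tc := ck_pred_cvg s0.
have tl : \forall n \near \oo, (ck n s).-1%:R * dyadic n < s.
  by near=> n; have [] := ckP n s0.
apply: cvgM; first exact: discount_cvg.
apply: cvg_cont => //; apply: cvgB.
  by apply: cvgD; [exact: cvg_cst|exact: lm_seq].
have eta_c := lm_seq (control_path_cadlag ne) s0 tl tc.
apply/cvgrPdist_le => e e0.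
have [t [t0 ts lt]] := lm_lt_ex ne s0 (l := lm eta s - e) ltac:(by rewrite ltrBlDr ltrDl).
pose t' := (t + s) / 2.
have tt' : t < t' by rewrite /t'; lra.
have t's : t' < s by rewrite /t'; lra.
near=> n.
have km : ((ck n s).-1 <= m * 2 ^ n)%N.
  by apply: leq_trans (leq_pred _) _; exact: (ck_m n (ltW s0) sm).
have l1 : lm eta s - e <= a n (ck n s).-1.
  have : t' <= (ck n s).-1%:R * dyadic n.
    by near: n; move/cvgrPdist_le : tc => /(_ (s - t')); rewrite subr_gt0 => /(_ t's);
      apply: filterS => n; rewrite ler_norml => /andP[_]; lra.
  by move: km; near: n; have := a_lim t0 tt' lt; apply: filterS => n + km; exact.
have l2 : a n (ck n s).-1 <= lm eta s.
  by apply: (le_trans (a_le km)); apply: lm_le => //; [exact: kh_ge0|near: n].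
by rewrite ger0_norm ?subr_ge0//; lra.
Unshelve. all: by end_near. Qed.

(** The price of the level [l]: at its passage the control counts as [l] exactly, so that a jump is
    paid along all intermediate positions. *)
Definition lev_pos l := discount (passage eta l) * c (x + xi (passage eta l) - l).

(** Each push is an integral of [c] over the levels gained. For a fixed level the approximation
    passes it after [eta] does, and soon after as soon as [eta] rises above [l] immediately;
    right-continuity of [xi] then gives the limit. *)
Lemma ctrl_cvg : mu.-integrable `]0, eta m%:R] (EFin \o lev_pos) /\
  \sum_(k < (m * 2 ^ n).+1) discount (k%:R * dyadic n) *
     (prim c (x + xi (k%:R * dyadic n) - pv (a n) k) - prim c (x + xi (k%:R * dyadic n) - a n k))
  @[n --> \oo] --> \int[mu]_(l in `]0, eta m%:R]) lev_pos l.
Proof.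
have [M M0 MP] := pos_bounded cc.
pose G n k l := if (k <= m * 2 ^ n)%N then discount (k%:R * dyadic n) * c (x + xi (k%:R * dyadic n) - l) else 0.
(* If [eta] stays equal to [l] for some time after the passage, then [l] is the value of [eta] at a
   rational time; the final value is excluded as well. *)
pose N := [set (if o is Some q then eta (ratr q) else eta m%:R) | o in [set: option rat]].
have cN : countable N by exact: sub_countable (card_image_le _ _) (countableP _).
have [] := @level_cvg R a G (fun n => m * 2 ^ n)%N lev_pos N M (eta m%:R) M0 a_nd a_ge0 a_le_end.
- move=> n k; rewrite /G; case: (k <= m * 2 ^ n)%N; last exact: measurable_cst.
  apply: measurable_funM => //; apply: measurableT_comp; first exact: continuous_measurable_fun.
  exact: measurable_funB.
- move=> n k l km l0 le; rewrite /G km normrM -[leRHS]mul1r; apply: ler_pM => //.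
    exact/discount_norm/kh_ge0.
  by apply: MP; [exact: kh_ge0|exact: kh_m|exact: ltW|].
- exact: cN.
- move=> l l0; rewrite le_eqVlt => /predU1P[->|lm]; first by move=> nN; exfalso; apply: nN; exists None.
  move=> nN.
  have m0 : 0 <= m%:R :> R by [].
  pose kap n := find (fun k => l <= a n k) (iota 0 (m * 2 ^ n).+1).
  have hk : \forall n \near \oo, (kap n <= m * 2 ^ n)%N /\ pv (a n) (kap n) < l <= a n (kap n).
    near=> n.
    have la : l <= a n (m * 2 ^ n)%N.
      near: n; move/cvgrPdist_le : a_end => /(_ (eta m%:R - l)); rewrite subr_gt0 => /(_ lm).
      by apply: filterS => n; rewrite ler_norml => /andP[_]; lra.
    have hs : has (fun k => l <= a n k) (iota 0 (m * 2 ^ n).+1).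
      by apply/hasP; exists (m * 2 ^ n)%N => //; rewrite mem_iota/= add0n ltnS.
    have km : (kap n < (m * 2 ^ n).+1)%N by move: hs; rewrite has_find size_iota.
    have := nth_find 0%N hs; rewrite -/(kap n) nth_iota// add0n => ->; split => //.
    rewrite andbT; case E : (kap n) => [|j] //=.
    have jk : (j < kap n)%N by rewrite E.
    have := before_find 0%N jk; rewrite nth_iota ?add0n; last exact: ltn_trans jk km.
    by move/negbT; rewrite -ltNge.
  exists kap => //.
  have kT : \forall n \near \oo, passage eta l <= (kap n)%:R * dyadic n.
    near=> n; have [|km /andP[_ la]] := near hk n; first by [].
    by apply: passage_le; [exact: kh_ge0|exact: le_trans la (a_le km)].
  have kc : (kap n)%:R * dyadic n @[n --> \oo] --> passage eta l.
    apply/cvgrPdist_le => e e0.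
    have T0 := passage_ge0 eta l.
    have [q] := @rat_in_itvoo R (passage eta l) (passage eta l + e / 2) ltac:(by rewrite ltrDl divr_gt0).
    rewrite in_itv/= => /andP[q1 q2].
    pose t' := passage eta l + e / 2.
    have q0 : 0 <= ratr q :> R by rewrite (le_trans T0)// ltW.
    have lq : l < eta (ratr q).
      rewrite lt_neqAle; apply/andP; split.
        by apply/eqP => E; apply: nN; exists (Some q).
      by rewrite -(passage_leP ne q0); [exact: ltW|exists m%:R => //; exact: ltW].
    near=> n.
    have AL : forall k, (k <= m * 2 ^ n)%N -> t' <= k%:R * dyadic n -> l <= a n k.
      by near: n; exact: (a_lim q0 q2 lq).
    have [|km /andP[la1 la2]] := near hk n; first by [].
    have Tk : passage eta l <= (kap n)%:R * dyadic n by near: n.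
    rewrite distrC ger0_norm ?subr_ge0// lerBlDr.
    have h2 : dyadic n <= e / 2.
      near: n; have e2 : 0 < e / 2 by rewrite divr_gt0.
      have /cvgrPdist_le /(_ _ e2) := @dyadic_cvg0 R; apply: filterS => n.
      by rewrite sub0r normrN ger0_norm ?dyadic_ge0.
    rewrite leNgt; apply/negP => big.
    case E : (kap n) => [|j]; first by move: big; rewrite E mul0r; lra.
    have jm : (j <= m * 2 ^ n)%N by rewrite ltnW// -E.
    have : t' <= j%:R * dyadic n by move: big; rewrite E -natr1 /t'; lra.
    move: la1; rewrite E/= ltNge => /negP; apply: contra_not => t'j.
    exact: AL.
  apply: (@cvg_trans _ ((fun n => discount ((kap n)%:R * dyadic n) * c (x + xi ((kap n)%:R * dyadic n) - l)) @ \oo)).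
    apply: near_eq_cvg; near=> n.
    by have [|km _] := near hk n; first by []; rewrite /G km.
  apply: cvgM; first exact: discount_cvg.
  apply: cvg_cont => //; apply: cvgB; last exact: cvg_cst.
  apply: cvgD; first exact: cvg_cst.
  by apply: rc_seq => //; apply: (proj1 cxi); exact: passage_ge0.
move=> ig c1; split => //; apply: cvg_trans c1; apply: near_eq_cvg; near=> n.
apply: eq_bigr => -[k km] _ /=; rewrite ltnS in km.
rewrite /G km RintegralZl//; last first.
  apply: integrableS (integrable_continuous (pv (a n) k) (a n k) _) => //.
    by apply: subset_itvr; rewrite bnd_simp.
  by have := @comp_affine_cont R c cc (x + xi (k%:R * dyadic n)) 1; under eq_fun do rewrite mulr1.
rewrite prim_level//; case: k {km} => [|k] /=; first exact: a_ge0.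
exact: a_nd.
Unshelve. all: by end_near. Qed.

End control_approx.

(** The cost per unit of control spent at time [s], whether or not [eta] jumps there. *)
Definition average_cost s := cbar c (x + xi s - lm eta s) (eta s - lm eta s).

Section average.
Variable phi : R -> R.
Hypothesis cphi : continuous phi.

(** A level [l] is charged at the first grid time after its passage, with the average over the whole
    grid step. The two ends of the step converge to the left limit and to the value of [eta] at the
    passage. The function [phi] will be the identity, the absolute value, or the positive or
    negative part. *)
Lemma average_cvg :
  mu.-integrable `]0, eta m%:R] (EFin \o (fun l => discount (passage eta l) * phi (average_cost (passage eta l)))) /\
  \sum_(k < (m * 2 ^ n).+1) discount (k%:R * dyadic n) * ((eta (k%:R * dyadic n) - pv (fun k => eta (k%:R * dyadic n)) k) *
     phi (cbar c (x + xi (k%:R * dyadic n) - pv (fun k => eta (k%:R * dyadic n)) k)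
                 (eta (k%:R * dyadic n) - pv (fun k => eta (k%:R * dyadic n)) k)))
  @[n --> \oo] --> \int[mu]_(l in `]0, eta m%:R]) (discount (passage eta l) * phi (average_cost (passage eta l))).
Proof.
pose a (n k : nat) := eta (k%:R * dyadic n).
have a_nd n j k : (j <= k)%N -> a n j <= a n k.
  by move=> jk; apply: (nd_le ne); [exact: kh_ge0|exact: kh_le].
have a_ge0 n k : 0 <= a n k by apply: (nd_ge0 ne); exact: kh_ge0.
have a_le n k : (k <= m * 2 ^ n)%N -> a n k <= eta m%:R.
  by move=> km; apply: (nd_le ne); [exact: kh_ge0|exact: kh_m].
have pv0 n k : 0 <= pv (a n) k by case: k => [|k] /=.
have pva n k : pv (a n) k <= a n k by case: k => [|k] //=; exact: a_nd.
have [M M0 MP] := pos_bounded cc.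
have [M' M'0 M'P] := continuous_bounded M cphi.
pose g n k := cbar c (x + xi (k%:R * dyadic n) - pv (a n) k) (a n k - pv (a n) k).
pose G n k (l : R) := if (k <= m * 2 ^ n)%N then discount (k%:R * dyadic n) * phi (g n k) else 0.
have gM n k : (k <= m * 2 ^ n)%N -> `|g n k| <= M.
  move=> km; apply: cbar_bound => // l /andP[l0 l1].
  rewrite -addrA -opprD; apply: MP; [exact: kh_ge0|exact: kh_m| |].
    by rewrite addr_ge0// mulr_ge0// subr_ge0.
  apply: le_trans (a_le n k km).
  by rewrite -lerBrDl; apply: ler_piMl => //; rewrite subr_ge0.
have [] := @level_cvg R a G (fun n => m * 2 ^ n)%N (fun l => discount (passage eta l) * phi (average_cost (passage eta l)))
   set0 M' (eta m%:R) M'0 a_nd a_ge0 a_le.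
- by move=> n k; exact: measurable_cst.
- move=> n k l km l0 le; rewrite /G km normrM -[leRHS]mul1r; apply: ler_pM => //.
    exact/discount_norm/kh_ge0.
  exact/M'P/gM.
- exact: countable0.
- move=> l l0 le _.
  have m0 : 0 <= m%:R :> R by [].
  have T0 := passage_ge0 eta l.
  have Tm : passage eta l <= m%:R by exact: passage_le.
  have lT : l <= eta (passage eta l) by exact: (passage_at ne m0 le).
  exists (fun n => ck n (passage eta l)).
    near=> n; split; first exact: ck_m.
    apply/andP; split; last first.
      by apply: (le_trans lT); apply: (nd_le ne) => //; exact: cT_ge.
    have := T0; rewrite le_eqVlt => /predU1P[<-|Tp]; first by rewrite ck0.
    have [c0 c1 _] := ckP n Tp; rewrite -(prednK c0) /= /a.
    by apply: lt_passage => //; exact: kh_ge0.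
  apply: (@cvg_trans _ ((fun n => discount (cT n (passage eta l)) * phi (g n (ck n (passage eta l)))) @ \oo)).
    by apply: near_eq_cvg; near=> n; rewrite /G ck_m.
  have kc := cT_cvg T0.
  have kT : \forall n \near \oo, passage eta l <= cT n (passage eta l) by near=> n; exact: cT_ge.
  apply: cvgM; first exact: discount_cvg.
  have cx : xi (cT n (passage eta l)) @[n --> \oo] --> xi (passage eta l).
    by apply: rc_seq => //; exact: (proj1 cxi).
  have ce : a n (ck n (passage eta l)) @[n --> \oo] --> eta (passage eta l).
    by apply: (rc_seq (nd_rc ne T0) kT kc).
  have capped_sup : pv (a n) (ck n (passage eta l)) @[n --> \oo] --> lm eta (passage eta l).
    have := T0; rewrite le_eqVlt => /predU1P[<-|Tp].
      by rewrite lm0; under eq_fun do rewrite ck0; exact: cvg_cst.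
    have tl : \forall n \near \oo, (ck n (passage eta l)).-1%:R * dyadic n < passage eta l.
      by near=> n; have [] := ckP n Tp.
    apply: cvg_trans (lm_seq (control_path_cadlag ne) Tp tl (ck_pred_cvg Tp)).
    apply: near_eq_cvg; near=> n; have [c0 _ _] := ckP n Tp.
    by rewrite -{2}(prednK c0).
  apply: cvg_cont => //; apply: cbar_cvg => //; last exact: cvgB.
  by apply: cvgB => //; apply: cvgD => //; exact: cvg_cst.
move=> ig c1; split => //; apply: cvg_trans c1; apply: near_eq_cvg; near=> n.
apply: eq_bigr => k _; have km : (k <= m * 2 ^ n)%N by rewrite -ltnS.
rewrite /G km Rintegral_cst// -mulrA; congr (_ * _).
rewrite mulrC; congr (_ * _).
exact: fine_mu_oc.
Unshelve. all: by end_near. Qed.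

End average.

(* Both sides are limits of the same sums over the grids. *)
Lemma lev_pos_average : \int[mu]_(l in `]0, eta m%:R]) lev_pos l =
  \int[mu]_(l in `]0, eta m%:R]) (discount (passage eta l) * average_cost (passage eta l)).
Proof.
have m0 : 0 <= m%:R :> R by [].
have [_ c1] := @average_cvg id (fun=> cvg_id).
pose a (n k : nat) := eta (k%:R * dyadic n).
have [|||||_ c2] := @ctrl_cvg a.
- by move=> n j k jk; apply: (nd_le ne); [exact: kh_ge0|exact: kh_le].
- by move=> n k; apply: (nd_ge0 ne); exact: kh_ge0.
- by [].
- move=> t t' l t0 tt' lt; near=> n => k km t'k; apply: (le_trans (ltW lt)).
  by apply: (nd_le ne) => //; apply: le_trans t'k; exact: ltW.
- by rewrite /a; under eq_fun do rewrite khm; exact: cvg_cst.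
apply: (@cvg_unique _ (@Rhausdorff R) _ _ _ _ c2).
apply: cvg_trans c1; apply: near_eq_cvg; near=> n.
apply: eq_bigr => k _; rewrite cbarE//; congr (_ * (_ - prim c _)).
by rewrite /a; ring.
Unshelve. all: by end_near. Qed.

End path_limits.

(** * Costs as integrals over levels *)

Section restricted_integral.
Context {R : realType} {d : measure_display} {T : measurableType d}.
Variable m : {measure set T -> \bar R}.

Lemma integral_mrestr (B D : set T) (mB : measurable B) (f : T -> \bar R) :
  measurable D -> measurable_fun D f -> (forall t, D t -> 0 <= f t)%E ->
  (\int[mrestr m mB]_(t in D) f t = \int[m]_(t in D `&` B) f t)%E.
Proof.
move=> mD mf f0.
have mDB : measurable (D `&` B) by exact: measurableI.
have mDB' : measurable (D `\` B) by exact: measurableD.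
have DE : D = (D `&` B) `|` (D `\` B) by rewrite setUIDK.
rewrite {1}DE ge0_integral_setU//=.
- rewrite [X in (_ + X)%E]null_set_integral ?adde0//.
  + apply: eq_measure_integral => A mA AD.
    by change (m (A `&` B) = m A); rewrite setIidl// => t /AD [].
  + exact: measurable_funS mD (@subDsetl _ _ _) mf.
  + change (m ((D `\` B) `&` B) = 0%E).
    by rewrite setDE -setIA setICl setI0 measure0.
- by rewrite -DE.
- by move=> t [[] Dt _|[] Dt _]; exact: f0.
- by apply/disj_setPS => t [[_ ?] []].
Qed.

End restricted_integral.

Section esum_extra.
Context {R : realType} {I : choiceType}.

Lemma esum_off (A J : set I) (a : I -> \bar R) : (forall i, A i -> ~ J i -> a i = 0%E) ->
  (\esum_(i in A) a i = \esum_(i in A `&` J) a i)%E.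
Proof.
move=> a0; rewrite esum_mkcond [RHS]esum_mkcond; apply: eq_esum => i _.
case: ifPn => [|/negP]; rewrite inE => Ai.
  by case: ifPn => //; rewrite notin_setE => nAJ; apply: a0 => // Ji; apply: nAJ.
by case: ifPn => //; rewrite inE => -[].
Qed.

End esum_extra.

Section countable_fibers.
Context {R : realType}.
Local Notation mu := (@lebesgue_measure R).

Lemma le_mu (A B : set R) : measurable A -> measurable B -> A `<=` B -> (mu A <= mu B)%E.
Proof. by move=> mA mB AB; apply: le_measure => //; rewrite inE. Qed.

(** An injection of [J] into the integers splits the domain into fibres of [T], on each of which the
    integrand is constant. *)
Lemma countable_fiber (B J : set R) (T : R -> R) (h : R -> R) :
  measurable B -> countable J -> (forall A : set R, measurable A -> measurable (T @^-1` A)) ->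
  (forall s, J s -> 0 <= h s) -> measurable_fun (B `&` T @^-1` J) (fun l => h (T l)) ->
  (\int[mu]_(l in B `&` T @^-1` J) (h (T l))%:E =
   \esum_(s in J) ((h s)%:E * mu (B `&` T @^-1` [set s])))%E.
Proof.
move=> mB cJ mT h0 mh.
have [e einj] := countable_injP _ cJ.
pose Jn n := J `&` e @^-1` [set n].
have Jsub n s t : Jn n s -> Jn n t -> s = t.
  by move=> [Js es] [Jt et]; apply: einj; rewrite ?inE// es et.
have mJ (A : set R) : A `<=` J -> measurable A.
  by move=> AJ; apply: countable_measurable => //; exact: sub_countable (subset_card_le AJ) cJ.
have JE : J = \bigcup_n Jn n.
  by apply/seteqP; split => [s Js|s [n _ []]//]; exists (e s).
have mE n : measurable (B `&` T @^-1` (Jn n)).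
  by apply: measurableI => //; apply: mT; apply: mJ => s [].
have BE : B `&` T @^-1` J = \bigcup_n (B `&` T @^-1` (Jn n)).
  by rewrite -setI_bigcupr -preimage_bigcup -JE.
have tJ : trivIset setT Jn.
  by apply/trivIsetP => i j _ _ ij; apply/seteqP; split => // s [[_ si] [_ sj]]; move: ij; rewrite -si -sj eqxx.
rewrite {1}BE ge0_integral_bigcup//; last 3 first.
- by rewrite -BE; apply/measurable_EFinP.
- by move=> l [n _ [_ [Jl _]]]; rewrite lee_fin h0.
- apply/trivIsetP => i j _ _ ij; apply/seteqP; split => // l [[_ [_ si]] [_ [_ sj]]].
  by move: ij; rewrite -si -sj eqxx.
rewrite nneseries_esumT; last first.
  by move=> n; apply: integral_ge0 => l [_ [Jl _]]; rewrite lee_fin h0.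
rewrite JE esum_bigcup//; last 2 first.
- exact: sub_trivIset tJ.
- by move=> s [n _ [Js _]]; rewrite mule_ge0// lee_fin h0.
apply: eq_esum => n _.
have [->|/set0P[s Js]] := eqVneq (Jn n) set0.
  by rewrite preimage_set0 setI0 integral_set0 esum_set0.
have -> : Jn n = [set s].
  by apply/seteqP; split => [t Jt|t ->//]; exact: Jsub Jt Js.
rewrite esum_set1; last by rewrite mule_ge0// lee_fin h0//; case: Js.
rewrite -integral_cst//; last by apply: measurableI => //; exact: mT.
by apply: eq_integral => l; rewrite inE => -[_ ->].
Qed.

End countable_fibers.

Section jump_times.
Context {R : realType}.

(** A jump is coded by its direction, a rational height strictly between left limit and value, and a
    rational time from which the path stays on the near side of that height until the jump. Such a
    code determines the jump time. *)
Lemma cadlag_jumps_countable (g : R -> R) : cadlag g ->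
  countable [set s | 0 < s /\ lm g s <> g s].
Proof.
move=> cg.
pose G (b : bool) t := if b then g t else - g t.
pose A (i : bool * rat * rat) := [set s | [/\ 0 < s, ratr i.2 < s,
  (forall t, ratr i.2 < t -> t < s -> G i.1.1 t < ratr i.1.2) & ratr i.1.2 < G i.1.1 s]].
have cA i : countable (A i).
  suff [->|[s ->]] : A i = set0 \/ exists s, A i = [set s]; [exact: countable0|exact: countable1|].
  have [->|/set0P[s As]] := eqVneq (A i) set0; [by left|right].
  exists s; apply/seteqP; split => [t At|t ->//].
  have [[s0 is_ s1 s2] [t0 it t1 t2]] := (As, At).
  have [ts|st|//] := ltgtP t s.
    by have := lt_trans (s1 t it ts) t2; rewrite ltxx.
  by have := lt_trans (t1 s is_ st) s2; rewrite ltxx.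
apply: (@sub_countable _ _ _ (\bigcup_i A i)); last first.
  by apply: bigcup_countable => //; exact: countableP.
apply: subset_card_le => s [s0 gs].
have key (b : bool) : G b @ s^'- --> (if b then lm g s else - lm g s) ->
  (if b then lm g s else - lm g s) < G b s -> exists i, A i s.
  move=> Gc /rat_in_itvoo[p]; rewrite in_itv/= => /andP[p1 p2].
  have [r r0 rP] := ll_near Gc (e := ratr p - (if b then lm g s else - lm g s)) ltac:(by rewrite subr_gt0).
  have [q] := @rat_in_itvoo R (s - r) s ltac:(by rewrite ltrBlDr ltrDl).
  rewrite in_itv/= => /andP[q1 q2].
  exists (b, p, q); split => //= t qt ts.
  by have := rP t ts (lt_trans q1 qt); rewrite ltr_norml => /andP[_]; rewrite ltrD2r.
have [lt|gt|//] := ltgtP (lm g s) (g s).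
  by have [i Ai] := key true (cadlag_lm cg s0) lt; exists i.
have [i Ai] := key false (cvgN (cadlag_lm cg s0)) ltac:(by rewrite /= ltrN2); by exists i.
Qed.

End jump_times.

Section decomposition.
Context {R : realType}.
Local Notation mu := (@lebesgue_measure R).
Implicit Types (s t e l : R).
Variables (eta : R -> R) (J : set R).
Hypothesis ne : control_path eta.
Hypothesis cJ : countable J.
Hypothesis J0 : J 0.
Hypothesis J_ge0 : forall s, J s -> 0 <= s.
Hypothesis nJ : forall s, 0 <= s -> ~ J s -> lm eta s = eta s.

Definition attained := [set l | 0 < l /\ exists2 t, 0 <= t & l <= eta t].

Lemma attained_bigcup : attained = \bigcup_n [set` `]0, eta n%:R]].
Proof.
apply/seteqP; split => [l [l0 [t t0 lt]]|l [n _ /=]]; last first.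
  by rewrite in_itv/= => /andP[l0 ln]; split => //; exists n%:R.
exists (Num.truncn t).+1 => //=; rewrite in_itv/= l0/=; apply: (le_trans lt).
by apply: (nd_le ne) => //; apply/ltW; rewrite truncnS_gt.
Qed.

Lemma attained_meas : measurable attained.
Proof. by rewrite attained_bigcup; apply: bigcup_measurable => n _; exact: measurable_itv. Qed.

Lemma passage_off l : ~ (exists2 t, 0 <= t & l <= eta t) -> passage eta l = 0.
Proof.
move=> nl; rewrite /passage (_ : [set t | _] = set0) ?inf0//.
by apply/seteqP; split => // t [t0 lt]; apply: nl; exists t.
Qed.

(** For [t >= 0], the levels with passage after [t] are those above [eta t] that are reached, since
    unreached levels have passage 0. *)
Lemma passage_meas : measurable_fun setT (passage eta).
Proof.
apply: (measurability _ (RGenOInfty.measurableE R)) => // _ [_ [t ->] <-]; rewrite setTI.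
have [t0|t0] := ltP t 0.
  rewrite (_ : _ @^-1` _ = setT)//; apply/seteqP; split => // l _ /=.
  by rewrite in_itv/= andbT (lt_le_trans t0 (passage_ge0 _ _)).
have -> : passage eta @^-1` `]t, +oo[ = [set` `]eta t, +oo[] `&` \bigcup_n [set` `]-oo, eta n%:R]].
  apply/seteqP; split => l /=; rewrite !in_itv/= !andbT.
    move=> tl; split; first exact: lt_passage.
    have [[s s0 ls]|/passage_off] := pselect (exists2 t, 0 <= t & l <= eta t); last by move: tl => /[swap] ->; rewrite ltNge t0.
    exists (Num.truncn s).+1 => //=; rewrite in_itv/=; apply: (le_trans ls).
    by apply: (nd_le ne) => //; apply/ltW; rewrite truncnS_gt.
  move=> [tl [n _ /=]]; rewrite in_itv/= => ln.
  rewrite ltNge (passage_leP ne t0); first by rewrite -ltNge.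
  by exists n%:R.
apply: measurableI; first exact: measurable_itv.
by apply: bigcup_measurable => n _; exact: measurable_itv.
Qed.

Lemma passage_pre (A : set R) : measurable A -> measurable (passage eta @^-1` A).
Proof. by move=> mA; rewrite -[X in measurable X]setTI; exact: passage_meas. Qed.

Lemma attained_le t : 0 <= t -> attained `&` passage eta @^-1` [set s | s <= t] = [set` `]0, eta t]].
Proof.
move=> t0; apply/seteqP; split => l /=; rewrite in_itv/=.
  by move=> [[-> ex]]; rewrite (passage_leP ne t0).
move=> /andP[l0 lt]; split; last exact: passage_le.
by split => //; exists t.
Qed.

(** The levels passed at time [s] lie between the half-open and the closed interval with end points
    [lm eta s] and [eta s], which have the same length. *)
Lemma attained_fiber s : 0 <= s -> mu (attained `&` passage eta @^-1` [set s]) = (eta s - lm eta s)%:E.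
Proof.
move=> s0.
have mE : measurable (attained `&` passage eta @^-1` [set s]).
  by apply: measurableI; [exact: attained_meas|exact: passage_pre].
have l1 := lm_le_self ne s0; have l2 := lm_ge0 ne s0.
apply/eqP; rewrite eq_le; apply/andP; split.
  have <- : mu [set` `[lm eta s, eta s]] = (eta s - lm eta s)%:E.
    rewrite lebesgue_measure_itv/= lte_fin; case: ifPn => //.
    by rewrite -leNgt => l3; congr EFin; apply/eqP; rewrite eq_sym subr_eq0 eq_le l1 l3.
  apply: le_mu => //.
  move=> l [[l0 [t t0 lt]] /= Ts]; rewrite in_itv/= -{1}Ts (lm_passage ne l0 t0 lt).
  by rewrite -Ts (passage_at ne t0 lt).
have <- : mu [set` `]lm eta s, eta s]] = (eta s - lm eta s)%:E.
  rewrite lebesgue_measure_itv/= lte_fin; case: ifPn => //.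
  by rewrite -leNgt => l3; congr EFin; apply/eqP; rewrite eq_sym subr_eq0 eq_le l1 l3.
apply: le_mu => //.
move=> l /=; rewrite in_itv/= => /andP[ll le]; split.
  by split; [exact: le_lt_trans ll|exists s].
apply/eqP; rewrite eq_le passage_le//= leNgt; apply/negP => lt.
have T0 := passage_ge0 eta l.
have := le_trans (passage_at ne s0 le) (lm_le ne T0 lt).
by rewrite leNgt ll.
Qed.

(** The measure of the continuous part of [eta]: the image under the passage time of Lebesgue
    measure on the levels, without those passed at times of [J]. *)
Definition level_measure (A : set R) := mu (attained `&` passage eta @^-1` (~` J `&` A)).

Lemma J_meas (A : set R) : A `<=` J -> measurable A.
Proof.
by move=> AJ; apply: countable_measurable => //; exact: sub_countable (subset_card_le AJ) cJ.
Qed.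

Lemma jumpE s : jump (from0 eta) s = if 0 <= s then eta s - lm eta s else 0.
Proof.
rewrite /jump -/(lm eta s); have [s0|s0] := leP 0 s; first by rewrite from0E.
rewrite /from0 leNgt s0 sub0r (_ : lm eta s = 0) ?oppr0//.
apply: cvg_lim => //; apply: cvg_near_cst; near=> t.
have : t < 0 by apply: lt_trans s0; near: t; exact: nbhs_left_lt.
by rewrite /from0 ltNge => /negbTE ->.
Unshelve. all: by end_near. Qed.

Lemma jump_ge0 s : 0 <= jump (from0 eta) s.
Proof. by rewrite jumpE; case: ifPn => // s0; rewrite subr_ge0 lm_le_self. Qed.

(** Jumps happen only at times of the countable set [J], and each has the length of the set of
    levels passed at its time. *)
Lemma esum_jump (A : set R) : measurable A ->
  (\esum_(s in A) (jump (from0 eta) s)%:E = mu (attained `&` passage eta @^-1` (J `&` A)))%E.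
Proof.
move=> mA; rewrite (@esum_off _ _ _ J); last first.
  move=> s _ Js; rewrite jumpE; case: ifPn => // s0; by rewrite nJ// subrr.
have mJA : measurable (J `&` A) by apply: J_meas => s [].
have mE : measurable (attained `&` passage eta @^-1` (J `&` A)).
  by apply: measurableI; [exact: attained_meas|exact: passage_pre].
rewrite setIC -[RHS]mul1e; have /= <- := @integral_cst _ _ R mu _ mE 1%E.
rewrite (countable_fiber (h := fun=> 1) attained_meas) //.
- apply: eq_esum => s [Js _]; rewrite mul1e attained_fiber ?J_ge0// jumpE J_ge0//.
- exact: sub_countable (subset_card_le (@subIsetl _ _ _)) cJ.
- exact: passage_pre.
Qed.

Lemma meas_le t : measurable [set s | s <= t].
Proof.
rewrite (_ : [set s | s <= t] = [set` `]-oo, t]]); first exact: measurable_itv.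
by apply/seteqP; split => s; rewrite /= in_itv.
Qed.

Lemma part_meas (K : set R) : measurable K -> measurable (attained `&` passage eta @^-1` K).
Proof. by move=> mK; apply: measurableI; [exact: attained_meas|exact: passage_pre]. Qed.

Lemma part_fin (K : set R) t : measurable K -> 0 <= t ->
  mu (attained `&` passage eta @^-1` (K `&` [set s | s <= t])) \is a fin_num.
Proof.
move=> mK t0; rewrite ge0_fin_numE; last exact: measure_ge0.
apply: (@le_lt_trans _ _ (mu [set` `]0, eta t]])).
  apply: le_mu; [|exact: measurable_itv|].
    by apply: part_meas; apply: measurableI => //; exact: meas_le.
  by rewrite -attained_le// => l [Ll [_ ?]]; split.
by rewrite lebesgue_measure_itv/=; case: ifP => // _; rewrite -EFinB ltry.
Qed.

Lemma mCJ : measurable (~` J).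
Proof. by apply: measurableC; exact: (@J_meas J). Qed.

Lemma part_neg (K : set R) t : t < 0 -> attained `&` passage eta @^-1` (K `&` [set s | s <= t]) = set0.
Proof.
move=> t0; apply/seteqP; split => // l [_ [_ /= lt]].
by have := lt_le_trans t0 (passage_ge0 eta l); rewrite ltNge lt.
Qed.

Lemma cont_partE t : cont_part (from0 eta) t = fine (level_measure [set s | s <= t]).
Proof.
rewrite /cont_part esum_jump; last exact: meas_le.
have [t0|t0] := leP 0 t; last first.
  by rewrite /from0 leNgt t0 sub0r /level_measure !part_neg// measure0 oppr0.
have mle := meas_le t; have mJ : measurable J by exact: (@J_meas J).
have EU : [set` `]0, eta t]] = (attained `&` passage eta @^-1` (J `&` [set s | s <= t])) `|`
    (attained `&` passage eta @^-1` (~` J `&` [set s | s <= t])).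
  rewrite -attained_le//; apply/seteqP; split => l.
    by move=> [Ll lt]; have [Jl|Jl] := pselect (J (passage eta l)); [left|right].
  by move=> [[Ll [_ ?]]|[Ll [_ ?]]].
have := fine_mu_oc (nd_ge0 ne t0); rewrite subr0 from0E// => <-.
rewrite EU measureU//; last 3 first.
- by apply: part_meas; exact: measurableI.
- by apply: part_meas; apply: measurableI => //; exact: mCJ.
- by apply/seteqP; split => // l [[_ [Jl _]] [_ [nJl _]]].
rewrite -[level_measure _]/(mu (attained `&` passage eta @^-1` (~` J `&` [set s | s <= t]))).
have := fineD (part_fin mJ t0) (part_fin mCJ t0); lra.
Qed.

Lemma cont_part_nd : nondecreasing (cont_part (from0 eta)).
Proof.
move=> s t st; rewrite !cont_partE.
have [t0|t0] := leP 0 t; last first.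
  by rewrite /level_measure !part_neg ?(le_lt_trans st).
have le : (level_measure [set r | (r <= s)%R] <= level_measure [set r | (r <= t)%R])%E.
  apply: le_mu.
  - by apply: part_meas; apply: measurableI; [exact: mCJ|exact: meas_le].
  - by apply: part_meas; apply: measurableI; [exact: mCJ|exact: meas_le].
  by move=> l [Ll [nJl /= ls]]; split => //; split => //=; exact: le_trans st.
have ft : level_measure [set r | r <= t] \is a fin_num by exact: part_fin mCJ t0.
apply: fine_le => //; rewrite ge0_fin_numE; last exact: measure_ge0.
by apply: (le_lt_trans le); rewrite ltey_eq ft.
Qed.

(** The sum of the jumps is non-decreasing, so the continuous part grows no faster than [eta] and
    inherits its right-continuity. *)
Lemma cont_part_incr s t : 0 <= s -> s <= t ->
  cont_part (from0 eta) t - cont_part (from0 eta) s <= eta t - eta s.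
Proof.
move=> s0 st; have t0 := le_trans s0 st.
have mJ : measurable J by exact: (@J_meas J).
rewrite /cont_part !from0E// !esum_jump; [|exact: meas_le..].
suff : fine (mu (attained `&` passage eta @^-1` (J `&` [set r | r <= s]))) <=
       fine (mu (attained `&` passage eta @^-1` (J `&` [set r | r <= t]))) by lra.
apply: fine_le; [exact: part_fin|exact: part_fin|].
apply: le_mu.
- by apply: part_meas; apply: measurableI => //; exact: meas_le.
- by apply: part_meas; apply: measurableI => //; exact: meas_le.
by move=> l [Ll [nJl /= ls]]; split => //; split => //=; exact: le_trans st.
Qed.

Lemma cont_part_rc : right_continuous (cont_part (from0 eta)).
Proof.
move=> t; have [t0|t0] := leP 0 t.
  apply/cvgrPdist_le => e e0; have [r r0 rP] := rc_near (nd_rc ne t0) e0.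
  near=> s.
  have ts : t <= s by near: s; exact: nbhs_right_ge.
  have sr : s < t + r by near: s; apply: nbhs_right_lt; rewrite ltrDl.
  have h1 := cont_part_nd ts; have h2 := cont_part_incr t0 ts.
  have := rP s ts sr; rewrite ger0_norm ?subr_ge0 ?(nd_le ne)// => h3.
  by rewrite distrC ger0_norm ?subr_ge0//; lra.
have cp0 s : s < 0 -> cont_part (from0 eta) s = 0.
  by move=> s0; rewrite cont_partE /level_measure part_neg// measure0.
rewrite (cp0 t)//; apply: cvg_near_cst; near=> s.
by rewrite cp0//; near: s; exact: nbhs_right_lt.
Unshelve. all: by end_near. Qed.

Lemma level_measure_measure : exists2 nu : {measure set (measurableTypeR R) -> \bar R},
  (forall A : set R, nu A = level_measure A) &
  forall (D : set R) (g : R -> \bar R), measurable D -> measurable_fun D g ->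
    (forall s, D s -> 0 <= g s)%E ->
    (\int[nu]_(s in D) g s = \int[mu]_(l in attained `&` passage eta @^-1` (~` J `&` D)) g (passage eta l))%E.
Proof.
have mB : measurable (attained `&` passage eta @^-1` (~` J)) by apply: part_meas; exact: mCJ.
pose nu := @measure_function_pushforward__canonical__measure_function_Measure
  _ _ _ (measurableTypeR R) R (mrestr mu mB) (passage eta) passage_meas.
exists nu.
  move=> A; rewrite /nu /= /pushforward /mrestr /level_measure.
  by rewrite setIC -setIA -preimage_setI.
move=> D g mD mg g0.
rewrite ge0_integral_pushforward//; last 2 first.
- exact: passage_meas.
- by move=> s; rewrite inE; exact: g0.
have mD' := passage_pre mD.
rewrite integral_mrestr//=.
- by rewrite setIC -setIA -preimage_setI.
- by apply: (measurable_comp mD) mg (measurable_funTS passage_meas) => _ [l Dl <-].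
- by move=> l; exact: g0.
Qed.

(** It suffices to compare half-open intervals, where the Stieltjes measure is an increment of
    [cont_part] and hence, by [cont_partE], a difference of level measures. *)
Lemma stieltjesE (A : set R) : measurable A -> stieltjes (cont_part (from0 eta)) A = level_measure A.
Proof.
move=> mA; rewrite /stieltjes; case: pselect => [h|]; last first.
  by case; split; [exact: cont_part_nd|exact: cont_part_rc].
have [nu nuE _] := level_measure_measure; rewrite -nuE.
apply: lebesgue_stieltjes_measure_unique => // _ [[a b]]/= _ <-.
rewrite /lebesgue_stieltjes_measure /measure_extension/=.
rewrite measurable_mu_extE/=; last exact: is_ocitv.
have [ab|ba] := leP a b; last first.
  by rewrite set_itv_ge ?wlength0 ?measure0// bnd_simp -leNgt ltW.
rewrite wlength_itv_bnd// /cumulative_fun !cont_partE.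
have [b0|b0] := leP 0 b; last first.
  rewrite /level_measure !part_neg ?(le_lt_trans ab)// measure0 subrr nuE.
  rewrite /level_measure (_ : _ `&` _ = set0) ?measure0//; apply/seteqP; split => // l [_ [_ /=]].
  rewrite in_itv/= => /andP[_ lb]; have := lt_le_trans b0 (passage_ge0 eta l).
  by rewrite ltNge lb.
have fb : level_measure [set s | s <= b] \is a fin_num by exact: part_fin mCJ b0.
have EU : attained `&` passage eta @^-1` (~` J `&` [set s | s <= b]) =
    (attained `&` passage eta @^-1` (~` J `&` [set s | s <= a])) `|`
    (attained `&` passage eta @^-1` (~` J `&` [set` `]a, b]])).
  apply/seteqP; split => l.
    move=> [Ll [nJl /= lb]]; have [la|al] := leP (passage eta l) a; [by left|right].
    by split => //; split => //=; rewrite in_itv/= al.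
  move=> [[Ll [nJl /= la]]|[Ll [nJl /=]]]; last by rewrite in_itv/= => /andP[_ lb].
  by split => //; split => //=; exact: le_trans ab.
have UE : (level_measure [set s | (s <= b)%R] = level_measure [set s | (s <= a)%R] + level_measure [set` `]a, b]])%E.
  rewrite /level_measure EU measureU//.
  - by apply: part_meas; apply: measurableI; [exact: mCJ|exact: meas_le].
  - by apply: part_meas; apply: measurableI; [exact: mCJ|exact: measurable_itv].
  apply/seteqP; split => // l [[_ [_ /= la]] [_ [_ /=]]].
  by rewrite in_itv/= ltNge la.
have /andP[fa fab] : (level_measure [set s | s <= a] \is a fin_num) && (level_measure [set` `]a, b]] \is a fin_num).
  by rewrite -fin_numD -UE.
rewrite nuE UE fineD// addrAC subrr add0r fineK//.
Qed.

Variables (delta x : R) (c phi xi : R -> R).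
Hypothesis phi0 : forall y, 0 <= phi y.
Hypothesis nJxi : forall s, 0 <= s -> ~ J s -> lm xi s = xi s.
Local Notation K := (average_cost x c xi eta).
Hypothesis mK : measurable_fun attained (fun l => discount delta (passage eta l) * phi (K (passage eta l))).
Hypothesis mg : measurable_fun ([set` `]0, +oo[] : set R) (fun s => discount delta s * phi (c (x + lm xi s - lm eta s))).

(* The passage time maps Lebesgue measure on the levels to [d eta]: the levels passed
   at a time in the countable set [J] account for the jumps, the others for the
   continuous part. *)
Lemma ctrl_decomp :
  (\int[stieltjes (cont_part (from0 eta))]_(s in `]0%R, +oo[)
      (discount delta s * phi (c (x + lm xi s - lm eta s)))%:E
   + \esum_(s in [set s | 0 <= s]%R) (discount delta s * jump (from0 eta) s * phi (K s))%:E
   = \int[mu]_(l in attained) (discount delta (passage eta l) * phi (K (passage eta l)))%:E)%E.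
Proof.
have [nu nuE nuI] := level_measure_measure.
have mJ : measurable J by exact: (@J_meas J).
have d0 s : 0 <= discount delta s by exact: expR_ge0.
rewrite (@eq_measure_integral _ _ _ _ nu); last first.
  by move=> A mA _; rewrite stieltjesE// nuE.
rewrite nuI; last 3 first.
- exact: measurable_itv.
- exact/measurable_EFinP.
- by move=> s _; rewrite lee_fin mulr_ge0.
have -> : attained `&` passage eta @^-1` (~` J `&` [set` `]0, +oo[]) = attained `&` passage eta @^-1` (~` J).
  apply/seteqP; split => l; first by move=> [Ll [nJl _]].
  move=> [Ll nJl]; split => //; split => //=; rewrite in_itv/= andbT lt_neqAle passage_ge0 andbT.
  by apply/eqP => T0; apply: nJl; rewrite /= -T0.
rewrite (@eq_integral _ _ _ mu _ (fun l => (discount delta (passage eta l) * phi (K (passage eta l)))%:E)); last first.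
  (* At a time outside [J] neither path jumps, and the average over a jump of size 0 is the value of
     [c]. *)
  move=> l; rewrite inE => -[Ll nJl]; congr (_ * phi _)%:E.
  have T0 := passage_ge0 eta l.
  by rewrite /average_cost (nJxi T0 nJl) (nJ T0 nJl) subrr cbar0.
rewrite (@esum_off _ _ _ J); last first.
  by move=> s s0 nJs; rewrite jumpE s0 (nJ s0 nJs) subrr mulr0 mul0r.
rewrite (_ : [set s | 0 <= s] `&` J = J); last first.
  by apply/seteqP; split => [s []//|s Js]; split => //; exact: J_ge0.
rewrite (eq_esum (b := fun s => ((discount delta s * phi (K s))%:E * mu (attained `&` passage eta @^-1` [set s]))%E)); last first.
  move=> s Js; rewrite attained_fiber ?J_ge0// jumpE J_ge0// -EFinM; congr EFin; ring.
rewrite -(countable_fiber (h := fun s => discount delta s * phi (K s)) attained_meas cJ)//; last 3 first.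
- exact: passage_pre.
- by move=> s _; rewrite mulr_ge0.
- by apply: measurable_funS mK => //; exact: attained_meas.
have EU : attained = (attained `&` passage eta @^-1` (~` J)) `|` (attained `&` passage eta @^-1` J).
  by rewrite -setIUr preimage_setC setUC setUv setIT.
rewrite [in RHS]EU ge0_integral_setU//.
- by apply: part_meas; exact: mCJ.
- exact: part_meas.
- by rewrite -EU; apply/measurable_EFinP.
- by move=> l _; rewrite lee_fin mulr_ge0.
- by apply/disj_setPS => l [[_ nJl] [_ Jl]].
Qed.

End decomposition.

Section set_convergence.
Context {R : realType}.
Local Notation mu := (@lebesgue_measure R).

Lemma Rint_set_cvg (A : set R) (A_ : nat -> set R) (f : R -> R) (N : set R) :
  measurable A -> (forall n, measurable (A_ n)) -> (forall n, A_ n `<=` A) -> countable N ->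
  (forall l, A l -> ~ N l -> \forall n \near \oo, A_ n l) ->
  mu.-integrable A (EFin \o f) ->
  \int[mu]_(l in A_ n) f l @[n --> \oo] --> \int[mu]_(l in A) f l.
Proof.
move=> mA mA_ A_A cN nA intf.
have N0 : mu N = 0 by exact: countable_lebesgue_measure0.
have mN : measurable N by exact: countable_measurable.
have mf : measurable_fun A (EFin \o f) by exact: (measurable_int mu intf).
have [] := @dominated_convergence _ _ R mu A mA (fun n => (EFin \o f) \_ (A_ n))
  (EFin \o f) (abse \o (EFin \o f)) _ mf _ (integrable_abse intf) _.
- move=> n; apply/(measurable_restrict (EFin \o f) (mA_ n) mA).
  by rewrite setIidr//; apply: measurable_funS mf.
- exists N; split => // l /= nl; apply: contrapT => Nl; apply: nl => Al.
  apply: cvg_near_cst; have := nA l Al Nl; apply: filterS => n An.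
  by rewrite patchE mem_set.
- exists set0; split => // l /= nl; exfalso; apply: nl => n Al.
  by rewrite patchE; case: ifP => // _; rewrite abse0.
move=> _ _ cF.
have Fn : (\int[mu]_(l in A) (f l)%:E)%E \is a fin_num by exact: integrable_fin_num.
have : (\int[mu]_(l in A_ n) (f l)%:E)%E @[n --> \oo] --> (\int[mu]_(l in A) (f l)%:E)%E.
  apply: cvg_trans cF; apply: near_eq_cvg; near=> n.
  by rewrite /= -integral_mkcondr setIidr.
by rewrite -(fineK Fn) => /fine_cvg; exact.
Unshelve. all: by end_near. Qed.

End set_convergence.

(** * The cost of one path in terms of levels *)

Section path_cost_formula.
Context {R : realType}.
Local Notation mu := (@lebesgue_measure R).
Implicit Types (s t e l : R).
Variables (delta x : R) (f c : R -> R) (xi eta : R -> R).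
Hypothesis delta0 : 0 <= delta.
Hypothesis cf : continuous f.
Hypothesis cc : continuous c.
Hypothesis cxi : cadlag xi.
Hypothesis ne : control_path eta.
Local Notation discount := (discount delta).
Local Notation K := (average_cost x c xi eta).

(** Jumps of [xi] belong to it because the Stieltjes integrand reads the left limit of the position,
    whereas the jump term includes the jump of [xi]. Time 0 belongs to it because the Stieltjes
    integral runs over positive times and the initial jump is in the sum. *)
Definition Jset := [set s | s = 0 \/ (0 < s /\ lm xi s <> xi s) \/ (0 < s /\ lm eta s <> eta s)].

Lemma Jset_countable : countable Jset.
Proof.
pose A (i : 'I_3) := match val i with 0%N => [set 0] |
  1%N => [set s | 0 < s /\ lm xi s <> xi s] | _ => [set s | 0 < s /\ lm eta s <> eta s] end.
apply: (@sub_countable _ _ _ (\bigcup_i A i)).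
  apply: subset_card_le => s [->|[h|h]].
  - by exists (inord 0) => //; rewrite /A /= inordK.
  - by exists (inord 1) => //; rewrite /A /= inordK.
  - by exists (inord 2) => //; rewrite /A /= inordK.
apply: bigcup_countable; first exact: countableP.
move=> [[|[|[|//]]] i3] _; rewrite /A /=; [exact: countable1|exact: cadlag_jumps_countable|].
exact/cadlag_jumps_countable/control_path_cadlag.
Qed.

Lemma Jset0 : Jset 0. Proof. by left. Qed.

Lemma Jset_ge0 s : Jset s -> 0 <= s.
Proof. by move=> [->|[[/ltW]|[/ltW]]]. Qed.

Lemma nJset s : 0 <= s -> ~ Jset s -> 0 < s /\ lm xi s = xi s /\ lm eta s = eta s.
Proof.
rewrite le_eqVlt => /predU1P[<- []|s0 nJ]; first by left.
by split => //; split; apply: contrapT => h; apply: nJ; right; [left|right].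
Qed.

Definition running_density (k : R -> R) s := discount s * k (x + lm xi s - lm eta s).
Definition level_density (phi : R -> R) l := discount (passage eta l) * phi (K (passage eta l)).

Lemma grid_ok m : [/\ forall n j k, (j <= k)%N -> eta (j%:R * dyadic n) <= eta (k%:R * dyadic n),
  forall n k, 0 <= eta (k%:R * dyadic n),
  forall t t' l, 0 <= t -> t < t' -> l < eta t ->
   \forall n \near \oo, forall k, (k <= m * 2 ^ n)%N -> t' <= k%:R * dyadic n -> l <= eta (k%:R * dyadic n) &
  eta ((m * 2 ^ n)%:R * dyadic n) @[n --> \oo] --> eta m%:R].
Proof.
split.
- by move=> n j k jk; apply: (nd_le ne); [exact: kh_ge0|exact: kh_le].
- by move=> n k; apply: (nd_ge0 ne); exact: kh_ge0.
- move=> t t' l t0 tt' lt; near=> n => k km t'k; apply: (le_trans (ltW lt)).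
  by apply: (nd_le ne) => //; apply: le_trans t'k; exact: ltW.
- by under eq_fun do rewrite khm; exact: cvg_cst.
Unshelve. all: by end_near. Qed.

Lemma running_density_cvg (k : R -> R) m : continuous k ->
  mu.-integrable `]0, m%:R] (EFin \o running_density k) /\
  \sum_(j < m * 2 ^ n) dyadic n * (discount (j%:R * dyadic n) * k (x + xi (j%:R * dyadic n) - eta (j%:R * dyadic n)))
    @[n --> \oo] --> \int[mu]_(s in `]0, m%:R]) running_density k s.
Proof.
move=> ck; have [g1 g2 g3 g4] := grid_ok m.
exact: (@run_cvg R delta x k xi eta m delta0 ck cxi ne (fun n j => eta (j%:R * dyadic n))).
Qed.

Lemma Rpos_bigcup : [set` `]0, +oo[] = \bigcup_m [set` `]0, m%:R]] :> set R.
Proof.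
apply/seteqP; split => s /=; rewrite in_itv/= andbT.
  move=> s0; exists (Num.truncn s).+1 => //=; rewrite in_itv/= s0/=.
  by apply/ltW; rewrite truncnS_gt.
by move=> [m _ /=]; rewrite in_itv/= => /andP[].
Qed.

Lemma running_density_meas (k : R -> R) : continuous k -> measurable_fun ([set` `]0, +oo[] : set R) (running_density k).
Proof.
move=> ck; rewrite Rpos_bigcup; apply/measurable_fun_bigcup => [m|m]; first exact: measurable_itv.
by apply/measurable_EFinP; exact: (measurable_int mu (running_density_cvg m ck).1).
Qed.

Lemma level_density_meas (phi : R -> R) : continuous phi -> measurable_fun (attained eta) (level_density phi).
Proof.
move=> cphi; rewrite attained_bigcup//; apply/measurable_fun_bigcup => [m|m]; first exact: measurable_itv.
by apply/measurable_EFinP; exact: (measurable_int mu (average_cvg x m delta0 cc cxi ne cphi).1).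
Qed.

Local Notation ctl := (controlled x (from0 xi) (from0 eta)).

Lemma left_ctl s : 0 <= s -> left_lim ctl s = x + lm xi s - lm eta s.
Proof.
rewrite le_eqVlt => /predU1P[<-|s0].
  rewrite !lm0 subr0 addr0; apply: cvg_lim => //; apply: cvg_near_cst; near=> t.
  have : t < 0 by near: t; exact: nbhs_left_lt.
  by rewrite /controlled /from0 ltNge => /negbTE ->; rewrite subr0 addr0.
apply: cvg_lim => //; rewrite /controlled; apply: cvgB.
  by apply: cvgD; [exact: cvg_cst|exact/from0_cvg/cadlag_lm].
exact/from0_cvg/cadlag_lm/s0/control_path_cadlag.
Unshelve. all: by end_near. Qed.

Lemma jump_costE s : 0 <= s -> jump_cost c x (from0 xi) (from0 eta) s = K s.
Proof.
move=> s0; apply: eq_Rintegral => l _; congr c.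
by rewrite /jump_pos left_ctl// /jump -!/(lm _ _) !from0E//; ring.
Qed.

Lemma ctrl_formula (phi : R -> R) : continuous phi -> (forall y, 0 <= phi y) ->
  (\int[stieltjes (cont_part (from0 eta))]_(s in `]0%R, +oo[)
      (running_density (phi \o c) s)%:E
   + \esum_(s in [set s | 0 <= s]%R) (discount s * jump (from0 eta) s * phi (K s))%:E
   = \int[mu]_(l in attained eta) (level_density phi l)%:E)%E.
Proof.
move=> cphi phi0.
have hJ s : 0 <= s -> ~ Jset s -> lm eta s = eta s by move=> s0 /(nJset s0)[_ []].
have hJxi s : 0 <= s -> ~ Jset s -> lm xi s = xi s by move=> s0 /(nJset s0)[_ []].
have mK := level_density_meas cphi.
have mg : measurable_fun ([set` `]0, +oo[] : set R) (running_density (phi \o c)).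
  apply: (@running_density_meas (phi \o c)) => y; by apply: continuous_comp; [exact: cc|exact: cphi].
have H := @ctrl_decomp R eta Jset ne Jset_countable Jset0 Jset_ge0 hJ delta x c phi xi phi0 hJxi mK mg.
rewrite /running_density /level_density /=.
exact: H.
Qed.

Lemma path_abs_costE : path_abs_cost delta f c x (from0 xi) (from0 eta) =
  (\int[mu]_(s in `]0%R, +oo[) (running_density (Num.norm \o f) s)%:E + \int[mu]_(l in attained eta) (level_density Num.norm l)%:E)%E.
Proof.
rewrite -ctrl_formula//; last exact: norm_continuous.
rewrite /path_abs_cost -addeA; congr (_ + (_ + _))%E.
- by apply: eq_integral => s; rewrite inE/= in_itv/= andbT => /ltW s0; rewrite left_ctl.
- by apply: eq_integral => s; rewrite inE/= in_itv/= andbT => /ltW s0; rewrite left_ctl.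
- by apply: eq_esum => s s0; rewrite jump_costE.
Qed.

Lemma level_density_norm l : `|level_density id l| = level_density Num.norm l.
Proof. by rewrite /level_density normrM ger0_norm// expR_ge0. Qed.

Lemma running_density_norm k s : `|running_density k s| = running_density (Num.norm \o k) s.
Proof. by rewrite /running_density normrM ger0_norm// expR_ge0. Qed.

Lemma fin_cost_integrable : (path_abs_cost delta f c x (from0 xi) (from0 eta) < +oo)%E ->
  mu.-integrable `]0, +oo[ (EFin \o running_density f) /\ mu.-integrable (attained eta) (EFin \o level_density id).
Proof.
rewrite path_abs_costE => h.
have A0 : (0 <= \int[mu]_(s in `]0%R, +oo[) (running_density (Num.norm \o f) s)%:E)%E.
  by apply: integral_ge0 => s _; rewrite lee_fin -running_density_norm.
have B0 : (0 <= \int[mu]_(l in attained eta) (level_density Num.norm l)%:E)%E.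
  by apply: integral_ge0 => s _; rewrite lee_fin -level_density_norm.
split; apply/integrableP; split.
- by apply/measurable_EFinP; exact: running_density_meas.
- apply: le_lt_trans h; under eq_integral do rewrite /= running_density_norm.
  exact: leeDl.
- by apply/measurable_EFinP; apply: level_density_meas => y; exact: cvg_id.
- apply: le_lt_trans h; under eq_integral do rewrite /= level_density_norm.
  exact: leeDr.
Qed.

Lemma max0_continuous : continuous (fun y : R => Num.max y 0).
Proof. by move=> y; apply: continuous_max; [exact: cvg_id|exact: cvg_cst]. Qed.

Lemma maxN0_continuous : continuous (fun y : R => Num.max (- y) 0).
Proof. by move=> y; apply: continuous_max; [apply: cvgN; exact: cvg_id|exact: cvg_cst]. Qed.

(** The formula over levels is for non-negative integrands, so it is applied to the positive and the
    negative parts; finiteness of the absolute cost allows the subtraction. *)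
Lemma path_costE : (path_abs_cost delta f c x (from0 xi) (from0 eta) < +oo)%E ->
  path_cost delta f c x (from0 xi) (from0 eta) =
  (\int[mu]_(s in `]0, +oo[) running_density f s + \int[mu]_(l in attained eta) level_density id l)%:E.
Proof.
move=> h; have [i1 i2] := fin_cost_integrable h.
have d0 s : 0 <= discount s by exact: expR_ge0.
have pE (a b : R) : 0 <= a -> maxe (a * b)%:E 0 = (a * Num.max b 0)%:E.
  by move=> a0; rewrite -EFin_max maxr_pMr// mulr0.
have nE (a b : R) : 0 <= a -> maxe (- (a * b)%:E)%E 0 = (a * Num.max (- b) 0)%:E.
  by move=> a0; rewrite -EFinN -mulrN; exact: pE.
have max0 (y : R) : 0 <= Num.max y 0 by rewrite le_max lexx orbT.
have maxN0 (y : R) : 0 <= Num.max (- y) 0 by rewrite le_max lexx orbT.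
have Fp := ctrl_formula max0_continuous max0.
have Fn := ctrl_formula maxN0_continuous maxN0.
have E1 : (\int[mu]_(s in `]0, +oo[) running_density f s)%:E = (\int[mu]_(s in `]0%R, +oo[) (running_density f s)%:E)%E.
  by rewrite /Rintegral fineK//; exact: integrable_fin_num.
have E2 : (\int[mu]_(l in attained eta) level_density id l)%:E = (\int[mu]_(l in attained eta) (level_density id l)%:E)%E.
  by rewrite /Rintegral fineK//; apply: integrable_fin_num => //; exact: attained_meas.
rewrite EFinD E1 E2 /path_cost -addeA; congr (_ + _)%E.
  by apply: eq_integral => s; rewrite inE/= in_itv/= andbT => /ltW s0; rewrite left_ctl.
have -> : (\int[mu]_(l in attained eta) (level_density id l)%:E =
    \int[mu]_(l in attained eta) (level_density (fun y => Num.max y 0) l)%:E -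
    \int[mu]_(l in attained eta) (level_density (fun y => Num.max (- y) 0) l)%:E)%E.
  rewrite integralE; congr (_ - _)%E; apply: eq_integral => l _.
    by rewrite funeposE pE.
  by rewrite funenegE nE.
have L2 : (\int[mu]_(l in attained eta) (level_density (fun y => Num.max (- y) 0) l)%:E < +oo)%E.
  have /integrableP[_] := i2; apply: le_lt_trans; apply: ge0_le_integral.
  - exact: attained_meas.
  - by move=> l _; rewrite lee_fin mulr_ge0.
  - by apply/measurable_EFinP; apply: level_density_meas; exact: maxN0_continuous.
  - by apply: measurableT_comp => //; exact: (measurable_int mu i2).
  move=> l _; rewrite /= lee_fin level_density_norm; apply: ler_wpM2l => //.
  by rewrite ge_max normr_ge0 -normrN ler_norm.
have j0 s : 0 <= jump (from0 eta) s.
  apply: (jump_ge0 ne).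
have fE : (\esum_(s in [set s | (0 <= s)%R]) (discount s * jump (from0 eta) s * Num.max (- K s) 0)%:E)%E \is a fin_num.
  rewrite ge0_fin_numE; last by apply: esum_ge0 => s _; rewrite lee_fin !mulr_ge0.
  apply: le_lt_trans L2; rewrite -Fn; apply: leeDr.
  by apply: integral_ge0 => s _; rewrite lee_fin; exact: mulr_ge0 (d0 s) (maxN0 (c _)).
(* The difference of the two sums is regrouped into Stieltjes terms and jump terms, which is
   legitimate because the negative jump sum is finite. *)
rewrite -Fp -Fn fin_num_oppeD// [RHS]addeACA; congr (_ + _)%E.
  rewrite integralE; congr (_ - _)%E; apply: eq_integral => s;
    rewrite inE/= in_itv/= andbT => /ltW s0.
    by rewrite funeposE left_ctl// pE.
  by rewrite funenegE left_ctl// nE.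
rewrite /signed_esum; congr (_ - _)%E; apply: eq_esum => s s0.
  by rewrite funeposE jump_costE// pE// mulr_ge0.
by rewrite funenegE jump_costE// nE// mulr_ge0.
Qed.

End path_cost_formula.

(** * The reflected chain *)

Section reflected_chain.
Context {R : realType} {d : measure_display} {T : measurableType d}.
Variables (P : probability T R) (F : R -> set (set T)) (X : R -> T -> R).
Hypothesis hF : usual_filtration P F.
Hypothesis hX : levy_process P F X.
Hypothesis hX0 : forall w, X 0 w = 0.
Hypothesis hXc : forall w, cadlag (X ^~ w).
Variables (theta dl : R).
Hypothesis th0 : 0 < theta.
Hypothesis dl0 : 0 <= dl.
Hypothesis mgp : forall t : R, 0 <= t -> (mg P X theta t <= (expR (dl * t))%:E)%E.
Hypothesis mgm : forall t : R, 0 <= t -> (mg P X (- theta) t <= (expR (dl * t))%:E)%E.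
Implicit Types (h y z e r s t : R).

Lemma gk_decr y z : y <= z -> z <= -1 -> gk z <= gk y.
Proof.
move=> yz z1; rewrite /gk !ifF; [nra| |]; apply/negbTE; rewrite -ltNge; lra.
Qed.

Variables (x b : R).

Definition overshoot t w : R := Num.max (x + X t w - b) 0.
Definition grid_overshoot n k w := grid_max (overshoot ^~ w) (dyadic n) k.
Local Notation p n := (pos X x (dyadic n)).
Local Notation Y n := (chain_pos X x (dyadic n) (grid_overshoot n)).

Lemma grid_overshoot_F n k : Fm F (k%:R * dyadic n) (grid_overshoot n k).
Proof.
apply: (Fm_grid_max hF (g := overshoot)); first exact: dyadic_ge0.
move=> t t0; apply: (Fm_max hF) => //; last exact: (Fm_cst hF).
apply: (Fm_sub hF) => //; last exact: (Fm_cst hF).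
apply: (Fm_add hF) => //; first exact: (Fm_cst hF).
exact: (Fm_X hX).
Qed.

Lemma grid_overshoot_ge0 n k w : 0 <= grid_overshoot n k w.
Proof. by apply: le_trans (grid_max_ge _ _ (leq0n k)); rewrite le_max lexx orbT. Qed.

Lemma grid_overshoot_nd n j k w : (j <= k)%N -> grid_overshoot n j w <= grid_overshoot n k w.
Proof. exact: grid_max_nd. Qed.

Lemma grid_overshoot_prev n k w : grid_overshoot n k w = Num.max (prev (grid_overshoot n) k w) (p n k w - b).
Proof.
case: k => [|k]; first by rewrite /grid_overshoot /= /overshoot /pos mul0r maxC.
rewrite /grid_overshoot /= -/(grid_overshoot n k w) /overshoot -/(p n k.+1 w).
by rewrite (maxC (p n k.+1 w - b)) maxA (max_l (grid_overshoot_ge0 n k w)).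
Qed.

Lemma Y_min n k w : Y n k w = Num.min (p n k w - prev (grid_overshoot n) k w) b.
Proof. rewrite /chain_pos grid_overshoot_prev; set q := p n k w; set r := prev _ _ _.
by case: (leP r (q - b)) => ?; case: (leP (q - r) b) => ?; lra. Qed.

Lemma Y_le n k w : Y n k w <= b.
Proof. by rewrite Y_min ge_min lexx orbT. Qed.

Lemma pS n k w : p n k.+1 w - grid_overshoot n k w = Y n k w + (X (k.+1%:R * dyadic n) w - X (k%:R * dyadic n) w).
Proof. by rewrite /chain_pos /pos; ring. Qed.

(** Lindley's recursion for the distance of the chain to the barrier. *)
Lemma VS n k w : b - Y n k.+1 w =
  Num.max (b - Y n k w - (X (k.+1%:R * dyadic n) w - X (k%:R * dyadic n) w)) 0.
Proof. rewrite Y_min [prev _ _ _]/= pS; set D := X _ w - X _ w; set v := chain_pos _ _ _ _ _ _.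
by case: (leP (v + D) b) => ?; case: (leP (b - v - D) 0) => ?; lra. Qed.

(** Starting at 1 or more places the argument of [gk] at most at -1 when the chain touches the
    barrier, in the region where [gk] is non-increasing. *)
Fixpoint grid_drawdown n k w : R := if k is k'.+1 then Num.max (grid_drawdown n k' w) (theta * (b - Y n k w))
  else Num.max 1 (theta * (b - Y n 0 w)).

Lemma grid_drawdown_ge1 n k w : 1 <= grid_drawdown n k w.
Proof. by elim: k => [|k IH] /=; rewrite le_max ?lexx// IH. Qed.

Lemma grid_drawdown_nd n j k w : (j <= k)%N -> grid_drawdown n j w <= grid_drawdown n k w.
Proof.
elim: k => [|k IH]; first by rewrite leqn0 => /eqP->.
rewrite leq_eqVlt => /orP[/eqP->//|jk]; apply: (le_trans (IH jk)) => /=.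
by rewrite le_max lexx.
Qed.

Lemma grid_drawdown_ge n j k w : (j <= k)%N -> theta * (b - Y n j w) <= grid_drawdown n k w.
Proof. by move=> jk; apply: le_trans (grid_drawdown_nd n w jk); case: j {jk} => [|j] /=; rewrite le_max lexx orbT. Qed.

Lemma grid_drawdown_le n k w B : 1 <= B -> (forall j, (j <= k)%N -> theta * (b - Y n j w) <= B) -> grid_drawdown n k w <= B.
Proof.
move=> B1; elim: k => [|k IH] hB /=; rewrite ge_max ?B1 ?hB// andbT.
by apply: IH => j jk; apply: hB; rewrite leqW.
Qed.

(** A finer grid sees a larger overshoot, hence pushes lower; this makes the maximal drawdown
    monotone in [n]. *)
Lemma Y_dyadic n k w : Y n.+1 (2 * k) w <= Y n k w.
Proof.
have E : dyadic n = 2%:R * dyadic n.+1 :> R by rewrite /dyadic exprS mulrA mulfV ?mul1r.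
rewrite /chain_pos /pos natrM mulrAC -E mulrC lerB// /grid_overshoot.
exact: grid_max_dyadic.
Qed.

Lemma grid_drawdown_dyadic n k w : grid_drawdown n k w <= grid_drawdown n.+1 (2 * k) w.
Proof.
apply: grid_drawdown_le; first exact: grid_drawdown_ge1.
move=> j jk; apply: le_trans (_ : theta * (b - Y n.+1 (2 * j) w) <= _).
  by rewrite ler_wpM2l ?(ltW th0)// lerB// Y_dyadic.
by apply: grid_drawdown_ge; rewrite leq_mul2l jk orbT.
Qed.

Lemma grid_drawdown_F n k : Fm F (k%:R * dyadic n) (grid_drawdown n k).
Proof.
have VF j : Fm F (j%:R * dyadic n) (fun w => theta * (b - Y n j w)).
  apply: (Fm_comp (Y := Y n j) (g := fun y => theta * (b - y))).
    by apply: measurable_funM => //; exact: measurable_funB.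
  apply: (chain_pos_F hF hX); [exact: dyadic_ge0|exact: grid_overshoot_F].
elim: k => [|k IH] /=.
  by apply: (Fm_max hF) => //; [exact: kh_ge0|apply: (Fm_cst hF); exact: kh_ge0].
apply: (Fm_max hF) => //; first exact: kh_ge0.
by apply: (Fm_mono hF _ _ IH); [exact: kh_ge0|exact: kh_le].
Qed.

Definition C0r := expR (Num.max 1 (theta * (b - Num.min x b))) *
   gk (theta * (b - Num.min x b) - Num.max 1 (theta * (b - Num.min x b))).

(** The estimate for a maximum and a current value, applied to the drawdown scaled by [theta]; the
    exponent is [- theta] because the drawdown grows when [X] falls. *)
Lemma expMr_le n k : (\int[P]_w (expR (grid_drawdown n k w))%:E <= (2 * C0r * expR (7 * kd dl 1 * (k%:R * dyadic n)))%:E)%E.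
Proof.
have gk0 y : 0 <= gk y :> R by apply: le_trans (gk_ge y); rewrite invr_ge0.
apply: (@expM_le _ _ _ P F X hF hX theta dl th0 dl0 mgp mgm (- theta) (dyadic n) 1 C0r (grid_drawdown n)
  (fun k w => theta * (b - Y n k w))).
- by right.
- exact: dyadic_ge0.
- exact: dyadic_le1.
- exact: grid_drawdown_F.
- move=> j; apply: (Fm_comp (Y := Y n j) (g := fun y => theta * (b - y))).
    by apply: measurable_funM => //; exact: measurable_funB.
  apply: (chain_pos_F hF hX); [exact: dyadic_ge0|exact: grid_overshoot_F].
- by move=> j w; exact: grid_drawdown_ge.
- move=> j w; rewrite [grid_drawdown n j.+1 w]/(Num.max (grid_drawdown n j w) (theta * (b - Y n j.+1 w))) gk_max.
  rewrite ler_wpM2l ?expR_ge0// VS.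
  set D := X _ w - X _ w; set v := b - Y n j w.
  (* If the step does not reach the barrier there is equality. Otherwise the drawdown is reset to 0,
     which lies above the unreflected value, and both arguments of [gk] are at most -1. *)
  case: (leP (v - D) 0) => vD; last first.
    by have -> : theta * (v - D) = theta * v + - theta * D by ring.
  have M1 := grid_drawdown_ge1 n j w.
  apply: gk_decr; last by rewrite mulr0; lra.
  rewrite mulr0 lerB// mulNr -mulrBr.
  by have := ler_wpM2l (ltW th0) vD; rewrite mulr0.
- by rewrite mulr_ge0 ?expR_ge0.
- move=> w; rewrite [grid_drawdown _ _ _]/= Y_min /= subr0 {1 2 3}/pos mul0r hX0 addr0.
  exact: lexx.
Qed.

Definition Bw m w := 1 + theta * (2 * (`|x| + `|b| + Xs X m w)).

Lemma X_le_Xs (m : nat) n k w : (k <= m * 2 ^ n)%N -> `|X (k%:R * dyadic n) w| <= Xs X m%:R w.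
Proof. by move=> km; apply: (Xs_ub hXc); [exact: kh_ge0|exact: kh_m]. Qed.

Lemma grid_overshoot_le (m : nat) n k w : (k <= m * 2 ^ n)%N -> grid_overshoot n k w <= `|x| + `|b| + Xs X m%:R w.
Proof.
move=> km; apply: grid_max_le => j jk; rewrite /overshoot ge_max; apply/andP; split.
  have := X_le_Xs w (leq_trans jk km); have := ler_norm x; have := ler_norm (- b).
  by rewrite normrN; have := ler_norm (X (j%:R * dyadic n) w); lra.
by rewrite !addr_ge0//; apply: (Xs_ge0 hXc).
Qed.

Lemma grid_drawdown_bound (m : nat) n k w : (k <= m * 2 ^ n)%N -> grid_drawdown n k w <= Bw m%:R w.
Proof.
move=> km; have s0 : 0 <= Xs X m%:R w by apply: (Xs_ge0 hXc).
apply: grid_drawdown_le => [|j jk].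
  by rewrite lerDl mulr_ge0 ?(ltW th0)// mulr_ge0// !addr_ge0.
rewrite -[leLHS]add0r lerD// ler_wpM2l ?(ltW th0)//.
have jm := leq_trans jk km.
have := grid_overshoot_le w jm; have := X_le_Xs w jm; rewrite /chain_pos /pos => h1 h2.
have := ler_norm (- X (j%:R * dyadic n) w); have := ler_norm b; have := ler_norm (- x); rewrite !normrN.
lra.
Qed.

Definition max_drawdown (m : nat) w := limn (fun n => grid_drawdown n (m * 2 ^ n) w).

Lemma grid_drawdown_seq_nd m w : nondecreasing_seq (fun n => grid_drawdown n (m * 2 ^ n) w).
Proof.
apply/nondecreasing_seqP => n; apply: (le_trans (grid_drawdown_dyadic n _ w)).
by rewrite expnS mulnCA lexx.
Qed.

Lemma max_drawdown_cvg m w : grid_drawdown n (m * 2 ^ n) w @[n --> \oo] --> max_drawdown m w.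
Proof.
apply: nondecreasing_is_cvgn; first exact: grid_drawdown_seq_nd.
by exists (Bw m%:R w) => _ [n _ <-]; exact: grid_drawdown_bound.
Qed.

Lemma max_drawdown_ge m n k w : (k <= m * 2 ^ n)%N -> theta * (b - Y n k w) <= max_drawdown m w.
Proof.
move=> km; apply: (le_trans (grid_drawdown_ge n w km)).
apply: (nondecreasing_cvgn_le (grid_drawdown_seq_nd m w)); exact/cvgP/max_drawdown_cvg.
Qed.

Lemma max_drawdown_meas m : measurable_fun setT (max_drawdown m).
Proof.
apply: (@measurable_fun_cvg _ _ _ _ (fun n w => grid_drawdown n (m * 2 ^ n) w)).
  by move=> n; apply: (Fm_meas hF _ (grid_drawdown_F n _)); exact: kh_ge0.
by move=> w _; exact: max_drawdown_cvg.
Qed.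

Lemma intg_expWr m : intg P (fun w => expR (max_drawdown m w)).
Proof.
apply: intg_ge0.
- by apply: measurableT_comp => //; exact: max_drawdown_meas.
- by move=> w; exact: expR_ge0.
apply: (@le_lt_trans _ _ (2 * C0r * expR (7 * kd dl 1 * m%:R))%:E); last by rewrite ltry.
apply: (@fatou_cvgR _ _ _ P (fun n w => expR (grid_drawdown n (m * 2 ^ n) w)) _
  (fun=> 2 * C0r * expR (7 * kd dl 1 * m%:R))).
- move=> n; apply: measurableT_comp => //.
  by apply: (Fm_meas hF _ (grid_drawdown_F n _)); exact: kh_ge0.
- by move=> n w; exact: expR_ge0.
- by move=> w; apply: cvg_expR; exact: max_drawdown_cvg.
- by move=> n; have := expMr_le n (m * 2 ^ n); rewrite khm.
- exact: cvg_cst.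
Qed.

(* dominates every exponential moment of the chain up to time [m] *)
Definition dom m w := expR (max_drawdown m w) + expR (theta * (`|x| + `|b|)) * expR (theta * Xs X m%:R w).

Lemma intg_dom_r m : intg P (dom m).
Proof.
apply: intgD; first exact: intg_expWr.
by apply: intgZ; apply: (intg_expXs hF hX hX0 hXc th0 dl0 mgp mgm).
Qed.

(** The range from [Y] to [p] contains the positions before and after a push. Below [b] the distance
    is a drawdown; above [b] it is bounded by the supremum of [|X|], as the chain without any push
    bounds it. *)
Lemma cosh_dom m n k w y : (k <= m * 2 ^ n)%N -> Y n k w <= y -> y <= p n k w ->
  cosh (theta * (y - b)) <= dom m w.
Proof.
move=> km y1 y2; have e0 := expR_ge0 (max_drawdown m w).
have [yb|yb] := leP y b.
  apply: (@le_trans _ _ (expR (max_drawdown m w))); last by rewrite lerDl mulr_ge0// expR_ge0.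
  apply: (le_trans (cosh_le_expR _)); rewrite ler_expR; apply: le_trans (max_drawdown_ge w km).
  by rewrite normrM (gtr0_norm th0) ler_wpM2l ?(ltW th0)// ler0_norm; lra.
apply: (@le_trans _ _ (expR (theta * (`|x| + `|b|)) * expR (theta * Xs X m%:R w))); last by rewrite lerDr.
apply: (le_trans (cosh_le_expR _)); rewrite -expRD ler_expR -mulrDr.
rewrite normrM (gtr0_norm th0) ler_wpM2l ?(ltW th0)// ger0_norm; last by lra.
have := X_le_Xs w km; have := ler_norm x; have := ler_norm (- b); rewrite normrN.
have := ler_norm (X (k%:R * dyadic n) w); move: y2; rewrite /pos; lra.
Qed.

Lemma Y_le_pre n k w : Y n k w <= p n k w - prev (grid_overshoot n) k w.
Proof. by rewrite Y_min ge_min lexx. Qed.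

Lemma prev_ge0 n k w : 0 <= prev (grid_overshoot n) k w.
Proof. by case: k => [|k] //=; exact: grid_overshoot_ge0. Qed.

Lemma pre_le n k w : p n k w - prev (grid_overshoot n) k w <= p n k w.
Proof. by rewrite gerBl prev_ge0. Qed.

Lemma Y_F n k : Fm F (k%:R * dyadic n) (Y n k).
Proof. by apply: (chain_pos_F hF hX); [exact: dyadic_ge0|exact: grid_overshoot_F]. Qed.

Lemma pre_F n k : Fm F (k%:R * dyadic n) (fun w => p n k w - prev (grid_overshoot n) k w).
Proof.
have k0 := kh_ge0 n k (R := R).
apply: (Fm_sub hF) => //.
  apply: (Fm_add hF) => //; [exact: (Fm_cst hF)|exact: (Fm_X hX)].
case: k k0 => [|k] k0 /=; first exact: (Fm_cst hF).
by apply: (Fm_mono hF _ _ (grid_overshoot_F n k)); [exact: kh_ge0|exact: kh_le].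
Qed.

Lemma intg_Y (u : R -> R) C n k : measurable_fun setT u ->
  (forall y, `|u y| <= C * cosh (theta * (y - b))) -> 0 <= C -> intg P (fun w => u (Y n k w)).
Proof.
move=> mu_ uC C0; apply: (intg_dom _ (intgZ C (intg_dom_r k))).
  by apply: measurableT_comp => //; exact: (Fm_meas hF (kh_ge0 n k) (Y_F n k)).
move=> w; apply: (le_trans (uC _)); rewrite ler_wpM2l//.
apply: cosh_dom (lexx _) _; first by rewrite leq_pmulr// expn_gt0.
exact: le_trans (Y_le_pre n k w) (pre_le n k w).
Qed.

Lemma intg_pre (u : R -> R) C n k : measurable_fun setT u ->
  (forall y, `|u y| <= C * cosh (theta * (y - b))) -> 0 <= C ->
  intg P (fun w => u (p n k w - prev (grid_overshoot n) k w)).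
Proof.
move=> mu_ uC C0; apply: (intg_dom _ (intgZ C (intg_dom_r k))).
  by apply: measurableT_comp => //; exact: (Fm_meas hF (kh_ge0 n k) (pre_F n k)).
move=> w; apply: (le_trans (uC _)); rewrite ler_wpM2l//.
apply: cosh_dom (Y_le_pre n k w) (pre_le n k w).
by rewrite leq_pmulr// expn_gt0.
Qed.

Let uc y : R := - cosh (theta * (y - b)).

Lemma cosh_b_meas : measurable_fun setT (fun y : R => cosh (theta * (y - b))).
Proof.
apply: (measurableT_comp (cosh_meas (R := R))); apply: measurable_funM => //.
exact: measurable_funB.
Qed.

Lemma intg_cosh_b y h : 0 <= h -> intg P (fun w => cosh (theta * (y + X h w - b))).
Proof.
move=> h0; apply: (@intg_shift _ _ _ P F X hF hX theta dl mgp mgm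
  (fun y => cosh (theta * (y - b))) (2 * cosh (theta * (y - b))) h y h0 cosh_b_meas) => z.
rewrite ger0_norm ?cosh_ge0//; apply: le_trans (cosh_add _ _).
by rewrite le_eqVlt; apply/orP; left; apply/eqP; congr cosh; ring.
Qed.

Lemma EE_cosh_b y h : 0 <= h ->
  EE P (fun w => cosh (theta * (y + X h w - b))) <= expR (dl * h) * cosh (theta * (y - b)).
Proof.
move=> h0; set z := theta * (y - b).
have i1 := intg_expX hF hX mgp mgm (or_introl erefl) h0.
have i2 := intg_expX hF hX mgp mgm (or_intror erefl) h0.
have -> : (fun w => cosh (theta * (y + X h w - b))) =
    (fun w => expR z / 2 * expR (theta * X h w) + expR (- z) / 2 * expR (- theta * X h w)).
  apply/funext => w; rewrite /cosh.
  have -> : theta * (y + X h w - b) = z + theta * X h w by rewrite /z; ring.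
  by rewrite opprD !expRD mulNr; field.
rewrite EED ?EEZ//; [|exact: intgZ..].
have E1 := EE_expX hF hX mgp mgm (or_introl erefl) h0.
have E2 := EE_expX hF hX mgp mgm (or_intror erefl) h0.
have e1 := expR_ge0 z; have e2 := expR_ge0 (- z).
have := ler_wpM2l e1 E1; have := ler_wpM2l e2 E2.
rewrite /cosh; lra.
Qed.

(** The chain inequality for [uc] with discount rate [dl] and no costs: a push moves the chain to
    [b], the minimum of [cosh (theta (y - b))], and a free step multiplies the mean by at most
    [e^{dl h}]. *)
Lemma EE_cosh_Y n k :
  EE P (fun w => cosh (theta * (Y n k w - b))) <= expR (dl * (k%:R * dyadic n)) * cosh (theta * (x - b)).
Proof.
have muc : measurable_fun setT uc by apply: measurableT_comp => //; exact: cosh_b_meas.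
have ucC y : `|uc y| <= 1 * cosh (theta * (y - b)).
  by rewrite /uc normrN ger0_norm ?cosh_ge0// mul1r.
have ic : intg P (fun w => cosh (theta * (Y n k w - b))).
  apply: (@intg_Y (fun y => cosh (theta * (y - b))) 1) => //; first exact: cosh_b_meas.
  by move=> y; rewrite ger0_norm ?cosh_ge0// mul1r.
have h0 := dyadic_ge0 n (R := R).
have := @chain _ _ _ P F X hF hX hX0 x (dyadic n) dl uc (fun=> 0) (fun=> 0) (grid_overshoot n) (fun=> true) h0 dl0
  (grid_overshoot_F n) _ 0 (lexx 0) _ _ muc _ _ _ _ _ k.
have -> : stopped_cost X x (dyadic n) dl uc (fun=> 0) (fun=> 0) (grid_overshoot n) (fun=> true) k =
    (fun w => - expR (- dl * (k%:R * dyadic n)) * cosh (theta * (Y n k w - b))).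
  apply/funext => w; rewrite stopped_cost_run; last by move=> j _; apply: inside_upto_all.
  rewrite /cost_upto [X in X + _ + _]big1 => [|j _]; last by rewrite !mulr0.
  rewrite [X in _ + X + _]big1 => [|j _]; last by rewrite /control_step subrr mulr0.
  by rewrite !add0r /uc /ee mulrN -mulNr.
rewrite [0 * (_ * _)]mul0r addr0 EEZ// => H.
have e1 : expR (dl * (k%:R * dyadic n)) * expR (- dl * (k%:R * dyadic n)) = 1.
  by rewrite -expRD mulNr subrr expR0.
have : uc x <= - expR (- dl * (k%:R * dyadic n)) * EE P (fun w => cosh (theta * (Y n k w - b))).
  apply: H => //.
  - move=> j w; rewrite /uc /control_step subrr opprK addrC subr_le0.
    have := Y_le_pre n j w; rewrite Y_min => _.
    rewrite minEle; case: ifPn => // /negbTE; rewrite leNgt => /negbFE yb.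
    by rewrite subrr mulr0 cosh0 cosh_ge1.
  - move=> j w _; rewrite mul0r oppr0 mulr0 addr0 /uc opprK /mean_shift.
    have := EE_cosh_b (Y n j w) h0.
    have -> : EE P (fun w0 => - cosh (theta * (Y n j w + X (dyadic n) w0 - b))) =
       - EE P (fun w0 => cosh (theta * (Y n j w + X (dyadic n) w0 - b))).
      rewrite -[RHS]mulN1r -EEZ; last exact: intg_cosh_b.
      by congr EE; apply/funext => w0; rewrite mulN1r.
    have e2 : expR (- dl * dyadic n) * expR (dl * dyadic n) = 1 by rewrite -expRD mulNr addNr expR0.
    have e3 := expR_ge0 (- dl * dyadic n).
    by move=> h1; have := ler_wpM2l e3 h1; rewrite mulrA e2; lra.
  - by move=> y; apply: intgN; exact: intg_cosh_b.
  - by move=> j; exact: (@intg_pre uc 1 n j.+1).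
  - by move=> j; exact: (@intg_Y uc 1).
  - by move=> j; exact: intg_cst.
  - by move=> j; rewrite /control_step; under eq_fun do rewrite subrr; exact: intg_cst.
rewrite /uc mulNr lerN2 => h1; have := ler_wpM2l (expR_ge0 (dl * (k%:R * dyadic n))) h1.
by rewrite (mulrA (expR _)) e1 mul1r.
Qed.

Variable delta : R.
Hypothesis dld : dl <= delta.

Let ue y : R := - expR (theta * y).

Definition esum_r n k w := \sum_(j < k.+1) expR (- delta * (j%:R * dyadic n)) *
  (expR (theta * (p n j w - prev (grid_overshoot n) j w)) - expR (theta * Y n j w)).

(** The chain inequality for [ue], with [ue] also in place of the primitive of [c]: [e^{theta X}]
    grows at most at rate [dl <= delta], so all it can lose through pushes, discounted, is its
    initial value. This will bound the control cost, since [c] is at most of order [e^{theta y}]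
    above [b]. *)
Lemma EE_esum_r n k : intg P (esum_r n k) /\ EE P (esum_r n k) <= expR (theta * x).
Proof.
pose C := 2 * expR (theta * b).
have C0 : 0 <= C by rewrite mulr_ge0// expR_ge0.
have mue : measurable_fun setT ue.
  by apply: measurableT_comp => //; apply: measurableT_comp => //; exact: measurable_funM.
have ueC y : `|ue y| <= C * cosh (theta * (y - b)).
  rewrite /ue normrN ger0_norm ?expR_ge0// /C.
  have -> : theta * y = theta * b + theta * (y - b) by ring.
  rewrite expRD; have := expR_le_cosh (theta * (y - b)); have := expR_gt0 (theta * b); nra.
have h0 := dyadic_ge0 n (R := R).
have delta0 : 0 <= delta by exact: le_trans dld.
have iC j : intg P (control_step X x (dyadic n) ue (grid_overshoot n) j).
  by apply: intgB; [exact: (@intg_pre ue C)|exact: (@intg_Y ue C)].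
have iE : intg P (esum_r n k).
  apply: (@intg_sum _ _ _ P _ _ (fun (j : 'I_k.+1) w => _)) => j.
  have -> : (fun w => expR (- delta * (j%:R * dyadic n)) * (expR (theta * (p n j w - prev (grid_overshoot n) j w)) -
     expR (theta * Y n j w))) = (fun w => - expR (- delta * (j%:R * dyadic n)) * control_step X x (dyadic n) ue (grid_overshoot n) j w).
    by apply/funext => w; rewrite /control_step /ue; ring.
  exact: intgZ.
split => //.
have := @chain _ _ _ P F X hF hX hX0 x (dyadic n) delta ue (fun=> 0) ue (grid_overshoot n) (fun=> true) h0 delta0
  (grid_overshoot_F n) _ 0 (lexx 0) _ _ mue _ _ _ _ _ k.
have -> : stopped_cost X x (dyadic n) delta ue (fun=> 0) ue (grid_overshoot n) (fun=> true) k =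
    (fun w => - 1 * esum_r n k w + ee (dyadic n) delta k * ue (Y n k w)).
  apply/funext => w; rewrite stopped_cost_run; last by move=> j _; apply: inside_upto_all.
  rewrite /cost_upto big1 ?add0r; last by move=> j _; rewrite !mulr0.
  congr (_ + _); rewrite /esum_r mulr_sumr; apply: eq_bigr => j _.
  by rewrite /control_step /ue /ee; ring.
have iY : intg P (fun w => ue (Y n k w)) by exact: (@intg_Y ue C).
rewrite [0 * (_ * _)]mul0r addr0 EED ?EEZ//; [|exact: intgZ..] => H.
have : ue x <= -1 * EE P (esum_r n k) + ee (dyadic n) delta k * EE P (fun w => ue (Y n k w)).
  apply: H => //.
  - move=> j w _; rewrite mul0r oppr0 mulr0 addr0 /ue opprK /mean_shift.
    have i1 := intg_expX hF hX mgp mgm (or_introl erefl) h0.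
    have E1 := EE_expX hF hX mgp mgm (or_introl erefl) h0.
    have -> : EE P (fun w0 => - expR (theta * (Y n j w + X (dyadic n) w0))) =
       - expR (theta * Y n j w) * EE P (fun w0 => expR (theta * X (dyadic n) w0)).
      rewrite -EEZ//; congr EE; apply/funext => w0.
      by rewrite mulrDr expRD mulNr.
    have e2 : expR (- delta * dyadic n) * EE P (fun w0 => expR (theta * X (dyadic n) w0)) <= 1.
      apply: (@le_trans _ _ (expR (- delta * dyadic n) * expR (dl * dyadic n))).
        by rewrite ler_wpM2l// expR_ge0.
      have q : (- delta + dl) * dyadic n <= 0 by apply: mulr_le0_ge0 => //; rewrite addrC subr_le0.
      by rewrite -expRD -mulrDl -[leRHS]expR0 ler_expR.
    have e3 := expR_ge0 (theta * Y n j w).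
    have := ler_wpM2l e3 e2; nra.
  - move=> y; apply: (@intg_shift _ _ _ P F X hF hX theta dl mgp mgm ue (2 * expR (theta * y)) (dyadic n) y h0 mue) => z.
    rewrite /ue normrN ger0_norm ?expR_ge0// mulrDr expRD mulrAC [leLHS]mulrC ler_pM2r; last exact: expR_gt0.
    exact: expR_le_cosh.
  - by move=> j; exact: (@intg_pre ue C n j.+1).
  - by move=> j; exact: (@intg_Y ue C).
  - by move=> j; exact: intg_cst.
have : EE P (fun w => ue (Y n k w)) <= 0.
  by rewrite -(EE_cst P 0); apply: EE_le => //; [exact: intg_cst|move=> w; rewrite oppr_le0 expR_ge0].
have q1 := ee_ge0 (dyadic n) delta k; move=> {H} q2; have := mulr_ge0_le0 q1 q2; rewrite /ue; lra.
Qed.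

End reflected_chain.

(** * The chain inequality in the limit *)

(** An estimate that holds for each radius and precision [j] from some grid on holds along a slowly
    growing choice of [j]; [Q 0] covers the early grids. *)
Lemma diagonal (Q : nat -> nat -> Prop) : (forall n, Q 0%N n) ->
  (forall j, \forall n \near \oo, Q j n) ->
  exists2 J : nat -> nat, (forall j, \forall n \near \oo, (j <= J n)%N) & forall n, Q (J n) n.
Proof.
move=> Q0 Qn.
pose p n j := (j <= n)%N && `[< Q j n >].
have p0 n : exists j, p n j by exists 0%N; rewrite /p /=; apply/asboolP.
have pn n j : p n j -> (j <= n)%N by case/andP.
exists (fun n => ex_maxn (p0 n) (pn n)) => [j|n].
  near=> n; case: ex_maxnP => i _; apply; apply/andP; split.
    by near: n; exists j.
  by apply/asboolP; near: n; exact: Qn.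
by case: ex_maxnP => i /andP[_ /asboolP].
Unshelve. all: by end_near. Qed.

Section chain_limit.
Context {R : realType} {d : measure_display} {T : measurableType d}.
Local Notation mu := (@lebesgue_measure R).
Variables (P : probability T R) (F : R -> set (set T)) (X : R -> T -> R).
Hypothesis hF : usual_filtration P F.
Hypothesis hX : levy_process P F X.
Hypothesis hX0 : forall w, X 0 w = 0.
Hypothesis hXc : forall w, cadlag (X ^~ w).
Variables (x delta : R) (u f c : R -> R).
Hypothesis delta0 : 0 <= delta.
Hypothesis cu : continuous u.
Hypothesis cf : continuous f.
Hypothesis cc : continuous c.
Hypothesis iu : forall n y, intg P (fun w => u (y + X (dyadic n) w)).
Variables (a : nat -> nat -> T -> R) (D : R -> T -> R) (m : nat) (s : R) (J : nat -> nat) (g : T -> R).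
Hypothesis J_oo : forall j, \forall n \near \oo, (j <= J n)%N.
Hypothesis neD : forall w, control_path (D ^~ w).
Hypothesis aF : forall n k, Fm F (k%:R * dyadic n) (a n k).
Hypothesis a_nd : forall n j k w, (j <= k)%N -> a n j w <= a n k w.
Hypothesis a_ge0 : forall n k w, 0 <= a n k w.
Hypothesis a_le : forall n k w, (k <= m * 2 ^ n)%N -> a n k w <= D (k%:R * dyadic n) w.
Hypothesis a_lim : forall w t t' l, 0 <= t -> t < t' -> l < D t w ->
  \forall n \near \oo, forall k, (k <= m * 2 ^ n)%N -> t' <= k%:R * dyadic n -> l <= a n k w.
Hypothesis a_end : forall w, a n (m * 2 ^ n)%N w @[n --> \oo] --> D m%:R w.
Local Notation Y n := (chain_pos X x (dyadic n) (a n)).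
Local Notation p n := (pos X x (dyadic n)).
Local Notation CC := (prim c).
Hypothesis hv : forall n k w, s * (u (p n k w - prev (a n) k w) - u (Y n k w)) <=
  s * control_step X x (dyadic n) CC (a n) k w.
Hypothesis hvt : forall n k w, `|Y n k w| <= (J n)%:R - 1 ->
  - ((J n).+1%:R^-1 * dyadic n) <=
  s * (expR (- delta * dyadic n) * mean_shift P X u (dyadic n) (Y n k w) + dyadic n * f (Y n k w) - u (Y n k w)).
Hypothesis iu1 : forall n k, intg P (fun w => u (p n k.+1 w - a n k w)).
Hypothesis iu0 : forall n k, intg P (fun w => u (Y n k w)).
Hypothesis if0 : forall n k, intg P (fun w => f (Y n k w)).
Hypothesis iC : forall n k, intg P (control_step X x (dyadic n) CC (a n) k).
Hypothesis ig : intg P g.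
Hypothesis hg : forall n j w, (j <= m * 2 ^ n)%N -> `|cost_upto X x (dyadic n) delta u f CC (a n) j w| <= g w.

(* The control cost is an integral over the levels reached by [D], not over time. *)
Definition horizon_cost w :=
  \int[mu]_(t in `]0, m%:R]) (discount delta t * f (x + lm (X ^~ w) t - lm (D ^~ w) t)) +
  \int[mu]_(l in `]0, D m%:R w]) lev_pos delta x c (X ^~ w) (D ^~ w) l +
  discount delta m%:R * u (x + X m%:R w - D m%:R w).

Lemma prevE n k w : prev (a n) k w = pv (fun k => a n k w) k.
Proof. by case: k. Qed.

Lemma cost_upto_cvg w :
  cost_upto X x (dyadic n) delta u f CC (a n) (m * 2 ^ n) w @[n --> \oo] --> horizon_cost w.
Proof.
have b1 n j k : (j <= k)%N -> a n j w <= a n k w by exact: a_nd.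
have b2 n k : 0 <= a n k w by exact: a_ge0.
have b3 n k : (k <= m * 2 ^ n)%N -> a n k w <= D (k%:R * dyadic n) w by exact: a_le.
have b4 := @a_lim w.
have [_ c1] := @run_cvg R delta x f (X ^~ w) (D ^~ w) m delta0 cf (hXc w) (neD w) (fun n k => a n k w) b2 b3 b4.
have [_ c2] := @ctrl_cvg R delta x c (X ^~ w) (D ^~ w) m delta0 cc (hXc w) (neD w) (fun n k => a n k w) b1 b2 b3 b4 (@a_end w).
rewrite /cost_upto /horizon_cost; apply: cvgD; last first.
  apply: (@cvg_trans _ ((fun n => discount delta m%:R * u (x + X m%:R w - a n (m * 2 ^ n)%N w)) @ \oo)).
    by apply: near_eq_cvg; near=> n; rewrite /ee /chain_pos /pos khm.
  apply: cvgM; first exact: cvg_cst.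
  by apply: cvg_cont => //; apply: cvgB => //; exact: cvg_cst.
apply: cvgD; first exact: c1.
apply: cvg_trans c2; apply: near_eq_cvg; near=> n.
by apply: eq_bigr => k _; rewrite /control_step prevE.
Unshelve. all: by end_near. Qed.

Local Notation Qs n := (stopped_cost X x (dyadic n) delta (fun y => s * u y) (fun y => s * f y) (fun y => s * CC y)
  (a n) (fun y => `|y| <= (J n)%:R - 1)).

Lemma cost_upto_scale n j w :
  cost_upto X x (dyadic n) delta (fun y => s * u y) (fun y => s * f y) (fun y => s * CC y) (a n) j w =
  s * cost_upto X x (dyadic n) delta u f CC (a n) j w.
Proof.
rewrite /cost_upto !mulrDr !mulr_sumr; congr (_ + _ + _); last by ring.
  by apply: eq_bigr => k _; ring.
by apply: eq_bigr => k _; rewrite /control_step; ring.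
Qed.

Lemma Jinv_cvg : ((J n).+1%:R^-1 : R) @[n --> \oo] --> (0 : R).
Proof.
apply/cvgrPdist_le => e e0; near=> n.
rewrite sub0r normrN ger0_norm ?invr_ge0//.
rewrite -[leRHS]invrK lef_pV2 ?posrE ?invr_gt0//.
apply/ltW/(lt_le_trans (truncnS_gt _)); rewrite ler_nat ltnS.
near: n; exact: J_oo.
Unshelve. all: by end_near. Qed.

(** Up to time [m] a given path, with its control, stays in a fixed ball, so on fine grids the
    freezing never occurs. *)
Lemma Qs_cvg w : Qs n (m * 2 ^ n) w @[n --> \oo] --> s * horizon_cost w.
Proof.
have c1 : s * cost_upto X x (dyadic n) delta u f CC (a n) (m * 2 ^ n) w @[n --> \oo] --> s * horizon_cost w.
  by apply: cvgMr; exact: cost_upto_cvg.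
apply: cvg_trans c1; apply: near_eq_cvg; near=> n.
rewrite -cost_upto_scale stopped_cost_run// => k km; apply: inside_upto_all => j jk.
have jm : (j <= m * 2 ^ n)%N by rewrite (leq_trans jk)// ltnW.
have D0 : 0 <= D m%:R w by exact: (nd_ge0 (neD w)).
apply: (@le_trans _ _ (`|x| + Xs X m%:R w + D m%:R w)).
  rewrite /chain_pos /pos; apply: (le_trans (ler_normB _ _)); apply: lerD.
    apply: (le_trans (ler_normD _ _)); rewrite lerD2l.
    by apply: (Xs_ub hXc); [exact: kh_ge0|exact: kh_m].
  rewrite ger0_norm//; apply: (le_trans (a_le w jm)).
  by apply: (nd_le (neD w)); [exact: kh_ge0|exact: kh_m].
rewrite lerBrDr; apply/ltW/(lt_le_trans (truncnS_gt _)); rewrite ler_nat.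
near: n; exact: J_oo.
Unshelve. all: by end_near. Qed.

(** The sign [s] is 1 for an arbitrary control and -1 for the reflecting one, for which the reversed
    inequalities hold. The function [g] dominates the costs of the chain at all indices, hence also
    the stopped ones. *)
Lemma chain_limit : intg P horizon_cost /\ s * u x <= s * EE P horizon_cost.
Proof.
have scale (v : T -> R) : intg P v -> intg P (fun w => s * v w) by exact: intgZ.
have h0 n := dyadic_ge0 n (R := R).
have mG n : measurable_fun setT (fun y : R => (`|y| <= (J n)%:R - 1)%R%:R : R).
  apply: measurableT_comp => //; apply: measurable_fun_ler => //; exact: measurableT_comp.
have iu0' n k : intg P (fun w => s * u (Y n k w)) by exact: scale.
have if0' n k : intg P (fun w => s * f (Y n k w)) by exact: scale.
have iC' n k : intg P (control_step X x (dyadic n) (fun y => s * CC y) (a n) k).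
  rewrite (_ : control_step _ _ _ _ _ _ = (fun w => s * control_step X x (dyadic n) CC (a n) k w)); first exact: scale.
  by apply/funext => w; rewrite /control_step /=; ring.
have iQ n k : intg P (Qs n k).
  exact: (@stopped_cost_intg _ _ _ P F X hF hX x (dyadic n) delta (fun y => s * u y) (fun y => s * f y)
    (fun y => s * CC y) (a n) _ (h0 n) (aF n) (mG n) (iu0' n) (if0' n) (iC' n)).
have mQ n : measurable_fun setT (Qs n (m * 2 ^ n)) by exact: (intg_meas (iQ n _)).
have bQ n w : `|Qs n (m * 2 ^ n) w| <= `|s| * g w.
  have [j jm ->] := stopped_cost_stop X x (dyadic n) delta (fun y => s * u y) (fun y => s * f y) (fun y => s * CC y)
    (a n) (fun y => `|y| <= (J n)%:R - 1) (m * 2 ^ n) w.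
  by rewrite cost_upto_scale normrM ler_wpM2l// hg.
have [_ cE] := EE_cvg mQ Qs_cvg (intgZ `|s| ig) bQ.
have mc n : measurable_fun setT (cost_upto X x (dyadic n) delta u f CC (a n) (m * 2 ^ n)).
  apply: (intg_meas (P := P)); rewrite /cost_upto; apply: intgD; last exact: intgZ.
  apply: intgD; apply: (@intg_sum _ _ _ P _ _ (fun (j : 'I_ _) w => _)) => j.
    by apply: intgZ; exact: intgZ.
  exact: intgZ.
have [ih _] := EE_cvg mc cost_upto_cvg ig (fun n w => hg w (leqnn _)).
split => //; rewrite -EEZ//.
(* The accumulated error is the precision [1 / (J n + 1)] times the horizon, and vanishes in the
   limit. *)
have cE' : EE P (Qs n (m * 2 ^ n)) + (J n).+1%:R^-1 * m%:R @[n --> \oo] -->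
    EE P (fun w => s * horizon_cost w) + 0 * m%:R.
  by apply: cvgD => //; apply: cvgM; [exact: Jinv_cvg|exact: cvg_cst].
rewrite mul0r addr0 in cE'.
apply: (cvg_ge_near cE'); near=> n.
rewrite -[m%:R in leRHS](khm n m).
apply: (@chain _ _ _ P F X hF hX hX0 x (dyadic n) delta (fun y => s * u y) (fun y => s * f y)
  (fun y => s * CC y) (a n) _ (h0 n) delta0 (aF n)) => //.
- by move=> k w; rewrite -mulrBr /control_step -mulrBr; exact: hv.
- move=> k w hY; apply: (le_trans (hvt hY)).
  have -> : mean_shift P X (fun y => s * u y) (dyadic n) (Y n k w) = s * mean_shift P X u (dyadic n) (Y n k w).
    by rewrite /mean_shift EEZ.
  by rewrite le_eqVlt; apply/orP; left; apply/eqP; ring.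
- by apply: measurable_funM => //; exact: continuous_measurable_fun.
- by move=> y; exact: scale.
- by move=> k; exact: scale.
Unshelve. all: by end_near. Qed.

End chain_limit.

(** * Measurability and truncation in time of the cost *)

Section random_costs.
Context {R : realType} {d : measure_display} {T : measurableType d}.
Local Notation mu := (@lebesgue_measure R).
Variables (P : probability T R) (X : R -> T -> R).
Hypothesis mX : forall t : R, 0 <= t -> measurable_fun setT (X t).
Hypothesis hXc : forall w, cadlag (X ^~ w).
Variables (x delta : R) (D : R -> T -> R).
Hypothesis delta0 : 0 <= delta.
Hypothesis mD : forall t : R, 0 <= t -> measurable_fun setT (D t).
Hypothesis neD : forall w, control_path (D ^~ w).
Local Notation Rn k w := (running_density delta x (X ^~ w) (D ^~ w) k).

Lemma pos_meas t : 0 <= t -> measurable_fun setT (fun w => x + X t w - D t w).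
Proof. by move=> t0; apply: measurable_funB; [apply: measurable_funD => //; exact: mX|exact: mD]. Qed.

Section running.
Variable k : R -> R.
Hypothesis ck : continuous k.

(** Integrals along the paths are measurable in [w] as limits of such finite sums. *)
Definition run_sum n m w := \sum_(j < m * 2 ^ n) dyadic n *
  (discount delta (j%:R * dyadic n) * k (x + X (j%:R * dyadic n) w - D (j%:R * dyadic n) w)).

Lemma run_sum_meas n m : measurable_fun setT (run_sum n m).
Proof.
apply: measurable_sum => j; apply: measurable_funM => //; apply: measurable_funM => //.
apply: measurableT_comp; first exact: continuous_measurable_fun.
by apply: pos_meas; exact: kh_ge0.
Qed.

Lemma run_upto_meas (m : nat) : measurable_fun setT (fun w => \int[mu]_(s in `]0, m%:R]) Rn k w s).
Proof.
apply: (@measurable_fun_cvg _ _ _ _ (fun n w => run_sum n m w)) => [n|w _].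
  exact: run_sum_meas.
exact: (running_density_cvg x delta0 (hXc w) (neD w) m ck).2.
Qed.

Hypothesis k0 : forall y, 0 <= k y.

Lemma Rn_ge0 w s : 0 <= Rn k w s.
Proof. by rewrite mulr_ge0// expR_ge0. Qed.

Lemma run_upto_EFin w (m : nat) :
  (\int[mu]_(s in `]0%R, m%:R]) (Rn k w s)%:E)%E = (\int[mu]_(s in `]0, m%:R]) Rn k w s)%:E.
Proof.
by rewrite /Rintegral fineK//; apply: integrable_fin_num => //; exact: (running_density_cvg x delta0 (hXc w) (neD w) m ck).1.
Qed.

Lemma run_total_cvg w : (\int[mu]_(s in `]0, m%:R]) Rn k w s)%:E @[m --> \oo] -->
  (\int[mu]_(s in `]0%R, +oo[) (Rn k w s)%:E)%E.
Proof.
have mk := running_density_meas x delta0 (hXc w) (neD w) ck.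
rewrite Rpos_bigcup; under eq_fun do rewrite -run_upto_EFin.
apply: ge0_nondecreasing_set_cvg_integral => //.
- move=> i j ij; apply/subsetPset => s /=; rewrite !in_itv/= => /andP[-> si].
  by apply: (le_trans si); rewrite ler_nat.
- move=> i; apply/measurable_EFinP; apply: measurable_funS mk => //.
  by move=> s /=; rewrite !in_itv/= andbT => /andP[].
- by move=> i s _; rewrite lee_fin Rn_ge0.
Qed.

Lemma run_total_meas : measurable_fun setT (fun w => \int[mu]_(s in `]0%R, +oo[) (Rn k w s)%:E)%E.
Proof.
apply: (@emeasurable_fun_cvg _ _ _ _ (fun m w => (\int[mu]_(s in `]0, m%:R]) Rn k w s)%:E)).
  by move=> m; apply/measurable_EFinP; exact: run_upto_meas.
by move=> w _; exact: run_total_cvg.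
Qed.

End running.

Lemma attained_sup (m : nat) w : [set` `]0, D m%:R w]] `<=` attained (D ^~ w).
Proof. by move=> l /=; rewrite in_itv/= => /andP[l0 lm]; split => //; exists m%:R. Qed.

Section controls.
Variable c : R -> R.
Hypothesis cc : continuous c.
Local Notation Ln phi w := (level_density delta x c (X ^~ w) (D ^~ w) phi).

Section levels.
Variable phi : R -> R.
Hypothesis cphi : continuous phi.

Definition lev_sum n m w := \sum_(j < (m * 2 ^ n).+1) discount delta (j%:R * dyadic n) *
  ((D (j%:R * dyadic n) w - pv (fun j => D (j%:R * dyadic n) w) j) *
     phi (cbar c (x + X (j%:R * dyadic n) w - pv (fun j => D (j%:R * dyadic n) w) j)
                 (D (j%:R * dyadic n) w - pv (fun j => D (j%:R * dyadic n) w) j))).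

Lemma pv_meas n j : measurable_fun setT (fun w => pv (fun j => D (j%:R * dyadic n) w) j).
Proof. by case: j => [|j] /=; [exact: measurable_cst|apply: mD; exact: kh_ge0]. Qed.

Lemma cbar_meas (p q : T -> R) : measurable_fun setT p -> measurable_fun setT q ->
  measurable_fun setT (fun w => cbar c (p w) (q w)).
Proof.
move=> mp mq.
apply: (@measurable_fun_cvg _ _ _ _ (fun n w => \sum_(k < 1 * 2 ^ n) dyadic n * c (p w - k%:R * dyadic n * q w))).
  move=> n; apply: measurable_sum => k; apply: measurable_funM => //.
  apply: measurableT_comp; first exact: continuous_measurable_fun.
  by apply: measurable_funB => //; exact: measurable_funM.
move=> w _; have [M M0 MP] := continuous_bounded (`|p w| + `|q w|) cc.
have [] := @time_cvg R (fun n k => c (p w - k%:R * dyadic n * q w)) 1 M (fun s => c (p w - s * q w)) M0.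
- move=> n k km; apply: MP; apply: (le_trans (ler_normB _ _)); rewrite lerD2l normrM ler_piMl//.
  rewrite ger0_norm ?kh_ge0//; have := @kh_m R n 1 k (ltnW km); exact.
- move=> s s0 s1; apply: cvg_cont => //; apply: cvgB; first exact: cvg_cst.
  by apply: cvgM; [exact: ck_pred_cvg|exact: cvg_cst].
move=> _; rewrite (Rintegral_itv_obnd_cbnd) //.
apply: integrableS (integrable_continuous 0 1 (@comp_affine_cont R c cc (p w) (q w))) => //.
by apply: subset_itvr; rewrite bnd_simp.
Qed.

Lemma lev_sum_meas n m : measurable_fun setT (lev_sum n m).
Proof.
apply: measurable_sum => j; apply: measurable_funM => //.
have mDj : measurable_fun setT (D (j%:R * dyadic n)) by apply: mD; exact: kh_ge0.
have mXj : measurable_fun setT (X (j%:R * dyadic n)) by apply: mX; exact: kh_ge0.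
have mp := pv_meas n j.
apply: measurable_funM; first exact: measurable_funB.
apply: measurableT_comp; first exact: continuous_measurable_fun.
apply: cbar_meas; last exact: measurable_funB.
by apply: measurable_funB => //; exact: measurable_funD.
Qed.

Lemma lev_upto_meas (m : nat) : measurable_fun setT (fun w => \int[mu]_(l in `]0, D m%:R w]) Ln phi w l).
Proof.
apply: (@measurable_fun_cvg _ _ _ _ (fun n w => lev_sum n m w)) => [n|w _].
  exact: lev_sum_meas.
exact: (average_cvg x m delta0 cc (hXc w) (neD w) cphi).2.
Qed.

Hypothesis phi0 : forall y, 0 <= phi y.

Lemma lev_upto_EFin w (m : nat) :
  (\int[mu]_(l in `]0%R, D m%:R w]) (Ln phi w l)%:E)%E = (\int[mu]_(l in `]0, D m%:R w]) Ln phi w l)%:E.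
Proof.
rewrite /Rintegral fineK//; apply: integrable_fin_num => //.
exact: (average_cvg x m delta0 cc (hXc w) (neD w) cphi).1.
Qed.

Lemma lev_total_cvg w : (\int[mu]_(l in `]0, D m%:R w]) Ln phi w l)%:E @[m --> \oo] -->
  (\int[mu]_(l in attained (D ^~ w)) (Ln phi w l)%:E)%E.
Proof.
have mk := level_density_meas x delta0 cc (hXc w) (neD w) cphi.
rewrite attained_bigcup//; under eq_fun do rewrite -lev_upto_EFin.
apply: ge0_nondecreasing_set_cvg_integral => //.
- move=> i j ij; apply/subsetPset => s /=; rewrite !in_itv/= => /andP[-> si].
  by apply: (le_trans si); apply: (nd_le (neD w)) => //; rewrite ler_nat.
- move=> i; apply/measurable_EFinP; apply: measurable_funS mk => //; first exact: attained_meas.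
  exact: attained_sup.
- by move=> i s _; rewrite lee_fin mulr_ge0// expR_ge0.
Qed.

Lemma lev_total_meas : measurable_fun setT (fun w => \int[mu]_(l in attained (D ^~ w)) (Ln phi w l)%:E)%E.
Proof.
apply: (@emeasurable_fun_cvg _ _ _ _ (fun m w => (\int[mu]_(l in `]0, D m%:R w]) Ln phi w l)%:E)).
  by move=> m; apply/measurable_EFinP; exact: lev_upto_meas.
by move=> w _; exact: lev_total_cvg.
Qed.

End levels.

Variable f : R -> R.
Hypothesis cf : continuous f.

Definition regular_abs_cost w := path_abs_cost delta f c x (from0 (X ^~ w)) (from0 (D ^~ w)).

Lemma norm_cont (k : R -> R) : continuous k -> continuous (Num.norm \o k).
Proof. by move=> ck y; apply: continuous_comp; [exact: ck|exact: norm_continuous]. Qed.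

Lemma abscE w : regular_abs_cost w = (\int[mu]_(s in `]0%R, +oo[) (Rn (Num.norm \o f) w s)%:E +
  \int[mu]_(l in attained (D ^~ w)) (Ln Num.norm w l)%:E)%E.
Proof. by rewrite /regular_abs_cost path_abs_costE//. Qed.

Lemma regular_abs_cost_meas : measurable_fun setT regular_abs_cost.
Proof.
rewrite (_ : regular_abs_cost = (fun w => (\int[mu]_(s in `]0%R, +oo[) (Rn (Num.norm \o f) w s)%:E +
  \int[mu]_(l in attained (D ^~ w)) (Ln Num.norm w l)%:E)%E)); last by apply/funext => w; exact: abscE.
apply: emeasurable_funD.
  by apply: run_total_meas; [exact: norm_cont|move=> y; exact: normr_ge0].
by apply: lev_total_meas => //; exact: norm_continuous.
Qed.

Lemma regular_abs_cost_ge0 w : (0 <= regular_abs_cost w)%E.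
Proof.
rewrite abscE adde_ge0//; apply: integral_ge0 => s _; rewrite lee_fin.
  by rewrite -running_density_norm.
by rewrite -level_density_norm.
Qed.

Definition upto (m : nat) w := \int[mu]_(s in `]0, m%:R]) Rn f w s + \int[mu]_(l in `]0, D m%:R w]) Ln id w l.

(* [path_cost] as a sum of Lebesgue integrals, which is seen to be measurable in [w]. *)
Definition regular_cost w := if (regular_abs_cost w < +oo)%E then
  \int[mu]_(s in `]0, +oo[) Rn f w s + \int[mu]_(l in attained (D ^~ w)) Ln id w l else 0.

Lemma regular_cost_cost w : (regular_abs_cost w < +oo)%E ->
  path_cost delta f c x (from0 (X ^~ w)) (from0 (D ^~ w)) = (regular_cost w)%:E.
Proof. by move=> h; rewrite /regular_cost h path_costE. Qed.

Lemma upto_cvg w : (regular_abs_cost w < +oo)%E -> upto m w @[m --> \oo] --> regular_cost w.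
Proof.
move=> h; rewrite /regular_cost h; have [i1 i2] := fin_cost_integrable delta0 cf cc (hXc w) (neD w) h.
apply: cvgD.
  apply: (@Rint_set_cvg _ _ (fun m => [set` `]0, m%:R]]) _ set0) => //.
  - by move=> n s /=; rewrite !in_itv/= andbT => /andP[].
  - move=> s /=; rewrite in_itv/= andbT => s0 _; near=> m; rewrite /= in_itv/= s0/=.
    apply/ltW/(lt_le_trans (truncnS_gt _)); rewrite ler_nat; near: m.
    by exists (Num.truncn s).+1.
apply: (@Rint_set_cvg _ _ (fun m => [set` `]0, D m%:R w]]) _ set0) => //.
- exact: attained_meas.
- by move=> n; exact: attained_sup.
- move=> l [l0 [t t0 lt]] _; near=> m; rewrite /= in_itv/= l0/=; apply: (le_trans lt).
  apply: (nd_le (neD w)) => //; apply/ltW/(lt_le_trans (truncnS_gt _)); rewrite ler_nat; near: m.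
  by exists (Num.truncn t).+1.
Unshelve. all: by end_near. Qed.

Lemma part_le (A B : set R) (k : R -> R) : measurable A -> measurable B -> A `<=` B ->
  mu.-integrable B (EFin \o k) -> `|\int[mu]_(s in A) k s| <= \int[mu]_(s in B) `|k s|.
Proof.
move=> mA mB AB ik; have ikA := @integrableS _ _ _ mu _ _ _ mB mA AB ik.
have hn := @le_normr_Rintegral _ _ _ mu A k mA ikA; apply: (le_trans hn).
have in_ := integrable_norm ik.
apply: fine_le.
- by apply: integrable_fin_num => //; exact: integrable_norm.
- exact: integrable_fin_num.
by apply: ge0_subset_integral => //; exact: (measurable_int mu in_).
Qed.

Lemma abs_fine w : (regular_abs_cost w < +oo)%E -> fine (regular_abs_cost w) =
  \int[mu]_(s in `]0, +oo[) `|Rn f w s| + \int[mu]_(l in attained (D ^~ w)) `|Ln id w l|.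
Proof.
move=> h; have [i1 i2] := fin_cost_integrable delta0 cf cc (hXc w) (neD w) h.
rewrite abscE fineD.
- congr (_ + _); rewrite /Rintegral; congr fine; apply: eq_integral => s _.
    by rewrite running_density_norm.
  by rewrite level_density_norm.
- have := integrable_fin_num _ (integrable_norm i1).
  by under eq_integral do rewrite /= running_density_norm; apply.
- have := integrable_fin_num _ (integrable_norm i2).
  by under eq_integral do rewrite /= level_density_norm; apply; exact: attained_meas.
Qed.

Lemma upto_le m w : (regular_abs_cost w < +oo)%E -> `|upto m w| <= fine (regular_abs_cost w).
Proof.
move=> h; have [i1 i2] := fin_cost_integrable delta0 cf cc (hXc w) (neD w) h.
rewrite abs_fine//; apply: (le_trans (ler_normD _ _)); apply: lerD; apply: part_le => //.
- by move=> s /=; rewrite !in_itv/= andbT => /andP[].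
- exact: attained_meas.
- exact: attained_sup.
Qed.

Lemma regular_cost_le w : (regular_abs_cost w < +oo)%E -> `|regular_cost w| <= fine (regular_abs_cost w).
Proof.
by move=> h; apply: (cvg_le_near (cvg_norm (upto_cvg h))); near=> m; exact: upto_le.
Unshelve. all: by end_near. Qed.

Lemma upto_meas m : measurable_fun setT (upto m).
Proof.
apply: measurable_funD; first exact: run_upto_meas.
by apply: lev_upto_meas => y; exact: cvg_id.
Qed.

Lemma fin_meas : measurable_fun setT (fun w => (regular_abs_cost w < +oo)%E).
Proof. by apply: measurable_fun_lte => //; exact: regular_abs_cost_meas. Qed.

Lemma regular_cost_meas : measurable_fun setT regular_cost.
Proof.
apply: (@measurable_fun_cvg _ _ _ _ (fun m w => if (regular_abs_cost w < +oo)%E then upto m w else 0)).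
  move=> m; apply: measurable_fun_ifT => //; [exact: fin_meas|exact: upto_meas].
move=> w _; case: (boolP (regular_abs_cost w < +oo)%E) => h; first exact: upto_cvg.
by rewrite /regular_cost (negbTE h); exact: cvg_cst.
Qed.

End controls.
End random_costs.

(** * Running suprema and their approximation on grids *)

Section running_sup.
Context {R : realType}.
Implicit Types (s t l : R).
Variable g : R -> R.

Definition run_sup t := sup [set g s | s in `[0, t]].

Hypothesis g_rc : forall s, 0 <= s -> g @ s^'+ --> g s.
Hypothesis g_bd : forall t, exists M, forall s, 0 <= s -> s <= t -> g s <= M.
Hypothesis g_ge0 : forall s, 0 <= s -> 0 <= g s.

Lemma run_sup_ge s t : 0 <= s -> s <= t -> g s <= run_sup t.
Proof.
move=> s0 st; apply: ub_le_sup; last by exists s => //=; rewrite in_itv/= s0.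
have [M MP] := g_bd t.
by exists M => _ [r + <-]; rewrite /= in_itv/= => /andP[r0 rt]; exact: MP.
Qed.

Lemma run_sup_le t M : 0 <= t -> (forall s, 0 <= s -> s <= t -> g s <= M) -> run_sup t <= M.
Proof.
move=> t0 gM; apply: ge_sup; first by exists (g 0); exists 0 => //=; rewrite in_itv/= lexx.
by move=> _ [s + <-]; rewrite /= in_itv/= => /andP[s0 st]; exact: gM.
Qed.

Lemma run_sup_lt_ex t l : 0 <= t -> l < run_sup t -> exists s, [/\ 0 <= s, s <= t & l < g s].
Proof.
move=> t0 lt; apply: contrapT => h; have : run_sup t <= l.
  by apply: run_sup_le => // s s0 st; rewrite leNgt; apply/negP => ls; apply: h; exists s.
by rewrite leNgt lt.
Qed.

Lemma run_sup_nd s t : 0 <= s -> s <= t -> run_sup s <= run_sup t.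
Proof.
by move=> s0 st; apply: run_sup_le => // r r0 rs; apply: run_sup_ge => //; exact: le_trans st.
Qed.

Lemma control_path_run_sup : control_path run_sup.
Proof.
split => [t t0|s t s0 st|t t0]; first exact: le_trans (g_ge0 t0) (run_sup_ge t0 (lexx t)).
  exact: run_sup_nd.
apply/cvgrPdist_le => e e0; have [r r0 rP] := rc_near (g_rc t0) e0.
near=> s; have ts : t <= s by near: s; exact: nbhs_right_ge.
have sr : s < t + r by near: s; apply: nbhs_right_lt; rewrite ltrDl.
rewrite distrC ger0_norm ?subr_ge0 ?run_sup_nd// lerBlDl.
apply: run_sup_le => [|q q0 qs]; first exact: le_trans ts.
case: (leP q t) => qt; first by rewrite (le_trans (run_sup_ge q0 qt))// lerDl ltW.
have := rP q (ltW qt) (le_lt_trans qs sr); rewrite ltr_norml => /andP[_ h].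
by have := run_sup_ge t0 (lexx t); lra.
Unshelve. all: by end_near. Qed.

Lemma grid_max_le_run_sup h k : 0 <= h -> grid_max g h k <= run_sup (k%:R * h).
Proof.
by move=> h0; apply: grid_max_le => j jk; apply: run_sup_ge; rewrite ?mulr_ge0// ler_wpM2r// ler_nat.
Qed.

Lemma grid_max_run_sup_near s t' l : 0 <= s -> s < t' -> l < g s ->
  \forall n \near \oo, forall k, t' <= k%:R * dyadic n -> l <= grid_max g (dyadic n) k.
Proof.
move=> s0 st ls; have [r r0 rP] := rc_near (g_rc s0) (e := g s - l) ltac:(by rewrite subr_gt0).
have rt : 0 < Num.min r (t' - s) by rewrite lt_min r0 subr_gt0.
have hs : \forall n \near \oo, dyadic n < Num.min r (t' - s).
  move/cvgrPdist_lt : (@dyadic_cvg0 R) => /(_ _ rt); apply: filterS => n.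
  by rewrite sub0r normrN ger0_norm ?dyadic_ge0.
apply: filterS hs => n; rewrite lt_min => /andP[hr ht] k tk.
have cs := cT_ge n s0; have cl := cT_lt n s0.
have /rP : s <= cT n s by [].
move=> /(_ ltac:(lra)); rewrite ltr_norml => /andP[h _].
apply: (@le_trans _ _ (g (cT n s))); first lra.
apply: grid_max_ge; rewrite ck_le//; lra.
Qed.

(** This is the property asked of an approximating control: a value above [l] at some time up to [t]
    persists, by right-continuity, to the next grid point, which comes before [t']. *)
Lemma grid_max_run_sup_lim t t' l : 0 <= t -> t < t' -> l < run_sup t ->
  \forall n \near \oo, forall k, t' <= k%:R * dyadic n -> l <= grid_max g (dyadic n) k.
Proof.
move=> t0 tt /(run_sup_lt_ex t0)[s [s0 st ls]].
by apply: grid_max_run_sup_near ls => //; exact: le_lt_trans tt.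
Qed.

Lemma grid_max_run_sup_end (m : nat) : grid_max g (dyadic n) (m * 2 ^ n) @[n --> \oo] --> run_sup m%:R.
Proof.
apply/cvgrPdist_le => e e0.
have [|s [s0 sm ls]] := @run_sup_lt_ex m%:R (run_sup m%:R - e) (ler0n _ _); first by rewrite ltrBlDr ltrDl.
have up n : grid_max g (dyadic n) (m * 2 ^ n) <= run_sup m%:R.
  by rewrite -(khm n m); apply: grid_max_le_run_sup; exact: dyadic_ge0.
suff : \forall n \near \oo, run_sup m%:R - e <= grid_max g (dyadic n) (m * 2 ^ n).
  apply: filterS => n h; rewrite ger0_norm ?subr_ge0//; lra.
move: sm; rewrite le_eqVlt => /predU1P[sm|sm].
  near=> n; apply: (le_trans (ltW ls)); rewrite sm -(khm n m); exact: grid_max_ge.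
have := grid_max_run_sup_near s0 sm ls; apply: filterS => n; apply; by rewrite khm.
Unshelve. all: by end_near. Qed.

End running_sup.

Section running_sup_adapted.
Context {R : realType} {d : measure_display} {T : measurableType d}.
Variables (P : probability T R) (F : R -> set (set T)).
Hypothesis hF : usual_filtration P F.
Variable g : R -> T -> R.
Hypothesis g_rc : forall w s, 0 <= s -> g ^~ w @ s^'+ --> g s w.
Hypothesis g_bd : forall w t, exists M, forall s, 0 <= s -> s <= t -> g s w <= M.
Hypothesis gF : forall t, 0 <= t -> Fm F t (g t).

(** The grids subdivide [[0, t]] itself, so the maxima are known at time [t] and not only at the
    next dyadic time. *)
Lemma run_sup_F t : 0 <= t -> Fm F t (fun w => run_sup (g ^~ w) t).
Proof.
move=> t0; apply/(FmE hF _ t0).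
apply: (@measurable_fun_cvg _ (g_sigma_algebraType (F t)) R _ (fun n w => grid_max (g ^~ w) (t * dyadic n) (2 ^ n))) => [n|w _].
  apply/(FmE hF _ t0); have th : 0 <= t * dyadic n by rewrite mulr_ge0// dyadic_ge0.
  by have := Fm_grid_max hF (2 ^ n) th gF; rewrite mulrCA hhM mulr1.
have [M MP] := g_bd w t; apply: (grid_max_cvg (M := M)) => // s s0 st; exact: g_rc.
Qed.

End running_sup_adapted.

Section almost_everywhere.
Context {R : realType} {d : measure_display} {T : measurableType d}.
Variable P : probability T R.

Lemma EE_ae (f g : T -> R) : measurable_fun setT f -> measurable_fun setT g ->
  {ae P, forall w, f w = g w} -> EE P f = EE P g.
Proof.
move=> mf mg fg; rewrite /EE /Rintegral; congr fine.
apply: ae_eq_integral => //; [exact/measurable_EFinP|exact/measurable_EFinP|].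
by apply: filterS fg => w /= -> _.
Qed.

Lemma intg_ae (f g : T -> R) : measurable_fun setT f -> measurable_fun setT g ->
  {ae P, forall w, f w = g w} -> intg P f -> intg P g.
Proof.
move=> mf mg fg jf; apply/integrableP; split; first exact/measurable_EFinP.
move/integrableP : jf => [_]; congr (_ < _)%E.
apply: ae_eq_integral => //; [exact/measurableT_comp/measurable_EFinP|
  exact/measurableT_comp/measurable_EFinP|].
by apply: filterS fg => w /= -> _.
Qed.

Lemma intg_ae_lty (A : T -> \bar R) : measurable_fun setT A -> (forall w, 0 <= A w)%E ->
  (\int[P]_w A w < +oo)%E -> intg P (fun w => fine (A w)) /\ {ae P, forall w, (A w < +oo)%E}.
Proof.
move=> mA A0 iA.
have jA : P.-integrable setT A.
  by apply/integrableP; split => //; under eq_integral do rewrite gee0_abs//.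
have aeA : {ae P, forall w, (A w < +oo)%E}.
  have := integrable_ae measurableT jA; apply: filterS => w /(_ I).
  by rewrite ge0_fin_numE.
split => //; apply/integrableP; split; first by apply/measurable_EFinP; exact: measurableT_comp.
apply: le_lt_trans iA; apply: ge0_le_integral => //.
- by apply/measurableT_comp => //; apply/measurable_EFinP; exact: measurableT_comp.
- move=> w _ /=; rewrite ger0_norm ?fine_ge0//; by have := A0 w; case: (A w) => [r _|_|]; rewrite ?lexx ?leey.
Qed.

End almost_everywhere.

Section geometric_grid.
Context {R : realType}.

(** A geometric series with ratio [e^{- kappa h}]; since [h <= 1],
    [1 - e^{- kappa h} >= kappa h e^{- kappa}], which makes the bound independent of the grid. *)
Lemma grid_sum_le (kappa : R) n M : 0 < kappa ->
  \sum_(j < M) dyadic n * expR (- kappa * (j%:R * dyadic n)) <= expR kappa / kappa.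
Proof.
move=> k0; set h := dyadic n; have h0 : 0 < h := dyadic_gt0 n.
have h1 : h <= 1 := dyadic_le1 n.
have q1 : kappa * h * expR (- kappa) <= 1 - expR (- kappa * h).
  have e1 : 1 + kappa * h <= expR (kappa * h) by exact: expR_ge1Dx.
  have e2 : expR (- kappa) <= expR (- kappa * h).
    by rewrite ler_expR mulNr lerN2 ler_piMr// ltW.
  have e3 : expR (kappa * h) * expR (- kappa * h) = 1 by rewrite -expRD mulNr subrr expR0.
  have := expR_gt0 (- kappa * h); have kh : 0 <= kappa * h by rewrite mulr_ge0 ?ltW.
  by move=> p; nra.
suff : kappa * expR (- kappa) * \sum_(j < M) h * expR (- kappa * (j%:R * h)) <= 1 - expR (- kappa * (M%:R * h)).
  move=> H; have kk : 0 < kappa * expR (- kappa) by rewrite mulr_gt0 ?expR_gt0.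
  rewrite -(ler_pM2l kk) (le_trans H)//.
  rewrite -mulrA [expR (- kappa) * _]mulrA -expRD addNr expR0 mul1r divff ?gt_eqF//.
elim: M => [|M IH]; first by rewrite big_ord0 mulr0 mul0r mulr0 expR0 subrr.
rewrite big_ord_recr/= mulrDr.
have -> : - kappa * (M.+1%:R * h) = - kappa * (M%:R * h) + - kappa * h.
  by rewrite -natr1; ring.
rewrite expRD; have := expR_gt0 (- kappa * (M%:R * h)); set e := expR (- kappa * (M%:R * h)) in IH *.
move=> e0; have : e * (kappa * h * expR (- kappa)) <= e * (1 - expR (- kappa * h)) by rewrite ler_wpM2l// ltW.
by move: IH; nra.
Qed.

End geometric_grid.

(** * Lower bound for an arbitrary control *)

Section increments.
Context {R : realType}.
Implicit Types (k c : R -> R).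

Lemma increment_le k (k1 : R -> R) (k' k1' : R -> R) (a b : R) : (forall z : R, is_derive z (1 : R) k (k' z)) ->
  (forall z : R, is_derive z (1 : R) k1 (k1' z)) -> (forall z, a < z -> z < b -> k' z <= k1' z) ->
  a <= b -> k b - k a <= k1 b - k1 a.
Proof.
move=> dk dk1 kk ab.
have : k1 a - k a <= k1 b - k b; last by lra.
apply: (@is_derive_le _ (fun z => k1 z - k z) (fun z => k1' z - k' z)) => //.
by move=> z az zb; rewrite subr_ge0 kk.
Qed.

Lemma prim_lip c (M a b : R) : continuous c -> (forall z, a < z -> z < b -> `|c z| <= M) ->
  a <= b -> `|prim c b - prim c a| <= M * (b - a).
Proof.
move=> cc cM ab.
have dM (r : R) z : is_derive z (1 : R) (fun y : R => r * y) r.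
  by apply: is_derive_eq; rewrite /GRing.scale/= mulr1.
have dp z := prim_derive z cc.
have h1 : prim c b - prim c a <= M * b - M * a.
  apply: (increment_le dp (dM M)) => // z az zb; exact: le_trans (ler_norm _) (cM z az zb).
have h2 : - M * b - - M * a <= prim c b - prim c a.
  apply: (increment_le (dM (- M)) dp) => // z az zb; have := cM z az zb.
  by rewrite ler_norml => /andP[].
by rewrite ler_norml; apply/andP; split; lra.
Qed.

Lemma C1_derive (u : R -> R) : C1 u -> forall z : R, is_derive z (1 : R) u (derive1 u z).
Proof. by move=> [du _] z; rewrite derive1E; apply: derivableP; exact: du. Qed.

Lemma value_increment (u c : R -> R) y z : C1 u -> continuous c -> (forall y, derive1 u y <= c y) ->
  y <= z -> u z - u y <= prim c z - prim c y.
Proof.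
by move=> u1 cc uc yz; apply: (increment_le (C1_derive u1) (fun r => prim_derive r cc)).
Qed.

Lemma value_increment_eq (u c : R -> R) b y z : C1 u -> continuous c ->
  (forall y, derive1 u y <= c y) -> (forall y, b <= y -> derive1 u y = c y) ->
  b <= y -> y <= z -> u z - u y = prim c z - prim c y.
Proof.
move=> u1 cc uc ub yb yz; apply/le_anti/andP; split; first exact: value_increment.
apply: (increment_le (fun r => prim_derive r cc) (C1_derive u1)) => // r yr _.
by rewrite ub// (le_trans yb)// ltW.
Qed.

End increments.

Section stopping_levels.
Context {R : realType} {d : measure_display} {T : measurableType d}.
Variables (P : probability T R) (F : R -> set (set T)) (X : R -> T -> R).
Hypothesis hF : usual_filtration P F.
Hypothesis hX : levy_process P F X.
Hypothesis hX0 : forall w, X 0 w = 0.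
Hypothesis hXc : forall w, cadlag (X ^~ w).
Variables (theta dl : R).
Hypothesis th0 : 0 < theta.
Hypothesis dl0 : 0 <= dl.
Hypothesis mgp : forall t : R, 0 <= t -> (mg P X theta t <= (expR (dl * t))%:E)%E.
Hypothesis mgm : forall t : R, 0 <= t -> (mg P X (- theta) t <= (expR (dl * t))%:E)%E.
Variables (u : R -> R) (K : R).
Hypothesis K0 : 0 <= K.
Hypothesis uK : forall x, `|u x| <= K * (1 + cosh (theta * x)).
Hypothesis cu : continuous u.
Hypothesis u_bv : has_bounded_variation P X -> C1 u.
Hypothesis u_ubv : ~ has_bounded_variation P X -> C2 u.
Variable L : R -> R.
Hypothesis hL : forall y, generator_quotient P X u y t @[t --> 0^'+] --> (L y)%:E.
Variables (delta : R) (f : R -> R).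
Hypothesis delta0 : 0 < delta.
Hypothesis cf : continuous f.

Lemma stopping_levels : exists2 J : nat -> nat, (forall j, \forall n \near \oo, (j <= J n)%N) &
  forall n y, `|y| <= (J n)%:R - 1 ->
    `|step_defect P X u delta f n y - dyadic n * rho u L delta f y| <= (J n).+1%:R^-1 * dyadic n.
Proof.
pose Q j n := forall y : R, `|y| <= j%:R - 1 ->
  `|step_defect P X u delta f n y - dyadic n * rho u L delta f y| <= j.+1%:R^-1 * dyadic n.
have [|j|J J1 J2] := @diagonal Q; last by exists J.
  (* For [j = 0] the radius is -1 and the estimate is vacuous, which starts the diagonal choice. *)
  by move=> n y; rewrite sub0r => h; exfalso; have := normr_ge0 y; lra.
have j0 : 0 < j.+1%:R^-1 :> R by rewrite invr_gt0.
exact: (step_defect_unif hF hX hX0 hXc th0 dl0 mgp mgm K0 uK cu u_bv u_ubv hL f delta0 _ j0).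
Qed.

Lemma rho_cont : continuous (rho u L delta f).
Proof.
have cL := L_cont hF hX hX0 hXc th0 dl0 mgp mgm K0 uK cu u_bv u_ubv hL.
by move=> y; apply: cvgD; [apply: cvgB; [exact: cL|apply: cvgMr; exact: cu]|exact: cf].
Qed.

(** The reflected chain sits at [b] itself after each push, so equality strictly below [b] has to be
    carried to [b] by continuity. *)
Lemma rho_left b : (forall y, y < b -> rho u L delta f y = 0) ->
  forall y, y <= b -> rho u L delta f y = 0.
Proof.
move=> h y; rewrite le_eqVlt => /predU1P[->|]; last exact: h.
have c1 : rho u L delta f y @[y --> b^'-] --> rho u L delta f b.
  by apply: cvg_at_left_filter; exact: rho_cont.
have c2 : rho u L delta f y @[y --> b^'-] --> (0 : R).
  by apply: cvg_near_cst; near=> z; apply: h; near: z; exact: nbhs_left_lt.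
exact: (cvg_unique _ c1 c2).
Unshelve. all: by end_near. Qed.

End stopping_levels.

(** * Capping a control at a level *)

Section capped.
Context {R : realType}.
Implicit Types (s t l : R).
Variables (eta : R -> R) (N : R).
Hypothesis ne : control_path eta.
Hypothesis N0 : 0 < N.

(** Values from [N] on are sent to 0 rather than to [N]: the running supremum then drops a jump
    across [N] altogether instead of cutting it. Every jump that is kept is a whole jump of [eta],
    with the same average cost. *)
Definition cap_below y : R := if y < N then y else 0.
Definition capped_sup t := run_sup (fun s => cap_below (eta s)) t.

Lemma cap_below_rc s : 0 <= s -> (fun s => cap_below (eta s)) @ s^'+ --> cap_below (eta s).
Proof.
move=> s0; have es := nd_rc ne s0; rewrite {2}/cap_below; case: ltP => h.
  apply: cvg_trans es; apply: near_eq_cvg.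
  have [r r0 rP] := rc_near (nd_rc ne s0) (e := N - eta s) ltac:(by rewrite subr_gt0).
  near=> t; rewrite /cap_below ifT//.
  have : `|eta t - eta s| < N - eta s.
    apply: rP; first by near: t; exact: nbhs_right_ge.
    by near: t; apply: nbhs_right_lt; rewrite ltrDl.
  by rewrite ltr_norml => /andP[]; lra.
apply: cvg_near_cst; near=> t; rewrite /cap_below ltNge (le_trans h)//.
by apply: (nd_le ne) => //; near: t; exact: nbhs_right_ge.
Unshelve. all: by end_near. Qed.

Lemma cap_below_ge0 s : 0 <= s -> 0 <= cap_below (eta s).
Proof. by move=> s0; rewrite /cap_below; case: ifP => // _; exact: (nd_ge0 ne). Qed.

Lemma cap_below_leN y : cap_below y <= N.
Proof. by rewrite /cap_below; case: ifPn => [/ltW|] // _; exact: ltW. Qed.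

Lemma cap_below_bd t : exists M, forall s, 0 <= s -> s <= t -> cap_below (eta s) <= M.
Proof. by exists N => s _ _; exact: cap_below_leN. Qed.

Lemma cap_below_le s t : 0 <= s -> s <= t -> cap_below (eta s) <= eta t.
Proof.
move=> s0 st; rewrite /cap_below; case: ifPn => _; first exact: (nd_le ne).
by apply: (nd_ge0 ne); exact: le_trans st.
Qed.

Lemma control_path_capped_sup : control_path capped_sup.
Proof. by apply: control_path_run_sup; [exact: cap_below_rc|exact: cap_below_bd|exact: cap_below_ge0]. Qed.

Lemma capped_sup_leN t : 0 <= t -> capped_sup t <= N.
Proof. by move=> t0; apply: run_sup_le => // s _ _; exact: cap_below_leN. Qed.

Lemma capped_sup_le t : 0 <= t -> capped_sup t <= eta t.
Proof. by move=> t0; apply: run_sup_le => // s s0 st; exact: cap_below_le. Qed.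

Lemma cpE t : 0 <= t -> eta t < N -> capped_sup t = eta t.
Proof.
move=> t0 tN; apply/le_anti; rewrite capped_sup_le//=.
by have := run_sup_ge cap_below_bd t0 (lexx t); rewrite {1}/cap_below tN.
Qed.

Lemma capped_sup_lm s : 0 < s -> (forall r, 0 <= r -> r < s -> eta r < N) -> lm capped_sup s = lm eta s.
Proof.
move=> s0 h; apply: lmE => //.
apply: cvg_trans (cadlag_lm (control_path_cadlag ne) s0); apply: near_eq_cvg; near=> r.
have r0 : 0 <= r by near: r; exact: nbhs_left_ge.
by rewrite cpE//; apply: h => //; near: r; exact: nbhs_left_lt.
Unshelve. all: by end_near. Qed.

(** A positive level strictly below the capped supremum is exceeded by a value of [eta] less than
    [N], and up to that time the capped control and [eta] coincide. *)
Lemma capped_sup_passage t l : 0 <= t -> 0 < l -> l < capped_sup t -> passage capped_sup l = passage eta l /\ eta (passage eta l) < N.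
Proof.
move=> t0 l0 /(run_sup_lt_ex t0)[s [s0 st]]; rewrite /cap_below; case: ifPn => [sN ls|_ ls]; last first.
  by have := lt_trans l0 ls; rewrite ltxx.
have Ts : passage eta l <= s by apply: passage_le => //; exact: ltW.
have T0 := passage_ge0 eta l.
have TN : eta (passage eta l) < N by apply: le_lt_trans sN; exact: (nd_le ne).
split => //.
have lT : l <= eta (passage eta l) by apply: (passage_at ne s0); exact: ltW.
have T1 : passage capped_sup l <= passage eta l by apply: passage_le => //; rewrite cpE.
apply/le_anti; rewrite T1/=; apply: passage_le; first exact: passage_ge0.
apply: (@le_trans _ _ (capped_sup (passage capped_sup l))); last by apply: capped_sup_le; exact: passage_ge0.
by apply: (passage_at control_path_capped_sup T0); rewrite cpE.
Qed.

Lemma capped_sup_average_cost x (c xi : R -> R) t l : 0 <= t -> 0 < l -> l < capped_sup t ->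
  average_cost x c xi capped_sup (passage capped_sup l) = average_cost x c xi eta (passage eta l).
Proof.
move=> t0 l0 lt; have [TE TN] := capped_sup_passage t0 l0 lt; rewrite TE /average_cost.
have T0 := passage_ge0 eta l.
have -> : capped_sup (passage eta l) = eta (passage eta l) by exact: cpE.
have -> // : lm capped_sup (passage eta l) = lm eta (passage eta l).
move: T0; rewrite le_eqVlt => /predU1P[<-|T0]; first by rewrite !lm0.
apply: capped_sup_lm => // r r0 rT; apply: le_lt_trans TN; apply: (nd_le ne) => //; exact: ltW.
Qed.

End capped.

Section capped_control.
Context {R : realType} {d : measure_display} {T : measurableType d}.
Local Notation mu := (@lebesgue_measure R).
Variables (P : probability T R) (F : R -> set (set T)) (X : R -> T -> R).
Hypothesis hF : usual_filtration P F.
Hypothesis hX : levy_process P F X.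
Hypothesis hX0 : forall w, X 0 w = 0.
Hypothesis hXc : forall w, cadlag (X ^~ w).
Variables (theta dl : R).
Hypothesis th0 : 0 < theta.
Hypothesis dl0 : 0 <= dl.
Hypothesis mgp : forall t : R, 0 <= t -> (mg P X theta t <= (expR (dl * t))%:E)%E.
Hypothesis mgm : forall t : R, 0 <= t -> (mg P X (- theta) t <= (expR (dl * t))%:E)%E.
Variables (u f c : R -> R) (K delta : R).
Hypothesis K0 : 0 <= K.
Hypothesis uK : forall x, `|u x| <= K * (1 + cosh (theta * x)).
Hypothesis fK : forall x, `|f x| <= K * (1 + cosh (theta * x)).
Hypothesis cK : forall x, `|c x| <= K * (1 + cosh (theta * x)).
Hypothesis cu : continuous u.
Hypothesis cf : continuous f.
Hypothesis cc : continuous c.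
Hypothesis dld : dl < delta.
Hypothesis uC1 : C1 u.
Hypothesis u_le : forall y, derive1 u y <= c y.
Variable J : nat -> nat.
Hypothesis J_oo : forall j, \forall n \near \oo, (j <= J n)%N.
Hypothesis J_step_defect : forall n y, `|y| <= (J n)%:R - 1 ->
  - ((J n).+1%:R^-1 * dyadic n) <= step_defect P X u delta f n y.
Variables (x : R) (D : R -> T -> R).
Hypothesis neD : forall w, control_path (D ^~ w).
Hypothesis DF : forall t, 0 <= t -> Fm F t (D t).
Variables (m : nat) (N : R).
Hypothesis N0 : 0 < N.

Definition capped_ctl N t w := capped_sup (D ^~ w) N t.
Local Notation a := (fun n k w => grid_max (fun t => cap_below N (D t w)) (dyadic n) k).
Local Notation Y n := (chain_pos X x (dyadic n) (a n)).
Local Notation p n := (pos X x (dyadic n)).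
Local Notation Bd := (Cy theta K (`|x| + N)).

Lemma delta_gt0 : 0 < delta. Proof. exact: le_lt_trans dld. Qed.

Lemma grow (k : R -> R) y z B : (forall x, `|k x| <= K * (1 + cosh (theta * x))) ->
  `|y| <= B -> `|k (y + z)| <= Cy theta K B * cosh (theta * z).
Proof.
move=> kK yB; apply: (le_trans (u_shift K0 kK y z)); rewrite ler_wpM2r ?cosh_ge0//.
rewrite /Cy ler_wpM2l// lerD2l ler_wpM2l//; apply: cosh_le.
by rewrite normrM gtr0_norm// ler_wpM2l// ltW.
Qed.

Lemma a_bd n k w : 0 <= a n k w <= N.
Proof.
apply/andP; split; last by apply: grid_max_le => j _; exact: cap_below_leN.
apply: le_trans (@grid_max_ge _ _ (dyadic n) k 0 (leq0n k)).
by have := @cap_below_ge0 _ (D ^~ w) N (neD w) (0 * dyadic n); apply; rewrite mul0r.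
Qed.

Lemma grow_pos (k : R -> R) t w l : (forall x, `|k x| <= K * (1 + cosh (theta * x))) ->
  0 <= l <= N -> `|k (x + X t w - l)| <= Bd * cosh (theta * X t w).
Proof.
move=> kK /andP[l0 lN]; rewrite (_ : x + X t w - l = x - l + X t w); last by ring.
by apply: grow => //; apply: (le_trans (ler_normB _ _)); rewrite lerD2l ger0_norm.
Qed.

Lemma a_F n k : Fm F (k%:R * dyadic n) (a n k).
Proof.
apply: (Fm_grid_max hF (g := fun t w => cap_below N (D t w))); first exact: dyadic_ge0.
move=> t t0; apply: (Fm_comp (Y := D t) (g := cap_below N)); last exact: DF.
by rewrite /cap_below; apply: measurable_fun_ifT => //; apply: measurable_fun_ltr.
Qed.

Lemma a_meas n k : measurable_fun setT (a n k).
Proof. by apply: (Fm_meas hF (kh_ge0 n k)); exact: a_F. Qed.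

Lemma a_le_next n k w : prev (a n) k w <= a n k w.
Proof.
case: k => [|k] /=; first by have /andP[] := a_bd n 0 w.
by rewrite le_max lexx.
Qed.

Lemma prev_bd n k w : 0 <= prev (a n) k w <= N.
Proof. by case: k => [|k] /=; [rewrite lexx ltW|exact: a_bd]. Qed.

Lemma Bd_ge0 : 0 <= Bd. Proof. exact: Cy_ge0. Qed.

Lemma intg_growX (b : T -> R) (k : R -> R) t : 0 <= t -> measurable_fun setT b ->
  (forall w, 0 <= b w <= N) -> continuous k -> (forall x, `|k x| <= K * (1 + cosh (theta * x))) ->
  intg P (fun w => k (x + X t w - b w)).
Proof.
move=> t0 mb bN ck kK; apply: (intg_dom _ (intgZ Bd (intg_coshX hF hX mgp mgm t0))).
  apply: measurableT_comp; first exact: continuous_measurable_fun.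
  by apply: measurable_funB => //; apply: measurable_funD => //; exact: (X_meas hF hX).
by move=> w; apply: grow_pos.
Qed.

Lemma control_step_le n k w : `|control_step X x (dyadic n) (prim c) (a n) k w| <=
  (a n k w - prev (a n) k w) * (Bd * cosh (theta * X (k%:R * dyadic n) w)).
Proof.
have pa := a_le_next n k w; have /andP[_ aN] := a_bd n k w; have /andP[p0 _] := prev_bd n k w.
rewrite /control_step mulrC; apply: (le_trans (prim_lip (M := Bd * cosh (theta * X (k%:R * dyadic n) w)) cc _ _)).
- move=> z; rewrite /chain_pos => az zb.
  rewrite (_ : z = p n k w - (p n k w - z)); last by ring.
  by apply: grow_pos => //; apply/andP; split; lra.
- by rewrite /chain_pos; lra.
- by rewrite le_eqVlt; apply/orP; left; apply/eqP; rewrite /chain_pos; ring.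
Qed.

Lemma coshX_Xs n k w : (k <= m * 2 ^ n)%N -> cosh (theta * X (k%:R * dyadic n) w) <= expR (theta * Xs X m%:R w).
Proof.
move=> km; apply: (le_trans (cosh_le_expR _)); rewrite ler_expR normrM gtr0_norm// ler_wpM2l ?(ltW th0)//.
by apply: (Xs_ub hXc); [exact: kh_ge0|exact: kh_m].
Qed.

Lemma sum_prev n k w : \sum_(j < k.+1) (a n j w - prev (a n) j w) = a n k w.
Proof.
elim: k => [|k IH]; first by rewrite big_ord_recr/= big_ord0 add0r subr0.
by rewrite big_ord_recr IH/= addrC subrK.
Qed.

(** The three terms of the factor are the length of the horizon for the running cost, the number of
    levels for the control cost, and 1 for the terminal value. *)
Definition capped_dominator w := ((m%:R + N + 1) * Bd) * expR (theta * Xs X m%:R w).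

Lemma cost_capped_dominator n j w : (j <= m * 2 ^ n)%N -> `|cost_upto X x (dyadic n) delta u f (prim c) (a n) j w| <= capped_dominator w.
Proof.
move=> jm; set E := Bd * expR (theta * Xs X m%:R w).
have d0 : 0 <= delta by exact/ltW/delta_gt0.
have E0 : 0 <= E by rewrite mulr_ge0 ?Bd_ge0 ?expR_ge0.
have ee1 k : ee (dyadic n) delta k <= 1 by apply: discount_le1 => //; exact: kh_ge0.
have eeE k (z : R) : `|z| <= E -> `|ee (dyadic n) delta k * z| <= E.
  by move=> zE; rewrite normrM ger0_norm ?expR_ge0//; apply: le_trans zE; rewrite ler_piMl.
have bE (k : R -> R) i : (forall x, `|k x| <= K * (1 + cosh (theta * x))) -> (i <= j)%N -> `|k (Y n i w)| <= E.
  move=> kK ij; apply: (le_trans (grow_pos _ _ kK (a_bd n i w))).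
  by rewrite ler_wpM2l ?Bd_ge0// coshX_Xs// (leq_trans ij).
rewrite /capped_dominator (_ : _ * _ = m%:R * E + N * E + E); last by rewrite /E; ring.
rewrite /cost_upto; apply: (le_trans (ler_normD _ _)); apply: lerD; last first.
  by apply: eeE; exact: bE.
apply: (le_trans (ler_normD _ _)); apply: lerD.
  apply: (le_trans (ler_norm_sum _ _ _)).
  apply: (@le_trans _ _ (\sum_(k < j) dyadic n * E)); last first.
    by rewrite sumr_const card_ord -[_ *+ j]mulr_natl mulrA ler_wpM2r// kh_m.
  apply: ler_sum => k _; rewrite normrM ger0_norm ?dyadic_ge0// ler_wpM2l ?dyadic_ge0//.
  by apply: eeE; apply: bE => //; exact: ltnW.
apply: (le_trans (ler_norm_sum _ _ _)).
apply: (@le_trans _ _ (\sum_(k < j.+1) (a n k w - prev (a n) k w) * E)); last first.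
  by rewrite -mulr_suml ler_wpM2r// sum_prev; have /andP[] := a_bd n j w.
apply: ler_sum => k _; rewrite normrM ger0_norm ?expR_ge0//.
apply: (@le_trans _ _ `|control_step X x (dyadic n) (prim c) (a n) k w|); first by rewrite ler_piMl.
apply: (le_trans (control_step_le n k w)); rewrite ler_wpM2l ?subr_ge0 ?a_le_next// ler_wpM2l ?Bd_ge0// coshX_Xs//.
by rewrite (leq_trans _ jm)// -ltnS.
Qed.

Lemma capped_bound : intg P (horizon_cost X x delta u f c (capped_ctl N) m) /\
  u x <= EE P (horizon_cost X x delta u f c (capped_ctl N) m).
Proof.
have g_rc w := cap_below_rc (N := N) (neD w).
have g_bd w := @cap_below_bd _ (D ^~ w) N N0.
have g_ge0 w := @cap_below_ge0 _ (D ^~ w) N (neD w).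
have [||||||||||||||||ih] := @chain_limit _ _ _ P F X hF hX hX0 hXc x delta u f c (ltW delta_gt0) cu cf cc
  _ (fun n k w => a n k w) (capped_ctl N) m 1 J capped_dominator J_oo.
- by move=> n y; exact: (intg_u hF hX mgp mgm K0 uK cu y (dyadic_ge0 n)).
- by move=> w; exact: control_path_capped_sup.
- exact: a_F.
- by move=> n j k w jk; exact: grid_max_nd.
- by move=> n k w; have /andP[] := a_bd n k w.
- by move=> n k w _; apply: grid_max_le_run_sup => //; exact: dyadic_ge0.
- move=> w t t' l t0 tt lt; have := grid_max_run_sup_lim (g_rc w) t0 tt lt.
  by apply: filterS => n h k _; exact: h.
- by move=> w; exact: (@grid_max_run_sup_end _ _ (g_rc w) (g_bd w) m).
- move=> n k w; rewrite !mul1r /control_step; apply: value_increment => //.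
  by rewrite /chain_pos lerD2l lerN2 a_le_next.
- by move=> n k w h; rewrite mul1r; exact: J_step_defect.
- move=> n k; apply: intg_growX => //; [exact: kh_ge0|exact: a_meas|exact: a_bd].
- move=> n k; apply: intg_growX => //; [exact: kh_ge0|exact: a_meas|exact: a_bd].
- move=> n k; apply: intg_growX => //; [exact: kh_ge0|exact: a_meas|exact: a_bd].
- move=> n k; have t0 := kh_ge0 (R := R) n k.
  apply: (intg_dom _ (intgZ (N * Bd) (intg_coshX hF hX mgp mgm t0))).
    have mX : measurable_fun setT (X (k%:R * dyadic n)) by exact: (X_meas hF hX).
    have mp : continuous (prim c) by exact: is_derive_continuous (fun z => prim_derive z cc).
    have mprev : measurable_fun setT (prev (a n) k).
      by case: k {t0 mX} => [|k] /=; [exact: measurable_cst|exact: a_meas].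
    by apply: measurable_funB; apply: measurableT_comp; do ?[exact: continuous_measurable_fun];
      apply: measurable_funB => //; do ?[exact: measurable_funD]; exact: a_meas.
  move=> w; apply: (le_trans (control_step_le n k w)); rewrite -mulrA; apply: ler_wpM2r.
    by rewrite mulr_ge0 ?Bd_ge0 ?cosh_ge0.
  by have /andP[] := a_bd n k w; have /andP[] := prev_bd n k w; lra.
- rewrite /capped_dominator; apply: intgZ; exact: (intg_expXs hF hX hX0 hXc th0 dl0 mgp mgm (ler0n _ m)).
- by move=> n j w jm; exact: cost_capped_dominator.
by rewrite !mul1r.
Qed.

Definition capped_tail w := discount delta m%:R * `|u (x + X m%:R w - capped_ctl N m%:R w)|.

(** A control of at most [N] can enlarge the [cosh] by a factor [e^{theta N}], while discounting
    leaves [e^{(dl - delta) m}] of its moment. *)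
Lemma tail_bound : intg P capped_tail /\
  EE P capped_tail <= K * (1 + 2 * cosh (theta * x)) * expR (theta * N + (dl - delta) * m%:R).
Proof.
have cpF : Fm F m%:R (capped_ctl N m%:R).
  apply: (run_sup_F hF (g := fun t w => cap_below N (D t w))) => //.
  - by move=> w; exact: cap_below_rc.
  - by move=> w; exact: cap_below_bd.
  - move=> t t0; apply: (Fm_comp (Y := D t) (g := cap_below N)); last exact: DF.
    by rewrite /cap_below; apply: measurable_fun_ifT => //; apply: measurable_fun_ltr.
have cpN w : 0 <= capped_ctl N m%:R w <= N.
  by rewrite (nd_ge0 (control_path_capped_sup (neD w) N0))//=; exact: capped_sup_leN.
have it : intg P capped_tail.
  apply: intgZ; apply: intg_norm; apply: intg_growX => //; exact: (Fm_meas hF _ cpF).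
split => //.
set C := K * (1 + 2 * cosh (theta * x)).
have ic := intg_coshX hF hX mgp mgm (ler0n R m).
apply: (@le_trans _ _ (EE P (fun w => discount delta m%:R * (C * expR (theta * N)) * cosh (theta * X m%:R w)))).
  apply: EE_le => //; first exact: intgZ.
  move=> w; rewrite -mulrA ler_wpM2l ?expR_ge0//.
  have := u_shift K0 uK (x - capped_ctl N m%:R w) (X m%:R w).
  rewrite (_ : x - _ + _ = x + X m%:R w - capped_ctl N m%:R w); last by ring.
  move=> /le_trans; apply; rewrite ler_wpM2r ?cosh_ge0// /Cy /C -mulrA ler_wpM2l//.
  have /andP[l0 lN] := cpN w; set l := capped_ctl N m%:R w in l0 lN *.
  have e1 : 1 <= expR (theta * N) by rewrite -[leLHS]expR0 ler_expR mulr_ge0// ltW.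
  have : cosh (theta * (x - l)) <= cosh (theta * x) * expR (theta * N).
    have el : expR (theta * l) <= expR (theta * N) by rewrite ler_expR ler_wpM2l// ltW.
    have pl : expR (- (theta * l)) <= expR (theta * N).
      by apply: le_trans e1; rewrite -[leRHS]expR0 ler_expR oppr_le0 mulr_ge0// ltW.
    rewrite /cosh mulrBr opprB expRD (addrC (theta * l)) expRD mulrAC ler_pM2r ?invr_gt0// mulrDl.
    by apply: lerD; rewrite ler_wpM2l ?expR_ge0.
  have := cosh_ge1 (theta * x); nra.
rewrite EEZ// expRD mulrDl expRD (_ : - delta * m%:R = - delta * m%:R) //.
have ecx := EE_coshX hF hX mgp mgm (ler0n R m).
have c0 : 0 <= discount delta m%:R * (C * expR (theta * N)).
  by rewrite !mulr_ge0 ?expR_ge0// addr_ge0// mulr_ge0// cosh_ge0.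
apply: (le_trans (ler_wpM2l c0 ecx)).
by rewrite le_eqVlt; apply/orP; left; apply/eqP; rewrite /discount; ring.
Qed.

End capped_control.

Section integrable_on.
Context {R : realType}.
Local Notation mu := (@lebesgue_measure R).
Implicit Types (A B : set R) (f g : R -> R).

Lemma integrable_onD A f g : measurable A -> mu.-integrable A (EFin \o f) ->
  mu.-integrable A (EFin \o g) -> mu.-integrable A (EFin \o (fun s => f s + g s)).
Proof. by move=> mA i1 i2; exact: (@integrableD _ _ _ mu _ mA _ _ i1 i2). Qed.

Lemma integrable_onB A f g : measurable A -> mu.-integrable A (EFin \o f) ->
  mu.-integrable A (EFin \o g) -> mu.-integrable A (EFin \o (fun s => f s - g s)).
Proof. by move=> mA i1 i2; exact: (@integrableB _ _ _ mu _ mA _ _ i1 i2). Qed.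

Lemma integrable_onZ A r f : measurable A -> mu.-integrable A (EFin \o f) ->
  mu.-integrable A (EFin \o (fun s => r * f s)).
Proof. by move=> mA i1; exact: (@integrableZl _ _ _ mu _ mA r _ i1). Qed.

Lemma integrable_on_norm A f : mu.-integrable A (EFin \o f) ->
  mu.-integrable A (EFin \o (fun s => `|f s|)).
Proof. by move=> i1; exact: (@integrable_norm _ _ _ mu _ _ i1). Qed.

Lemma integrable_onS A B f : measurable A -> measurable B -> A `<=` B ->
  mu.-integrable B (EFin \o f) -> mu.-integrable A (EFin \o f).
Proof. by move=> mA mB AB i1; exact: (@integrableS _ _ _ mu _ _ _ mB mA AB i1). Qed.

Lemma integrable_on_restrict A B f : measurable A -> measurable B ->
  mu.-integrable B (EFin \o f) -> mu.-integrable B (EFin \o (f \_ A)).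
Proof.
move=> mA mB i1; rewrite -restrict_EFin; apply/(@integrable_restrict _ _ R mu A mA B mB).
by apply: integrable_onS i1; [exact: measurableI|by []|move=> s []].
Qed.

Lemma Rint_oc_eq (a b : R) f g : (forall l, a < l -> l < b -> f l = g l) ->
  mu.-integrable `]a, b] (EFin \o f) -> mu.-integrable `]a, b] (EFin \o g) ->
  \int[mu]_(l in `]a, b]) f l = \int[mu]_(l in `]a, b]) g l.
Proof.
move=> fg i1 i2.
have sub : [set` `]a, b[] `<=` ([set` `]a, b]] : set R).
  by apply: subset_itvl; rewrite bnd_simp.
have j1 := integrable_onS (measurable_itv _) (measurable_itv _) sub i1.
have j2 := integrable_onS (measurable_itv _) (measurable_itv _) sub i2.
have <- := @Rintegral_itv_bndo_bndc R (BRight a) b f j1.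
have <- := @Rintegral_itv_bndo_bndc R (BRight a) b g j2.
by apply: eq_Rintegral => l; rewrite inE/= in_itv/= => /andP[]; exact: fg.
Qed.

End integrable_on.

Section zero_control.
Context {R : realType}.

Lemma ndrc0 : control_path (fun _ : R => 0 : R).
Proof. by split => // t _; exact: cvg_cst. Qed.

Lemma lm_zero (s : R) : lm (fun _ : R => 0 : R) s = 0.
Proof.
rewrite /lm (_ : from0 _ = fun=> 0); last by apply/funext => t; rewrite /from0; case: ifP.
by apply: cvg_lim => //; exact: cvg_cst.
Qed.

End zero_control.

Section capped_path.
Context {R : realType}.
Local Notation mu := (@lebesgue_measure R).
Implicit Types (s t l : R).
Variables (delta x theta C : R) (f c xi eta : R -> R).
Hypothesis delta0 : 0 <= delta.
Hypothesis theta0 : 0 <= theta.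
Hypothesis cf : continuous f.
Hypothesis cc : continuous c.
Hypothesis cxi : cadlag xi.
Hypothesis ne : control_path eta.
Hypothesis C0 : 0 <= C.
Hypothesis fstar : forall y z, z <= y -> f y <= `|f z| + C * (1 + expR (theta * y)).

Definition exp_growth (y : R) := 1 + expR (theta * y).

(** What the running cost of the capped control can exceed that of [eta] by: [f] at the higher
    position is at most [|f|] at the lower one plus the exponential term, and replacing [|f|] by [f]
    costs another [|f|]. The exponential is read off the uncontrolled position, which is the
    highest. *)
Definition overflow s := 2 * `|running_density delta x xi eta f s| + C * running_density delta x xi (fun=> 0) exp_growth s.

Definition below N := [set s | 0 < s /\ eta s < N].

Lemma below_meas N : measurable (below N).
Proof.
apply: is_interval_measurable => s t [s0 sN] [t0 tN] r /andP[sr rt].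
have r0 : 0 < r by exact: lt_le_trans sr.
by split => //; apply: le_lt_trans tN; apply: (nd_le ne) => //; exact: ltW.
Qed.

Section horizon.
Variables (N : R) (m : nat).
Hypothesis N0 : 0 < N.
Local Notation cpN := (capped_sup eta N).

Lemma lm_capped_sup_le s : 0 < s -> lm cpN s <= lm eta s.
Proof.
move=> s0; rewrite leNgt; apply/negP => /(lm_lt_ex (control_path_capped_sup ne N0) s0)[r [r0 rs lr]].
have := lm_le ne r0 rs; have := capped_sup_le N ne r0; lra.
Qed.

Lemma running_density_capped_le s : 0 < s ->
  running_density delta x xi cpN f s <= running_density delta x xi eta f s + (overflow s - (overflow \_ (below N)) s).
Proof.
move=> s0; have s0' := ltW s0; rewrite patchE; case: ifPn => [|] hA.
  have [_ sN] : below N s by rewrite inE in hA.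
  rewrite subrr addr0 /running_density (@capped_sup_lm _ eta N)// => r r0 rs.
  by apply: le_lt_trans sN; apply: (nd_le ne) => //; exact: ltW.
rewrite subr0 /overflow -[X in X + _]/(running_density delta x xi eta f s).
have d0 : 0 <= discount delta s by exact: expR_ge0.
have l0 : 0 <= lm cpN s by apply: lm_ge0 => //; exact: control_path_capped_sup.
have ll := lm_capped_sup_le s0.
have := @fstar (x + lm xi s - lm cpN s) (x + lm xi s - lm eta s) ltac:(lra).
have : expR (theta * (x + lm xi s - lm cpN s)) <= expR (theta * (x + lm xi s)).
  by rewrite ler_expR ler_wpM2l//; lra.
rewrite /running_density normrM (ger0_norm d0) lm_zero subr0 /exp_growth.
set e1 := expR _; set e2 := expR _; set f1 := f _; set f2 := f (x + lm xi s - lm eta s).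
move=> ee ff; have f3 : f1 <= `|f2| + C * (1 + e2) by apply: (le_trans ff); rewrite lerD2l ler_wpM2l// lerD2l.
have := ler_wpM2l d0 f3; have n2 : - `|f2| <= f2 by rewrite lerNl ler_normr lexx orbT.
by have := ler_wpM2l d0 n2; lra.
Qed.

Hypothesis i1 : mu.-integrable [set` `]0, +oo[] (EFin \o running_density delta x xi eta f).
Hypothesis i3 : mu.-integrable [set` `]0, +oo[] (EFin \o running_density delta x xi (fun=> 0) exp_growth).

Lemma overflow_intg : mu.-integrable [set` `]0, +oo[] (EFin \o overflow).
Proof.
apply: (@integrable_onD _ _ (fun s => 2 * `|running_density delta x xi eta f s|)) => //.
  by apply: integrable_onZ => //; exact: integrable_on_norm.
exact: integrable_onZ.
Qed.

Lemma below_sub M : below M `<=` [set` `]0, +oo[].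
Proof. by move=> s [s0 _] /=; rewrite in_itv/= s0. Qed.

Lemma overflow_ge0 s : 0 <= overflow s.
Proof. by rewrite addr_ge0// mulr_ge0// mulr_ge0 ?expR_ge0// addr_ge0// expR_ge0. Qed.

Lemma overflow_restrict : mu.-integrable [set` `]0, +oo[] (EFin \o (overflow \_ (below N))).
Proof.
by apply: integrable_on_restrict; [exact: below_meas|exact: measurable_itv|exact: overflow_intg].
Qed.

Definition capped_upper := \int[mu]_(s in `]0, m%:R]) running_density delta x xi eta f s +
  \int[mu]_(l in `]0, cpN m%:R]) level_density delta x c xi eta id l +
  (\int[mu]_(s in `]0, +oo[) overflow s - \int[mu]_(s in below N) overflow s).

(** The two running costs agree while the control is below [N]; afterwards [overflow] bounds the
    excess, and its integral over those times is the difference on the right, which tends to 0 as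
    [N] grows. *)
Lemma capped_run_le : \int[mu]_(s in `]0, m%:R]) running_density delta x xi cpN f s <=
  \int[mu]_(s in `]0, m%:R]) running_density delta x xi eta f s +
  (\int[mu]_(s in `]0, +oo[) overflow s - \int[mu]_(s in below N) overflow s).
Proof.
have sub : [set` `]0, m%:R]] `<=` ([set` `]0, +oo[] : set R).
  by move=> s /=; rewrite !in_itv/= andbT => /andP[].
have iD : mu.-integrable [set` `]0, +oo[] (EFin \o (fun s => overflow s - (overflow \_ (below N)) s)).
  by apply: integrable_onB; [exact: measurable_itv|exact: overflow_intg|exact: overflow_restrict].
have i1m := integrable_onS (measurable_itv _) (measurable_itv _) sub i1.
have iDm := integrable_onS (measurable_itv _) (measurable_itv _) sub iD.
apply: (@le_trans _ _ (\int[mu]_(s in `]0, m%:R]) (running_density delta x xi eta f s + (overflow s - (overflow \_ (below N)) s)))).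
  apply: le_Rintegral => //.
  - exact: (running_density_cvg x delta0 cxi (control_path_capped_sup ne N0) m cf).1.
  - exact: integrable_onD.
  - by move=> s /=; rewrite in_itv/= => /andP[s0 _]; exact: running_density_capped_le.
rewrite RintegralD// lerD2l.
have := part_le (measurable_itv `]0, m%:R]) (measurable_itv `]0, +oo[) sub iD.
move/(le_trans (ler_norm _)) => /le_trans; apply.
rewrite -(setIidr (@below_sub N)) Rintegral_mkcondr (setIidr (@below_sub N)) -RintegralB//; [|exact: overflow_intg|exact: overflow_restrict].
rewrite le_eqVlt; apply/orP; left; apply/eqP; apply: eq_Rintegral => s _.
rewrite ger0_norm// patchE; case: ifP => _; rewrite ?subrr// subr0; exact: overflow_ge0.
Qed.

Hypothesis i2 : mu.-integrable (attained eta) (EFin \o level_density delta x c xi eta id).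

Lemma capped_sup_attained : [set` `]0, cpN m%:R]] `<=` attained eta.
Proof.
move=> l /=; rewrite in_itv/= => /andP[l0 lm]; split => //; exists m%:R => //.
by apply: (le_trans lm); exact: capped_sup_le.
Qed.

(** In averaged form, the price of a level below the capped supremum is the same for both controls;
    only the end point of the interval is left out. *)
Lemma capped_levels : \int[mu]_(l in `]0, cpN m%:R]) lev_pos delta x c xi cpN l =
  \int[mu]_(l in `]0, cpN m%:R]) level_density delta x c xi eta id l.
Proof.
have nc := control_path_capped_sup ne N0.
rewrite (@lev_pos_average R delta x c xi cpN m delta0 cc cxi nc).
have ci : continuous (@id R) by move=> y; exact: cvg_id.
have j1 := (@average_cvg R delta x c xi cpN m delta0 cc cxi nc id ci).1.
have j2 := integrable_onS (measurable_itv _) (attained_meas ne) capped_sup_attained i2.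
apply: (Rint_oc_eq _ j1 j2) => l l0 lc.
by rewrite /level_density (capped_sup_average_cost ne N0 x c xi (ler0n _ m) l0 lc) (capped_sup_passage ne N0 (ler0n _ m) l0 lc).1.
Qed.

End horizon.

Section limit.
Variable N : nat -> R.
Hypothesis N0 : forall m, 0 < N m.
Hypothesis N_oo : forall B, \forall m \near \oo, B < N m.
Hypothesis i1 : mu.-integrable [set` `]0, +oo[] (EFin \o running_density delta x xi eta f).
Hypothesis i2 : mu.-integrable (attained eta) (EFin \o level_density delta x c xi eta id).
Hypothesis i3 : mu.-integrable [set` `]0, +oo[] (EFin \o running_density delta x xi (fun=> 0) exp_growth).

Lemma capped_upper_cvg : capped_upper (N m) m @[m --> \oo] -->
  \int[mu]_(s in `]0, +oo[) running_density delta x xi eta f s + \int[mu]_(l in attained eta) level_density delta x c xi eta id l.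
Proof.
rewrite -[X in _ --> X]addr0; apply: cvgD; first apply: cvgD.
- apply: (@Rint_set_cvg _ _ (fun m => [set` `]0, m%:R]]) _ set0) => //.
  + by move=> n s /=; rewrite !in_itv/= andbT => /andP[].
  + move=> s /=; rewrite in_itv/= andbT => s0 _; near=> m; rewrite /= in_itv/= s0/=.
    apply/ltW/(lt_le_trans (truncnS_gt _)); rewrite ler_nat; near: m.
    by exists (Num.truncn s).+1.
- apply: (@Rint_set_cvg _ _ (fun m => [set` `]0, capped_sup eta (N m) m%:R]]) _ set0) => //.
  + exact: attained_meas.
  + by move=> n; exact: capped_sup_attained.
  + move=> l [l0 [t t0 lt]] _; near=> m; rewrite /= in_itv/= l0/=; apply: (le_trans lt).
    rewrite -(@cpE _ eta (N m) ne (N0 m) t)//; last by near: m; exact: N_oo.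
    apply: (nd_le (control_path_capped_sup ne (N0 m))) => //; apply/ltW/(lt_le_trans (truncnS_gt _)); rewrite ler_nat; near: m.
    by exists (Num.truncn t).+1.
- have h3 : \int[mu]_(s in below (N m)) overflow s @[m --> \oo] --> \int[mu]_(s in `]0, +oo[) overflow s.
    apply: (@Rint_set_cvg _ _ (fun m => below (N m)) _ set0) => //.
    + by move=> n; exact: below_meas.
    + by move=> n; exact: below_sub.
    + move=> s /=; rewrite in_itv/= andbT => s0 _; near=> m; split => //; near: m; exact: N_oo.
    + exact: overflow_intg.
  have := cvgB (cvg_cst (\int[mu]_(s in `]0, +oo[) overflow s)) h3.
  by rewrite subrr; exact.
Unshelve. all: by end_near. Qed.

End limit.

End capped_path.

Section total_running.
Context {R : realType} {d : measure_display} {T : measurableType d}.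
Local Notation mu := (@lebesgue_measure R).
Variables (P : probability T R) (X D : R -> T -> R).
Hypothesis mX : forall t : R, 0 <= t -> measurable_fun setT (X t).
Hypothesis hXc : forall w, cadlag (X ^~ w).
Hypothesis mD : forall t : R, 0 <= t -> measurable_fun setT (D t).
Hypothesis neD : forall w, control_path (D ^~ w).
Variable a : nat -> nat -> T -> R.
Hypothesis a_ge0 : forall n k w, 0 <= a n k w.
Hypothesis a_le : forall n k w, a n k w <= D (k%:R * dyadic n) w.
Hypothesis a_lim : forall w t t' l, 0 <= t -> t < t' -> l < D t w ->
  \forall n \near \oo, forall k, t' <= k%:R * dyadic n -> l <= a n k w.
Variables (x dl delta C : R) (k : R -> R).
Hypothesis delta0 : 0 <= delta.
Hypothesis dld : dl < delta.
Hypothesis ck : continuous k.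
Hypothesis k0 : forall y, 0 <= k y.
Hypothesis C0 : 0 <= C.
Local Notation ky n j := (fun w => k (x + X (j%:R * dyadic n) w - a n j w)).
Hypothesis ik : forall n j, intg P (ky n j).
Hypothesis Ek : forall n j, EE P (ky n j) <= C * expR (dl * (j%:R * dyadic n)).

(** Fatou's lemma in the grid and then in the horizon, with the geometric sum [grid_sum_le] as a
    bound uniform in both. *)
Lemma total_running_le : (\int[P]_w \int[mu]_(s in `]0%R, +oo[)
    (running_density delta x (X ^~ w) (D ^~ w) k s)%:E <=
  (C * (expR (delta - dl) / (delta - dl)))%:E)%E.
Proof.
pose B := C * (expR (delta - dl) / (delta - dl)).
pose S m n w := \sum_(j < m * 2 ^ n) dyadic n * (discount delta (j%:R * dyadic n) * ky n j w).
have ij n (j : nat) : intg P (fun w => dyadic n * (discount delta (j%:R * dyadic n) * ky n j w)).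
  by do 2! apply: intgZ.
have iS m n : intg P (S m n) by exact: intg_sum.
apply: (@fatou_cvg _ _ _ P (fun m w => (\int[mu]_(s in `]0, m%:R]) running_density delta x (X ^~ w) (D ^~ w) k s)%:E) _ (fun=> B%:E)) => //.
- by move=> m; apply/measurable_EFinP; exact: (run_upto_meas mX hXc).
- by move=> m w _; rewrite lee_fin; apply: Rintegral_ge0 => s _; rewrite mulr_ge0// expR_ge0.
- by move=> w _; exact: run_total_cvg.
- move=> m; apply: (@fatou_cvgR _ _ _ P (S m) _ (fun=> B)) => //.
  + by move=> n; exact: (intg_meas (iS m n)).
  + by move=> n w; apply: sumr_ge0 => j _; rewrite !mulr_ge0// ?dyadic_ge0// expR_ge0.
  + move=> w; apply: (@run_cvg R delta x k (X ^~ w) (D ^~ w) m delta0 ck (hXc w) (neD w) (fun n j => a n j w) _ _ _).2 => //.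
    move=> t t' l t0 tt lt; have := a_lim t0 tt lt.
    by apply: filterS => n h j _; exact: h.
  + move=> n; rewrite EE_EFin// lee_fin /S EE_sum//.
    have k1 : 0 < delta - dl by rewrite subr_gt0.
    apply: le_trans (ler_wpM2l C0 (grid_sum_le n (m * 2 ^ n) k1)).
    rewrite mulr_sumr; apply: ler_sum => j _.
    rewrite EEZ; last exact: intgZ.
    rewrite EEZ// [leRHS]mulrCA ler_wpM2l ?dyadic_ge0//.
    apply: (le_trans (ler_wpM2l (expR_ge0 _) (Ek n j))).
    rewrite mulrCA -expRD le_eqVlt; apply/orP; left; apply/eqP; congr (_ * expR _); ring.
  + exact: cvg_cst.
- exact: cvg_cst.
Qed.

End total_running.

Lemma upper_estimate (R : realType) (a b g g' r l e : R) : `|a| <= r -> `|b| <= l -> 0 <= g' ->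
  g' <= g -> g = 2 * r + e -> 0 <= l -> `|a + b + (g - g')| <= 3 * (r + l) + e.
Proof.
move=> grid_overshoot bl g0 gg ge l0; apply: (le_trans (ler_normD _ _)); have := ler_normD a b.
by rewrite [X in _ -> _ + X <= _]ger0_norm ?subr_ge0//; lra.
Qed.

Section lower_bound.
Context {R : realType} {d : measure_display} {T : measurableType d}.
Local Notation mu := (@lebesgue_measure R).
Variables (P : probability T R) (F : R -> set (set T)) (X : R -> T -> R).
Hypothesis hF : usual_filtration P F.
Hypothesis hX : levy_process P F X.
Hypothesis hX0 : forall w, X 0 w = 0.
Hypothesis hXc : forall w, cadlag (X ^~ w).
Variables (theta dl : R).
Hypothesis th0 : 0 < theta.
Hypothesis dl0 : 0 <= dl.
Hypothesis mgp : forall t : R, 0 <= t -> (mg P X theta t <= (expR (dl * t))%:E)%E.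
Hypothesis mgm : forall t : R, 0 <= t -> (mg P X (- theta) t <= (expR (dl * t))%:E)%E.
Variables (u f c : R -> R) (K delta : R).
Hypothesis K0 : 0 <= K.
Hypothesis uK : forall x, `|u x| <= K * (1 + cosh (theta * x)).
Hypothesis fK : forall x, `|f x| <= K * (1 + cosh (theta * x)).
Hypothesis cK : forall x, `|c x| <= K * (1 + cosh (theta * x)).
Hypothesis cu : continuous u.
Hypothesis cf : continuous f.
Hypothesis cc : continuous c.
Hypothesis dld : dl < delta.
Hypothesis uC1 : C1 u.
Hypothesis u_le : forall y, derive1 u y <= c y.
Variable J : nat -> nat.
Hypothesis J_oo : forall j, \forall n \near \oo, (j <= J n)%N.
Hypothesis J_step_defect : forall n y, `|y| <= (J n)%:R - 1 ->
  - ((J n).+1%:R^-1 * dyadic n) <= step_defect P X u delta f n y.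
Variables (x : R) (D : R -> T -> R).
Hypothesis neD : forall w, control_path (D ^~ w).
Hypothesis DF : forall t, 0 <= t -> Fm F t (D t).
Variable C : R.
Hypothesis C0 : 0 <= C.
Hypothesis fstar : forall y z, z <= y -> f y <= `|f z| + C * (1 + expR (theta * y)).
Local Notation A := (regular_abs_cost X x delta D c f).
Hypothesis iA : (\int[P]_w A w < +oo)%E.

Let delta0 : 0 <= delta. Proof. exact: ltW (le_lt_trans dl0 dld). Qed.
Let mX t : 0 <= t -> measurable_fun setT (X t). Proof. exact: (X_meas hF hX). Qed.
Let mD t : 0 <= t -> measurable_fun setT (D t).
Proof. by move=> t0; exact: (Fm_meas hF t0 (DF t0)). Qed.

(** The total discounted exponential growth along the uncontrolled path; its mean is finite because
    [dl < delta], and it dominates what capping adds to the cost. *)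
Definition exp_running w := (\int[mu]_(s in `]0%R, +oo[) (running_density delta x (X ^~ w) (fun=> 0) (exp_growth theta) s)%:E)%E.

Lemma exp_growth_cont : continuous (exp_growth theta : R -> R).
Proof.
move=> y; apply: cvgD; first exact: cvg_cst.
apply: continuous_comp; last exact: continuous_expR.
by apply: cvgM; [exact: cvg_cst|exact: cvg_id].
Qed.

Lemma exp_growth_ge0 (y : R) : 0 <= exp_growth theta y.
Proof. by rewrite addr_ge0// expR_ge0. Qed.

Let m0 (t : R) : 0 <= t -> measurable_fun setT ((fun _ _ => 0) t : T -> R).
Proof. by move=> _; exact: measurable_cst. Qed.

Lemma exp_running_meas : measurable_fun setT exp_running.
Proof.
exact: (@run_total_meas _ _ _ X mX hXc x delta (fun _ _ => 0) delta0 m0 (fun=> ndrc0) _ exp_growth_cont exp_growth_ge0).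
Qed.

Lemma exp_running_ge0 w : (0 <= exp_running w)%E.
Proof. by apply: integral_ge0 => s _; rewrite lee_fin mulr_ge0 ?expR_ge0 ?exp_growth_ge0. Qed.

Lemma exp_running_fin : (\int[P]_w exp_running w < +oo)%E.
Proof.
have e0 := expR_ge0 (theta * x).
have ex t : 0 <= t -> intg P (fun w => expR (theta * X t w)).
  by move=> t0; exact: (intg_expX hF hX mgp mgm (or_introl erefl) t0).
have kX t : (fun w => exp_growth theta (x + X t w - 0)) = (fun w => 1 + expR (theta * x) * expR (theta * X t w)).
  by apply/funext => w; rewrite /exp_growth subr0 mulrDr expRD.
apply: (@le_lt_trans _ _ ((1 + expR (theta * x)) * (expR (delta - dl) / (delta - dl)))%:E); last exact: ltry.
apply: (@total_running_le _ _ _ P X (fun _ _ => 0) mX hXc m0 (fun=> ndrc0) (fun _ _ _ => 0) _ _ _ x dl delta _ (exp_growth theta)) => //.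
- by move=> w t t' l _ _ /ltW l0; near=> n.
- exact: exp_growth_cont.
- exact: exp_growth_ge0.
- by move=> n j; rewrite kX; apply: intgD; [exact: intg_cst|apply: intgZ; apply: ex; exact: kh_ge0].
- move=> n j; have t0 := kh_ge0 (R := R) n j; rewrite kX EED; [|exact: intg_cst|apply: intgZ; exact: ex].
  rewrite EE_cst EEZ; last exact: ex.
  have := EE_expX hF hX mgp mgm (or_introl erefl) t0.
  have : 1 <= expR (dl * (j%:R * dyadic n)) by rewrite -[leLHS]expR0 ler_expR mulr_ge0.
  by move=> h1 h2; have := ler_wpM2l e0 h2; lra.
Unshelve. all: by end_near. Qed.

Definition good w := (A w < +oo)%E && (exp_running w < +oo)%E.

Lemma good_meas : measurable_fun setT good.
Proof.
apply: measurable_and; first exact: (fin_meas mX hXc _ delta0 mD neD cc cf).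
by apply: measurable_fun_lte => //; exact: exp_running_meas.
Qed.

Lemma A_meas : measurable_fun setT A.
Proof. exact: (regular_abs_cost_meas mX hXc _ delta0 mD neD cc cf). Qed.

Lemma A_ge0 w : (0 <= A w)%E.
Proof. exact: regular_abs_cost_ge0. Qed.

Lemma good_ae : {ae P, forall w, good w}.
Proof.
have [_ h1] := intg_ae_lty A_meas A_ge0 iA.
have [_ h2] := intg_ae_lty exp_running_meas exp_running_ge0 exp_running_fin.
by apply: filterS2 h1 h2 => w h1 h2; rewrite /good h1 h2.
Qed.

Local Notation pc := (regular_cost X x delta D c f).

Lemma regular_cost_intg : intg P pc.
Proof.
have [h1 h2] := intg_ae_lty A_meas A_ge0 iA.
apply: (intg_dom _ h1); first exact: (regular_cost_meas mX hXc _ delta0 mD neD cc cf).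
move=> w; case: (boolP (A w < +oo)%E) => h; first exact: (regular_cost_le hXc delta0 neD cc cf h).
by rewrite /regular_cost (negbTE h) normr0 fine_ge0// A_ge0.
Qed.

(* The exponential moment of the cap then grows like [e^{(delta - dl) m / 2}], more
   slowly than [e^{-delta m} E cosh (theta X_m)] decays. *)
Definition cap_level m := (delta - dl) / (2 * theta) * m.+1%:R.

Lemma cap_level_gt0 m : 0 < cap_level m.
Proof. by rewrite mulr_gt0// divr_gt0 ?subr_gt0// mulr_gt0. Qed.

Lemma cap_level_oo B : \forall m \near \oo, B < cap_level m.
Proof.
have k0 : 0 < (delta - dl) / (2 * theta) by rewrite divr_gt0 ?subr_gt0// mulr_gt0.
near=> m; rewrite /cap_level mulrC -ltr_pdivrMr//.
apply: (lt_le_trans (truncnS_gt _)); rewrite ler_nat ltnS; near: m.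
by exists (Num.truncn (B / ((delta - dl) / (2 * theta)))).
Unshelve. all: by end_near. Qed.

Local Notation hc m := (horizon_cost X x delta u f c (capped_ctl D (cap_level m)) m).
Local Notation tl m := (capped_tail X u delta x D m (cap_level m)).
Local Notation up m w := (capped_upper delta x theta C f c (X ^~ w) (D ^~ w) (cap_level m) m).

(* The truncated cost has an upper bound that converges to [pc w], but no lower bound. *)
Definition truncated_cost m w := if good w then Num.max (hc m w - tl m w) (pc w) else 0.

Lemma good_path w : good w ->
  [/\ mu.-integrable [set` `]0, +oo[] (EFin \o running_density delta x (X ^~ w) (D ^~ w) f),
      mu.-integrable (attained (D ^~ w)) (EFin \o level_density delta x c (X ^~ w) (D ^~ w) id),
      mu.-integrable [set` `]0, +oo[] (EFin \o running_density delta x (X ^~ w) (fun=> 0) (exp_growth theta)) &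
      pc w = \int[mu]_(s in `]0, +oo[) running_density delta x (X ^~ w) (D ^~ w) f s +
        \int[mu]_(l in attained (D ^~ w)) level_density delta x c (X ^~ w) (D ^~ w) id l].
Proof.
move=> /andP[gA gE]; have [i1 i2] := fin_cost_integrable delta0 cf cc (hXc w) (neD w) gA.
split => //; last by rewrite /regular_cost gA.
apply/integrableP; split.
  by apply/measurable_EFinP; apply: (running_density_meas _ delta0 (hXc w) ndrc0); exact: exp_growth_cont.
move: gE; rewrite /exp_running; congr (_ < _)%E; apply: eq_integral => s _ /=.
by rewrite ger0_norm// mulr_ge0 ?expR_ge0 ?exp_growth_ge0.
Qed.

Lemma hc_le m w : good w -> hc m w - tl m w <= up m w.
Proof.
move=> /good_path[i1 i2 i3 _]; have N0 := cap_level_gt0 m.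
rewrite /horizon_cost /capped_upper (capped_levels delta0 cc (hXc w) (neD w) m N0 i2).
have := capped_run_le delta0 (ltW th0) cf (hXc w) (neD w) C0 fstar m N0 i1 i3.
have : discount delta m%:R * u (x + X m%:R w - capped_ctl D (cap_level m) m%:R w) <= tl m w.
  by rewrite ler_wpM2l ?expR_ge0// ler_norm.
by rewrite /running_density /capped_ctl; lra.
Qed.

Lemma up_le m w : good w -> `|up m w| <= 3 * fine (A w) + C * fine (exp_running w).
Proof.
move=> gw; have [i1 i2 i3 _] := good_path gw; have /andP[gA gE] := gw; have N0 := cap_level_gt0 m.
have iG := overflow_intg C i1 i3.
have eA := abs_fine hXc delta0 neD cc cf gA.
have mu_ := measurable_itv (R := R).
have sub : [set` `]0, m%:R]] `<=` ([set` `]0, +oo[] : set R).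
  by move=> s /=; rewrite !in_itv/= andbT => /andP[].
have h1 := part_le (mu_ _) (mu_ _) sub i1.
have sub2 : [set` `]0, capped_sup (D ^~ w) (cap_level m) m%:R]] `<=` attained (D ^~ w) by exact: capped_sup_attained.
have h2 := part_le (mu_ _) (attained_meas (neD w)) sub2 i2.
have G0 s : 0 <= overflow delta x theta C f (X ^~ w) (D ^~ w) s by exact: overflow_ge0.
have h3 := part_le (below_meas (neD w) (cap_level m)) (mu_ _) (@below_sub _ (D ^~ w) (cap_level m)) iG.
have h4 : 0 <= \int[mu]_(s in below (D ^~ w) (cap_level m)) overflow delta x theta C f (X ^~ w) (D ^~ w) s.
  by apply: Rintegral_ge0.
have h5 : \int[mu]_(s in `]0, +oo[) `|overflow delta x theta C f (X ^~ w) (D ^~ w) s| =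
    \int[mu]_(s in `]0, +oo[) overflow delta x theta C f (X ^~ w) (D ^~ w) s.
  by apply: eq_Rintegral => s _; rewrite ger0_norm.
have h6 : \int[mu]_(s in `]0, +oo[) overflow delta x theta C f (X ^~ w) (D ^~ w) s =
    2 * \int[mu]_(s in `]0, +oo[) `|running_density delta x (X ^~ w) (D ^~ w) f s| + C * fine (exp_running w).
  rewrite RintegralD//.
  - congr (_ + _); first by rewrite RintegralZl//; exact: integrable_on_norm.
    by rewrite RintegralZl.
  - by apply: integrable_onZ => //; exact: integrable_on_norm.
  - exact: integrable_onZ.
have h7 : 0 <= \int[mu]_(l in attained (D ^~ w)) `|level_density delta x c (X ^~ w) (D ^~ w) id l|.
  exact: Rintegral_ge0.
rewrite eA; rewrite h5 (ger0_norm h4) in h3.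
exact: (upper_estimate h1 h2 h4 h3 h6 h7).
Qed.

Lemma truncated_cost_le m w : `|truncated_cost m w| <= 4 * fine (A w) + C * fine (exp_running w).
Proof.
have a0 : 0 <= fine (A w) by rewrite fine_ge0// A_ge0.
have e0 : 0 <= C * fine (exp_running w) by rewrite mulr_ge0// fine_ge0// exp_running_ge0.
rewrite /truncated_cost; case: ifPn => gw; last by rewrite normr0 addr_ge0// mulr_ge0.
have h1 := hc_le m gw; have := up_le m gw; rewrite ler_norml => /andP[_ h2].
have /andP[gA _] := gw.
have := regular_cost_le hXc delta0 neD cc cf gA; rewrite ler_norml => /andP[h3 h4].
rewrite ler_norml le_max ge_max; apply/and3P; split; [apply/orP; right|..]; lra.
Qed.

Lemma truncated_cost_cvg w : truncated_cost m w @[m --> \oo] --> (if good w then pc w else 0).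
Proof.
rewrite /truncated_cost; case: ifPn => gw; last exact: cvg_cst.
have [i1 i2 i3 pE] := good_path gw.
have c1 : up m w @[m --> \oo] --> pc w.
  by rewrite pE; apply: capped_upper_cvg => //; [exact: cap_level_gt0|exact: cap_level_oo].
(* The truncated cost lies between [pc w] and this quantity, since its other entry is at most
   [up m w]. *)
have c2 : pc w + `|up m w - pc w| @[m --> \oo] --> pc w + `|pc w - pc w|.
  by apply: cvgD; [exact: cvg_cst|apply: cvg_norm; apply: cvgB => //; exact: cvg_cst].
rewrite subrr normr0 addr0 in c2.
apply: (squeeze_cvgr _ (cvg_cst (pc w)) c2); near=> m.
rewrite le_max lexx orbT/= ge_max lerDl normr_ge0 andbT -lerBlDl.
apply: (le_trans _ (ler_norm _)); rewrite lerB//; exact: hc_le.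
Unshelve. all: by end_near. Qed.

Lemma tl_cvg : EE P (tl m) @[m --> \oo] --> (0 : R).
Proof.
have kap : 0 < delta - dl by rewrite subr_gt0.
pose b m := K * (1 + 2 * cosh (theta * x)) * (expR ((delta - dl) / 2) * expR (- ((delta - dl) / 2)) ^+ m).
have b0 : b m @[m --> \oo] --> (0 : R).
  suff : b m @[m --> \oo] --> K * (1 + 2 * cosh (theta * x)) * (expR ((delta - dl) / 2) * 0) by rewrite !mulr0.
  apply: cvgMr; apply: cvgMr; apply: cvg_expr.
  rewrite ger0_norm ?expR_ge0// -[ltRHS]expR0 ltr_expR oppr_lt0 divr_gt0//.
apply: (squeeze_cvgr _ (cvg_cst 0) b0); near=> m.
have [_ h] := tail_bound hF hX th0 mgp mgm delta K0 uK cu x neD DF m (cap_level_gt0 m).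
apply/andP; split.
  by apply: EE_ge0 => w; rewrite mulr_ge0// expR_ge0.
apply: (le_trans h); rewrite ler_wpM2l//.
  by rewrite mulr_ge0// addr_ge0// mulr_ge0// cosh_ge0.
rewrite -expRM_natl -expRD ler_expR le_eqVlt; apply/orP; left; apply/eqP.
by rewrite /cap_level -natr1; field; rewrite gt_eqF.
Unshelve. all: by end_near. Qed.

(** For each horizon the chain gives [u x <= E hc], and [E hc] is at most [E truncated_cost + E tl].
    The first mean converges by domination, the second vanishes. *)
Lemma lower_bound : u x <= EE P pc.
Proof.
have [iA1 _] := intg_ae_lty A_meas A_ge0 iA.
have [iE1 _] := intg_ae_lty exp_running_meas exp_running_ge0 exp_running_fin.
have cb m := capped_bound hF hX hX0 hXc th0 dl0 mgp mgm K0 uK fK cK cu cf cc dld uC1 u_le J_oo J_step_defect x neD DF m (cap_level_gt0 m).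
have tb m := (tail_bound hF hX th0 mgp mgm delta K0 uK cu x neD DF m (cap_level_gt0 m)).1.
have ih m : intg P (fun w => hc m w - tl m w) by apply: intgB; [exact: (cb m).1|exact: tb].
have mvm m : measurable_fun setT (truncated_cost m).
  apply: measurable_fun_ifT => //; first exact: good_meas.
  by apply: measurable_maxr; [exact: (intg_meas (ih m))|exact: (intg_meas regular_cost_intg)].
have iW : intg P (fun w => 4 * fine (A w) + C * fine (exp_running w)).
  by apply: intgD; exact: intgZ.
have [_ cE] := EE_cvg mvm truncated_cost_cvg iW truncated_cost_le.
have EE' : EE P (fun w => if good w then pc w else 0) = EE P pc.
  apply: EE_ae; first by apply: measurable_fun_ifT => //; [exact: good_meas|exact: (intg_meas regular_cost_intg)].
    exact: (intg_meas regular_cost_intg).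
  by apply: filterS good_ae => w ->.
rewrite EE' in cE.
have c2 : EE P (truncated_cost m) + EE P (tl m) @[m --> \oo] --> EE P pc + 0 by apply: cvgD => //; exact: tl_cvg.
rewrite addr0 in c2.
apply: (cvg_ge_near c2); near=> m.
apply: (le_trans (cb m).2); rewrite -lerBlDr -EEB//; last exact: (cb m).1.
have mi : measurable_fun setT (fun w => if good w then hc m w - tl m w else 0).
  by apply: measurable_fun_ifT => //; [exact: good_meas|exact: (intg_meas (ih m))].
have eq1 : {ae P, forall w, hc m w - tl m w = if good w then hc m w - tl m w else 0}.
  by apply: filterS good_ae => w ->.
rewrite (EE_ae (intg_meas (ih m)) mi eq1); apply: EE_le.
- exact: (intg_ae (intg_meas (ih m)) mi eq1 (ih m)).
- by apply: (intg_dom (mvm m) iW); exact: truncated_cost_le.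
- by move=> w; rewrite /truncated_cost; case: ifP => // _; rewrite le_max lexx.
Unshelve. all: by end_near. Qed.

End lower_bound.

(** * The reflecting control *)

Section reflected.
Context {R : realType} {d : measure_display} {T : measurableType d}.
Local Notation mu := (@lebesgue_measure R).
Variables (P : probability T R) (F : R -> set (set T)) (X : R -> T -> R).
Hypothesis hF : usual_filtration P F.
Hypothesis hX : levy_process P F X.
Hypothesis hX0 : forall w, X 0 w = 0.
Hypothesis hXc : forall w, cadlag (X ^~ w).
Variables (theta dl : R).
Hypothesis th0 : 0 < theta.
Hypothesis dl0 : 0 <= dl.
Hypothesis mgp : forall t : R, 0 <= t -> (mg P X theta t <= (expR (dl * t))%:E)%E.
Hypothesis mgm : forall t : R, 0 <= t -> (mg P X (- theta) t <= (expR (dl * t))%:E)%E.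
Variables (u f c : R -> R) (K delta : R).
Hypothesis K0 : 0 <= K.
Hypothesis uK : forall x, `|u x| <= K * (1 + cosh (theta * x)).
Hypothesis fK : forall x, `|f x| <= K * (1 + cosh (theta * x)).
Hypothesis cK : forall x, `|c x| <= K * (1 + cosh (theta * x)).
Hypothesis cu : continuous u.
Hypothesis cf : continuous f.
Hypothesis cc : continuous c.
Hypothesis dld : dl < delta.
Variables (x b : R).
Hypothesis uC1 : C1 u.
Hypothesis u_le : forall y, derive1 u y <= c y.
Hypothesis u_eq : forall y, b <= y -> derive1 u y = c y.
Variable J : nat -> nat.
Hypothesis J_oo : forall j, \forall n \near \oo, (j <= J n)%N.
Hypothesis J_step_defect : forall n y, y <= b -> `|y| <= (J n)%:R - 1 ->
  step_defect P X u delta f n y <= (J n).+1%:R^-1 * dyadic n.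

Let delta0 : 0 <= delta. Proof. exact: ltW (le_lt_trans dl0 dld). Qed.
Let mX t : 0 <= t -> measurable_fun setT (X t). Proof. exact: (X_meas hF hX). Qed.

Definition reflecting_path t w := run_sup (overshoot X x b ^~ w) t.
Local Notation a := (grid_overshoot X x b).
Local Notation Y n := (chain_pos X x (dyadic n) (a n)).
Local Notation p n := (pos X x (dyadic n)).
Local Notation pre n k w := (p n k w - prev (a n) k w).
Local Notation DM := (dom X theta x b).

Lemma overshoot_rc w s : 0 <= s -> overshoot X x b ^~ w @ s^'+ --> overshoot X x b s w.
Proof.
move=> s0; have h : (fun r => x + X r w - b) @ s^'+ --> x + X s w - b.
  by apply: cvgB; [apply: cvgD; [exact: cvg_cst|exact: (hXc w).1]|exact: cvg_cst].
exact: (cvg_comp _ _ h (@max0_continuous R (x + X s w - b))).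
Qed.

Lemma overshoot_le w s t : 0 <= s -> s <= t -> overshoot X x b s w <= `|x| + `|b| + Xs X t w.
Proof.
move=> s0 st; rewrite /overshoot ge_max; apply/andP; split.
  have := Xs_ub hXc w s0 st; have := ler_norm x; have := ler_norm (- b).
  by rewrite normrN; have := ler_norm (X s w); lra.
by rewrite !addr_ge0//; apply: (Xs_ge0 hXc); exact: le_trans st.
Qed.

Lemma overshoot_bd w t : exists M, forall s, 0 <= s -> s <= t -> overshoot X x b s w <= M.
Proof. by exists (`|x| + `|b| + Xs X t w) => s; exact: overshoot_le. Qed.

Lemma overshoot_ge0 w s : 0 <= s -> 0 <= overshoot X x b s w.
Proof. by move=> _; rewrite le_max lexx orbT. Qed.

Lemma control_path_reflecting_path w : control_path (reflecting_path ^~ w).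
Proof. apply: control_path_run_sup; [exact: overshoot_rc|exact: overshoot_bd|exact: overshoot_ge0]. Qed.

Lemma overshoot_F t : 0 <= t -> Fm F t (overshoot X x b t).
Proof.
move=> t0; apply: (Fm_max hF) => //; last exact: (Fm_cst hF).
apply: (Fm_sub hF) => //; last exact: (Fm_cst hF).
apply: (Fm_add hF) => //; first exact: (Fm_cst hF).
exact: (Fm_X hX).
Qed.

Lemma reflecting_path_F t : 0 <= t -> Fm F t (reflecting_path t).
Proof. by move=> t0; apply: (run_sup_F hF overshoot_rc overshoot_bd overshoot_F). Qed.

Let mDb t : 0 <= t -> measurable_fun setT (reflecting_path t).
Proof. by move=> t0; exact: (Fm_meas hF t0 (reflecting_path_F t0)). Qed.

Lemma reflecting_path_intg t : 0 <= t -> intg P (reflecting_path t).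
Proof.
move=> t0; have s0 w := Xs_ge0 hXc w t0.
apply: (@intg_dom _ _ _ P (fun w => `|x| + `|b| + theta^-1 * expR (theta * Xs X t w))); first exact: mDb.
  apply: intgD; first exact: intg_cst.
  by apply: intgZ; exact: (intg_expXs hF hX hX0 hXc th0 dl0 mgp mgm t0).
move=> w; rewrite ger0_norm; last exact: (nd_ge0 (control_path_reflecting_path w)).
apply: run_sup_le => // s s0' st; apply: (le_trans (overshoot_le w s0' st)); rewrite lerD2l mulrC ler_pdivlMr// mulrC.
by apply: le_trans (expR_ge1Dx _); rewrite lerDr.
Qed.

Lemma grid_overshoot_lim w t t' l : 0 <= t -> t < t' -> l < reflecting_path t w ->
  \forall n \near \oo, forall k, t' <= k%:R * dyadic n -> l <= a n k w.
Proof. by move=> t0 tt lt; exact: (grid_max_run_sup_lim (@overshoot_rc w) t0 tt lt). Qed.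

Lemma grid_overshoot_le_reflecting_path n k w : a n k w <= reflecting_path (k%:R * dyadic n) w.
Proof. by apply: grid_max_le_run_sup; [exact: overshoot_bd|exact: dyadic_ge0]. Qed.

Lemma grid_overshoot_end m w : a n (m * 2 ^ n)%N w @[n --> \oo] --> reflecting_path m%:R w.
Proof. exact: (@grid_max_run_sup_end _ _ (@overshoot_rc w) (@overshoot_bd w) m). Qed.

Definition Kd := K * (1 + 2 * cosh (theta * b)).

Lemma Kd_ge0 : 0 <= Kd. Proof. exact: Cy_ge0. Qed.

Lemma grow_b (k : R -> R) y : (forall x, `|k x| <= K * (1 + cosh (theta * x))) ->
  `|k y| <= Kd * cosh (theta * (y - b)).
Proof. by move=> kK; have := u_shift K0 kK b (y - b); rewrite addrC subrK. Qed.

(** Chosen so that [K (1 + cosh (theta y)) <= K2 e^{theta y}] for [y >= b]: there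
    [1 <= e^{theta y} B] and [e^{- theta y} <= B <= e^{theta y} B^2] with [B = e^{- theta b}]. *)
Definition K2 := K * (expR (- theta * b) + 1 + expR (- theta * b) ^+ 2).

Lemma K2_ge0 : 0 <= K2.
Proof. by rewrite mulr_ge0// !addr_ge0 ?exprn_ge0 ?expR_ge0. Qed.

Lemma c_exp y : b <= y -> `|c y| <= K2 * expR (theta * y).
Proof.
move=> yb; apply: (le_trans (cK _)); rewrite /K2 -mulrA ler_wpM2l//.
set E := expR (theta * y); set B := expR (- theta * b).
have E0 : 0 < E := expR_gt0 _; have B0 : 0 < B := expR_gt0 _.
have EB : 1 <= E * B.
  by rewrite /E /B -expRD -[leLHS]expR0 ler_expR mulNr -mulrBr mulr_ge0 ?subr_ge0// ltW.
have -> : cosh (theta * y) = (E + E^-1) / 2 by rewrite /cosh expRN.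
have : E^-1 <= B by rewrite -[leLHS]mul1r ler_pdivrMr// mulrC.
have : B <= E * B * B by rewrite ler_peMl// ltW.
have : 0 <= E^-1 by rewrite invr_ge0 ltW.
nra.
Qed.

Lemma exp_derive (r z : R) : is_derive z (1 : R) (fun y => r / theta * expR (theta * y)) (r * expR (theta * z)).
Proof.
apply: is_derive_eq; rewrite /GRing.scale/=.
by field; rewrite gt_eqF.
Qed.

Lemma prim_exp (k : R -> R) y z : continuous k -> (forall y, b <= y -> `|k y| <= K2 * expR (theta * y)) ->
  b <= y -> y <= z ->
  `|prim k z - prim k y| <= K2 / theta * (expR (theta * z) - expR (theta * y)).
Proof.
move=> ck kK yb yz; have dp r := prim_derive r ck.
have h1 : prim k z - prim k y <= K2 / theta * expR (theta * z) - K2 / theta * expR (theta * y).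
  apply: (increment_le dp (exp_derive K2)) => // r yr _.
  by apply: le_trans (ler_norm _) (kK _ _); apply: (le_trans yb); exact: ltW.
have h2 : - K2 / theta * expR (theta * z) - - K2 / theta * expR (theta * y) <= prim k z - prim k y.
  apply: (increment_le (exp_derive (- K2)) dp) => // r yr _.
  have := kK r (le_trans yb (ltW yr)); rewrite ler_norml => /andP[h _].
  by rewrite mulNr.
by rewrite ler_norml mulrBr; apply/andP; split => //; move: h2; rewrite !mulNr; lra.
Qed.

Lemma Y_cases n k w : Y n k w = pre n k w \/ (Y n k w = b /\ b <= pre n k w).
Proof.
by rewrite Y_min; case: (leP (pre n k w) b) => h; [left|right; split=> //; exact: ltW].
Qed.

(** A push, if any, ends at [b] and starts above it, so it only covers positions where [u' = c]. *)
Lemma u_control_step n k w : u (pre n k w) - u (Y n k w) = control_step X x (dyadic n) (prim c) (a n) k w.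
Proof.
rewrite /control_step; case: (Y_cases n k w) => [->|[-> h]]; first by rewrite !subrr.
exact: (value_increment_eq uC1 cc u_le u_eq).
Qed.

Lemma dprim_le (k : R -> R) n j w : continuous k -> (forall y, b <= y -> `|k y| <= K2 * expR (theta * y)) ->
  `|prim k (pre n j w) - prim k (Y n j w)| <=
  K2 / theta * (expR (theta * pre n j w) - expR (theta * Y n j w)).
Proof.
move=> ck kK; case: (Y_cases n j w) => [->|[-> h]]; first by rewrite !subrr normr0 mulr0.
exact: prim_exp.
Qed.

Lemma intg_u_pre n k : intg P (fun w => u (pre n k w)).
Proof.
apply: (intg_pre hF hX hX0 hXc th0 dl0 mgp mgm x n k _ _ Kd_ge0).
  exact: continuous_measurable_fun.
by move=> y; exact: grow_b.
Qed.

Lemma intg_kY (k : R -> R) n j : continuous k -> (forall x, `|k x| <= K * (1 + cosh (theta * x))) ->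
  intg P (fun w => k (Y n j w)).
Proof.
move=> ck kK; apply: (intg_Y hF hX hX0 hXc th0 dl0 mgp mgm x n j _ _ Kd_ge0).
  exact: continuous_measurable_fun.
by move=> y; exact: grow_b.
Qed.

Section fixed_horizon.
Variable m : nat.

(** Up to time [m] the uncontrolled position is at most [|x|] plus the supremum of [|X|]; its
    exponential factors out, and what remains telescopes in [e^{- theta a}], with total at most
    1. *)
Lemma sum_exp_le n j w : (j <= m * 2 ^ n)%N ->
  \sum_(k < j.+1) (expR (theta * pre n k w) - expR (theta * Y n k w)) <= DM m w.
Proof.
move=> jm; set E := expR (theta * (`|x| + Xs X m%:R w)).
apply: (@le_trans _ _ E); last first.
  apply: (@le_trans _ _ (expR (theta * (`|x| + `|b|)) * expR (theta * Xs X m%:R w))).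
    rewrite -expRD ler_expR -mulrDr ler_wpM2l ?(ltW th0)//; have := normr_ge0 b; lra.
  by rewrite lerDr expR_ge0.
apply: (@le_trans _ _ (\sum_(k < j.+1) E * (expR (- theta * prev (a n) k w) - expR (- theta * a n k w)))).
  apply: ler_sum => k _.
  have -> : expR (theta * pre n k w) - expR (theta * Y n k w) =
      expR (theta * p n k w) * (expR (- theta * prev (a n) k w) - expR (- theta * a n k w)).
    by rewrite [RHS]mulrBr -!expRD /chain_pos; congr (expR _ - expR _); ring.
  apply: ler_wpM2r.
    rewrite subr_ge0 ler_expR !mulNr lerN2 ler_wpM2l ?(ltW th0)//.
    by rewrite [a n k w]grid_overshoot_prev le_max lexx.
  rewrite /E ler_expR ler_wpM2l ?(ltW th0)// /pos lerD ?ler_norm//.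
  apply: (le_trans (ler_norm _)); apply: (X_le_Xs hXc); apply: leq_trans jm.
  by rewrite -ltnS.
rewrite -mulr_sumr ler_piMr ?expR_ge0//.
suff -> : \sum_(k < j.+1) (expR (- theta * prev (a n) k w) - expR (- theta * a n k w)) =
    1 - expR (- theta * a n j w) by rewrite gerBl expR_ge0.
elim: (j) => [|i IH]; first by rewrite big_ord_recr/= big_ord0 add0r mulr0 expR0.
by rewrite big_ord_recr/= IH; ring.
Qed.

Definition reflected_dominator w := (m%:R * Kd + K2 / theta + Kd) * DM m w.

Lemma kY_dom (k : R -> R) n j w : (forall x, `|k x| <= K * (1 + cosh (theta * x))) -> (j <= m * 2 ^ n)%N ->
  `|k (Y n j w)| <= Kd * DM m w.
Proof.
move=> kK jm; apply: (le_trans (grow_b _ kK)); rewrite ler_wpM2l ?Kd_ge0//.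
apply: (cosh_dom hXc th0 jm (lexx _)).
exact: le_trans (Y_le_pre _ _ _ _ _ _) (pre_le _ _ _ _ _ _).
Qed.

Lemma cost_reflected_dominator n j w : (j <= m * 2 ^ n)%N -> `|cost_upto X x (dyadic n) delta u f (prim c) (a n) j w| <= reflected_dominator w.
Proof.
move=> jm.
have ee1 k : ee (dyadic n) delta k <= 1 by apply: discount_le1 => //; exact: kh_ge0.
have eeE k (z E : R) : `|z| <= E -> `|ee (dyadic n) delta k * z| <= E.
  by move=> zE; rewrite normrM ger0_norm ?expR_ge0//; apply: le_trans zE; rewrite ler_piMl.
have D0 : 0 <= Kd * DM m w by apply: le_trans (kY_dom w uK jm).
rewrite /reflected_dominator !mulrDl -mulrA.
rewrite /cost_upto; apply: (le_trans (ler_normD _ _)); apply: lerD; last first.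
  by apply: eeE; exact: kY_dom.
apply: (le_trans (ler_normD _ _)); apply: lerD.
  apply: (le_trans (ler_norm_sum _ _ _)).
  apply: (@le_trans _ _ (\sum_(k < j) dyadic n * (Kd * DM m w))); last first.
    by rewrite sumr_const card_ord -[_ *+ j]mulr_natl mulrA ler_wpM2r// kh_m.
  apply: ler_sum => k _; rewrite normrM ger0_norm ?dyadic_ge0// ler_wpM2l ?dyadic_ge0//.
  by apply: eeE; apply: kY_dom => //; rewrite (leq_trans _ jm)// ltnW.
apply: (le_trans (ler_norm_sum _ _ _)).
have k20 : 0 <= K2 / theta by rewrite divr_ge0 ?K2_ge0// ltW.
apply: le_trans (ler_wpM2l k20 (sum_exp_le w jm)).
rewrite mulr_sumr; apply: ler_sum => k _; apply: eeE.
by apply: dprim_le => //; exact: c_exp.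
Qed.

Lemma intg_DM : intg P (DM m).
Proof. exact: (intg_dom_r hF hX hX0 hXc th0 dl0 mgp mgm). Qed.

Lemma reflected_bound : intg P (horizon_cost X x delta u f c reflecting_path m) /\
  EE P (horizon_cost X x delta u f c reflecting_path m) <= u x.
Proof.
have [||||||||||||||||ih] := @chain_limit _ _ _ P F X hF hX hX0 hXc x delta u f c delta0 cu cf cc
  _ a reflecting_path m (-1) J reflected_dominator J_oo.
- by move=> n y; exact: (intg_u hF hX mgp mgm K0 uK cu y (dyadic_ge0 n)).
- exact: control_path_reflecting_path.
- exact: (grid_overshoot_F hF hX).
- by move=> n j k w jk; exact: grid_overshoot_nd.
- by move=> n k w; exact: grid_overshoot_ge0.
- by move=> n k w _; exact: grid_overshoot_le_reflecting_path.
- move=> w t t' l t0 tt lt; have := grid_overshoot_lim t0 tt lt.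
  by apply: filterS => n h k _; exact: h.
- by move=> w; exact: grid_overshoot_end.
- by move=> n k w; rewrite u_control_step.
- move=> n k w h; rewrite mulN1r lerN2; apply: J_step_defect h; exact: Y_le.
- by move=> n k; exact: (intg_u_pre n k.+1).
- by move=> n k; exact: intg_kY.
- by move=> n k; exact: intg_kY.
- move=> n k; rewrite (_ : control_step _ _ _ _ _ _ = fun w => u (pre n k w) - u (Y n k w)).
    by apply: intgB; [exact: intg_u_pre|exact: intg_kY].
  by apply/funext => w; rewrite u_control_step.
- by rewrite /reflected_dominator; apply: intgZ; exact: intg_DM.
- by move=> n j w jm; exact: cost_reflected_dominator.
by rewrite !mulN1r lerN2.
Qed.

Definition reflected_tail w := discount delta m%:R * u (x + X m%:R w - reflecting_path m%:R w).

(** The moment bound for the reflected chain is uniform in the grid and passes to the reflected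
    position; the discount then beats the growth rate [dl]. *)
Lemma reflected_tail_bound : intg P reflected_tail /\
  `|EE P reflected_tail| <= Kd * cosh (theta * (x - b)) * expR ((dl - delta) * m%:R).
Proof.
pose q n w := cosh (theta * (Y n (m * 2 ^ n) w - b)).
have Ym n w : Y n (m * 2 ^ n) w = x + X m%:R w - a n (m * 2 ^ n) w by rewrite /chain_pos /pos khm.
have Ycvg w : Y n (m * 2 ^ n) w @[n --> \oo] --> x + X m%:R w - reflecting_path m%:R w.
  by under eq_fun do rewrite Ym; apply: cvgB; [exact: cvg_cst|exact: grid_overshoot_end].
have mY n : measurable_fun setT (Y n (m * 2 ^ n)).
  exact: (Fm_meas hF (kh_ge0 n _) (Y_F hF hX x b n _)).
have iq n : measurable_fun setT (q n).
  apply: (measurableT_comp (cosh_meas (R := R))); apply: measurable_funM => //.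
  exact: measurable_funB.
have qc w : q n w @[n --> \oo] --> cosh (theta * (x + X m%:R w - reflecting_path m%:R w - b)).
  apply: cvg_cont; first exact: cosh_continuous.
  by apply: cvgMr; apply: cvgB => //; exact: cvg_cst.
have qd n w : `|q n w| <= DM m w.
  rewrite ger0_norm ?cosh_ge0//; apply: (cosh_dom hXc th0 (leqnn _) (lexx _)).
  exact: le_trans (Y_le_pre _ _ _ _ _ _) (pre_le _ _ _ _ _ _).
have [ic cE] := EE_cvg iq qc intg_DM qd.
have it : intg P reflected_tail.
  apply: intgZ; apply: (intg_dom _ (intgZ Kd ic)).
    apply: measurableT_comp; first exact: continuous_measurable_fun.
    by apply: (measurable_funB (measurable_funD _ _)) => //; [exact: mX|exact: mDb].
  by move=> w; exact: grow_b.
split => //; apply: (le_trans (EE_norm it)).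
apply: (@le_trans _ _ (EE P (fun w => discount delta m%:R * Kd * cosh (theta * (x + X m%:R w - reflecting_path m%:R w - b))))).
  apply: EE_le => //; [exact: intg_norm|exact: intgZ|].
  move=> w; rewrite normrM ger0_norm ?expR_ge0// -mulrA ler_wpM2l ?expR_ge0//; exact: grow_b.
rewrite EEZ//.
have ec : EE P (fun w => cosh (theta * (x + X m%:R w - reflecting_path m%:R w - b))) <= expR (dl * m%:R) * cosh (theta * (x - b)).
  apply: (cvg_le_near cE); near=> n.
  have := EE_cosh_Y hF hX hX0 hXc th0 dl0 mgp mgm x b n (m * 2 ^ n); by rewrite khm.
have k0 : 0 <= discount delta m%:R * Kd by rewrite mulr_ge0 ?expR_ge0 ?Kd_ge0.
apply: (le_trans (ler_wpM2l k0 ec)); rewrite mulrDl expRD le_eqVlt; apply/orP; left; apply/eqP.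
by rewrite /discount; ring.
Unshelve. all: by end_near. Qed.

End fixed_horizon.

End reflected.

Section absolute_average.
Context {R : realType}.
Local Notation mu := (@lebesgue_measure R).
Variable c : R -> R.
Hypothesis cc : continuous c.

Lemma cbar_norm p q : `|cbar c p q| <= cbar (Num.norm \o c) p q.
Proof.
have hn := @le_normr_Rintegral _ _ _ mu _ _ (measurable_itv `[0, 1]) (integrable_continuous 0 1 (comp_affine_cont cc (p := p) (q := q))).
exact: hn.
Qed.

Lemma level_density_le_abs delta x (xi eta : R -> R) l :
  level_density delta x c xi eta Num.norm l <= level_density delta x (Num.norm \o c) xi eta id l.
Proof. by rewrite /level_density ler_wpM2l ?expR_ge0// /average_cost cbar_norm. Qed.

Lemma prim_nd (k : R -> R) y z : continuous k -> (forall r, 0 <= k r) -> y <= z -> prim k y <= prim k z.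
Proof.
by move=> ck k0 yz; apply: (is_derive_le (fun r => prim_derive r ck)).
Qed.

End absolute_average.

Section reflected_cost.
Context {R : realType} {d : measure_display} {T : measurableType d}.
Local Notation mu := (@lebesgue_measure R).
Variables (P : probability T R) (F : R -> set (set T)) (X : R -> T -> R).
Hypothesis hF : usual_filtration P F.
Hypothesis hX : levy_process P F X.
Hypothesis hX0 : forall w, X 0 w = 0.
Hypothesis hXc : forall w, cadlag (X ^~ w).
Variables (theta dl : R).
Hypothesis th0 : 0 < theta.
Hypothesis dl0 : 0 <= dl.
Hypothesis mgp : forall t : R, 0 <= t -> (mg P X theta t <= (expR (dl * t))%:E)%E.
Hypothesis mgm : forall t : R, 0 <= t -> (mg P X (- theta) t <= (expR (dl * t))%:E)%E.
Variables (u f c : R -> R) (K delta : R).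
Hypothesis K0 : 0 <= K.
Hypothesis uK : forall x, `|u x| <= K * (1 + cosh (theta * x)).
Hypothesis fK : forall x, `|f x| <= K * (1 + cosh (theta * x)).
Hypothesis cK : forall x, `|c x| <= K * (1 + cosh (theta * x)).
Hypothesis cu : continuous u.
Hypothesis cf : continuous f.
Hypothesis cc : continuous c.
Hypothesis dld : dl < delta.
Variables (x b : R).
Hypothesis uC1 : C1 u.
Hypothesis u_le : forall y, derive1 u y <= c y.
Hypothesis u_eq : forall y, b <= y -> derive1 u y = c y.
Variable J : nat -> nat.
Hypothesis J_oo : forall j, \forall n \near \oo, (j <= J n)%N.
Hypothesis J_step_defect : forall n y, y <= b -> `|y| <= (J n)%:R - 1 ->
  step_defect P X u delta f n y <= (J n).+1%:R^-1 * dyadic n.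

Let delta0 : 0 <= delta. Proof. exact: ltW (le_lt_trans dl0 dld). Qed.
Let mX t : 0 <= t -> measurable_fun setT (X t). Proof. exact: (X_meas hF hX). Qed.
Let D := reflecting_path X x b.
Let neD w : control_path (D ^~ w). Proof. exact: control_path_reflecting_path. Qed.
Let mD t : 0 <= t -> measurable_fun setT (D t).
Proof. by move=> t0; exact: (Fm_meas hF t0 (reflecting_path_F hF hX hXc x b t0)). Qed.
Local Notation a := (grid_overshoot X x b).
Local Notation Y n := (chain_pos X x (dyadic n) (a n)).
Local Notation p n := (pos X x (dyadic n)).
Local Notation pre n k w := (p n k w - prev (a n) k w).
Local Notation Kd := (Kd theta K b).
Local Notation K2 := (K2 theta K b).

Lemma intg_coshY n j : intg P (fun w => cosh (theta * (Y n j w - b))).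
Proof.
apply: (@intg_Y _ _ _ P F X hF hX hX0 hXc theta dl th0 dl0 mgp mgm x b (fun y => cosh (theta * (y - b))) 1 n j) => //.
  exact: cosh_b_meas.
by move=> y; rewrite mul1r ger0_norm ?cosh_ge0.
Qed.

Lemma reflected_running_fin : (\int[P]_w \int[mu]_(s in `]0%R, +oo[)
    (running_density delta x (X ^~ w) (D ^~ w) (Num.norm \o f) s)%:E < +oo)%E.
Proof.
have k0 : 0 <= Kd by exact: Kd_ge0.
have fY n j : intg P (fun w => f (Y n j w)) by exact: (intg_kY hF hX hX0 hXc th0 dl0 mgp mgm K0 x b n j cf fK).
apply: (@le_lt_trans _ _ (Kd * cosh (theta * (x - b)) * (expR (delta - dl) / (delta - dl)))%:E); last exact: ltry.
apply: (@total_running_le _ _ _ P X D mX hXc mD neD a) => //.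
- by move=> n k w; exact: grid_overshoot_ge0.
- by move=> n k w; exact: grid_overshoot_le_reflecting_path.
- by move=> w t t' l; exact: grid_overshoot_lim.
- exact: norm_cont.
- by move=> y; exact: normr_ge0.
- by rewrite mulr_ge0// cosh_ge0.
- by move=> n j; exact: intg_norm (fY n j).
- move=> n j; have ec := EE_cosh_Y hF hX hX0 hXc th0 dl0 mgp mgm x b n j.
  apply: (@le_trans _ _ (EE P (fun w => Kd * cosh (theta * (Y n j w - b))))).
    apply: EE_le; [exact: intg_norm (fY n j)|apply: intgZ; exact: intg_coshY|].
    by move=> w; exact: grow_b.
  rewrite EEZ; last exact: intg_coshY.
  by rewrite -mulrA ler_wpM2l// mulrC.
Qed.

Let cn := Num.norm \o c.
Let ccn : continuous cn. Proof. exact: norm_cont. Qed.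

Lemma cn_exp y : b <= y -> `|cn y| <= K2 * expR (theta * y).
Proof. by move=> yb; rewrite /cn /= normr_id; exact: c_exp. Qed.

Definition lev_bound := K2 / theta * expR (theta * x).

(** Pushes take place above [b], where [|c|] is at most [K2 e^{theta y}]; the discounted sum of the
    exponential losses has mean at most [e^{theta x}], whatever the grid and the horizon. *)
Lemma reflected_levels_upto (m : nat) :
  (\int[P]_w (\int[mu]_(l in `]0, D m%:R w]) lev_pos delta x cn (X ^~ w) (D ^~ w) l)%:E <= lev_bound%:E)%E.
Proof.
pose S n w := \sum_(k < (m * 2 ^ n).+1) discount delta (k%:R * dyadic n) *
  (prim cn (pre n k w) - prim cn (Y n k w)).
have k20 : 0 <= K2 / theta by rewrite divr_ge0 ?K2_ge0// ltW.
have S0 n w : 0 <= S n w.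
  apply: sumr_ge0 => k _; rewrite mulr_ge0 ?expR_ge0// subr_ge0.
  by apply: (prim_nd ccn) => //; [move=> y; exact: normr_ge0|exact: Y_le_pre].
have mS n : measurable_fun setT (S n).
  have mp : measurable_fun setT (prim cn).
    by apply: continuous_measurable_fun; exact: is_derive_continuous (fun z => prim_derive z ccn).
  apply: measurable_sum => k; apply: measurable_funM => //; apply: measurable_funB; apply: measurableT_comp => //.
    exact: (Fm_meas hF (kh_ge0 n _) (pre_F hF hX x b n _)).
  exact: (Fm_meas hF (kh_ge0 n _) (Y_F hF hX x b n _)).
have Sle n w : S n w <= K2 / theta * esum_r X theta x b delta n (m * 2 ^ n) w.
  rewrite /esum_r mulr_sumr; apply: ler_sum => k _.
  rewrite [leRHS]mulrCA ler_wpM2l ?expR_ge0//; apply: (le_trans (ler_norm _)).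
  by apply: dprim_le => //; exact: cn_exp.
have er n := EE_esum_r hF hX hX0 hXc th0 dl0 mgp mgm x b (ltW dld) n (m * 2 ^ n).
have iS n : intg P (S n).
  by apply: (intg_dom (mS n) (intgZ (K2 / theta) (er n).1)) => w; rewrite ger0_norm.
apply: (@fatou_cvgR _ _ _ P S _ (fun=> lev_bound)) => //.
- move=> w; have hend : a n (m * 2 ^ n)%N w @[n --> \oo] --> D m%:R w by exact: grid_overshoot_end.
  have hlim (t t' l : R) : 0 <= t -> t < t' -> l < D t w -> \forall n \near \oo,
      forall k, (k <= m * 2 ^ n)%N -> t' <= k%:R * dyadic n -> l <= a n k w.
    by move=> t0 tt lt; have := grid_overshoot_lim hXc t0 tt lt; apply: filterS => n h1 j _; exact: h1.
  have [_ h] := @ctrl_cvg R delta x cn (X ^~ w) (D ^~ w) m delta0 ccn (hXc w) (neD w) (fun n k => a n k w)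
    (fun n j k => @grid_overshoot_nd _ _ _ X x b n j k w) (fun n k => grid_overshoot_ge0 _ _ _ _ _ _) (fun n k _ => grid_overshoot_le_reflecting_path hXc _ _ _ _ _)
    hlim hend.
  apply: cvg_trans h.
  by apply: near_eq_cvg; near=> n; apply: eq_bigr => k _; rewrite prevE.
- move=> n; rewrite EE_EFin// lee_fin.
  apply: (@le_trans _ _ (EE P (fun w => K2 / theta * esum_r X theta x b delta n (m * 2 ^ n) w))).
    by apply: EE_le => //; apply: intgZ; exact: (er n).1.
  rewrite EEZ; last exact: (er n).1.
  by rewrite ler_wpM2l//; exact: (er n).2.
- exact: cvg_cst.
Unshelve. all: by end_near. Qed.

(** The bound for finite horizons concerns the levels priced one by one with [|c|]. In averaged form
    this dominates the absolute value of the average of [c], and Fatou's lemma removes the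
    horizon. *)
Lemma reflected_levels_fin : (\int[P]_w \int[mu]_(l in attained (D ^~ w))
    (level_density delta x c (X ^~ w) (D ^~ w) Num.norm l)%:E < +oo)%E.
Proof.
have cno : continuous (@Num.norm _ R) by exact: norm_continuous.
have cid : continuous (@id R) by move=> y; exact: cvg_id.
apply: (@le_lt_trans _ _ lev_bound%:E); last exact: ltry.
apply: (@fatou_cvg _ _ _ P (fun m w => (\int[mu]_(l in `]0, D m%:R w]) level_density delta x c (X ^~ w) (D ^~ w) Num.norm l)%:E) _ (fun=> lev_bound%:E)) => //.
- by move=> m; apply/measurable_EFinP; exact: (lev_upto_meas mX hXc).
- by move=> m w _; rewrite lee_fin; apply: Rintegral_ge0 => l _; rewrite mulr_ge0// expR_ge0.
- by move=> w _; exact: lev_total_cvg.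
- move=> m; apply: le_trans (reflected_levels_upto m).
  have e1 w : \int[mu]_(l in `]0, D m%:R w]) lev_pos delta x cn (X ^~ w) (D ^~ w) l =
      \int[mu]_(l in `]0, D m%:R w]) level_density delta x cn (X ^~ w) (D ^~ w) id l.
    exact: (@lev_pos_average R delta x cn (X ^~ w) (D ^~ w) m delta0 ccn (hXc w) (neD w)).
  apply: ge0_le_integral => //.
  + by move=> w _; rewrite lee_fin; apply: Rintegral_ge0 => l _; rewrite mulr_ge0// expR_ge0.
  + by apply/measurable_EFinP; exact: (lev_upto_meas mX hXc).
  + under eq_fun do rewrite e1.
    by apply/measurable_EFinP; exact: (lev_upto_meas mX hXc).
  + move=> w _; rewrite lee_fin e1; apply: le_Rintegral => //.
    * exact: (@average_cvg R delta x c (X ^~ w) (D ^~ w) m delta0 cc (hXc w) (neD w) Num.norm cno).1.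
    * exact: (@average_cvg R delta x cn (X ^~ w) (D ^~ w) m delta0 ccn (hXc w) (neD w) id cid).1.
    * by move=> l _; exact: level_density_le_abs.
- exact: cvg_cst.
Qed.

Local Notation A := (regular_abs_cost X x delta D c f).

Lemma reflected_cost_fin : (\int[P]_w A w < +oo)%E.
Proof.
rewrite (_ : A = fun w => (\int[mu]_(s in `]0%R, +oo[) (running_density delta x (X ^~ w) (D ^~ w) (Num.norm \o f) s)%:E +
  \int[mu]_(l in attained (D ^~ w)) (level_density delta x c (X ^~ w) (D ^~ w) Num.norm l)%:E)%E); last first.
  by apply/funext => w; rewrite abscE.
rewrite ge0_integralD//.
- by rewrite lte_add_pinfty//; [exact: reflected_running_fin|exact: reflected_levels_fin].
- by move=> w _; apply: integral_ge0 => s _; rewrite lee_fin mulr_ge0 ?expR_ge0//=.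
- by apply: (run_total_meas mX hXc) => //; [exact: norm_cont|move=> y; exact: normr_ge0].
- by move=> w _; apply: integral_ge0 => s _; rewrite lee_fin mulr_ge0 ?expR_ge0//=.
- by apply: (lev_total_meas mX hXc) => //; exact: norm_continuous.
Qed.

Local Notation pc := (regular_cost X x delta D c f).
Local Notation hc m := (horizon_cost X x delta u f c D m).
Local Notation tl m := (reflected_tail X u delta x b m).
Let up m w := if (A w < +oo)%E then upto X x delta D c f m w else 0.

Lemma hc_upto m w : hc m w - tl m w = upto X x delta D c f m w.
Proof.
rewrite /horizon_cost /upto /reflected_tail.
have -> := @lev_pos_average R delta x c (X ^~ w) (D ^~ w) m delta0 cc (hXc w) (neD w).
by rewrite addrK.
Qed.

(** The absolute cost, now known to be integrable, dominates the costs up to each horizon; these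
    have mean at most [u x] up to the discounted terminal value, which vanishes. *)
Lemma upper_bound : EE P pc <= u x.
Proof.
have mA : measurable_fun setT A by exact: (regular_abs_cost_meas mX hXc _ delta0 mD neD cc cf).
have A0 w : (0 <= A w)%E by exact: regular_abs_cost_ge0.
have [iA aeA] := intg_ae_lty mA A0 reflected_cost_fin.
have mup m : measurable_fun setT (up m).
  apply: measurable_fun_ifT => //; first exact: (fin_meas mX hXc _ delta0 mD neD cc cf).
  exact: (upto_meas mX hXc _ delta0 mD neD cc cf).
have upb m w : `|up m w| <= fine (A w).
  rewrite /up; case: ifPn => h; last by rewrite normr0 fine_ge0.
  exact: (upto_le hXc delta0 neD cc cf).
have upc w : up m w @[m --> \oo] --> pc w.
  rewrite /up; case: (boolP (A w < +oo)%E) => h; first exact: (upto_cvg hXc delta0 neD cc cf).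
  by rewrite /regular_cost (negbTE h); exact: cvg_cst.
have [_ cE] := EE_cvg mup upc iA upb.
have rb m := reflected_bound hF hX hX0 hXc th0 dl0 mgp mgm K0 uK fK cK cu cf cc dld x uC1 u_le u_eq J_oo J_step_defect m.
have tb m := reflected_tail_bound hF hX hX0 hXc th0 dl0 mgp mgm delta K0 uK cu x b m.
have kap : 0 < delta - dl by rewrite subr_gt0.
pose e m := Kd * cosh (theta * (x - b)) * expR (- (delta - dl)) ^+ m.
have ec : e m @[m --> \oo] --> Kd * cosh (theta * (x - b)) * 0.
  apply: cvgMr; apply: cvg_expr.
  by rewrite ger0_norm ?expR_ge0// -[ltRHS]expR0 ltr_expR oppr_lt0.
rewrite mulr0 in ec.
have c2 : EE P (up m) - e m @[m --> \oo] --> EE P pc by rewrite -[X in _ --> X]subr0; exact: cvgB.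
apply: (cvg_le_near c2); near=> m.
have ih : intg P (fun w => hc m w - tl m w) by apply: intgB; [exact: (rb m).1|exact: (tb m).1].
have -> : EE P (up m) = EE P (fun w => hc m w - tl m w).
  apply: EE_ae; [exact: mup|exact: (intg_meas ih)|].
  by apply: filterS aeA => w h; rewrite hc_upto /up h.
rewrite EEB; [|exact: (rb m).1|exact: (tb m).1].
have := (rb m).2; have := (tb m).2; rewrite ler_norml => /andP[h _].
have eE : expR ((dl - delta) * m%:R) = expR (- (delta - dl)) ^+ m.
  by rewrite -expRM_natl opprB mulrC.
by rewrite eE -/(e m) in h; lra.
Unshelve. all: by end_near. Qed.

End reflected_cost.

(** * Regularization of paths *)

Section completeness.
Context {R : realType} {d : measure_display} {T : measurableType d}.
Variables (P : probability T R) (F : R -> set (set T)).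
Hypothesis hF : usual_filtration P F.

(** Completeness is used only through this: a function may be altered on a set all of whose subsets
    are measurable. *)
Lemma measurable_off d1 d2 (T1 : measurableType d1) (U : measurableType d2) (f g : T1 -> U) (E : set T1) :
  (forall E', E' `<=` E -> measurable E') -> (forall w, ~ E w -> f w = g w) ->
  measurable_fun setT f -> measurable_fun setT g.
Proof.
move=> hE fg mf _ B mB; rewrite setTI.
have -> : g @^-1` B = (f @^-1` B `\` E) `|` (g @^-1` B `&` E).
  apply/seteqP; split => w /=.
    by move=> capped_dominator; have [Ew|nE] := pselect (E w); [right|left; rewrite fg].
  by move=> [[fB nE]|[]//]; rewrite -fg.
apply: measurableU; last by apply: hE => w [].
apply: measurableD; last exact: hE.
by rewrite -[X in measurable X]setTI; exact: mf.
Qed.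

Lemma negligible_F t E : 0 <= t -> P.-negligible E -> F t E.
Proof. by move=> t0 nE; apply: (filtration_mono hF (lexx 0) t0); exact: (filtration_complete hF). Qed.

Lemma negligible_measurable E : P.-negligible E -> measurable E.
Proof. by move=> nE; apply: (filtration_measurable hF (lexx 0)); exact: negligible_F. Qed.

Lemma ae_measurable d' (U : measurableType d') (f g : T -> U) : measurable_fun setT f ->
  {ae P, forall w, f w = g w} -> measurable_fun setT g.
Proof.
move=> mf fg; apply: (@measurable_off _ _ _ _ f g (~` [set w | f w = g w])) => //.
  by move=> E' E'E; apply: negligible_measurable; exact: negligibleS fg.
by move=> w /=; rewrite notK.
Qed.

Lemma ae_Fm d' (U : measurableType d') t (f g : T -> U) : 0 <= t -> Fm F t f ->
  {ae P, forall w, f w = g w} -> Fm F t g.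
Proof.
move=> t0 /(FmE hF _ t0) mf fg; apply/(FmE hF _ t0).
apply: (@measurable_off _ _ (g_sigma_algebraType (F t)) _ f g (~` [set w | f w = g w])) => //.
  move=> E' E'E; rewrite /measurable/= (sigma_algebra_id (filtration_sigma hF t0)).
  by apply: negligible_F => //; exact: negligibleS fg.
by move=> w /=; rewrite notK.
Qed.

Lemma ae_measure_eq (A B : set T) : measurable A -> measurable B ->
  {ae P, forall w, A w <-> B w} -> P A = P B.
Proof.
move=> mA mB AB; have iE C : measurable C -> P C = (\int[P]_w (\1_C w)%:E)%E.
  by move=> mC; rewrite integral_indic// setIT.
rewrite (iE A)// (iE B)//; apply: ae_eq_integral => //.
- by apply/measurable_EFinP; exact: measurable_indic.
- by apply/measurable_EFinP; exact: measurable_indic.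
- apply: filterS AB => w AB _; congr (_%:E); rewrite !indicE; congr (_%:R); congr nat_of_bool.
  by apply/idP/idP; rewrite !inE => /AB.
Qed.

(** Paths outside [Q] are replaced by the zero path, which is both a regular path of the process and
    an admissible path of a control. *)
Definition keep (Q : T -> Prop) (X : R -> T -> R) (t : R) w := if `[< Q w >] then X t w else 0.

Lemma keepE Q X t w : Q w -> keep Q X t w = X t w.
Proof. by move=> Qw; rewrite /keep asboolT. Qed.

Lemma keep_ae Q X : {ae P, forall w, Q w} -> {ae P, forall w, forall t, X t w = keep Q X t w}.
Proof. by apply: filterS => w Qw t; rewrite keepE. Qed.

Lemma keep_F Q X t : {ae P, forall w, Q w} -> 0 <= t -> Fm F t (X t) -> Fm F t (keep Q X t).
Proof.
move=> hQ t0 XF; apply: (ae_Fm t0 XF); apply: filterS (keep_ae X hQ) => w; exact.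
Qed.

Lemma levy_keep Q X : {ae P, forall w, Q w} -> levy_process P F X -> levy_process P F (keep Q X).
Proof.
move=> hQ hX; have exp_growth := keep_ae X hQ.
have mX t : 0 <= t -> measurable_fun setT (X t) by exact: (X_meas hF hX).
have mK t : 0 <= t -> measurable_fun setT (keep Q X t).
  by move=> t0; apply: (Fm_meas hF t0); apply: keep_F => //; exact: (Fm_X hX).
have pm (Y : R -> T -> R) s t B : (forall t, 0 <= t -> measurable_fun setT (Y t)) -> 0 <= s -> 0 <= t ->
    measurable B -> measurable ((Y t \- Y s) @^-1` B).
  move=> mY s0 t0 mB; rewrite -[X in measurable X]setTI.
  by apply: (measurable_funB (mY t t0) (mY s s0)).
have p1 (Y : R -> T -> R) t B : (forall t, 0 <= t -> measurable_fun setT (Y t)) -> 0 <= t ->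
    measurable B -> measurable (Y t @^-1` B).
  by move=> mY t0 mB; rewrite -[X in measurable X]setTI; exact: mY.
have diffE s t (B : set R) : 0 <= s -> 0 <= t -> measurable B ->
    P ((keep Q X t \- keep Q X s) @^-1` B) = P ((X t \- X s) @^-1` B).
  move=> s0 t0 mB; apply: ae_measure_eq; [exact: pm|exact: pm|].
  by apply: filterS exp_growth => w e; rewrite /= -!e.
split.
- by move=> t t0 B mB; apply: keep_F => //; exact: (Fm_X hX).
- by apply: filterS2 exp_growth (levy_start hX) => w <-.
- apply: filterS2 exp_growth (levy_cadlag hX) => w e.
  by rewrite (_ : X ^~ w = keep Q X ^~ w)//; apply/funext => t.
- move=> s t s0 st A B FA mB; have t0 := le_trans s0 st.
  have mA : measurable A by exact: (filtration_measurable hF s0).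
  rewrite (diffE s t)// -(levy_independent hX)//.
  apply: ae_measure_eq; [by apply: measurableI => //; exact: pm|by apply: measurableI => //; exact: pm|].
  by apply: filterS exp_growth => w e; rewrite /= -!e.
- move=> s t s0 st B mB; have t0 := le_trans s0 st; have ts : 0 <= t - s by rewrite subr_ge0.
  rewrite (diffE s t)// (levy_stationary hX)//.
  apply: ae_measure_eq; [exact: p1|exact: p1|].
  by apply: filterS exp_growth => w e; rewrite /= -e.
Qed.

End completeness.

Section transfer.
Context {R : realType} {d : measure_display} {T : measurableType d}.
Variables (P : probability T R) (F : R -> set (set T)).
Hypothesis hF : usual_filtration P F.
Variables (X X' D D' : R -> T -> R) (x delta : R) (f c : R -> R).
Hypothesis delta0 : 0 <= delta.
Hypothesis cf : continuous f.
Hypothesis cc : continuous c.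
Hypothesis mX : forall t : R, 0 <= t -> measurable_fun setT (X' t).
Hypothesis hXc : forall w, cadlag (X' ^~ w).
Hypothesis mD : forall t : R, 0 <= t -> measurable_fun setT (D' t).
Hypothesis neD : forall w, control_path (D' ^~ w).
Hypothesis eX : {ae P, forall w, forall t, 0 <= t -> X t w = X' t w}.
Hypothesis eD : {ae P, forall w, forall t, 0 <= t -> D t w = D' t w}.
Local Notation A := (regular_abs_cost X' x delta D' c f).

Let e0 : {ae P, forall w, from0 (X ^~ w) = from0 (X' ^~ w) /\ from0 (D ^~ w) = from0 (D' ^~ w)}.
Proof.
apply: filterS2 eX eD => w hx hd; split; apply/funext => t; rewrite /from0; case: ifP => //.
  exact: hx.
exact: hd.
Qed.

Lemma transfer_abs : (\int[P]_w path_abs_cost delta f c x (from0 (X ^~ w)) (from0 (D ^~ w)) = \int[P]_w A w)%E.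
Proof.
have mA : measurable_fun setT A by exact: (regular_abs_cost_meas mX hXc _ delta0 mD neD cc cf).
have ae : {ae P, forall w, A w = path_abs_cost delta f c x (from0 (X ^~ w)) (from0 (D ^~ w))}.
  by apply: filterS e0 => w [-> ->].
apply: ae_eq_integral; [exact: measurableT|exact: (ae_measurable hF mA ae)|exact: mA|].
by apply: filterS ae => w -> _.
Qed.

Lemma transfer_cost : (\int[P]_w A w < +oo)%E ->
  intg P (regular_cost X' x delta D' c f) /\
  cost_J P X delta f c x D = (EE P (regular_cost X' x delta D' c f))%:E.
Proof.
move=> iA; set pc := regular_cost X' x delta D' c f.
have mA : measurable_fun setT A by exact: (regular_abs_cost_meas mX hXc _ delta0 mD neD cc cf).
have A0 w : (0 <= A w)%E by exact: regular_abs_cost_ge0.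
have [h1 aeA] := intg_ae_lty mA A0 iA.
have mp : measurable_fun setT pc by exact: (regular_cost_meas mX hXc _ delta0 mD neD cc cf).
have ip : intg P pc.
  apply: (intg_dom mp h1) => w; case: (boolP (A w < +oo)%E) => h; first exact: (regular_cost_le hXc delta0 neD cc cf h).
  by rewrite /pc /regular_cost (negbTE h) normr0 fine_ge0.
split => //; rewrite -EE_EFin//.
have ae : {ae P, forall w, (pc w)%:E = path_cost delta f c x (from0 (X ^~ w)) (from0 (D ^~ w))}.
  apply: filterS2 e0 aeA => w [-> ->] h; by rewrite (regular_cost_cost hXc delta0 neD cc cf h).
have me : measurable_fun setT (EFin \o pc) by exact/measurable_EFinP.
apply: ae_eq_integral => //; first exact: (ae_measurable hF me ae).
by apply: filterS ae => w /= ->.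
Qed.

End transfer.

Section left_growth.
Context {R : realType}.
Variables (f : R -> R) (theta K : R).
Hypothesis th0 : 0 < theta.
Hypothesis K0 : 0 <= K.
Hypothesis fK : forall x, `|f x| <= K * (1 + cosh (theta * x)).

Lemma growth_right (B y : R) : - B <= y -> f y <= K * (1 + expR (theta * B)) * (1 + expR (theta * y)).
Proof.
move=> By; apply: (le_trans (ler_norm _)); apply: (le_trans (fK y)); rewrite -mulrA ler_wpM2l// /cosh.
have : expR (- (theta * y)) <= expR (theta * B).
  by rewrite ler_expR -mulrN ler_wpM2l ?(ltW th0)//; lra.
have := expR_gt0 (theta * y); have := expR_gt0 (theta * B); have := expR_gt0 (- (theta * y)).
by set e1 := expR (theta * y); set e2 := expR (theta * B); set e3 := expR _; nra.
Qed.

(** To the right of any point the growth assumption is already exponential. To the left, either [f]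
    is bounded above, or it is decreasing, and then [f y <= f z]. *)
Lemma left_growth :
  (exists M : R, (limf_esup (EFin \o f) -oo%R <= M%:E)%E) \/
    (exists2 M : R, 0 < M & forall x y, x <= y -> y <= - M -> f y <= f x) ->
  exists2 C, 0 <= C & forall y z, z <= y -> f y <= `|f z| + C * (1 + expR (theta * y)).
Proof.
have Kge B : 0 <= K * (1 + expR (theta * B)) by rewrite mulr_ge0// addr_ge0// expR_ge0.
have e0 y : 0 <= expR (theta * y) by exact: expR_ge0.
case=> [[M hM]|[M M0 hM]].
  have : (limf_esup (EFin \o f) -oo%R < (M + 1)%:E)%E.
    by apply: le_lt_trans hM _; rewrite lte_fin ltrDl.
  move=> /ereal_inf_lt[_ [V [B [_ BV]] <-]] hV.
  (* A limit superior of at most [M] only gives values below [M + 1] near minus infinity; [1 - B] is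
     chosen so that [y >= B] implies [y >= - (1 - B)]. *)
  pose C := `|M| + 1 + K * (1 + expR (theta * (1 - B))).
  exists C; first by rewrite !addr_ge0.
  move=> y z _; apply: (@le_trans _ _ (C * (1 + expR (theta * y)))); last by rewrite lerDr.
  case: (ltP y B) => yB.
    have : ((f y)%:E < (M + 1)%:E)%E.
      by apply: le_lt_trans hV; apply: ereal_sup_ubound; exists y => //; exact: BV.
    rewrite lte_fin => h; have := Kge (1 - B); have := ler_norm M; have := e0 y.
    by rewrite /C; move: (K * _) => k e1 m1 k1; have := normr_ge0 M; nra.
  have /growth_right h : - (1 - B) <= y by lra.
  by apply: (le_trans h); rewrite ler_wpM2r ?addr_ge0// /C lerDr !addr_ge0.
exists (K * (1 + expR (theta * M))) => // y z zy.
case: (leP y (- M)) => yM; last first.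
  by apply: (le_trans (growth_right (ltW yM))); rewrite lerDr.
apply: (le_trans (hM z y zy yM)); apply: (le_trans (ler_norm _)); rewrite lerDl.
by rewrite mulr_ge0// addr_ge0.
Qed.

End left_growth.

Section regular_paths.
Context {R : realType} {d : measure_display} {T : measurableType d}.
Local Notation mu := (@lebesgue_measure R).
Variables (P : probability T R) (F : R -> set (set T)) (X : R -> T -> R).
Hypothesis hF : usual_filtration P F.
Hypothesis hX : levy_process P F X.
Hypothesis hX0 : forall w, X 0 w = 0.
Hypothesis hXc : forall w, cadlag (X ^~ w).
Variables (theta dl : R).
Hypothesis th0 : 0 < theta.
Hypothesis dl0 : 0 <= dl.
Hypothesis mgp : forall t : R, 0 <= t -> (mg P X theta t <= (expR (dl * t))%:E)%E.
Hypothesis mgm : forall t : R, 0 <= t -> (mg P X (- theta) t <= (expR (dl * t))%:E)%E.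
Variables (u f c : R -> R) (K delta : R).
Hypothesis K0 : 0 <= K.
Hypothesis uK : forall x, `|u x| <= K * (1 + cosh (theta * x)).
Hypothesis fK : forall x, `|f x| <= K * (1 + cosh (theta * x)).
Hypothesis cK : forall x, `|c x| <= K * (1 + cosh (theta * x)).
Hypothesis cu : continuous u.
Hypothesis cf : continuous f.
Hypothesis cc : continuous c.
Hypothesis dld : dl < delta.
Hypothesis u_bv : has_bounded_variation P X -> C1 u.
Hypothesis u_ubv : ~ has_bounded_variation P X -> C2 u.
Variable L : R -> R.
Hypothesis hL : forall y, generator_quotient P X u y t @[t --> 0^'+] --> (L y)%:E.
Variable b : R.
Hypothesis rho_ge0 : forall y, 0 <= rho u L delta f y.
Hypothesis rho_eq0 : forall y, y < b -> rho u L delta f y = 0.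
Hypothesis u_le : forall y, derive1 u y <= c y.
Hypothesis u_eq : forall y, b <= y -> derive1 u y = c y.
Variable C : R.
Hypothesis C0 : 0 <= C.
Hypothesis fstar : forall y z, z <= y -> f y <= `|f z| + C * (1 + expR (theta * y)).

Lemma smooth_C1 : C1 u.
Proof. by have [/u_bv|/u_ubv[]] := pselect (has_bounded_variation P X). Qed.

Lemma control_lower_bound x (D : R -> T -> R) : (forall w, control_path (D ^~ w)) ->
  (forall t, 0 <= t -> Fm F t (D t)) -> (\int[P]_w regular_abs_cost X x delta D c f w < +oo)%E ->
  u x <= EE P (regular_cost X x delta D c f).
Proof.
move=> neD DF iD.
have [J J1 J2] := stopping_levels hF hX hX0 hXc th0 dl0 mgp mgm K0 uK cu u_bv u_ubv hL f (le_lt_trans dl0 dld).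
have J3 n y : `|y| <= (J n)%:R - 1 -> - ((J n).+1%:R^-1 * dyadic n) <= step_defect P X u delta f n y.
  move=> h; have := J2 n y h; rewrite ler_norml => /andP[h1 _].
  by apply: (le_trans h1); rewrite lerBlDr lerDl mulr_ge0// dyadic_ge0.
exact: (lower_bound hF hX hX0 hXc th0 dl0 mgp mgm K0 uK fK cK cu cf cc dld smooth_C1 u_le J1 J3 neD DF C0 fstar iD).
Qed.

(** The upper estimate is special to this control; the lower one is the general bound, applicable
    once the absolute cost is known to be integrable. *)
Lemma reflected_value x : (\int[P]_w regular_abs_cost X x delta (reflecting_path X x b) c f w < +oo)%E /\
  EE P (regular_cost X x delta (reflecting_path X x b) c f) = u x.
Proof.
have [J J1 J2] := stopping_levels hF hX hX0 hXc th0 dl0 mgp mgm K0 uK cu u_bv u_ubv hL f (le_lt_trans dl0 dld).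
have fin := reflected_cost_fin hF hX hX0 hXc th0 dl0 mgp mgm K0 fK cK cf cc dld x b.
split => //; apply/le_anti/andP; split; last first.
  apply: control_lower_bound => //; first by move=> w; exact: control_path_reflecting_path.
  by move=> t t0; exact: (reflecting_path_F hF hX hXc).
apply: (upper_bound hF hX hX0 hXc th0 dl0 mgp mgm K0 uK fK cK cu cf cc dld x smooth_C1 u_le u_eq J1).
move=> n y yb h; have := J2 n y h.
rewrite (rho_left hF hX hX0 hXc th0 dl0 mgp mgm K0 uK cu u_bv u_ubv hL cf rho_eq0 yb) mulr0 subr0.
by move/(le_trans (ler_norm _)).
Qed.

End regular_paths.

Section reflecting.
Context {R : realType}.

(** The reflecting control takes the positive part after the supremum, while the grid construction
    takes it before; the positive part is non-decreasing, so the order does not matter. *)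
Lemma sup_reflect (xi : R -> R) x b t : cadlag xi -> 0 <= t ->
  Num.max (sup [set x + xi s | s in `[0, t]] - b) 0 = run_sup (fun s => Num.max (x + xi s - b) 0) t.
Proof.
move=> cxi t0; have [M M0 MP] := cadlag_bounded t cxi.
have bd s : 0 <= s -> s <= t -> x + xi s <= `|x| + M.
  by move=> s0 st; rewrite lerD ?ler_norm// (le_trans (ler_norm _))// MP.
have bd' r : exists B, forall s, 0 <= s -> s <= r -> Num.max (x + xi s - b) 0 <= B.
  have [B B0 BP] := cadlag_bounded r cxi; exists (`|x| + B + `|b|) => s s0 sr.
  rewrite ge_max; apply/andP; split; last by rewrite !addr_ge0.
  have := BP s s0 sr; have := ler_norm (xi s); have := ler_norm x; have := ler_norm (- b).
  by rewrite normrN; lra.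
apply/le_anti/andP; split.
  rewrite ge_max; apply/andP; split.
    rewrite lerBlDr; apply: ge_sup; first by exists (x + xi 0); exists 0 => //=; rewrite in_itv/= lexx.
    move=> _ [s + <-]; rewrite /= in_itv/= => /andP[s0 st].
    rewrite -lerBlDr; apply: le_trans (run_sup_ge bd' s0 st).
    by rewrite le_max lexx.
  by apply: le_trans (run_sup_ge bd' (lexx 0) t0); rewrite le_max lexx orbT.
apply: run_sup_le => // s s0 st; rewrite ge_max !le_max lexx orbT andbT; apply/orP; left.
rewrite lerB//; apply: ub_le_sup; last by exists s => //=; rewrite in_itv/= s0.
by exists (`|x| + M) => _ [r + <-]; rewrite /= in_itv/= => /andP[r0 rt]; exact: bd.
Qed.

End reflecting.

Section regularization.
Context {R : realType} {d : measure_display} {T : measurableType d}.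
Variables (P : probability T R) (X X' : R -> T -> R).
Hypothesis mX : forall t : R, 0 <= t -> measurable_fun setT (X t).
Hypothesis mX' : forall t : R, 0 <= t -> measurable_fun setT (X' t).
Hypothesis eX : {ae P, forall w, forall t, X t w = X' t w}.

Lemma expectation_ae (g : R -> R) t : 0 <= t -> measurable_fun setT g ->
  ('E_P[fun w => g (X t w)] = 'E_P[fun w => g (X' t w)])%E.
Proof.
move=> t0 mg; rewrite unlock; apply: ae_eq_integral => //.
- by apply/measurable_EFinP; apply: measurableT_comp => //; exact: mX.
- by apply/measurable_EFinP; apply: measurableT_comp => //; exact: mX'.
- by apply: filterS eX => w e _ /=; rewrite e.
Qed.

Lemma bounded_variation_ae : has_bounded_variation P X -> has_bounded_variation P X'.
Proof.
rewrite /has_bounded_variation => h; apply: filterS2 eX h => w e bv t t0.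
by rewrite (_ : X' ^~ w = X ^~ w); [exact: bv|apply/funext => s; rewrite e].
Qed.

Lemma generator_quotient_ae (u : R -> R) y t : 0 <= t -> continuous u ->
  generator_quotient P X u y t = generator_quotient P X' u y t.
Proof.
move=> t0 cu; rewrite /generator_quotient; congr ((_ - _) * _)%E.
apply: (expectation_ae (g := fun z => u (y + z))) => //.
apply: measurableT_comp; first exact: continuous_measurable_fun.
exact: measurable_funD.
Qed.

Lemma mmt_mg a : mmt_gen_fun P (X 1) a = mg P X' a 1.
Proof.
have me : measurable_fun setT (fun z : R => expR (a * z)).
  by apply: measurableT_comp => //; exact: measurable_funM.
have := expectation_ae ler01 me; rewrite /mmt_gen_fun /mg unlock => <-.
by apply: eq_integral => w _ /=; rewrite mulrC.
Qed.

End regularization.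

Theorem theorem1 (R : realType) (d : measure_display) (T : measurableType d)
    (P : probability T R) (F : R -> set (set T)) (X : R -> T -> R)
    (delta theta : R) (f c : R -> R) (xstar : R) (u : R -> R)
    (hF : usual_filtration P F)
    (hX : levy_process P F X)
    (hXnt : nontrivial P X)
    (hXmean : finite_mean P X)
    (hdelta : 0 < delta)
    (hA1 : assumption_A1 P X delta theta)
    (hA2 : assumption_A2 P X theta f c)
    (hu_bv : has_bounded_variation P X -> C1 u)
    (hu_ubv : ~ has_bounded_variation P X -> C2 u)
    (hu_growth : exists2 K : R, 0 < K &
       forall x, `|u x| <= K * (1 + cosh (theta * x)))
    (hu_domain : in_generator_domain P X u)
    (hu_gen : forall x, 0 <= generator P X u x - delta * u x + f x)
    (hu_gen_eq : forall x, x < xstar ->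
       generator P X u x - delta * u x + f x = 0)
    (hu_der : forall x, derive1 u x <= c x)
    (hu_der_eq : forall x, xstar <= x -> derive1 u x = c x)
    (x : R) :
  [/\ admissible P F X delta f c x (reflecting X x xstar),
      (u x)%:E = cost_J P X delta f c x (reflecting X x xstar) &
      cost_J P X delta f c x (reflecting X x xstar)
      = value_G P F X delta f c x].
Proof.
(* From here on [X'], which agrees with [X] off a null set, starts at 0 and is càdlàg on every
   path. *)
pose Q w := X 0 w = 0 /\ cadlag (X ^~ w).
have hQ : {ae P, forall w, Q w} by apply: filterS2 (levy_start hX) (levy_cadlag hX) => w.
pose X' := keep Q X.
have hX' : levy_process P F X' by exact: levy_keep.
have X'0 w : X' 0 w = 0 by rewrite /X' /keep; case: asboolP => // -[].
have X'c w : cadlag (X' ^~ w).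
  have [Qw|nQ] := pselect (Q w).
    by rewrite (_ : X' ^~ w = X ^~ w); [exact: Qw.2|apply/funext => t; exact: keepE].
  rewrite (_ : X' ^~ w = fun=> 0); last by apply/funext => t; rewrite /X' /keep asboolF.
  by split => t _; [exact: cvg_cst|exact: is_cvg_cst].
have eX : {ae P, forall w, forall t, X t w = X' t w} by exact: keep_ae.
have mX t : 0 <= t -> measurable_fun setT (X t) by exact: (X_meas hF hX).
have mX' t : 0 <= t -> measurable_fun setT (X' t) by exact: (X_meas hF hX').
have mm a := mmt_mg mX mX' eX a.
case: hA1 => th0 m1 m2 hmax; rewrite !mm in m1 m2.
(* The exponents may both be negative, whereas the growth rate of the moments is taken non-negative;
   [delta > 0] keeps [dl] below [delta]. *)
pose dl := Num.max 0 (Num.max (char_exponent P X theta) (char_exponent P X (- theta))).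
have dl0 : 0 <= dl by rewrite le_max lexx.
have dld : dl < delta by rewrite gt_max hdelta.
have ceE a : char_exponent P X a = phi1 P X' a by rewrite /char_exponent mm.
have mgp t : 0 <= t -> (mg P X' theta t <= (expR (dl * t))%:E)%E.
  move=> t0; apply: (le_trans (mg_le hF hX' X'0 X'c m1 t0)); rewrite lee_fin ler_expR ler_wpM2r// -ceE.
  by rewrite /dl !le_max lexx orbT.
have mgm t : 0 <= t -> (mg P X' (- theta) t <= (expR (dl * t))%:E)%E.
  move=> t0; apply: (le_trans (mg_le hF hX' X'0 X'c m2 t0)); rewrite lee_fin ler_expR ler_wpM2r// -ceE.
  by rewrite /dl !le_max lexx !orbT.
have eX' : {ae P, forall w, forall t, X' t w = X t w} by apply: filterS eX => w e t; rewrite e.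
have u_bv : has_bounded_variation P X' -> C1 u.
  by move=> h; apply: hu_bv; exact: bounded_variation_ae h.
have u_ubv : ~ has_bounded_variation P X' -> C2 u.
  by move=> h; apply: hu_ubv => /(bounded_variation_ae eX).
have uC1 : C1 u by exact: smooth_C1 u_bv u_ubv.
have cu := C1_continuous uC1.
have cf := C1_continuous (A2_f_C1 hA2).
have cc := C1_continuous (A2_c_C1 hA2).
have [Ku Ku0 hKu] := hu_growth.
have [Kf Kf0 hKf] := A2_growth hA2.
pose K := Ku + Kf.
have ch0 y : 0 <= 1 + cosh (theta * y) by rewrite addr_ge0// cosh_ge0.
have K0 : 0 <= K by rewrite addr_ge0 ?ltW.
have uK y : `|u y| <= K * (1 + cosh (theta * y)).
  by apply: (le_trans (hKu y)); rewrite ler_wpM2r// lerDl ltW.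
have fcK y : `|f y| <= K * (1 + cosh (theta * y)) /\ `|c y| <= K * (1 + cosh (theta * y)).
  have := hKf y; rewrite !ge_max => /andP[/andP[hf _] hc].
  by split; [apply: (le_trans hf)|apply: (le_trans hc)]; rewrite ler_wpM2r// lerDr ltW.
have fK y := (fcK y).1.
have cK y := (fcK y).2.
pose L := generator P X u.
(* The quotients of [X] and [X'] are means of almost surely equal variables, so the generator of [X]
   serves for [X']. *)
have hL y : generator_quotient P X' u y t @[t --> 0^'+] --> (L y)%:E.
  have [l hl] := hu_domain y.
  have -> : L y = l by rewrite /L /generator (cvg_lim _ hl).
  apply: cvg_trans hl; apply: near_eq_cvg; near=> t.
  by rewrite (generator_quotient_ae mX mX' eX).
have [C C0 fstar] := left_growth th0 K0 fK (A2_f_left hA2).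
have [fin val] := reflected_value hF hX' X'0 X'c th0 dl0 mgp mgm K0 uK fK cK cu cf cc dld
  u_bv u_ubv hL hu_gen hu_gen_eq hu_der hu_der_eq C0 fstar x.
have lower := @control_lower_bound _ _ _ P F X' hF hX' X'0 X'c theta dl th0 dl0 mgp mgm u f c K delta K0 uK fK cK
  cu cf cc dld u_bv u_ubv L hL hu_gen hu_der C C0 fstar x.
pose D := reflecting_path X' x xstar.
have delta0 := ltW hdelta.
have neD w : control_path (D ^~ w) by exact: control_path_reflecting_path.
have DF t : 0 <= t -> Fm F t (D t) by move=> t0; exact: (reflecting_path_F hF hX' X'c).
have mD t : 0 <= t -> measurable_fun setT (D t) by move=> t0; exact: (Fm_meas hF t0 (DF t t0)).
have eX0 : {ae P, forall w, forall t, 0 <= t -> X t w = X' t w} by apply: filterS eX => w e t _.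
have eD : {ae P, forall w, forall t, 0 <= t -> reflecting X x xstar t w = D t w}.
  apply: filterS eX => w e t t0; rewrite /D /reflecting_path /overshoot -sup_reflect// /reflecting.
  by rewrite (_ : (fun s => x + X s w) = (fun s => x + X' s w))//; apply/funext => s; rewrite e.
have adm : admissible P F X delta f c x (reflecting X x xstar).
  split.
  - by move=> t w _; rewrite le_max lexx orbT.
  - move=> t t0; apply: (ae_Fm hF t0 (DF t t0)).
    by apply: filterS eD => w e; rewrite e.
  - apply: filterS eD => w e; split => [t t0|s t s0 st].
      rewrite e//; apply: cvg_trans (nd_rc (neD w) t0); apply: near_eq_cvg; near=> s.
      by rewrite e// (le_trans t0)//; near: s; exact: nbhs_right_ge.
    by rewrite !e ?(le_trans s0)//; exact: (nd_le (neD w)).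
  - move=> t t0; have eDt : {ae P, forall w, D t w = reflecting X x xstar t w}.
      by apply: filterS eD => w e; rewrite e.
    apply: (intg_ae (mD t t0) (ae_measurable hF (mD t t0) eDt) eDt).
    exact: (reflecting_path_intg hF hX' X'0 X'c th0 dl0 mgp mgm x xstar t0).
  - by rewrite (transfer_abs hF x delta0 cf cc mX' X'c mD neD eX0 eD).
have [_ costE] := transfer_cost hF delta0 cf cc mX' X'c mD neD eX0 eD fin.
have cE : cost_J P X delta f c x (reflecting X x xstar) = (u x)%:E.
  by rewrite costE val.
split => //; rewrite cE; apply/le_anti/andP; split; last first.
  by rewrite -cE; apply: ereal_inf_lbound; exists (reflecting X x xstar).
apply: le_ereal_inf_tmp => _ [D1 adm1 <-].
(* An admissible control is right-continuous and non-decreasing only almost surely, so it is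
   regularized like the process; its cost does not change. *)
pose Q1 w := (forall t, 0 <= t -> D1 ^~ w @ t^'+ --> D1 t w) /\
  (forall s t, 0 <= s -> s <= t -> D1 s w <= D1 t w).
have hQ1 : {ae P, forall w, Q1 w} := admissible_path adm1.
pose D1' := keep Q1 D1.
have neD1 w : control_path (D1' ^~ w).
  have [Qw|nQ] := pselect (Q1 w).
    rewrite (_ : D1' ^~ w = D1 ^~ w); last by apply/funext => t; exact: keepE.
    by split; [move=> t; exact: (admissible_ge0 adm1)|exact: Qw.2|exact: Qw.1].
  rewrite (_ : D1' ^~ w = fun=> 0); first exact: ndrc0.
  by apply/funext => t; rewrite /D1' /keep asboolF.
have D1F t : 0 <= t -> Fm F t (D1' t).
  by move=> t0; apply: (keep_F hF hQ1 t0) => B; exact: (admissible_adapted adm1).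
have mD1 t : 0 <= t -> measurable_fun setT (D1' t) by move=> t0; exact: (Fm_meas hF t0 (D1F t t0)).
have eD1 : {ae P, forall w, forall t, 0 <= t -> D1 t w = D1' t w}.
  by apply: filterS (keep_ae D1 hQ1) => w e t _.
have fin1 : (\int[P]_w regular_abs_cost X' x delta D1' c f w < +oo)%E.
  by rewrite -(transfer_abs hF x delta0 cf cc mX' X'c mD1 neD1 eX0 eD1); exact: (admissible_cost adm1).
have [_ ->] := transfer_cost hF delta0 cf cc mX' X'c mD1 neD1 eX0 eD1 fin1.
by rewrite lee_fin; apply: lower.
Unshelve. all: by end_near. Qed.
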